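(* With the notation of the context, for every $v\in\mathfrak{U}_{\mathrm{SM}}$ (with fixed initial state $X_0=X^{*,v,w}_0=x$), $$\Lambda_v=\limsup_{T\to\infty}\ \sup_{w\in\mathcal{A}}\ \mathbb{E}\Big[\frac1T\int_0^T\Big(r\big(X^{*,v,w}_t,v(X^{*,v,w}_t)\big)-\frac12\|w_t\|^2\Big)dt\Big].$$
   Context: Fix $d$, constants $\lambda_i,\mu_i,\gamma_i>0$ with $\sum_i\lambda_i/\mu_i=1$, $\ell\in\mathbb{R}^d$, $\kappa\in\mathbb{R}^d_+$; $e=(1,\dots,1)^{\mathsf T}$; $\mathbb{U}=\{u\in\mathbb{R}^d_+:e\cdot u=1\}$; $b(x,u)=\ell-R(x-(e\cdot x)^+u)-(e\cdot x)^+\Gamma u$ with $R=\mathrm{diag}(\mu_i)$, $\Gamma=\mathrm{diag}(\gamma_i)$; $\Sigma=\mathrm{diag}(\sqrt{2\lambda_i})$; $r(x,u)=\kappa\cdot[(e\cdot x)^+u]$; $W$ is a $d$-dimensional standard Brownian motion with completed filtration $(\mathcal{G}_t)$. $\mathfrak{U}_{\mathrm{SM}}$ is the set of stationary Markov controls, i.e. Borel maps $v:\mathbb{R}^d\to\mathbb{U}$, or more generally relaxed ones $v:\mathbb{R}^d\to\mathcal{P}(\mathbb{U})$, in which case $b(x,v(x))$ and $r(x,v(x))$ mean $\int b(x,u)v(du|x)$ and $\int r(x,u)v(du|x)$. For $v\in\mathfrak{U}_{\mathrm{SM}}$, $X$ solves $dX_t=b(X_t,v(X_t))dt+\Sigma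 dW_t$, $X_0=x$, and $$\Lambda_v=\Lambda_v(x)=\limsup_{T\to\infty}\frac1T\log\mathbb{E}\Big[e^{\int_0^Tr(X_t,v(X_t))dt}\Big].$$ $\mathcal{A}$ is the set of $\mathcal{G}_t$-progressively measurable $\mathbb{R}^d$-valued processes $w$ with $\frac1T\mathbb{E}\int_0^T\|w_s\|^2ds<\infty$ for every $T>0$. For $w\in\mathcal{A}$, $X^{*,v,w}$ solves $dX^{*,v,w}_t=b(X^{*,v,w}_t,v(X^{*,v,w}_t))dt+\Sigma w_tdt+\Sigma dW_t$, $X^{*,v,w}_0=x$. *)

(* Defs.v *)
From HB Require Import structures.
From mathcomp Require Import all_boot all_order all_algebra.
From mathcomp Require Import all_classical all_reals all_analysis.
From mathcomp Require Import ring.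

Set Implicit Arguments.
Unset Strict Implicit.
Unset Printing Implicit Defensive.

Import Order.TTheory GRing.Theory Num.Theory.
Import numFieldNormedType.Exports.

Local Open Scope classical_set_scope.
Local Open Scope ring_scope.

(* R^d is 'cV[R]_d; [borelV R d] is the same type carrying the Borel
   sigma-algebra (generated by the open sets of the product topology). *)
Notation borelV R d := (g_sigma_algebraType (@open 'cV[R]_d)).

(* Stochastic processes are indexed by all of R, but only their values at times
   t >= 0 are ever constrained or used. *)
Notation process R d Omega := (R -> Omega -> 'cV[R]_d).

Section Vectors.
Context {R : realType} {d : nat}.
Implicit Types x y : 'cV[R]_d.

Definition dotv x y : R := \sum_(i < d) x i 0 * y i 0.

(* The Euclidean norm squared; the library's norm on matrices is the sup norm. *)
Definition sqnormv x : R := dotv x x.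

Definition ones : 'cV[R]_d := const_mx 1.

Definition simplex : set 'cV[R]_d :=
  [set u : 'cV[R]_d | (forall i, 0 <= u i 0) /\ dotv ones u = 1].

Definition integralv (t : R) (f : R -> 'cV[R]_d) : 'cV[R]_d :=
  \col_i \int[lebesgue_measure]_(s in `[0, t]) f s i 0.

End Vectors.

Section ControlledModel.
Context {R : realType} {d : nat}.
Implicit Types x u ell kappa : 'cV[R]_d.
Implicit Types lambda mu gamma : 'I_d -> R.

(* (e . x)^+ *)
Definition queue x : R := Num.max (dotv ones x) 0.

Definition drift ell mu gamma x u : 'cV[R]_d :=
  ell - diag_mx (\row_i mu i) *m (x - queue x *: u)
      - queue x *: (diag_mx (\row_i gamma i) *m u).

Definition Sigma lambda : 'M[R]_d :=
  diag_mx (\row_i Num.sqrt (2 * lambda i)).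

Definition cost kappa x u : R := dotv kappa (queue x *: u).

(* A (relaxed) stationary Markov control: a probability kernel from R^d to R^d
   all of whose values are carried by the simplex, i.e. a Borel map from R^d to
   the probability measures on the simplex. An ordinary control is identified
   with the corresponding kernel of Dirac masses, see [precise_control]. *)
Record SM_control := SMControl {
  SM_kernel :> R.-pker (borelV R d) ~> (borelV R d);
  SM_simplex : forall x, SM_kernel x simplex = 1%E }.

Definition relaxed (v : SM_control) (f : 'cV[R]_d -> 'cV[R]_d -> R) x : R :=
  \int[v x]_(u in simplex) f x u.

Definition relaxedv (v : SM_control) (f : 'cV[R]_d -> 'cV[R]_d -> 'cV[R]_d) x
    : 'cV[R]_d :=
  \col_i relaxed v (fun y u => f y u i 0) x.

End ControlledModel.

Arguments SM_control R d : clear implicits.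

Section Probability.
Context {R : realType} {d : nat} {disp : measure_display}
  {Omega : measurableType disp} (P : probability Omega R).
Implicit Types W X w : process R d Omega.

(* The sigma-algebra generated by W_s, 0 <= s <= t. *)
Definition natural_filtration W (t : R) : set (set Omega) :=
  <<s [set A | exists s : R, exists2 B : set (borelV R d),
         (0 <= s <= t) /\ measurable B & A = W s @^-1` B] >>.

Definition completed_filtration W (t : R) : set (set Omega) :=
  <<s natural_filtration W t `|` P.-negligible >>.

Definition brownian_motion W : Prop :=
  [/\ forall t, 0 <= t -> measurable_fun [set: Omega] (W t : Omega -> borelV R d),
      {ae P, forall omega, W 0 omega = 0
        /\ {within `[0, +oo[, continuous (W ^~ omega)}},
      (* W_t - W_s is independent of the past up to time s *)
      forall (s t : R) (A : set Omega) (B : set (borelV R d)),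
        0 <= s -> s <= t -> natural_filtration W s A -> measurable B ->
        P (A `&` [set omega | B (W t omega - W s omega)%R])
        = (P A * P [set omega | B (W t omega - W s omega)%R])%E
    & (* W_t - W_s has law N(0, (t - s) I); the second argument of normal_prob
         is the standard deviation *)
      forall (s t : R) (B : 'I_d -> set R),
        0 <= s -> s < t -> (forall i, measurable (B i)) ->
        P [set omega | forall i, B i ((W t omega - W s omega)%R i 0)]
        = (\prod_(i < d) normal_prob 0 (Num.sqrt (t - s)) (B i))%E].

Definition adapted (G : R -> set (set Omega)) X : Prop :=
  forall t, 0 <= t ->
    measurable_fun [set: g_sigma_algebraType (G t)]
      (X t : g_sigma_algebraType (G t) -> borelV R d).

Definition progressively_measurable (G : R -> set (set Omega)) w : Prop :=
  forall t : R, 0 <= t ->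
    measurable_fun (`[0, t] `*` [set: g_sigma_algebraType (G t)])
      ((fun p => w p.1 p.2) : R * g_sigma_algebraType (G t) -> borelV R d).

(* The set of processes over which the variational formula takes its supremum. *)
Definition admissible W : set (process R d Omega) :=
  [set w | progressively_measurable (completed_filtration W) w /\
    forall T : R, 0 < T ->
      ((T^-1)%:E * \int[P]_omega \int[lebesgue_measure]_(s in `[0%R, T])
                     (sqnormv (w s omega))%:E < +oo)%E].

(* X solves dX_t = b(X_t) dt + S w_t dt + S dW_t, X_0 = x. The matrix S is
   constant, so that the stochastic integral is S W_t. *)
Definition solves_SDE W (b : 'cV[R]_d -> 'cV[R]_d) (S : 'M[R]_d) w
    (x : 'cV[R]_d) X : Prop :=
  [/\ adapted (completed_filtration W) X,
      forall omega, {within `[0, +oo[, continuous (X ^~ omega)}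
    & {ae P, forall omega, forall t, 0 <= t ->
        X t omega = x + integralv t (fun s => b (X s omega) + S *m w s omega)
                      + S *m W t omega}].

(* Growth rate of the risk-sensitive functional; r is the running cost as a
   function of the state. *)
Definition risk_sensitive_value (r : 'cV[R]_d -> R) X : \bar R :=
  limf_esup (fun T : R => (T^-1)%:E *
      lne 'E_P[(fun omega =>
        expR (\int[lebesgue_measure]_(t in `[0, T]) r (X t omega)))%R])%E +oo%R.

Definition penalized_average (r : 'cV[R]_d -> R) w X (T : R) : \bar R :=
  'E_P[(fun omega => T^-1 * \int[lebesgue_measure]_(t in `[0, T])
          (r (X t omega) - 2^-1 * sqnormv (w t omega)))%R]%E.

End Probability.

Section PreciseControls.
Context {R : realType} {d : nat}.
Implicit Types x u ell kappa : 'cV[R]_d.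

Let continuousv_measurable (f : 'cV[R]_d -> R) :
  continuous f -> measurable_fun [set: borelV R d] (f : borelV R d -> R).
Proof.
move=> /continuousP cf.
apply: (measurability _ (measurable_realfun.RGenOpens.measurableE R)).
move=> _ [_ [a [b ->] <-]]; rewrite setTI.
by apply: sub_sigma_algebra; apply: cf; exact: interval_open.
Qed.

Let dotv_continuous x : continuous (dotv x).
Proof.
apply: (continuous_big add_continuous) => i _ u.
exact: (continuousM (@cst_continuous _ _ (x i 0) u) (@coord_continuous R d 1 i 0 u)).
Qed.

Let measurable_simplex : measurable (simplex : set (borelV R d)).
Proof.
rewrite (_ : simplex =
    (\bigcap_(i in [set: 'I_d]) ((fun u : borelV R d => u i 0) @^-1` `[0, +oo[))
    `&` ((dotv ones : borelV R d -> R) @^-1` [set 1])); last first.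
  apply/seteqP; split => [u [u0 u1]|u [u0 u1]]; split => //=.
    by move=> i _ /=; rewrite in_itv/= andbT.
  by move=> i; have /= := u0 i I; rewrite in_itv/= andbT.
apply: measurableI.
  apply: fin_bigcap_measurable => [|i _]; first exact: finite_finset.
   rewrite -[X in measurable X]setTI.
  by apply: continuousv_measurable => //; exact: coord_continuous.
rewrite -[X in measurable X]setTI.
by apply: continuousv_measurable => //; exact: dotv_continuous.
Qed.

Variables (f : 'cV[R]_d -> 'cV[R]_d)
  (mf : measurable_fun [set: borelV R d] (f : borelV R d -> borelV R d))
  (fU : forall x, simplex (f x)).

Let precise_kernel : R.-pker (borelV R d) ~> (borelV R d) := kdirac mf.

Let precise_kernel_simplex x : precise_kernel x simplex = 1%E.
Proof. by rewrite /= /kdirac/= diracE mem_set. Qed.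

Definition precise_control : SM_control R d :=
  SMControl precise_kernel_simplex.

Lemma relaxed_precise (g : 'cV[R]_d -> 'cV[R]_d -> R) x :
  continuous (g x) -> relaxed precise_control g x = g x (f x).
Proof.
move=> cg; rewrite /relaxed /Rintegral /= /kdirac integral_dirac//.
  by rewrite diracE mem_set// mul1e.
apply/measurable_realfun.measurable_EFinP; apply: measurable_funTS.
exact: continuousv_measurable.
Qed.

Lemma cost_precise kappa x :
  relaxed precise_control (cost kappa) x = cost kappa x (f x).
Proof.
apply: relaxed_precise.
rewrite (_ : cost kappa x = dotv (queue x *: kappa)); first exact: dotv_continuous.
by apply/funext => u; apply: eq_bigr => i _; rewrite !mxE mulrCA mulrA.
Qed.

Lemma drift_precise ell (mu gamma : 'I_d -> R) x :
  relaxedv precise_control (drift ell mu gamma) x = drift ell mu gamma x (f x).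
Proof.
apply/matrixP => i j; rewrite (ord1 j) mxE relaxed_precise// => u.
rewrite (_ : (fun u => _) = fun u : 'cV[R]_d => (ell i 0 - mu i * x i 0)
    + queue x * (mu i - gamma i) * u i 0).
  apply: (continuousD (@cst_continuous _ _ (ell i 0 - mu i * x i 0) u)).
  exact: (continuousM (@cst_continuous _ _ (queue x * (mu i - gamma i)) u)
                      (@coord_continuous R d 1 i 0 u)).
by apply/funext => y; rewrite /drift !mul_diag_mx !mxE; ring.
Qed.

End PreciseControls.

(* Main.v *)
(** The proof works at a fixed horizon T and compares the two sides there. Writing
    dX = sigma (beta(X) dt + w dt + dW), the claim is the Boue-Dupuis formula
      ln E e^Phi(X) = sup_w E (Phi(X^w) - 1/2 int_0^T |w|^2),  Phi(X) = int_0^T r(X),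
    which is obtained without any change of measure on path space.

    For functionals F of the increments of W over a dyadic grid, both inequalities are
    dynamic programming: the conditional expectations U_k of e^F are Gaussian averages,
    Jensen's inequality for a shifted Gaussian law gives the upper bound for each control, and the
    feedback control grad ln U_k loses only O(dt^2) per step when F is C^{1,1}.

    The drift beta is merely Borel, so X is not a continuous functional of W. But beta is
    close, in L^2 of the occupation measures of X and of X^w, to a bounded Lipschitz
    function c. The grid values of X^w are those of the Euler scheme with drift c driven
    by W + int (w + e), where e is a drift error of small energy, and likewise
    for X with w = 0; the price of e is O(th) when its energy is at most th^2.

    For the lower bound a control w is first chosen for a smooth cylinder functional H(W) that is
    L^1-close to Phi(X). To see that the same w is good for X^w, the upper bound is
    applied to 2 H - Phi, which is close to Phi along the uncontrolled motion and whose controlled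
    value is 2 H(W + int w) - Phi(X^w). Unbounded r is reached by monotone convergence. *)

Require Import Defs.
From HB Require Import structures.
From mathcomp Require Import all_boot all_order all_algebra.
From mathcomp Require Import all_classical all_reals all_analysis.
From mathcomp Require Import measurable_realfun.
From mathcomp Require Import ring lra.

Set Implicit Arguments.
Unset Strict Implicit.
Unset Printing Implicit Defensive.

Import Order.TTheory GRing.Theory Num.Theory.
Import numFieldNormedType.Exports.

Local Open Scope classical_set_scope.
Local Open Scope ring_scope.

(** * Expectations and approximation in mean *)

(** [X] and [Xstar w] are only known to satisfy their equations along almost every path; no common
    solution map is available. They are therefore compared through what both share: one Lipschitz
    drift and the increments of [W]. Why 2 H - Phi: let w be nearly optimal for H. The upper bound
    reads E(2 H(W + int w) - Phi(X^w)) - 1/2 E|w|^2 <= ln E e^(2 H - Phi(X)). Its right side is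
    about ln E e^Phi, hence about E H(W + int w) - 1/2 E|w|^2. Cancelling leaves E H(W + int w) <= E
    Phi(X^w) up to small errors. Order of choices: the accuracy eta of H comes first, and with it w
    and the Lipschitz constant of H; only then does th tend to 0. The Lipschitz constant of the
    Euler scheme may grow with the grid, but it enters no estimate, because the entropy inequality
    does not contain it. The energy of e is th^2 and not th because replacing W + int e by W in an
    exponential moment costs a division by th. *)

Section bounded_measurable.
Context {disp} {T : measurableType disp} {R : realType}.
Implicit Types f g : T -> R.

Definition bmeas f :=
  measurable_fun [set: T] f /\ exists M, forall x, `|f x| <= M.

Lemma bmeas_cst (r : R) : bmeas (fun=> r).
Proof. by split; [exact: measurable_cst|exists `|r|]. Qed.

Lemma bmeasD f g : bmeas f -> bmeas g -> bmeas (fun x => f x + g x).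
Proof.
move=> [mf [M fM]] [mg [N gN]]; split; first exact: measurable_funD.
by exists (M + N) => x; rewrite (le_trans (ler_normD _ _))// lerD.
Qed.

Lemma bmeasM f g : bmeas f -> bmeas g -> bmeas (fun x => f x * g x).
Proof.
move=> [mf [M fM]] [mg [N gN]]; split; first exact: measurable_funM.
by exists (M * N) => x; rewrite normrM ler_pM.
Qed.

Lemma bmeasZ (r : R) f : bmeas f -> bmeas (fun x => r * f x).
Proof. by apply: bmeasM; exact: bmeas_cst. Qed.

Lemma bmeasN f : bmeas f -> bmeas (fun x => - f x).
Proof.
by move=> /(bmeasZ (-1)); rewrite (_ : (fun x => -1 * f x) = fun x => - f x)//;
  apply/funext => x; rewrite mulN1r.
Qed.

Lemma bmeasB f g : bmeas f -> bmeas g -> bmeas (fun x => f x - g x).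
Proof. by move=> bf /bmeasN; exact: bmeasD. Qed.

Lemma bmeas_norm f : bmeas f -> bmeas (fun x => `|f x|).
Proof.
move=> [mf [M fM]]; split; first exact: measurableT_comp.
by exists M => x; rewrite normr_id.
Qed.

Lemma bmeas_expR f : bmeas f -> bmeas (fun x => expR (f x)).
Proof.
move=> [mf [M fM]]; split; first exact: measurableT_comp.
exists (expR M) => x; rewrite ger0_norm ?expR_ge0// ler_expR.
exact: le_trans (ler_norm _) (fM x).
Qed.

Lemma bmeas_sum n (F : nat -> T -> R) : (forall i, (i < n)%N -> bmeas (F i)) ->
  bmeas (fun x => \sum_(i < n) F i x).
Proof.
elim: n => [_|n ih bF].
  by under eq_fun do rewrite big_ord0; exact: bmeas_cst.
under eq_fun do rewrite big_ord_recr/=.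
by apply: bmeasD; [apply: ih => i /ltnW; exact: bF|exact: bF].
Qed.

Lemma bmeas_sumI (I : Type) (s : seq I) (F : I -> T -> R) :
  (forall i, bmeas (F i)) -> bmeas (fun x => \sum_(i <- s) F i x).
Proof.
move=> bF; elim: s => [|i s ih].
  by under eq_fun do rewrite big_nil; exact: bmeas_cst.
by under eq_fun do rewrite big_cons; exact: bmeasD.
Qed.

Lemma bmeas_indic (A : set T) : measurable A -> bmeas (\1_A : T -> R).
Proof.
move=> mA; split; first exact: measurable_indic.
by exists 1 => x; rewrite indicE; case: (_ \in _); rewrite ?normr1// normr0.
Qed.

End bounded_measurable.

Lemma bmeas_comp {d1 d2} {T1 : measurableType d1} {T2 : measurableType d2}
    {R : realType} (f : T2 -> R) (g : T1 -> T2) :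
  bmeas f -> measurable_fun [set: T1] g -> bmeas (fun x => f (g x)).
Proof.
move=> [mf [M fM]] mg; split; first exact: measurableT_comp.
by exists M => x; exact: fM.
Qed.

Section expectation.
Context {disp} {T : measurableType disp} {R : realType}.
Variable m : {finite_measure set T -> \bar R}.
Implicit Types f g : T -> R.

Definition L1 f := m.-integrable [set: T] (EFin \o f).

Lemma bmeas_L1 f : bmeas f -> L1 f.
Proof.
move=> [mf [M fM]]; apply: measurable_bounded_integrable => //.
  by rewrite ltey_eq; apply/orP; left; exact: fin_num_measure.
by exists M; split; [exact: num_real|] => x Mx y _ /=; rewrite (le_trans (fM y))// ltW.
Qed.

Lemma L1_meas f : L1 f -> measurable_fun setT f.
Proof. by move=> /measurable_int /measurable_EFinP. Qed.

Lemma L1D f g : L1 f -> L1 g -> L1 (fun x => f x + g x).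
Proof. by move=> f1 g1; exact: (integrableD measurableT f1 g1). Qed.

Lemma L1Z (r : R) f : L1 f -> L1 (fun x => r * f x).
Proof. by move=> f1; exact: (integrableZl measurableT r f1). Qed.

Lemma L1N f : L1 f -> L1 (fun x => - f x).
Proof.
by move=> /(L1Z (-1)); rewrite (_ : (fun x => -1 * f x) = fun x => - f x)//;
  apply/funext => x; rewrite mulN1r.
Qed.

Lemma L1B f g : L1 f -> L1 g -> L1 (fun x => f x - g x).
Proof. by move=> f1 /L1N; exact: L1D. Qed.

Lemma L1_norm f : L1 f -> L1 (fun x => `|f x|).
Proof. exact: integrable_norm. Qed.

Lemma L1_sum n (F : nat -> T -> R) : (forall i, (i < n)%N -> L1 (F i)) ->
  L1 (fun x => \sum_(i < n) F i x).
Proof.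
elim: n => [_|n ih bF].
  by under eq_fun do rewrite big_ord0; exact/bmeas_L1/bmeas_cst.
under eq_fun do rewrite big_ord_recr/=.
by apply: L1D; [apply: ih => i /ltnW; exact: bF|exact: bF].
Qed.

Lemma L1_dom f g : measurable_fun setT f -> L1 g -> (forall x, `|f x| <= g x) ->
  L1 f.
Proof.
move=> mf g1 fg; apply: (le_integrable measurableT _ _ g1).
  exact/measurable_EFinP.
move=> x _ /=; rewrite lee_fin (le_trans (fg x))//; exact: ler_norm.
Qed.

Lemma ED f g : L1 f -> L1 g ->
  \int[m]_x (f x + g x) = \int[m]_x f x + \int[m]_x g x.
Proof. by move=> f1 g1; rewrite RintegralD. Qed.

Lemma EZ (r : R) f : L1 f -> \int[m]_x (r * f x) = r * \int[m]_x f x.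
Proof. by move=> f1; rewrite RintegralZl. Qed.

Lemma EB f g : L1 f -> L1 g ->
  \int[m]_x (f x - g x) = \int[m]_x f x - \int[m]_x g x.
Proof. by move=> f1 g1; rewrite RintegralB. Qed.

Lemma EN f : L1 f -> \int[m]_x (- f x) = - \int[m]_x f x.
Proof.
move=> f1; rewrite -mulN1r -EZ//; apply: eq_Rintegral => x _.
by rewrite mulN1r.
Qed.

Lemma E_sum n (F : nat -> T -> R) : (forall i, (i < n)%N -> L1 (F i)) ->
  \int[m]_x (\sum_(i < n) F i x) = \sum_(i < n) \int[m]_x F i x.
Proof.
elim: n => [_|n ih bF].
  under eq_Rintegral do rewrite big_ord0.
  by rewrite big_ord0 Rintegral_cst// mul0r.
under eq_Rintegral do rewrite big_ord_recr/=.
rewrite big_ord_recr/= ED; last exact: bF.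
  by rewrite ih// => i ni; apply: bF; exact: ltnW.
by apply: L1_sum => i /ltnW; exact: bF.
Qed.

Lemma L1_sumI (I : Type) (s : seq I) (F : I -> T -> R) : (forall i, L1 (F i)) ->
  L1 (fun x => \sum_(i <- s) F i x).
Proof.
move=> LF; elim: s => [|i s ih].
  by under eq_fun do rewrite big_nil; exact/bmeas_L1/bmeas_cst.
by under eq_fun do rewrite big_cons; exact: L1D.
Qed.

Lemma E_sumI (I : Type) (s : seq I) (F : I -> T -> R) : (forall i, L1 (F i)) ->
  \int[m]_x (\sum_(i <- s) F i x) = \sum_(i <- s) \int[m]_x F i x.
Proof.
move=> LF; elim: s => [|i s ih].
  under eq_Rintegral do rewrite big_nil.
  by rewrite big_nil Rintegral_cst// mul0r.
under eq_Rintegral do rewrite big_cons.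
by rewrite big_cons ED ?ih//; exact: L1_sumI.
Qed.

Lemma le_E f g : L1 f -> L1 g -> (forall x, f x <= g x) ->
  \int[m]_x f x <= \int[m]_x g x.
Proof. by move=> f1 g1 fg; apply: le_Rintegral. Qed.

Lemma E_ge0 f : (forall x, 0 <= f x) -> 0 <= \int[m]_x f x.
Proof. by move=> f0; apply: Rintegral_ge0. Qed.

Lemma le_normE f : L1 f -> `|\int[m]_x f x| <= \int[m]_x `|f x|.
Proof. by move=> f1; apply: le_normr_Rintegral. Qed.

Lemma le_distE f g : L1 f -> L1 g ->
  `|\int[m]_x f x - \int[m]_x g x| <= \int[m]_x `|f x - g x|.
Proof. by move=> f1 g1; rewrite -EB//; apply: le_normE; exact: L1B. Qed.

Lemma EFinE f : L1 f -> (\int[m]_x (f x)%:E)%E = (\int[m]_x f x)%:E.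
Proof. by move=> f1; rewrite /Rintegral fineK//; exact: (integrable_fin_num measurableT f1). Qed.

End expectation.

Lemma E_cst {disp} {T : measurableType disp} {R : realType}
  (P : probability T R) (r : R) : \int[P]_x r = r.
Proof. rewrite /Rintegral integral_cst// [X in (_ * X)%E](_ : _ = 1%E) ?mule1//.
exact: probability_setT. Qed.

(* Closure of the sets approximable in mean by a class of [0,1]-valued functions
   stable under complement and product. *)
Section approximation.
Context {disp} {T : measurableType disp} {R : realType}.
Variables (m : {finite_measure set T -> \bar R}) (A : set (T -> R)).
Hypotheses (A_meas : forall f, A f -> measurable_fun setT f)
  (A_ge0 : forall f x, A f -> 0 <= f x) (A_le1 : forall f x, A f -> f x <= 1)
  (A0 : A (fun=> 0)) (AC : forall f, A f -> A (fun x => 1 - f x))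
  (AM : forall f g, A f -> A g -> A (fun x => f x * g x)).

Definition approximable (B : set T) := measurable B /\
  forall e : R, 0 < e -> exists2 f, A f & \int[m]_x `|f x - \1_B x| <= e.

Let A_bmeas f : A f -> bmeas f.
Proof.
move=> Af; split; first exact: A_meas.
by exists 1 => x; rewrite ger0_norm ?A_ge0 ?A_le1.
Qed.

Let bdiff f B : A f -> measurable B -> L1 m (fun x => `|f x - \1_B x|).
Proof.
move=> Af mB; apply: bmeas_L1; apply: bmeas_norm; apply: bmeasB.
  exact: A_bmeas.
exact: bmeas_indic.
Qed.

Lemma approximable0 : approximable set0.
Proof.
split=> // e e0; exists (fun=> 0) => //.
under eq_Rintegral do rewrite indic0 subrr normr0.
by rewrite Rintegral_cst// mul0r ltW.
Qed.

Lemma approximableC B : approximable B -> approximable (~` B).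
Proof.
move=> [mB aB]; split; first exact: measurableC.
move=> e /aB[f Af fe]; exists (fun x => 1 - f x); first exact: AC.
rewrite (le_trans _ fe)// le_eqVlt; apply/orP; left; apply/eqP.
apply: eq_Rintegral => x _; rewrite !indicE in_setC.
by case: (_ \in _) => /=; [rewrite subr0 distrC|rewrite addrAC subrr add0r subr0 normrN].
Qed.

Lemma approximableI B C : approximable B -> approximable C ->
  approximable (B `&` C).
Proof.
move=> [mB aB] [mC aC]; split; first exact: measurableI.
move=> e e0; have e20 : 0 < e / 2 by rewrite divr_gt0.
have [f Af fe] := aB _ e20; have [g Ag ge] := aC _ e20.
exists (fun x => f x * g x); first exact: AM.
apply: (@le_trans _ _ (\int[m]_x (`|f x - \1_B x| + `|g x - \1_C x|))); last first.
  by rewrite ED//; [lra|exact: bdiff|exact: bdiff].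
apply: le_E.
- by apply: bdiff; [exact: AM|exact: measurableI].
- by apply: L1D; exact: bdiff.
- move=> x; rewrite indicI/=.
  have -> : f x * g x - \1_B x * \1_C x =
    (f x - \1_B x) * g x + \1_B x * (g x - \1_C x) by ring.
  rewrite (le_trans (ler_normD _ _))// !normrM lerD//.
    by rewrite ler_piMr// ger0_norm ?A_ge0// A_le1.
  by rewrite ler_piMl// indicE; case: (_ \in _); rewrite ?normr1// normr0.
Qed.

Lemma approximableU B C : approximable B -> approximable C ->
  approximable (B `|` C).
Proof.
move=> aB aC; rewrite -[_ `|` _]setCK setCU.
by apply: approximableC; apply: approximableI; exact: approximableC.
Qed.

(** Continuity from below: a finite union already carries all but [e / 2] of the mass, and finite
    unions are approximable through complements and products. *)
Lemma approximable_bigcup (F : (set T)^nat) : (forall i, approximable (F i)) ->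
  approximable (\bigcup_i F i).
Proof.
move=> aF.
pose G n := \big[setU/set0]_(i < n) F i.
have aG n : approximable (G n).
  rewrite /G; elim: n => [|n ih]; first by rewrite big_ord0; exact: approximable0.
  by rewrite big_ord_recr/=; exact: approximableU.
have mG n : measurable (G n) by have [] := aG n.
have mF : measurable (\bigcup_i F i).
  by apply: bigcupT_measurable => i; have [] := aF i.
split=> // e e0; have e20 : 0 < e / 2 by rewrite divr_gt0.
have UG : \bigcup_i F i = \bigcup_n G n.
  rewrite /G -bigcup_bigsetU_bigcup; apply/seteqP; split=> [x [i _ xi]|x [[|i] _]].
    by exists i.+1.
    by rewrite big_ord0.
  by exists i.
have ndG : nondecreasing_seq G.
  by move=> i j ij; rewrite subsetEset /G; apply: subset_bigsetU.
have cG := @nondecreasing_cvg_mu _ _ _ m G mG.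
have {}cG : m (G n) @[n --> \oo] --> m (\bigcup_n F n).
  by rewrite UG; apply: cG => //; rewrite -UG.
have mfin B : measurable B -> m B \is a fin_num by exact: fin_num_measure.
have /fine_cvgP[_ cG'] : m (G n) @[n --> \oo] --> (fine (m (\bigcup_n F n)))%:E.
  by rewrite fineK//; exact: mfin.
have /cvgrPdist_le/(_ _ e20)[n _ /(_ n (leqnn _))/= Gn] := cG'.
have [_ /(_ _ e20)[f Af fe]] := aG n.
exists f => //.
have GF : G n `<=` \bigcup_i F i by rewrite UG => x Gx; exists n.
apply: (@le_trans _ _ (\int[m]_x (`|f x - \1_(G n) x| +
    (\1_(\bigcup_i F i) x - \1_(G n) x)))).
  apply: le_E.
  - exact: bdiff.
  - apply: L1D; first exact: bdiff.
    by apply: bmeas_L1; apply: bmeasB; exact: bmeas_indic.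
  - move=> x; rewrite -[X in `|f x - X|](subrK (\1_(G n) x)) opprD addrCA addrC.
    rewrite (le_trans (ler_normD _ _))// lerD2l normrN ger0_norm// subr_ge0.
    rewrite !indicE; case: (boolP (x \in G n)) => //.
    by move=> /set_mem/GF xF; rewrite mem_set.
rewrite ED; [|exact: bdiff|]; last first.
  by apply: bmeas_L1; apply: bmeasB; exact: bmeas_indic.
rewrite EB; [|exact/bmeas_L1/bmeas_indic..].
have E1 B : measurable B -> \int[m]_x (\1_B x : R) = fine (m B).
  by move=> mB; rewrite /Rintegral integral_indic// setIT.
rewrite !E1//.
move: Gn fe; rewrite ler_norml => /andP[_ ]; lra.
Qed.

Lemma approximable_sigma (G : set (set T)) : G `<=` approximable ->
  <<s G >> `<=` approximable.
Proof.
move=> Ga; apply: smallest_sub => //; split.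
- exact: approximable0.
- by move=> B aB; rewrite setTD; exact: approximableC.
- exact: approximable_bigcup.
Qed.

(** Counts the integers [i < n] strictly below [t], which is the ceiling of [t] capped at [n]. It
    compares a function with the sum of the indicators of its superlevel sets. *)
Let layers (n : nat) (t : R) : 0 <= t ->
  (t <= n%:R -> t <= \sum_(i < n) (i%:R < t)%R%:R <= t + 1) /\
  (n%:R < t -> \sum_(i < n) (i%:R < t)%R%:R = n%:R :> R).
Proof.
move=> t0; elim: n => [|n [ih1 ih2]].
  rewrite !big_ord0; split => // t1.
  by rewrite t1/= (le_trans t0)// lerDl.
rewrite !big_ord_recr/=; split; last first.
  move=> nt; have n't : n%:R < t by rewrite (lt_trans _ nt)// ltr_nat.
  by rewrite ih2// n't -natr1.
have [tn _|nt tn1] := leP t n%:R.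
  by rewrite addr0; exact: ih1.
rewrite ih2// natr1 tn1/= -natr1; lra.
Qed.

(** Layer cake. [M / n] times the number of levels [i M / n] below [f] differs from [f] by at most
    [M / n]. Each of the [n] level sets is then replaced by an element of [A] at cost [e / (2 M)],
    which the factor [M / n] turns into a total of [e / 2]. *)
Lemma approximable_fun (f : T -> R) (M : R) : 0 < M -> measurable_fun setT f ->
  (forall x, 0 <= f x <= M) ->
  (forall c : R, 0 <= c -> approximable [set x | c < f x]) ->
  forall e : R, 0 < e -> exists n (F : nat -> T -> R),
    [/\ (0 < n)%N, forall i, (i < n)%N -> A (F i) &
    \int[m]_x `|M / n%:R * \sum_(i < n) F i x - f x| <= e].
Proof.
move=> M0 mf f0M af e e0.
pose K := fine (m setT) + 1.
have K0 : 0 < K by rewrite /K ltr_wpDl// fine_ge0.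
have e' : 0 < e / (2 * M) by rewrite divr_gt0// mulr_gt0.
(* [n] exceeds [2 M K / e], so the layer width times the mass, at most [M / n * K], stays below
   [e / 2]. [K] is the mass plus one, hence positive. *)
pose n := (Num.truncn (2 * M * K / e)).+1.
have nM : M / n%:R <= e / (2 * K).
  rewrite ler_pdivrMr ?ltr0n// mulrAC ler_pdivlMr ?mulr_gt0//.
  have /ltW : 2 * M * K / e < n%:R by exact: truncnS_gt.
  by rewrite ler_pdivrMr//; lra.
pose c i : R := i%:R * (M / n%:R).
have c0 i : 0 <= c i by rewrite mulr_ge0// divr_ge0// ltW.
have /choice[F HF] i : exists F, A F /\ \int[m]_x `|F x - \1_[set x | c i < f x] x| <= e / (2 * M).
  by have [_ /(_ _ e')[F AF Fe]] := af _ (c0 i); exists F.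
exists n, F; split => // [i _|]; first by have [] := HF i.
have mfc i : measurable [set x | c i < f x] by have [] := af _ (c0 i).
have n0 : 0 < n%:R :> R by rewrite ltr0n.
have Mn0 : 0 < M / n%:R by rewrite divr_gt0.
have bF i : (i < n)%N -> bmeas (F i) by move=> _; apply: A_bmeas; have [] := HF i.
have bf : bmeas f.
  by split => //; exists M => x; have /andP[? ?] := f0M x; rewrite ger0_norm.
have bdF i : (i < n)%N -> L1 m (fun x => `|F i x - \1_[set x | c i < f x] x|).
  by move=> _; apply: bdiff => //; have [] := HF i.
apply: (@le_trans _ _ (\int[m]_x (M / n%:R *
   (\sum_(i < n) `|F i x - \1_[set x | c i < f x] x|) + M / n%:R))).
  apply: le_E.
  - apply: bmeas_L1; apply: bmeas_norm; apply: bmeasB => //.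
    by apply: bmeasZ; exact: bmeas_sum.
  - by apply: L1D; [apply: L1Z; exact: (L1_sum bdF)|exact/bmeas_L1/bmeas_cst].
  - move=> x.
    have fx : `|M / n%:R * (\sum_(i < n) \1_[set x | c i < f x] x) - f x| <= M / n%:R.
      have /andP[fx0 fxM] := f0M x.
      have [+ _] := layers n (divr_ge0 fx0 (ltW Mn0)).
      rewrite ler_pdivrMr// mulrC divfK ?gt_eqF// => /(_ fxM)/andP[].
      set s := \sum_(i < n) _; set s' := (\sum_(i < n) \1__ _).
      have -> : s' = s.
        apply: eq_bigr => i _; rewrite indicE mem_setE/=; congr (_%:R).
        by rewrite ltr_pdivlMr//; apply/idP/idP; rewrite inE.
      rewrite ler_pdivrMr// -lerBlDr ler_pdivlMr// => h1 h2.
      by rewrite ler_norml; apply/andP; split; lra.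
    have -> : M / n%:R * (\sum_(i < n) F i x) - f x =
      M / n%:R * (\sum_(i < n) (F i x - \1_[set x | c i < f x] x)) +
      (M / n%:R * (\sum_(i < n) \1_[set x | c i < f x] x) - f x).
      by rewrite sumrB; ring.
    rewrite (le_trans (ler_normD _ _))// lerD// normrM ger0_norm; last exact: ltW.
    by rewrite ler_pM2l// ler_norm_sum.
rewrite ED; [|by apply: L1Z; exact: (L1_sum bdF)|exact/bmeas_L1/bmeas_cst].
rewrite EZ; last exact: (L1_sum bdF).
rewrite (E_sum bdF) Rintegral_cst//.
apply: (@le_trans _ _ (M / n%:R * (\sum_(i < n) e / (2 * M)) + M / n%:R * K)).
  rewrite lerD//; last by rewrite ler_pM2l// /K lerDl.
  by rewrite ler_pM2l//; apply: ler_sum => i _; have [] := HF i.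
rewrite sumr_const card_ord -[e / (2 * M) *+ n]mulr_natr.
have -> : M / n%:R * (e / (2 * M) * n%:R) = e / 2.
  by field; rewrite !gt_eqF.
have : M / n%:R * K <= e / (2 * K) * K by rewrite ler_pM2r.
have -> : e / (2 * K) * K = e / 2 by field; rewrite !gt_eqF.
lra.
Qed.

End approximation.

(** * Borel sets and measurable maps of R^d *)

Section borel_vectors.
Context {R : realType} {d : nat}.

Lemma continuousv_measurable (f : 'cV[R]_d -> R) :
  continuous f -> measurable_fun [set: borelV R d] (f : borelV R d -> R).
Proof.
move=> /continuousP cf.
apply: (measurability _ (RGenOpens.measurableE R)).
move=> _ [_ [a [b ->] <-]]; rewrite setTI.
by apply: sub_sigma_algebra; apply: cf; exact: interval_open.
Qed.

Lemma measurable_coordv (i : 'I_d) :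
  measurable_fun [set: borelV R d] (fun u : borelV R d => u i 0).
Proof. by apply: continuousv_measurable => u; exact: coord_continuous. Qed.

(** Sup-norm cubes with rational centre and radius [1 / (k + 1)]: a base of the topology indexed by
    a countable type. *)
Let box (q : 'cV[rat]_d * nat) : set 'cV[R]_d :=
  [set y | forall i, `|y i 0 - ratr (q.1 i 0)| < q.2.+1%:R^-1].

Let open_box (U : set 'cV[R]_d) : open U ->
  U = \bigcup_(q in [set q | box q `<=` U]) box q.
Proof.
move=> oU; apply/seteqP; split => [x Ux|x [q qU /qU//]].
have : nbhs x U by apply: open_nbhs_nbhs.
move=> /nbhs_ballP[e /= e0 xU].
have [k ke] : exists k : nat, k.+1%:R^-1 < e / 2.
  have e20 : 0 < e / 2 by rewrite divr_gt0.
  by have [k _ /(_ k (leqnn _))/=] := near_infty_natSinv_lt (PosNum e20); exists k.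
have k0 : 0 < k.+1%:R^-1 :> R by rewrite invr_gt0 ltr0n.
have /choice[q Hq] (i : 'I_d) : exists q : rat, `|x i 0 - ratr q| < k.+1%:R^-1.
  move: (k.+1%:R^-1 : R) k0 => r k0.
  have : x i 0 - r < x i 0 + r by lra.
  move=> /rat_in_itvoo[q]; rewrite in_itv/= => /andP[h1 h2]; exists q.
  by rewrite ltr_norml; apply/andP; split; lra.
exists (\col_i q i, k) => /=; last by move=> i; rewrite mxE.
move=> y /= yq; apply: xU; split => // i j; rewrite (ord1 j) /ball/=.
have := yq i; have := Hq i; rewrite mxE => h1 h2.
rewrite (le_lt_trans (ler_distD (ratr (q i)) _ _))// [ltRHS]splitr ltrD//.
  exact: lt_trans ke.
by rewrite distrC (lt_trans h2).
Qed.

(** An open set is a countable union of rational cubes, and membership in a cube is a finite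
    conjunction of conditions on single coordinates. *)
Lemma measurable_funV {disp} {T : measurableType disp} (D : set T)
    (f : T -> borelV R d) : measurable D ->
  (forall i, measurable_fun D (fun x => f x i 0)) -> measurable_fun D f.
Proof.
move=> mD mf.
apply: (@measurability _ _ _ (borelV R d) D f (@open 'cV[R]_d)) => //.
move=> _ [U oU <-]; rewrite (open_box oU) bigcup_mkcond preimage_bigcup setI_bigcupr.
apply: countable_bigcupT_measurable => // q.
case: ifPn => _; last by rewrite preimage_set0 setI0.
rewrite (_ : _ `&` _ = D `&` \bigcap_(i in [set: 'I_d])
    (D `&` (fun x => `|f x i 0 - ratr (q.1 i 0)|) @^-1` `]-oo, q.2.+1%:R^-1[)).
  apply: measurableI => //; apply: fin_bigcap_measurable => // i _.
  have : measurable_fun D (fun x => `|f x i 0 - ratr (q.1 i 0)|).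
    by apply: measurableT_comp => //; apply: measurable_funB.
  by apply.
apply/seteqP; split => [x [Dx fx]|x [Dx fx]]; split => // i.
  by move=> _; split=> //=; rewrite in_itv/=; exact: fx.
by have [//|_ /=] := fx i; rewrite in_itv.
Qed.

Lemma lipschitz_measurable (L : R) (f : 'cV[R]_d -> R) :
  (forall x y, `|f x - f y| <= L * `|x - y|) ->
  measurable_fun [set: borelV R d] (f : borelV R d -> R).
Proof.
move=> fL; apply: continuousv_measurable => x.
have FF : Filter (nbhs x) := nbhs_filter x.
apply/cvgrPdist_lt => e e0; have L0 : 0 < `|L| + 1 by rewrite ltr_wpDl.
apply/(@nbhs_ballP R 'cV[R]_d x); exists (e / (`|L| + 1)) => [|y] /=; first by rewrite divr_gt0.
rewrite -ball_normE/= ltr_pdivlMr// mulrC => xy.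
rewrite (le_lt_trans _ xy)// (le_trans (fL _ _))// ler_wpM2r//.
by rewrite (le_trans (ler_norm _))// lerDl.
Qed.

Lemma coordv_norm (x : 'cV[R]_d) i : `|x i 0| <= `|x|.
Proof. rewrite [leRHS]mx_normrE.
exact: (le_bigmax _ (fun ij : 'I_d * 'I_1 => `|x ij.1 ij.2|) (i, 0)). Qed.

Definition halfspaces : set (set 'cV[R]_d) :=
  [set B | exists (i : 'I_d) (a : R), B = [set x : 'cV[R]_d | a < x i 0]].

(** By [measurable_funV] the identity is measurable from the sigma-algebra of half-spaces to the
    Borel one, since each coordinate is. *)
Lemma borelV_halfspaces (B : set (borelV R d)) : measurable B ->
  <<s halfspaces >> B.
Proof.
have mid : measurable_fun [set: g_sigma_algebraType halfspaces]
    (id : g_sigma_algebraType halfspaces -> borelV R d).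
  apply: measurable_funV => // i.
  apply: (measurability _ (RGenOInfty.measurableE R)) => _ [_ [a ->] <-].
  rewrite setTI; apply: sub_sigma_algebra; exists i, a.
  by apply/seteqP; split => x /=; rewrite in_itv/= andbT.
by move=> mB; have := mid measurableT B mB; rewrite setTI.
Qed.

End borel_vectors.

Section bounded_convergence.
Context {disp} {T : measurableType disp} {R : realType}.
Variable m : {finite_measure set T -> \bar R}.

Lemma bounded_cvg_E (f : nat -> T -> R) (g : T -> R) (M : R) :
  (forall n, measurable_fun setT (f n)) -> measurable_fun setT g ->
  (forall n x, `|f n x| <= M) ->
  {ae m, forall x, f n x @[n --> \oo] --> g x} ->
  \int[m]_x f n x @[n --> \oo] --> \int[m]_x g x.
Proof.
move=> mf mg fM fg.
have iM : m.-integrable [set: T] (cst M%:E) by apply: finite_measure_integrable_cst.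
have [] := @dominated_convergence _ _ _ m setT measurableT
  (fun n => EFin \o f n) (EFin \o g) (cst M%:E) _ _ _ iM _.
- by move=> n; exact/measurable_EFinP.
- exact/measurable_EFinP.
- by apply: filterS fg => x fx _; apply: cvg_EFin => //; exact: nearW.
- by apply: aeW => x n _ /=; rewrite lee_fin.
move=> ig _ fi; apply: fine_cvg; rewrite fineK; last exact: integrable_fin_num ig.
exact: fi.
Qed.

End bounded_convergence.

(* A C^{1,1} sigmoid: the indicator of the positive reals is the limit of u |->
   psi (n u). *)
Section sigmoid.
Context {R : realType}.
Implicit Types u v : R.

Definition psi u : R := if u <= 0 then 0 else u ^+ 2 / (1 + u ^+ 2).
Definition dpsi u : R := if u <= 0 then 0 else 2 * u / (1 + u ^+ 2) ^+ 2.

Lemma psi_ge0 u : 0 <= psi u.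
Proof.
rewrite /psi; case: ifP => // _; rewrite divr_ge0// ?sqr_ge0// addr_ge0//.
exact: sqr_ge0.
Qed.

Lemma psi_le1 u : psi u <= 1.
Proof.
rewrite /psi; case: ifP => // _; rewrite ler_pdivrMr ?mul1r ?lerDr//.
by rewrite ltr_pwDl// sqr_ge0.
Qed.

Let p1 u : 0 < 1 + u ^+ 2. Proof. by rewrite ltr_pwDl// sqr_ge0. Qed.

(** The square in the numerator of [psi] makes the function and its derivative vanish together at 0,
    so the estimate survives when [u] and [v] lie on opposite sides of the kink of [dpsi]. After
    clearing denominators every sign case is a polynomial inequality. *)
Lemma psi_C11 u v : `|psi v - psi u - dpsi u * (v - u)| <= 3 * (v - u) ^+ 2.
Proof.
rewrite /psi /dpsi; have [u0|u0] := leP u 0; have [v0|v0] := leP v 0.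
- by rewrite mul0r !subrr normr0 mulr_ge0// sqr_ge0.
- rewrite mul0r !subr0 ger0_norm ?divr_ge0 ?sqr_ge0 ?(ltW (p1 v))//.
  rewrite ler_pdivrMr//; have := sqr_ge0 v; have := sqr_ge0 (v - u).
  nra.
- have pu := p1 u.
  have -> : 0 - u ^+ 2 / (1 + u ^+ 2) - 2 * u / (1 + u ^+ 2) ^+ 2 * (v - u) =
    (2 * u * (u - v) - u ^+ 2 * (1 + u ^+ 2)) / (1 + u ^+ 2) ^+ 2.
    by field; rewrite gt_eqF.
  rewrite normrM (ger0_norm (x := _^-1)) ?invr_ge0 ?exprn_ge0 ?(ltW pu)//.
  rewrite ler_pdivrMr ?exprn_gt0// ler_norml; apply/andP; split; nra.
- have pu := p1 u; have pv := p1 v.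
  have -> : v ^+ 2 / (1 + v ^+ 2) - u ^+ 2 / (1 + u ^+ 2) -
      2 * u / (1 + u ^+ 2) ^+ 2 * (v - u) =
    (v - u) ^+ 2 * ((1 - u ^+ 2 - 2 * u * v) / ((1 + u ^+ 2) ^+ 2 * (1 + v ^+ 2))).
    by field; rewrite !gt_eqF.
  rewrite normrM ger0_norm ?sqr_ge0// mulrC ler_wpM2r ?sqr_ge0//.
  rewrite normrM (ger0_norm (x := _^-1)) ?invr_ge0 ?mulr_ge0 ?exprn_ge0 ?(ltW pu) ?(ltW pv)//.
  rewrite ler_pdivrMr ?mulr_gt0 ?exprn_gt0//.
  have h : 2 * u * v <= u ^+ 2 + v ^+ 2 by have := sqr_ge0 (u - v); nra.
  have uv : 0 <= u ^+ 2 * v ^+ 2 by rewrite mulr_ge0 ?sqr_ge0.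
  have h2 : 1 + u ^+ 2 + v ^+ 2 <= (1 + u ^+ 2) ^+ 2 * (1 + v ^+ 2).
    have := sqr_ge0 u; have := sqr_ge0 v; have := sqr_ge0 (u * v); have := sqr_ge0 (u ^+ 2); nra.
  have := mulr_gt0 u0 v0; have := sqr_ge0 u; have := sqr_ge0 v.
  move=> v2 u2 uv0; rewrite ler_norml; apply/andP; split; nra.
Qed.

Lemma dpsi_bound u : `|dpsi u| <= 1.
Proof.
rewrite /dpsi; case: ifPn; first by rewrite normr0.
rewrite -ltNge => u0; rewrite ger0_norm; last first.
  by rewrite divr_ge0// ?mulr_ge0// ?exprn_ge0// ltW.
rewrite ler_pdivrMr ?exprn_gt0// mul1r.
have := sqr_ge0 (u - 1); have := sqr_ge0 u; nra.
Qed.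

Lemma psi_lip u v : `|psi v - psi u| <= 2 * `|v - u|.
Proof.
wlog uv : u v / u <= v.
  move=> H; have [/H//|/ltW/H] := leP u v.
  by rewrite distrC (distrC u).
rewrite (ger0_norm (x := v - u)) ?subr_ge0// /psi.
have [u0|u0] := leP u 0; have [v0|v0] := leP v 0.
- by rewrite subrr normr0 mulr_ge0// subr_ge0.
- rewrite subr0 ger0_norm ?divr_ge0 ?sqr_ge0 ?(ltW (p1 v))//.
  rewrite ler_pdivrMr//; have := sqr_ge0 (v - 1); have := sqr_ge0 v; nra.
- by move: (lt_le_trans u0 uv); rewrite ltNge v0.
- have pu := p1 u; have pv := p1 v.
  have -> : v ^+ 2 / (1 + v ^+ 2) - u ^+ 2 / (1 + u ^+ 2) =
    (v - u) * ((v + u) / ((1 + u ^+ 2) * (1 + v ^+ 2))).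
    by field; rewrite !gt_eqF.
  rewrite ger0_norm; last first.
    by rewrite mulr_ge0 ?subr_ge0// divr_ge0 ?mulr_ge0 ?addr_ge0 ?sqr_ge0 ?(ltW u0) ?(ltW v0).
  rewrite [leRHS]mulrC ler_wpM2l ?subr_ge0// ler_pdivrMr ?mulr_gt0//.
  have := sqr_ge0 (v - 1); have := sqr_ge0 (u - 1).
  have := mulr_ge0 (sqr_ge0 u) (sqr_ge0 v); nra.
Qed.

Lemma psi_cvg u : psi (n%:R * u) @[n --> \oo] --> ((0 < u)%R%:R : R).
Proof.
have [u0|u0] := ltP 0 u; last first.
  rewrite [X in X @ _ --> _](_ : _ = fun=> 0); first exact: cvg_cst.
  by apply/funext => n; rewrite /psi mulr_ge0_le0// ler0n.
apply/cvgrPdist_le => e e0; near=> n.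
have n0 : 0 < n%:R :> R by rewrite ltr0n; near: n; exists 1%N.
have nu0 : 0 < n%:R * u by rewrite mulr_gt0.
rewrite /psi (leNgt _ 0) nu0/=.
have -> : 1 - (n%:R * u) ^+ 2 / (1 + (n%:R * u) ^+ 2) = (1 + (n%:R * u) ^+ 2)^-1.
  by field; rewrite gt_eqF.
rewrite ger0_norm ?invr_ge0 ?(ltW (p1 _))// invf_ple ?posrE//.
apply: (@le_trans _ _ (n%:R * u)); last by have := sqr_ge0 (n%:R * u - 1); nra.
rewrite -ler_pdivrMr//; near: n; exact: nbhs_infty_ger.
Unshelve. all: end_near. Qed.

End sigmoid.

Definition lipschitzv {R : realType} {d} (L : R) (f : 'cV[R]_d -> R) :=
  forall x y, `|f x - f y| <= L * `|x - y|.

Section lipschitz_density.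
Context {R : realType} {d : nat}.
Variable nu : {finite_measure set (borelV R d) -> \bar R}.

Let A : set (borelV R d -> R) :=
  [set f | (exists L, 0 <= L /\ lipschitzv L f) /\ forall x, 0 <= f x <= 1].

(** [psi (n (x i 0 - a))] is Lipschitz with constant [2 n] and tends boundedly to the indicator. *)
Let approximable_halfspace (i : 'I_d) (a : R) :
  approximable nu A [set x : 'cV[R]_d | a < x i 0].
Proof.
have mB : measurable ([set x : 'cV[R]_d | a < x i 0] : set (borelV R d)).
  rewrite (_ : [set _ | _] = setT `&` (fun x : borelV R d => x i 0) @^-1` `]a, +oo[).
    by apply: measurable_coordv.
  by rewrite setTI; apply/seteqP; split => x /=; rewrite in_itv/= andbT.
split=> // e e0.
have L n : lipschitzv (2 * n%:R : R) (fun x : 'cV[R]_d => psi (n%:R * (x i 0 - a))).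
  move=> x y; rewrite (le_trans (psi_lip _ _))// -mulrA ler_wpM2l//.
  rewrite -mulrBr normrM ger0_norm// ler_wpM2l// opprB addrA subrK.
  by have := coordv_norm (x - y) i; rewrite !mxE.
pose f n (x : borelV R d) := `|psi (n%:R * (x i 0 - a)) - \1_[set x : 'cV[R]_d | a < x i 0] x|.
have : \int[nu]_x f n x @[n --> \oo] --> \int[nu]_x (0 : R).
  apply: (@bounded_cvg_E _ _ _ _ _ _ 1) => //.
  - move=> n; apply: measurableT_comp => //; apply: measurable_funB.
      exact: lipschitz_measurable (L n).
    exact: measurable_indic.
  - move=> n x; rewrite normr_id indicE ler_norml.
    have := psi_ge0 (n%:R * (x i 0 - a)); have := psi_le1 (n%:R * (x i 0 - a)).
    by case: (_ \in _) => /=; lra.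
  - apply: aeW => x; rewrite -[X in _ --> X](@normr0 R R); apply: cvg_norm.
    rewrite -[X in _ --> X](subrr (\1_[set x : 'cV[R]_d | a < x i 0] x)).
    apply: cvgB; last exact: cvg_cst.
    rewrite indicE (_ : (x \in _) = (0 < x i 0 - a)); first exact: psi_cvg.
    by rewrite subr_gt0; apply/idP/idP; rewrite inE.
rewrite Rintegral_cst// mul0r => /cvgrPdist_le/(_ _ e0)[n _ /(_ n (leqnn _))].
rewrite sub0r normrN => fn; exists (fun x : 'cV[R]_d => psi (n%:R * (x i 0 - a))).
  split; first by exists (2 * n%:R); split; [exact: mulr_ge0|exact: L].
  by move=> x; rewrite psi_ge0 psi_le1.
exact: le_trans (ler_norm _) fn.
Qed.

Lemma lipschitzv_weaken (L L' : R) (f : 'cV[R]_d -> R) : L <= L' ->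
  lipschitzv L f -> lipschitzv L' f.
Proof. by move=> LL fL x y; rewrite (le_trans (fL x y))// ler_wpM2r. Qed.

Let Ameas f : A f -> measurable_fun [set: borelV R d] f.
Proof. by move=> [[L [_ fL]] _]; exact: lipschitz_measurable fL. Qed.

Let A0 : A (fun=> 0).
Proof.
split; last by move=> x; rewrite lexx ler01.
by exists 0; split=> // x y; rewrite subrr normr0 mul0r.
Qed.

Let AC f : A f -> A (fun x => 1 - f x).
Proof.
move=> [[L [L0 fL]] f01]; split; last by move=> x; have := f01 x; lra.
exists L; split=> // x y; rewrite (_ : 1 - f x - (1 - f y) = f y - f x); last ring.
by rewrite distrC.
Qed.

Let AM f g : A f -> A g -> A (fun x => f x * g x).
Proof.
move=> [[L [L0 fL]] f01] [[K [K0 gK]] g01]; split; last first.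
  move=> x; have /andP[f0 f1] := f01 x; have /andP[g0 g1] := g01 x.
  by rewrite mulr_ge0// mulr_ile1.
exists (L + K); split=> [|x y]; first exact: addr_ge0.
have -> : f x * g x - f y * g y = (f x - f y) * g x + f y * (g x - g y) by ring.
rewrite (le_trans (ler_normD _ _))// !normrM mulrDl lerD//.
  have /andP[g0 g1] := g01 x.
  by rewrite (le_trans _ (fL x y))// ler_piMr// ger0_norm.
have /andP[f0 f1] := f01 y.
by rewrite (le_trans _ (gK x y))// ler_piMl// ger0_norm.
Qed.

(** The sets approximable by Lipschitz functions with values in [0,1] form a sigma-algebra
    containing the half-spaces, hence all Borel sets; [approximable_fun] passes from sets to [g].
    The bound [M] is automatic: a sum of [n] such functions stays in [[0, M]] after the factor
    [M / n]. *)
Lemma lipschitz_dense (g : borelV R d -> R) (M : R) : 0 < M ->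
  measurable_fun setT g -> (forall x, 0 <= g x <= M) ->
  forall e : R, 0 < e -> exists (f : 'cV[R]_d -> R) (L : R),
    [/\ 0 <= L, lipschitzv L f, forall x, 0 <= f x <= M &
    \int[nu]_x `|f x - g x| <= e].
Proof.
move=> M0 mg gM e e0.
have A01 f x : A f -> 0 <= f x <= 1 by move=> [_].
have app B : measurable B -> approximable nu A B.
  move=> mB; apply: (@approximable_sigma _ _ _ nu A Ameas _ _ A0 AC AM
    (@halfspaces R d)) (borelV_halfspaces mB).
  - by move=> f x /A01 - /(_ x)/andP[].
  - by move=> f x /A01 - /(_ x)/andP[].
  - by move=> _ [i [a ->]]; exact: approximable_halfspace.
have [n [F [n0 AF Fe]]] : exists n (F : nat -> borelV R d -> R),
    [/\ (0 < n)%N, forall i, (i < n)%N -> A (F i) &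
    \int[nu]_x `|M / n%:R * \sum_(i < n) F i x - g x| <= e].
  apply: (@approximable_fun _ _ _ nu A) => //.
  - by move=> f x /A01 - /(_ x)/andP[].
  - by move=> f x /A01 - /(_ x)/andP[].
  - move=> c _; apply: app.
    rewrite (_ : [set _ | _] = setT `&` g @^-1` `]c, +oo[); first exact: mg.
    by rewrite setTI; apply/seteqP; split => x /=; rewrite in_itv/= andbT.
have n0' : 0 < n%:R :> R by rewrite ltr0n.
exists (fun x => M / n%:R * \sum_(i < n) F i x).
have [L [L0 FL]] : exists L, 0 <= L /\ lipschitzv L (fun x => \sum_(i < n) F i x).
  elim: n AF {Fe n0 n0'} => [_|n ih AF].
    by exists 0; split => // x y; rewrite !big_ord0 subrr normr0 mul0r.
  have [L [L0 FL]] : exists L, 0 <= L /\ lipschitzv L (fun x => \sum_(i < n) F i x).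
    by apply: ih => i /ltnW; exact: AF.
  have [[K [K0 FK]] _] := AF n (ltnSn n).
  exists (L + K); split=> [|x y]; first exact: addr_ge0.
  rewrite !big_ord_recr/= opprD addrACA mulrDl (le_trans (ler_normD _ _))//.
  by rewrite lerD.
exists (M / n%:R * L); split=> //.
- by rewrite mulr_ge0// divr_ge0// ltW.
- move=> x y; rewrite -mulrBr normrM ger0_norm ?divr_ge0 ?(ltW M0)//.
  by rewrite -mulrA ler_wpM2l// divr_ge0// ltW.
- move=> x; rewrite mulr_ge0 ?divr_ge0 ?(ltW M0)//=; last first.
    by apply: sumr_ge0 => i _; have /andP[] := A01 _ x (AF i (ltn_ord i)).
  rewrite mulrAC ler_pdivrMr// ler_pM2l//.
  rewrite (le_trans (ler_sum _ (G := fun=> 1) _))//.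
    by move=> i _; have /andP[] := A01 _ x (AF i (ltn_ord i)).
  by rewrite sumr_const card_ord.
Qed.

End lipschitz_density.

(** Generators of the product sigma-algebra. Infinite sequences, rather than tuples of length
    [2 ^ m], let all grids share one type of increments. *)
Definition seqV_gen (R : realType) (d : nat) : set (set (nat -> 'cV[R]_d)) :=
  [set A | exists k (B : set (borelV R d)), measurable B /\
    A = (fun s : nat -> 'cV[R]_d => s k) @^-1` B].

Notation seqV R d := (g_sigma_algebraType (@seqV_gen R d)).

Section sequences_of_vectors.
Context {R : realType} {d : nat}.

Lemma measurable_seqV_coord k :
  measurable_fun [set: seqV R d] (fun s : seqV R d => s k : borelV R d).
Proof.
move=> _ B mB; rewrite setTI; apply: sub_sigma_algebra; by exists k, B.
Qed.

Lemma measurable_seqV_coordi k (i : 'I_d) :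
  measurable_fun [set: seqV R d] (fun s : seqV R d => s k i 0).
Proof. exact: measurableT_comp (measurable_coordv i) (measurable_seqV_coord k). Qed.

Lemma measurable_fun_seqV {disp} {T : measurableType disp} (f : T -> seqV R d) :
  (forall k, measurable_fun [set: T] (fun x => f x k : borelV R d)) ->
  measurable_fun [set: T] f.
Proof.
move=> mf; apply: (@measurability _ _ _ (seqV R d) setT f (@seqV_gen R d)) => //.
by move=> _ [_ [k [B [mB ->]]] <-]; exact: (mf k measurableT B mB).
Qed.

Definition upd (y : nat -> 'cV[R]_d) (k : nat) (z : 'cV[R]_d) : nat -> 'cV[R]_d :=
  fun j => if j == k then z else y j.

Lemma measurable_upd k : measurable_fun [set: (seqV R d * borelV R d)%type]
  ((fun p => upd p.1 k p.2) : seqV R d * borelV R d -> seqV R d).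
Proof.
apply: measurable_fun_seqV => j; rewrite /upd; case: (j == k).
  exact: measurable_snd.
exact: measurableT_comp (measurable_seqV_coord j) measurable_fst.
Qed.

End sequences_of_vectors.

(** * Gaussian laws on R^d *)

Import HBNNSimple.

Section density.
Local Open Scope ereal_scope.
Context {disp} {T : measurableType disp} {R : realType}.
Variables (m m' : {measure set T -> \bar R}) (g : T -> R).
Hypotheses (mg : measurable_fun setT g) (g0 : forall x, (0 <= g x)%R)
  (m'E : forall A, measurable A -> m' A = \int[m]_(x in A) (g x)%:E).

Let integral_density_nnsfun (f : {nnsfun T >-> R}) :
  \int[m']_x (f x)%:E = \int[m]_x ((f x)%:E * (g x)%:E).
Proof.
have mgE : measurable_fun setT (EFin \o g) by exact/measurable_EFinP.
under [LHS]eq_integral do rewrite fimfunE -fsumEFin//.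
rewrite [LHS]ge0_integral_fsum//; last 2 first.
- by move=> r; exact/measurable_EFinP/measurableT_comp.
- by move=> n x _; rewrite EFinM nnfun_muleindic_ge0.
under [RHS]eq_integral.
  move=> x _; rewrite fimfunE -fsumEFin// ge0_mule_fsuml; last first.
    by move=> r; rewrite EFinM nnfun_muleindic_ge0.
  over.
rewrite [RHS]ge0_integral_fsum//; last 2 first.
- move=> r; apply/emeasurable_funM => //.
  by apply/measurable_EFinP/measurableT_comp.
- move=> n x _; apply: mule_ge0; last by rewrite lee_fin.
  by rewrite EFinM nnfun_muleindic_ge0.
apply: eq_fsbigr => r _.
have [r0|r0] := leP 0%R r; last first.
  rewrite (preimage_nnfun0 f r0).
  under eq_integral do rewrite indic0 mulr0.
  by under [RHS]eq_integral do rewrite indic0 mulr0 mul0e; rewrite !integral0.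
under [RHS]eq_integral do rewrite EFinM -muleA.
under [LHS]eq_integral do rewrite EFinM.
rewrite !ge0_integralZl//; last 3 first.
- apply: emeasurable_funM => //; exact/measurable_EFinP.
- by move=> x _; rewrite mule_ge0 ?lee_fin.
- exact/measurable_EFinP.
rewrite integral_indic// setIT m'E//; congr (_ * _).
rewrite [LHS]integral_mkcond; apply: eq_integral => x _.
by rewrite patchE indicE; case: (_ \in _); rewrite ?mul1e ?mul0e.
Qed.

(** Simple functions first, then monotone convergence on both sides. *)
Lemma ge0_integral_density (f : T -> \bar R) : measurable_fun setT f ->
  (forall x, 0 <= f x) -> \int[m']_x f x = \int[m]_x (f x * (g x)%:E).
Proof.
move=> mf f0.
have mgE : measurable_fun setT (EFin \o g) by exact/measurable_EFinP.
pose f_ := nnsfun_approx measurableT mf.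
transitivity (lim (\int[m']_x (f_ n x)%:E @[n --> \oo])).
  rewrite -monotone_convergence//=.
  - apply: eq_integral => ? /[!inE] xD; apply/esym/cvg_lim => //=.
    exact: cvg_nnsfun_approx.
  - by move=> n; exact/measurable_EFinP/measurable_funTS.
  - by move=> n ? _; rewrite lee_fin.
  - by move=> ? _ ? ? mn; rewrite lee_fin; exact/lefP/nd_nnsfun_approx.
transitivity (lim (\int[m]_x ((f_ n x)%:E * (g x)%:E) @[n --> \oo])).
  by apply: congr_lim; apply/funext => n; exact: integral_density_nnsfun.
rewrite -monotone_convergence//=.
- apply: eq_integral => x _; apply/cvg_lim => //.
  by apply: cvgeZr => //; exact: cvg_nnsfun_approx.
- by move=> n; apply: emeasurable_funM => //; exact/measurable_EFinP/measurable_funTS.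
- by move=> n x _; rewrite mule_ge0 ?lee_fin.
- move=> x _ i j ij; rewrite lee_wpmul2r ?lee_fin//.
  exact/lefP/nd_nnsfun_approx.
Qed.

End density.

Section normal_shift.
Local Open Scope ereal_scope.
Context {R : realType}.
Local Notation mu := (@lebesgue_measure R).

Lemma lebesgue_measure_shift (h : R) (A : set (measurableTypeR R)) : measurable A ->
  pushforward mu ((fun x => x + h)%R : _ -> measurableTypeR R) A = mu A.
Proof.
move=> mA.
have mh : measurable_fun setT ((fun x => x + h)%R : measurableTypeR R -> measurableTypeR R).
  exact: measurable_funD.
pose nu := measure_function_pushforward__canonical__measure_function_Measure mu mh.
apply/esym; apply: (@lebesgue_measure_unique R nu) => // _ [[a b] _ <-].
rewrite /nu/=.
rewrite /pushforward.
have -> : (fun x => x + h)%R @^-1` `]a, b] = `](a - h)%R, (b - h)%R]%classic.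
  by apply/seteqP; split => x /=; rewrite !in_itv/= ltrBlDr lerBrDr.
by rewrite !lebesgue_measure_itv/= !lte_fin ltrD2r -!EFinB opprB addrA subrK.
Qed.

Lemma ge0_integral_shift (h : R) (f : R -> \bar R) :
  measurable_fun setT f -> (forall x, 0 <= f x) ->
  \int[mu]_x f (x + h)%R = \int[mu]_x f x.
Proof.
move=> mf f0.
have mh : measurable_fun setT ((fun x => x + h)%R : R -> measurableTypeR R).
  exact: measurable_funD.
transitivity (\int[pushforward mu ((fun x => x + h)%R : _ -> measurableTypeR R)]_x f x).
  by rewrite ge0_integral_pushforward.
by apply: eq_measure_integral => A mA _; exact: lebesgue_measure_shift.
Qed.

(** Completing the square: the exponential factor times the centred density at [x] is the density at
    [x + del * a]. This is the Cameron-Martin formula in dimension one. *)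
Lemma normal_prob_shift (del a : R) (f : R -> \bar R) : (0 < del)%R ->
  measurable_fun setT f -> (forall x, 0 <= f x) ->
  \int[normal_prob 0 (Num.sqrt del)]_x
     (f (x + del * a)%R * (expR (- a * x - 2^-1 * del * a ^+ 2))%:E) =
  \int[normal_prob 0 (Num.sqrt del)]_x f x.
Proof.
move=> del0 mf f0.
pose g := normal_pdf 0 (Num.sqrt del).
have mg : measurable_fun setT g by exact: measurable_normal_pdf.
have g0 x : (0 <= g x)%R by exact: normal_pdf_ge0.
have mgE : measurable_fun setT (EFin \o g) by exact/measurable_EFinP.
have m'E A : measurable A -> normal_prob 0 (Num.sqrt del) A = \int[mu]_(x in A) (g x)%:E by [].
have me : measurable_fun setT (fun x : R => expR (- a * x - 2^-1 * del * a ^+ 2)).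
  by apply: measurableT_comp => //; apply: measurable_funB.
have mfs : measurable_fun setT (fun x : R => f (x + del * a)%R).
  by apply: measurableT_comp => //; exact: measurable_funD.
have D := @ge0_integral_density _ (measurableTypeR R) R mu (normal_prob 0 (Num.sqrt del)) g mg g0 m'E.
rewrite !D//; last 2 first.
- by apply: emeasurable_funM => //; exact/measurable_EFinP.
- by move=> x; rewrite mule_ge0// lee_fin expR_ge0.
rewrite -[RHS](@ge0_integral_shift (del * a)); last 2 first.
- exact: emeasurable_funM.
- by move=> x; rewrite mule_ge0// lee_fin.
apply: eq_integral => x _; rewrite -muleA -EFinM; congr (_ * _%:E).
have s0 : Num.sqrt del != 0%R by rewrite gt_eqF// sqrtr_gt0.
rewrite /g /normal_pdf (negbTE s0) mulrCA; congr (_ * _)%R.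
rewrite /normal_fun -expRD sqr_sqrtr ?(ltW del0)//; congr expR.
by field; rewrite gt_eqF.
Qed.

End normal_shift.

(** * Independence and freezing of independent variables *)

Section independence.
Local Open Scope ereal_scope.
Context {disp} {T : measurableType disp} {R : realType} (P : probability T R).

(** The sets independent of [E] form a Dynkin system; stability of [G] under intersection upgrades
    this to the generated sigma-algebra. *)
Lemma indep_sigma (G : set (set T)) (E : set T) : setI_closed G ->
  G `<=` measurable -> measurable E ->
  (forall A, G A -> P (A `&` E) = P A * P E) ->
  forall A, <<s G >> A -> measurable A /\ P (A `&` E) = P A * P E.
Proof.
move=> GI Gm mE GE.
rewrite -(setI_closed_g_dynkin_g_sigma_algebra GI).
apply: smallest_sub; last by move=> A GA; split; [exact: Gm|exact: GE].
split.
- by split=> //; rewrite setTI probability_setT mul1e.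
- move=> A [mA AE]; split; first exact: measurableC.
  have -> : ~` A `&` E = E `\` (A `&` E).
    by rewrite setDIr setDv setU0 setIC setDE.
  rewrite measureD//; [|exact: measurableI|exact: le_lt_trans (probability_le1 P mE) (ltry _)].
  rewrite probability_setC// setICA setIid.
  rewrite [X in _ - X](_ : _ = P A * P E)// muleBl ?mul1e//; exact: fin_num_measure.
- move=> F tF mF.
  have mFi i : measurable (F i) by have [] := mF i.
  split; first exact: bigcupT_measurable.
  rewrite setI_bigcupl measure_bigcup//; last 2 first.
  - by move=> i _; exact: measurableI.
  - by apply: trivIset_setIr.
  rewrite measure_bigcup//.
  rewrite muleC -(@fineK _ (P E)) ?fin_num_measure// -nneseriesZl//.
  apply: eq_eseriesr => i _; rewrite fineK ?fin_num_measure//.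
  by have [_ e] := mF i; rewrite muleC; exact: e.
Qed.

Context {d1 d2} {S : measurableType d1} {U : measurableType d2}.
Variables (M : probability U R) (zeta : T -> S) (xi : T -> U).
Hypotheses (mzeta : measurable_fun setT zeta) (mxi : measurable_fun setT xi)
  (ind : forall A B, measurable A -> measurable B ->
     P (zeta @^-1` A `&` xi @^-1` B) = P (zeta @^-1` A) * M B).

(** By uniqueness on rectangles, the joint law of [(zeta, xi)] is the product of the law of [zeta]
    with [M]; Tonelli does the rest. It plays the role of a conditional expectation given [zeta]. *)
Lemma ge0_freeze (F : S * U -> \bar R) : measurable_fun setT F ->
  (forall p, 0 <= F p) ->
  \int[P]_x F (zeta x, xi x) = \int[P]_x \int[M]_z F (zeta x, z).
Proof.
move=> mF F0.
have mp : measurable_fun setT (fun x => (zeta x, xi x)) by exact: measurable_fun_pair.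
pose Pp := distribution P (mfun_Sub (mem_set mp)).
pose Pz := distribution P (mfun_Sub (mem_set mzeta)).
have -> : \int[P]_x F (zeta x, xi x) = \int[Pp]_p F p.
  by rewrite ge0_integral_distribution.
transitivity (\int[Pz \x M]_p F p).
  apply: eq_measure_integral => A mA _; apply/esym.
  apply: (@product_measure_unique _ _ _ _ _ Pz M Pp) => // B C mB mC; exact: ind.
rewrite fubini_tonelli1// ge0_integral_distribution//.
  exact: measurable_fun_fubini_tonelli_F.
by move=> y; apply: integral_ge0.
Qed.

Lemma bmeas_freeze_inner (F : S * U -> R) : bmeas F ->
  bmeas (fun y : S => \int[M]_z F (y, z))%R.
Proof.
move=> [mF [K FK]].
have mFy (y : S) : measurable_fun setT (fun z => F (y, z)).
  exact: measurableT_comp mF (pair1_measurable y).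
have LF y : L1 M (fun z => F (y, z)) by apply: bmeas_L1; split=> //; exists K.
split; last first.
  exists K => y; rewrite (le_trans (le_normE (LF y)))//.
  rewrite -[leRHS](E_cst M); apply: le_E => //; first exact: L1_norm.
  exact/bmeas_L1/bmeas_cst.
have -> : (fun y => \int[M]_z F (y, z))%R =
    (fun y => fine (\int[M]_z (F (y, z) + K)%:E) - K)%R.
  apply/funext => y; rewrite -/(Rintegral _ _ _) ED//; last exact/bmeas_L1/bmeas_cst.
  by rewrite E_cst addrK.
apply: measurable_funB => //; apply: measurableT_comp => //.
apply: (measurable_fun_fubini_tonelli_F (m2 := M) (fun p => (F p + K)%:E)).
  by apply/measurable_EFinP; exact: measurable_funD.
by move=> p; rewrite lee_fin; have := FK p; rewrite ler_norml => /andP[]; lra.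
Qed.

(** A bounded [F] becomes nonnegative after adding its bound [K], and [K] cancels from both
    sides. *)
Lemma freeze (F : S * U -> R) : bmeas F ->
  (\int[P]_x F (zeta x, xi x) = \int[P]_x \int[M]_z F (zeta x, z))%R.
Proof.
move=> bF; have [mF [K FK]] := bF.
have mFy (y : S) : measurable_fun setT (fun z => F (y, z)).
  exact: measurableT_comp mF (pair1_measurable y).
have LF y : L1 M (fun z => F (y, z)) by apply: bmeas_L1; split=> //; exists K.
have F0 p : (0 <= F p + K)%R.
  by have := FK p; rewrite ler_norml => /andP[]; lra.
have := @ge0_freeze (fun p => (F p + K)%:E).
have mFK : measurable_fun setT (fun p => (F p + K)%:E).
  by apply/measurable_EFinP; exact: measurable_funD.
move=> /(_ mFK F0).
have bP : bmeas (fun x => F (zeta x, xi x)).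
  by apply: bmeas_comp bF _; exact: measurable_fun_pair.
have LK (Q : probability T R) : L1 Q (fun=> K) by exact/bmeas_L1/bmeas_cst.
have -> : \int[P]_x (F (zeta x, xi x) + K)%:E =
    (\int[P]_x F (zeta x, xi x) + K)%:E.
  rewrite EFinE; last by apply: L1D => //; exact: bmeas_L1.
  by rewrite ED ?E_cst//; exact: bmeas_L1.
under eq_integral.
  move=> x _; rewrite EFinE; last by apply: L1D => //; exact/bmeas_L1/bmeas_cst.
  rewrite ED//; last exact/bmeas_L1/bmeas_cst.
  rewrite E_cst.
  over.
have bI : bmeas (fun x => \int[M]_z F (zeta x, z))%R.
  exact: (bmeas_comp (bmeas_freeze_inner bF) mzeta).
rewrite EFinE; last by apply: L1D => //; exact: bmeas_L1.
rewrite ED ?E_cst//; last exact: bmeas_L1.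
by move=> [] /addIr.
Qed.

End independence.

(** The centred Gaussian law with covariance [del] times the identity, characterised on boxes. No
    such law is constructed: it will be supplied by the increments of the Brownian motion. *)
Definition gaussV {R : realType} {d} (del : R) (N : set (borelV R d) -> \bar R) :=
  forall B : 'I_d -> set R, (forall i, measurable (B i)) ->
    N [set x : 'cV[R]_d | forall i, B i (x i 0)] =
    (\prod_(i < d) normal_prob 0 (Num.sqrt del) (B i))%E.

Section gaussian_shift.
Context {R : realType} {d : nat}.
Variables (del : R) (N : probability (borelV R d) R).
Hypotheses (del0 : 0 < del) (gN : gaussV del N).
Let M : probability (measurableTypeR R) R := normal_prob 0 (Num.sqrt del).

Let off (l : 'I_d) (x : 'cV[R]_d) : 'cV[R]_d := \col_i (if i == l then 0 else x i 0).
Definition axis (l : 'I_d) (z : R) : 'cV[R]_d := \col_i (if i == l then z else 0).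

Let box (C : 'I_d -> set R) : set (borelV R d) :=
  [set x : 'cV[R]_d | forall i, C i (x i 0)].

Let measurable_box C : (forall i, measurable (C i)) -> measurable (box C).
Proof.
move=> mC; rewrite (_ : box C = \bigcap_(i in [set: 'I_d]) (fun u : borelV R d => u i 0) @^-1` C i).
  apply: fin_bigcap_measurable => // i _.
  by rewrite -[X in measurable X]setTI; apply: measurable_coordv.
by apply/seteqP; split=> [x Cx i _|x Cx i]; exact: Cx.
Qed.

Let measurable_off l : measurable_fun [set: borelV R d]
  ((off l : 'cV[R]_d -> 'cV[R]_d) : borelV R d -> borelV R d).
Proof.
apply: measurable_funV => // i; rewrite /off.
under eq_fun do rewrite mxE; case: (i == l); first exact: measurable_cst.
exact: measurable_coordv.
Qed.

(** Boxes whose [l]-th side is the whole line are stable under intersection and generate every event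
    about the other coordinates, so the product formula on boxes extends by Dynkin's argument. *)
Let indep_off l (A : set (borelV R d)) (B : set R) : measurable A -> measurable B ->
  N (off l @^-1` A `&` (fun u : borelV R d => u l 0) @^-1` B) = (N (off l @^-1` A) * M B)%E.
Proof.
move=> mA mB.
pose G : set (set (borelV R d)) :=
  [set E | exists C, [/\ forall i, measurable (C i), C l = setT & E = box C]].
have NE C : (forall i, measurable (C i)) -> N (box C) = (\prod_(i < d) M (C i))%E.
  by move=> mC; exact: gN.
have mE : measurable ((fun u : borelV R d => u l 0) @^-1` B).
  by rewrite -[X in measurable X]setTI; apply: measurable_coordv.
have EE : (fun u : borelV R d => u l 0) @^-1` B = box (fun i => if i == l then B else setT).
  apply/seteqP; split => x /= Bx; last by have := Bx l; rewrite eqxx.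
  by move=> i; case: eqP => [->|].
have NB : N ((fun u : borelV R d => u l 0) @^-1` B) = M B.
  rewrite EE NE; last by move=> i; case: ifP.
  rewrite (bigD1 l)//= eqxx big1 ?mule1// => i /negbTE ->.
  exact: probability_setT.
have GI : setI_closed G.
  move=> _ _ [C [mC Cl ->]] [C' [mC' Cl' ->]].
  exists (fun i => C i `&` C' i); split => [i||].
  - exact: measurableI.
  - by rewrite Cl Cl' setTI.
  - apply/seteqP; split => x; last by move=> h; split=> i; have [] := h i.
    by move=> [h h'] i; split; [exact: h|exact: h'].
have Gm : G `<=` measurable by move=> _ [C [mC _ ->]]; exact: measurable_box.
have GE C : (forall i, measurable (C i)) -> C l = setT ->
    (N (box C `&` (fun u : borelV R d => u l 0%R) @^-1` B) = N (box C) * M B)%E.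
  move=> mC Cl; rewrite EE.
  have -> : box C `&` box (fun i => if i == l then B else setT) =
            box (fun i => if i == l then B else C i).
    apply/seteqP; split => x.
      by move=> [h h'] i; have := h i; have := h' i; case: eqP => [->|].
    move=> h; split => i; have := h i; case: eqP => [->|//]//.
    by rewrite Cl.
  rewrite !NE//; last by move=> i; case: ifP.
  rewrite (bigD1 l)//= eqxx muleC [in RHS](bigD1 l)//= Cl.
  have -> : M setT = 1%E by exact: probability_setT.
  rewrite mul1e; congr (_ * _)%E; apply: eq_bigr => i /negbTE il.
  by rewrite il.
have mid : measurable_fun [set: g_sigma_algebraType G]
    ((off l : 'cV[R]_d -> 'cV[R]_d) : g_sigma_algebraType G -> borelV R d).
  apply: measurable_funV => // i.
  rewrite /off; under eq_fun do rewrite mxE.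
  case: eqP => [_|/eqP il]; first exact: measurable_cst.
  move=> _ C mC; rewrite setTI; apply: sub_sigma_algebra.
  exists (fun j => if j == i then C else setT); split.
  - by move=> j; case: ifP.
  - by rewrite eq_sym (negbTE il).
  - apply/seteqP; split => x /= Cx; last by have := Cx i; rewrite eqxx.
    by move=> j; case: eqP => [->|].
have GA : <<s G >> (off l @^-1` A).
  by have := mid measurableT A mA; rewrite setTI.
have GE' E : G E -> N (E `&` (fun u : borelV R d => u l 0%R) @^-1` B) =
    (N E * N ((fun u : borelV R d => u l 0%R) @^-1` B))%E.
  by move=> [C [mC Cl ->]]; rewrite NB; exact: GE.
have [_ e] := indep_sigma GI Gm mE GE' GA.
by move: e; rewrite NB.
Qed.

Let off_axis l x : x = off l x + axis l (x l 0).
Proof.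
apply/matrixP => i j; rewrite !mxE (ord1 j).
by case: eqP => [->|_]; rewrite ?add0r ?addr0.
Qed.

Let measurable_addV {dT} {T : measurableType dT} (f g : T -> 'cV[R]_d) :
  measurable_fun setT (f : T -> borelV R d) -> measurable_fun setT (g : T -> borelV R d) ->
  measurable_fun setT ((fun x => f x + g x) : T -> borelV R d).
Proof.
move=> mf mg; apply: measurable_funV => // i; under eq_fun do rewrite mxE.
by apply: measurable_funD; exact: measurableT_comp (measurable_coordv i) _.
Qed.

Let measurable_axis {dT} {T : measurableType dT} l (f : T -> R) :
  measurable_fun setT f -> measurable_fun setT ((fun x => axis l (f x)) : T -> borelV R d).
Proof.
move=> mf; apply: measurable_funV => // i; under eq_fun do rewrite mxE.
by case: (i == l) => //; exact: measurable_cst.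
Qed.

Lemma gauss_shift1 l (a : R) (f : borelV R d -> \bar R) : measurable_fun setT f ->
  (forall x, 0 <= f x)%E ->
  (\int[N]_x (f ((x : 'cV[R]_d) + axis l (del * a))%R *
     (expR (- a * x l 0 - 2^-1 * del * a ^+ 2))%:E) = \int[N]_x f x)%E.
Proof.
move=> mf f0.
have fz := @ge0_freeze _ _ _ N _ _ _ _ M _ _ (measurable_off l) (measurable_coordv l) (indep_off l).
pose F (p : borelV R d * measurableTypeR R) := f ((p.1 : 'cV[R]_d) + axis l p.2).
have mF : measurable_fun setT F.
  apply: measurableT_comp mf _; apply: measurable_addV; first exact: measurable_fst.
  by apply: measurable_axis; exact: measurable_snd.
pose F' (p : borelV R d * measurableTypeR R) := (f ((p.1 : 'cV[R]_d) + axis l (p.2 + del * a)%R)%R *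
  (expR (- a * p.2 - 2^-1 * del * a ^+ 2))%:E)%E.
have mF' : measurable_fun setT F'.
  apply: emeasurable_funM.
    apply: measurableT_comp mf _; apply: measurable_addV; first exact: measurable_fst.
    apply: measurable_axis; apply: measurable_funD => //; exact: measurable_snd.
  apply/measurable_EFinP; apply: measurableT_comp => //; apply: measurable_funB => //.
  by apply: measurable_funM => //; exact: measurable_snd.
transitivity (\int[N]_x F' (off l x, x l 0%R))%E.
  apply: eq_integral => x _; rewrite /F'/= {1}(off_axis l x) -addrA.
  congr (f _ * _)%E; congr (_ + _); apply/matrixP => i j; rewrite !mxE.
  by case: ifP; rewrite ?addr0.
transitivity (\int[N]_x F (off l x, x l 0%R))%E; last first.
  by apply: eq_integral => x _; rewrite /F/= -off_axis.
rewrite (fz F')//; last by move=> p; rewrite mule_ge0// lee_fin expR_ge0.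
rewrite (fz F)//; last by move=> p; exact: f0.
apply: eq_integral => x _.
pose h z := f (off l x + axis l z).
have mh : measurable_fun setT h.
  by apply: measurableT_comp mf _; apply: measurable_addV => //; exact: measurable_axis.
exact: (normal_prob_shift a del0 mh (fun z => f0 _)).
Qed.

(** One coordinate at a time, along a list without repetition: shifting coordinate [l] does not
    touch the exponents attached to the other coordinates. *)
Lemma gauss_shift (a : 'cV[R]_d) (f : borelV R d -> \bar R) : measurable_fun setT f ->
  (forall x, 0 <= f x)%E ->
  (\int[N]_x (f ((x : 'cV[R]_d) + del *: a)%R *
     (expR (- dotv a x - 2^-1 * del * dotv a a))%:E) = \int[N]_x f x)%E.
Proof.
move=> mf f0.
pose sh (s : seq 'I_d) : 'cV[R]_d := \sum_(l <- s) axis l (del * a l 0).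
pose ex (s : seq 'I_d) (x : 'cV[R]_d) :=
  \sum_(l <- s) (- a l 0 * x l 0 - 2^-1 * del * a l 0 ^+ 2).
have mex s : measurable_fun [set: borelV R d] (ex s).
  apply: measurable_sum => l; apply: measurable_funB => //.
  by apply: measurable_funM => //; exact: measurable_coordv.
have mfs s : measurable_fun [set: borelV R d] (fun x : borelV R d => f ((x : 'cV[R]_d) + sh s)).
  by apply: measurableT_comp mf _; apply: measurable_addV.
suff H s : uniq s -> (\int[N]_x (f ((x : 'cV[R]_d) + sh s)%R * (expR (ex s x))%:E) = \int[N]_x f x)%E.
  have <- := H (index_enum 'I_d) (index_enum_uniq _).
  apply: eq_integral => x _; congr (f _ * (expR _)%:E)%E.
    congr (_ + _); apply/matrixP => i j; rewrite !mxE summxE (bigD1 i)//= !mxE eqxx (ord1 j) big1 ?addr0//.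
    by move=> k ki; rewrite mxE eq_sym (negbTE ki).
  rewrite /ex [RHS]sumrB /dotv; congr (_ + - _).
    by rewrite -sumrN; apply: eq_bigr => i _; rewrite mulNr.
  by rewrite mulr_sumr; apply: eq_bigr => i _; rewrite expr2.
elim: s => [_|l s ih /= /andP[ls us]].
  by apply: eq_integral => x _; rewrite /sh /ex !big_nil addr0 expR0 mule1.
rewrite -(ih us) -[RHS](gauss_shift1 l (a l 0)); last 2 first.
- apply: emeasurable_funM => //; apply/measurable_EFinP.
  exact: measurableT_comp.
- by move=> x; rewrite mule_ge0// lee_fin expR_ge0.
apply: eq_integral => x _; rewrite -muleA -EFinM -expRD.
congr (f _ * (expR _)%:E)%E.
  by rewrite /sh big_cons addrA.
rewrite /ex big_cons addrC; congr (_ + _).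
rewrite big_seq [RHS]big_seq; apply: eq_bigr => i si; rewrite !mxE.
case: eqP => [il|_]; last by rewrite addr0.
by move: ls; rewrite -il si.
Qed.

End gaussian_shift.

Section gaussian_moments.
Context {R : realType} {d : nat}.

Lemma expR_normv (x : 'cV[R]_d) (lam : R) : 0 <= lam ->
  expR (lam * `|x|) <=
    1 + \sum_(i < d) (expR (lam * x i 0) + expR (- lam * x i 0)).
Proof.
move=> lam0; have S0 : 0 <= \sum_(i < d) (expR (lam * x i 0) + expR (- lam * x i 0)).
  by apply: sumr_ge0 => i _; rewrite addr_ge0 ?expR_ge0.
have [x0|/mx_norm_neq0[[i j] /= xE]] := eqVneq (mx_norm x) 0.
  by rewrite [`|x|]x0 mulr0 expR0 lerDl.
rewrite [`|x|]xE (ord1 j) (bigD1 i)//=.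
have S1 : 0 <= \sum_(k < d | k != i) (expR (lam * x k 0) + expR (- lam * x k 0)).
  by apply: sumr_ge0 => k _; rewrite addr_ge0 ?expR_ge0.
have h1 := expR_ge0 (lam * x i 0); have h2 := expR_ge0 (- lam * x i 0).
have [xi|xi] := leP 0 (x i 0).
  by rewrite ger0_norm//; lra.
by rewrite ltr0_norm// mulrN -mulNr; lra.
Qed.

Lemma normv_meas : measurable_fun [set: borelV R d] (fun x : borelV R d => `|x : 'cV[R]_d|).
Proof.
apply: (@lipschitz_measurable _ _ 1) => x y; rewrite mul1r.
exact: ler_dist_dist.
Qed.

Lemma dotv_axis (i : 'I_d) (c : R) (x : 'cV[R]_d) : dotv (axis i c) x = c * x i 0.
Proof.
rewrite /dotv (bigD1 i)//= mxE eqxx big1 ?addr0// => j /negbTE ji.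
by rewrite mxE ji mul0r.
Qed.

Variables (del : R) (N : probability (borelV R d) R).
Hypotheses (del0 : 0 < del) (gN : gaussV del N).

(** The shift formula for the constant function 1, in the direction [- lam] along the axis [i]. *)
Lemma gauss_mgf (i : 'I_d) (lam : R) :
  (\int[N]_x (expR (lam * x i 0))%:E = (expR (2^-1 * del * lam ^+ 2))%:E)%E.
Proof.
have mE : measurable_fun [set: borelV R d]
    (fun x : borelV R d => expR (lam * x i 0 - 2^-1 * del * lam ^+ 2)).
  apply: measurableT_comp => //; apply: measurable_funB => //.
  by apply: measurable_funM => //; exact: measurable_coordv.
have := @gauss_shift _ _ _ _ del0 gN (axis i (- lam)) (cst 1%E) (measurable_cst _)
   (fun _ => lee01).
under eq_integral.
  move=> x _; rewrite mul1e !dotv_axis mxE eqxx.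
  rewrite (_ : - (- lam * x i 0) - _ = lam * x i 0 - 2^-1 * del * lam ^+ 2); last ring.
  over.
rewrite integral_cst//= mul1e probability_setT => h.
transitivity (\int[N]_x ((expR (2^-1 * del * lam ^+ 2))%:E *
    (expR (lam * x i 0 - 2^-1 * del * lam ^+ 2))%:E))%E.
  by apply: eq_integral => x _; rewrite -EFinM -expRD addrC subrK.
rewrite ge0_integralZl//; last exact/measurable_EFinP.
by rewrite h mule1.
Qed.

Lemma gauss_exp_L1 (i : 'I_d) (lam : R) : L1 N (fun x => expR (lam * x i 0)).
Proof.
apply/integrableP; split.
  apply/measurable_EFinP; apply: measurableT_comp => //.
  by apply: measurable_funM => //; exact: measurable_coordv.
under eq_integral do rewrite /= ger0_norm ?expR_ge0//.
by rewrite gauss_mgf ltry.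
Qed.

Lemma gauss_expE (i : 'I_d) (lam : R) :
  \int[N]_x expR (lam * x i 0) = expR (2^-1 * del * lam ^+ 2).
Proof. by rewrite /Rintegral gauss_mgf. Qed.

Lemma gauss_exp_norm (lam : R) : 0 <= lam ->
  L1 N (fun x => expR (lam * `|x : 'cV[R]_d|)) /\
  \int[N]_x expR (lam * `|x : 'cV[R]_d|) <=
    1 + d%:R * (2 * expR (2^-1 * del * lam ^+ 2)).
Proof.
move=> lam0.
have LS : L1 N (fun x => \sum_(i < d) (expR (lam * x i 0) + expR (- lam * x i 0))).
  by apply: L1_sumI => i; apply: L1D; exact: gauss_exp_L1.
have LS1 := L1D (bmeas_L1 N (bmeas_cst 1)) LS.
have LN : L1 N (fun x => expR (lam * `|x : 'cV[R]_d|)).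
  apply: (L1_dom _ LS1); last by move=> x; rewrite ger0_norm ?expR_ge0 ?expR_normv.
  by apply: measurableT_comp => //; apply: measurable_funM => //; exact: normv_meas.
split=> //; apply: (le_trans (le_E LN LS1 (fun x => expR_normv x lam0))).
rewrite ED//; last exact/bmeas_L1/bmeas_cst.
rewrite E_cst lerD2l E_sumI; last by move=> i; apply: L1D; exact: gauss_exp_L1.
under eq_bigr.
  move=> i _; rewrite ED; [|exact: gauss_exp_L1..].
  rewrite !gauss_expE sqrrN -mulr2n -[_ *+ 2]mulr_natl.
  over.
by rewrite sumr_const card_ord -[_ *+ d]mulr_natl.
Qed.

(** Scaling: with [s = sqrt del] and [t = |z| / s], one has [t^4 <= 4^4 e^t], so the integrand is at
    most [4^4 del^2 exp ((1/s + C) |z|)], and the exponential moment at [1/s + C] involves only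
    [(1 + s C)^2 <= (1 + C)^2]. The order [del^2] is what makes the total loss over a grid vanish
    with the mesh. *)
Lemma gauss_moment4 (C : R) : 0 <= C -> del <= 1 ->
  L1 N (fun z => `|z : 'cV[R]_d| ^+ 4 * expR (C * `|z : 'cV[R]_d|)) /\
  \int[N]_z (`|z : 'cV[R]_d| ^+ 4 * expR (C * `|z : 'cV[R]_d|)) <=
    4 ^+ 4 * (1 + d%:R * (2 * expR (2^-1 * (1 + C) ^+ 2))) * del ^+ 2.
Proof.
move=> C0 del1; pose s := Num.sqrt del.
have s0 : 0 < s by rewrite sqrtr_gt0.
have ss : s ^+ 2 = del by rewrite sqr_sqrtr// ltW.
have s1 : s <= 1.
  by rewrite -(@ler_pXn2r _ 2)// ?nnegrE ?(ltW s0)// ss expr1n.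
pose lam := s^-1 + C.
have lam0 : 0 <= lam by rewrite addr_ge0// invr_ge0 ltW.
have [L Li] := gauss_exp_norm lam0.
have bnd (z : 'cV[R]_d) : `|z| ^+ 4 * expR (C * `|z|) <= 4 ^+ 4 * del ^+ 2 * expR (lam * `|z|).
  pose t := `|z| / s.
  have t0 : 0 <= t by rewrite divr_ge0// ltW.
  have zt : `|z| = s * t by rewrite /t mulrC divfK// gt_eqF.
  have tE : t ^+ 4 <= 4 ^+ 4 * expR t.
    have h : t / 4 <= expR (t / 4) by rewrite (le_trans _ (expR_ge1Dx _))// lerDr.
    have -> : t ^+ 4 = 4 ^+ 4 * (t / 4) ^+ 4 by field.
    rewrite ler_pM2l ?exprn_gt0//.
    have -> : expR t = expR (t / 4) ^+ 4 by rewrite -expRM_natl; congr expR; field.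
    by apply: lerXn2r => //; rewrite nnegrE ?expR_ge0// divr_ge0.
  have -> : lam * `|z| = t + C * `|z|.
    by rewrite /lam mulrDl zt mulKf ?gt_eqF.
  rewrite expRD mulrA ler_wpM2r ?expR_ge0// zt exprMn.
  have -> : s ^+ 4 = del ^+ 2 by rewrite -ss; ring.
  by have := ler_wpM2l (sqr_ge0 del) tE; lra.
have L4 : L1 N (fun z => `|z : 'cV[R]_d| ^+ 4 * expR (C * `|z : 'cV[R]_d|)).
  apply: (L1_dom _ (L1Z (4 ^+ 4 * del ^+ 2) L)).
    apply: measurable_funM; first by apply: measurable_funX; exact: normv_meas.
    by apply: measurableT_comp => //; apply: measurable_funM => //; exact: normv_meas.
  by move=> z; rewrite ger0_norm ?mulr_ge0 ?exprn_ge0 ?expR_ge0.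
split=> //; apply: (le_trans (le_E L4 (L1Z (4 ^+ 4 * del ^+ 2) L) bnd)).
rewrite EZ// [leRHS]mulrAC ler_wpM2l ?mulr_ge0 ?exprn_ge0 ?(ltW del0)//.
apply: (le_trans Li); rewrite lerD2l ler_wpM2l// ler_wpM2l// ler_expR.
rewrite -mulrA ler_wpM2l// -ss -exprMn /lam mulrDr mulfV ?gt_eqF//.
rewrite ler_pXn2r ?nnegrE ?addr_ge0 ?mulr_ge0 ?(ltW s0)//.
by rewrite lerD2l ler_piMl.
Qed.

Lemma gauss_coord_L1 (i : 'I_d) : L1 N (fun x => x i 0).
Proof.
apply: (L1_dom (measurable_coordv i) (L1D (gauss_exp_L1 i 1) (gauss_exp_L1 i (-1)))).
move=> x; rewrite mul1r mulN1r.
have h1 := expR_ge1Dx (x i 0); have h2 := expR_ge1Dx (- x i 0).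
have h3 := expR_ge0 (x i 0); have h4 := expR_ge0 (- x i 0).
by rewrite ler_norml; apply/andP; split; lra.
Qed.

(** Read off from the moment generating function: [1 + lam m <= E e^(lam x) = exp (del lam^2 / 2)]
    for all [lam], and a nonzero [m] contradicts this at [lam = c m] with [c] small. *)
Lemma gauss_mean (i : 'I_d) : \int[N]_x (x i 0) = 0.
Proof.
set m := \int[N]_x (x i 0).
have H lam : 1 + lam * m <= expR (2^-1 * del * lam ^+ 2).
  rewrite -(gauss_expE i) -(E_cst N 1) -EZ; last exact: gauss_coord_L1.
  have L := L1Z lam (gauss_coord_L1 i).
  rewrite -ED//; last exact/bmeas_L1/bmeas_cst.
  apply: le_E; [|exact: gauss_exp_L1|by move=> x; exact: expR_ge1Dx].
  by apply: L1D => //; exact/bmeas_L1/bmeas_cst.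
apply/eqP/negPn/negP => m0.
have m2 : 0 < m ^+ 2 by rewrite exprn_even_gt0.
(* Small enough that [c m^2] and [del c] are both below 1; then [u = del c^2 m^2 / 2] satisfies
   [exp u <= 1 + 2 u < 1 + c m^2]. *)
pose c := (2 * (1 + del) * (1 + m ^+ 2))^-1.
have p0 : 0 < 2 * (1 + del) * (1 + m ^+ 2) by rewrite !mulr_gt0// addr_gt0.
have c0 : 0 < c by rewrite invr_gt0.
have cp : c * (2 * (1 + del) * (1 + m ^+ 2)) = 1 by rewrite mulVf// gt_eqF.
have h1 := mulr_gt0 c0 m2; have h2 := mulr_gt0 c0 del0.
have h3 := mulr_gt0 (mulr_gt0 c0 del0) m2.
have cE : 2 * c + 2 * (c * m ^+ 2) + 2 * (c * del) + 2 * (c * del * m ^+ 2) = 1.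
  by transitivity (c * (2 * (1 + del) * (1 + m ^+ 2))); [ring|exact: cp].
have dc : del * c < 1 by rewrite mulrC; lra.
have cm : c * m ^+ 2 < 1 by lra.
have := H (c * m).
set u := 2^-1 * del * (c * m) ^+ 2.
have cm0 : 0 < (c * m) ^+ 2.
  by rewrite exprn_even_gt0//= mulf_neq0// gt_eqF.
have u0 : 0 < u by apply: mulr_gt0 => //; apply: mulr_gt0.
have uE : u = 2^-1 * (del * c) * (c * m ^+ 2) by rewrite /u; ring.
have u1 : u < 2^-1.
  rewrite uE; have : (del * c) * (c * m ^+ 2) < 1.
    apply: mulr_ilt1 => //; last exact: ltW.
    by rewrite mulrC ltW.
  by move=> h; rewrite -mulrA; lra.
have : expR u <= 1 + 2 * u.
  have h := expR_ge1Dx (- u).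
  have e0 := expR_gt0 u.
  have eN : expR (- u) * expR u = 1 by rewrite -expRD addNr expR0.
  have := ler_wpM2r (ltW e0) h; rewrite eN => h'.
  have p : 0 < 1 - u by lra.
  by rewrite -(ler_pM2l p) (le_trans h')//; nra.
have -> : 1 + c * m * m = 1 + c * m ^+ 2 by ring.
move=> h4 h5.
have : del * c * (c * m ^+ 2) < c * m ^+ 2 by rewrite gtr_pMl.
have : 2 * u = del * c * (c * m ^+ 2) by rewrite uE; field.
lra.
Qed.

End gaussian_moments.

Section dot_product.
Context {R : realType} {d : nat}.
Implicit Types a x : 'cV[R]_d.

Lemma dotvDr a x y : dotv a (x + y) = dotv a x + dotv a y.
Proof. by rewrite /dotv -big_split; apply: eq_bigr => i _; rewrite mxE mulrDr. Qed.

Lemma dotvZr a x (r : R) : dotv a (r *: x) = r * dotv a x.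
Proof. by rewrite /dotv mulr_sumr; apply: eq_bigr => i _; rewrite mxE mulrCA. Qed.

Lemma dotvZl a x (r : R) : dotv (r *: a) x = r * dotv a x.
Proof. by rewrite /dotv mulr_sumr; apply: eq_bigr => i _; rewrite mxE mulrA. Qed.

Lemma dotvv_ge0 a : 0 <= dotv a a.
Proof. by apply: sumr_ge0 => i _; rewrite -expr2 sqr_ge0. Qed.

Lemma dotv_norm a x : `|dotv a x| <= d%:R * (`|a| * `|x|).
Proof.
rewrite (le_trans (ler_norm_sum _ _ _))//.
rewrite (le_trans (ler_sum _ (G := fun=> `|a| * `|x|) _))//.
  by move=> i _; rewrite normrM ler_pM// coordv_norm.
by rewrite sumr_const card_ord -[_ *+ d]mulr_natl.
Qed.

End dot_product.

Lemma ln_bmeas {R : realType} {disp} {T : measurableType disp} (f : T -> R)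
    (c C : R) : 0 < c -> measurable_fun setT f -> (forall x, c <= f x <= C) -> bmeas (fun x => ln (f x)).
Proof.
move=> c0 mf fc; split; first by apply: measurableT_comp => //; exact: measurable_ln.
exists (`|ln c| + `|ln C|) => x; have /andP[f1 f2] := fc x.
have f0 := lt_le_trans c0 f1.
have h1 : ln c <= ln (f x) by rewrite ler_ln ?posrE.
have h2 : ln (f x) <= ln C by rewrite ler_ln ?posrE// (lt_le_trans f0).
have := ler_norm (ln C); have := ler_norm (- ln c); rewrite normrN => h3 h4.
have := normr_ge0 (ln C); have := normr_ge0 (ln c) => h5 h6.
by rewrite ler_norml; apply/andP; split; lra.
Qed.

Section one_step.
Context {R : realType} {d : nat}.
Variables (del : R) (N : probability (borelV R d) R).
Hypotheses (del0 : 0 < del) (gN : gaussV del N).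

Lemma gauss_dotv_L1 (a : 'cV[R]_d) : L1 N (dotv a).
Proof. by apply: L1_sumI => i; apply: L1Z; exact: (gauss_coord_L1 del0 gN). Qed.

Lemma gauss_dotv_mean (a : 'cV[R]_d) : \int[N]_x dotv a x = 0.
Proof.
rewrite /dotv E_sumI; last by move=> i; apply: L1Z; exact: (gauss_coord_L1 del0 gN).
rewrite big1// => i _; rewrite EZ; last exact: (gauss_coord_L1 del0 gN).
by rewrite (gauss_mean del0 gN) mulr0.
Qed.

Variables (G : borelV R d -> R) (c C : R).
Hypotheses (mG : measurable_fun setT G) (c0 : 0 < c) (Gc : forall z, c <= G z <= C).

Let G0 z : 0 < G z. Proof. by apply: lt_le_trans c0 _; have /andP[] := Gc z. Qed.

Let C0 : 0 < C.
Proof. by apply: lt_le_trans (G0 0) _; have /andP[] := Gc 0. Qed.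

(** Logarithm of the integrand left by the shift formula: [exp (gam a)] has the same Gaussian
    integral as [G], while the mean of [gam a] is the reward of the shift [a] minus its cost. *)
Let gam (a z : 'cV[R]_d) := ln (G (z + del *: a)) - dotv a z - 2^-1 * del * dotv a a.

Let mshift (a : 'cV[R]_d) : measurable_fun [set: borelV R d]
  ((fun z : 'cV[R]_d => z + del *: a) : borelV R d -> borelV R d).
Proof.
apply: measurable_funV => // i; under eq_fun do rewrite mxE.
by apply: measurable_funD => //; exact: measurable_coordv.
Qed.

Let blnG a : bmeas (fun z : borelV R d => ln (G ((z : 'cV[R]_d) + del *: a))).
Proof. by apply: (ln_bmeas c0 (C := C)) => //; exact: (measurableT_comp mG (mshift a)). Qed.

Let gam_L1 a : L1 N (gam a).
Proof.
apply: L1B; last exact/bmeas_L1/bmeas_cst.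
by apply: L1B; [exact: bmeas_L1|exact: gauss_dotv_L1].
Qed.

Let gamE a : \int[N]_z gam a z =
  \int[N]_z ln (G ((z : 'cV[R]_d) + del *: a)) - 2^-1 * del * dotv a a.
Proof.
rewrite EB ?E_cst; [|by apply: L1B; [exact: bmeas_L1|exact: gauss_dotv_L1]|exact/bmeas_L1/bmeas_cst].
by rewrite EB ?gauss_dotv_mean ?subr0//; [exact: bmeas_L1|exact: gauss_dotv_L1].
Qed.

Let exp_gam a : L1 N (fun z => expR (gam a z)) /\
  \int[N]_z expR (gam a z) = \int[N]_z G z.
Proof.
have bG : bmeas G.
  by split => //; exists C => z; have /andP[h1 h2] := Gc z; rewrite ger0_norm// ltW.
have E : (\int[N]_z (expR (gam a z))%:E = \int[N]_z (G z)%:E)%E.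
  rewrite -[RHS](gauss_shift del0 gN a); last 2 first.
  - exact/measurable_EFinP.
  - by move=> z; rewrite lee_fin ltW.
  apply: eq_integral => z _; rewrite -EFinM /gam -addrA expRD lnK//.
  by rewrite posrE.
split; last by rewrite /Rintegral E.
apply/integrableP; split.
  apply/measurable_EFinP; apply: measurableT_comp => //.
  exact: L1_meas (gam_L1 a).
under eq_integral do rewrite /= ger0_norm ?expR_ge0//.
by rewrite E EFinE ?ltry//; exact: bmeas_L1.
Qed.

Let intG0 : 0 < \int[N]_z G z.
Proof.
apply: lt_le_trans c0 _; rewrite -(E_cst N c); apply: le_E.
- exact/bmeas_L1/bmeas_cst.
- apply: bmeas_L1; split => //; exists C => z.
  by have /andP[h1 h2] := Gc z; rewrite ger0_norm// ltW.
- by move=> z; have /andP[] := Gc z.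
Qed.

(** Jensen's inequality for [exp], through its tangent line at the mean [c1] of [gam a]. *)
Lemma jensen_shift (a : 'cV[R]_d) :
  \int[N]_z ln (G ((z : 'cV[R]_d) + del *: a)) - 2^-1 * del * dotv a a <=
  ln (\int[N]_z G z).
Proof.
rewrite -gamE; have [Le EG] := exp_gam a.
set c1 := \int[N]_z gam a z.
rewrite -(expRK c1) ler_ln ?posrE ?expR_gt0// -EG.
have L' : L1 N (fun z => expR c1 * (1 + (gam a z - c1))).
  apply: L1Z; apply: L1D; first exact/bmeas_L1/bmeas_cst.
  by apply: L1B => //; exact/bmeas_L1/bmeas_cst.
have -> : expR c1 = \int[N]_z (expR c1 * (1 + (gam a z - c1))).
  rewrite EZ; last first.
    apply: L1D; first exact/bmeas_L1/bmeas_cst.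
    by apply: L1B => //; exact/bmeas_L1/bmeas_cst.
  rewrite ED; [|exact/bmeas_L1/bmeas_cst|by apply: L1B => //; exact/bmeas_L1/bmeas_cst].
  by rewrite EB ?E_cst ?subrr ?addr0 ?mulr1//; exact/bmeas_L1/bmeas_cst.
apply: le_E => // z; rewrite -[in leRHS](subrK c1 (gam a z)) expRD mulrC.
by rewrite ler_wpM2r ?expR_ge0// expR_ge1Dx.
Qed.

(* Constant of the quadratic error made by the gradient control on one step. *)
Definition step_cst (K : R) : R :=
  let A := K / c in
  8 * (K / c + K ^+ 2 * C / c ^+ 3) ^+ 2 *
    expR (2 * (`|ln c| + `|ln C|) + d%:R * (A * A)) *
  (4 ^+ 4 * (1 + d%:R * (2 * expR (2^-1 * (1 + d%:R * A) ^+ 2))) +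
   A ^+ 4 * (1 + d%:R * (2 * expR (2^-1 * (d%:R * A) ^+ 2)))).

Lemma expR_taylor2 (x : R) : expR x <= 1 + x + x ^+ 2 * expR `|x|.
Proof.
have e0 := expR_gt0 x; have h := expR_ge1Dx (- x).
have eN : expR (- x) * expR x = 1 by rewrite -expRD addNr expR0.
have h1 : (1 - x) * expR x <= 1 by have := ler_wpM2r (ltW e0) h; rewrite eN.
have h2 := expR_ge1Dx x.
have [x0|x0] := leP 0 x.
  by rewrite ger0_norm//; nra.
rewrite ltr0_norm//; have h3 : 1 <= expR (- x) by lra.
have h4 : x ^+ 2 <= x ^+ 2 * expR (- x) by rewrite ler_peMr ?sqr_ge0.
nra.
Qed.

Lemma ln_le_sub1 (y : R) : 0 < y -> ln y <= y - 1.
Proof.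
by move=> y0; rewrite -ler_expR lnK ?posrE//; have := expR_ge1Dx (y - 1); lra.
Qed.

(** [ln y <= y - 1] at [y = b / b0] and at [y = b0 / b] encloses the logarithm; the gap between the
    two bounds is [(b - b0)^2 / (b b0)]. *)
Lemma ln_taylor2 (b b0 : R) : c <= b <= C -> c <= b0 <= C ->
  `|ln b - ln b0 - (b - b0) / b0| <= (b - b0) ^+ 2 * (C / c ^+ 3).
Proof.
move=> /andP[b1 b2] /andP[b3 b4].
have bp := lt_le_trans c0 b1; have b0p := lt_le_trans c0 b3.
have lnE : ln b - ln b0 = ln (b / b0) by rewrite ln_div ?posrE.
have tp : 0 < b / b0 by rewrite divr_gt0.
have u : ln (b / b0) <= b / b0 - 1 by exact: ln_le_sub1.
have l : - ln (b / b0) <= b0 / b - 1.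
  by rewrite -lnV ?posrE// invf_div; apply: ln_le_sub1; rewrite divr_gt0.
have e1 : (b - b0) / b0 = b / b0 - 1 by field; rewrite gt_eqF.
have e2 : b0 / b - 1 + (b / b0 - 1) = (b - b0) ^+ 2 / (b * b0).
  by field; rewrite !gt_eqF.
have bb : (b * b0)^-1 <= C / c ^+ 3.
  rewrite ler_pdivlMr ?exprn_gt0// mulrC ler_pdivrMr ?mulr_gt0//.
  have -> : c ^+ 3 = c * c * c by ring.
  have h1 : c * c <= b * b0 by rewrite ler_pM// ltW.
  have h2 : c <= C by rewrite (le_trans b1).
  by rewrite mulrC ler_pM// ?mulr_ge0 ?ltW.
have q : (b - b0) ^+ 2 / (b * b0) <= (b - b0) ^+ 2 * (C / c ^+ 3).
  by rewrite ler_wpM2l ?sqr_ge0.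
have q0 : 0 <= (b - b0) ^+ 2 * (C / c ^+ 3).
  by rewrite mulr_ge0 ?sqr_ge0// divr_ge0 ?exprn_ge0 ?(ltW c0) ?(ltW C0).
by rewrite lnE e1 ler_norml; apply/andP; split; lra.
Qed.

Lemma shift_reverse (p : 'cV[R]_d) (K : R) : del <= 1 -> `|p| <= K ->
  (forall z : 'cV[R]_d, `|G z - G 0| <= K * `|z|) ->
  (forall z : 'cV[R]_d, `|G z - G 0 - dotv p z| <= K * `|z| ^+ 2) ->
  ln (\int[N]_z G z) - step_cst K * del ^+ 2 <=
  \int[N]_z ln (G ((z : 'cV[R]_d) + del *: ((G 0)^-1 *: p))) -
    2^-1 * del * dotv ((G 0)^-1 *: p) ((G 0)^-1 *: p).
Proof.
move=> del1 pK Glip GC11.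
set a := (G 0)^-1 *: p; pose A := K / c.
have K0 : 0 <= K by rewrite (le_trans _ pK).
have A0 : 0 <= A by rewrite divr_ge0// ltW.
have /andP[cG0 G0C] := Gc 0; have G00 := G0 0.
have aA : `|a| <= A.
  rewrite /a /A normrZ mulrC ger0_norm ?invr_ge0 ?(ltW G00)//.
  by rewrite ler_pM ?invr_ge0 ?(ltW G00)// lef_pV2 ?posrE.
rewrite -gamE lerBlDr; have [Le EG] := exp_gam a.
pose K1 := K / c + K ^+ 2 * C / c ^+ 3.
have K10 : 0 <= K1.
  rewrite /K1; apply: addr_ge0; first exact: A0.
  by rewrite divr_ge0 ?exprn_ge0 ?mulr_ge0 ?exprn_ge0 ?(ltW c0) ?(ltW C0).
have qz (z : 'cV[R]_d) : `|ln (G z) - ln (G 0) - dotv a z| <= K1 * `|z| ^+ 2.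
  have -> : ln (G z) - ln (G 0) - dotv a z =
     (ln (G z) - ln (G 0) - (G z - G 0) / G 0) + (G z - G 0 - dotv p z) / G 0.
    by rewrite dotvZl; field; rewrite gt_eqF.
  rewrite (le_trans (ler_normD _ _))// /K1 [leRHS]mulrDl [leRHS]addrC lerD//; last first.
    rewrite normrM (ger0_norm (x := (G 0)^-1)) ?invr_ge0 ?(ltW G00)//.
    by rewrite mulrAC ler_pM ?invr_ge0 ?(ltW G00)// lef_pV2 ?posrE.
  rewrite (le_trans (ln_taylor2 (Gc z) (Gc 0)))//.
  rewrite [leRHS](_ : _ = (K * `|z|) ^+ 2 * (C / c ^+ 3)); last by field; rewrite gt_eqF.
  rewrite ler_wpM2r//; first by rewrite divr_ge0 ?exprn_ge0 ?(ltW c0) ?(ltW C0).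
  by rewrite -real_normK ?num_real// ler_pXn2r ?nnegrE ?mulr_ge0.
clearbody a.
pose Gam0 := ln (G 0) + 2^-1 * del * dotv a a.
pose Rm (z : 'cV[R]_d) := gam a z - Gam0.
have RmE z : Rm z = ln (G (z + del *: a)) - ln (G 0) - dotv a (z + del *: a).
  rewrite /Rm /gam /Gam0 dotvDr dotvZr.
  by move: (ln (G (z + _))) (ln (G 0)) (dotv a z) (dotv a a) => r1 r2 r3 r4; field.
have zda (z : 'cV[R]_d) : `|z + del *: a| <= `|z| + del * A.
  rewrite (le_trans (ler_normD _ _))// lerD2l normrZ ger0_norm ?(ltW del0)//.
  by rewrite ler_wpM2l// ltW.
pose Mq := `|ln c| + `|ln C|; pose B0 := 2 * Mq + d%:R * (A * A); pose B1 := d%:R * A.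
have Mq0 : 0 <= Mq by rewrite addr_ge0.
have B00 : 0 <= B0 by apply: addr_ge0; apply: mulr_ge0 => //; exact: mulr_ge0.
have B10 : 0 <= B1 by rewrite mulr_ge0.
(* Two bounds on the same remainder: linear growth, from the boundedness of [ln G], keeps [exp |Rm|]
   integrable; the quadratic bound [Rm2] provides the smallness. *)
have Rm1 z : `|Rm z| <= B0 + B1 * `|z|.
  have lnM y : `|ln (G y)| <= Mq.
    have /andP[f1 f2] := Gc y; have f0 := G0 y.
    have h1 : ln c <= ln (G y) by rewrite ler_ln ?posrE.
    have h2 : ln (G y) <= ln C by rewrite ler_ln ?posrE// (lt_le_trans f0).
    have := ler_norm (ln C); have := ler_norm (- ln c); rewrite normrN => h3 h4.
    have := normr_ge0 (ln C); have := normr_ge0 (ln c) => h5 h6.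
    by rewrite /Mq ler_norml; apply/andP; split; lra.
  rewrite RmE (le_trans (ler_normB _ _))//.
  have h1 := le_trans (ler_normB (ln (G (z + del *: a))) (ln (G 0))) (lerD (lnM _) (lnM _)).
  have h2 : `|dotv a (z + del *: a)| <= d%:R * (A * (`|z| + A)).
    rewrite (le_trans (dotv_norm _ _))// ler_wpM2l// ler_pM//.
    by rewrite (le_trans (zda z))// lerD2l ler_piMl.
  rewrite (le_trans (lerD h1 h2))// /B0 /B1; lra.
have Rm2 z : Rm z ^+ 2 <= 8 * K1 ^+ 2 * (`|z| ^+ 4 + del ^+ 2 * A ^+ 4).
  have h : `|Rm z| <= K1 * (2 * (`|z| ^+ 2 + (del * A) ^+ 2)).
    rewrite RmE (le_trans (qz _))// ler_wpM2l//.
    apply: (@le_trans _ _ ((`|z| + del * A) ^+ 2)).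
      have h := zda z; apply: lerXn2r => //; rewrite nnegrE//.
      by rewrite addr_ge0// mulr_ge0// ltW.
    by have := sqr_ge0 (`|z| - del * A); lra.
  rewrite -(real_normK (num_real (Rm z))).
  apply: (@le_trans _ _ ((K1 * (2 * (`|z| ^+ 2 + (del * A) ^+ 2))) ^+ 2)).
    by rewrite ler_pXn2r ?nnegrE// mulr_ge0// mulr_ge0// addr_ge0 ?sqr_ge0.
  have -> : (K1 * (2 * (`|z| ^+ 2 + (del * A) ^+ 2))) ^+ 2 =
     8 * K1 ^+ 2 * (2^-1 * (`|z| ^+ 2 + (del * A) ^+ 2) ^+ 2) by field.
  rewrite ler_wpM2l ?mulr_ge0 ?sqr_ge0//.
  apply: (@le_trans _ _ (`|z| ^+ 4 + (del * A) ^+ 4)).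
    by have := sqr_ge0 (`|z| ^+ 2 - (del * A) ^+ 2); lra.
  rewrite lerD2l exprMn ler_wpM2r ?exprn_ge0//.
  by rewrite -[del ^+ 4]/(del ^+ (2 + 2)) exprD ler_piMr ?sqr_ge0// expr_le1 ?(ltW del0).
have LRm : L1 N Rm by apply: L1B; [exact: gam_L1|exact/bmeas_L1/bmeas_cst].
have [L4 I4] := gauss_moment4 del0 gN B10 del1.
have [L0 I0] := gauss_exp_norm del0 gN B10.
(* [J] dominates the term [Rm^2 exp |Rm|] of the second-order expansion of the exponential; its
   integral is where the fourth moment enters. *)
pose J (z : 'cV[R]_d) := 8 * K1 ^+ 2 * expR B0 *
  (`|z| ^+ 4 * expR (B1 * `|z|) + del ^+ 2 * A ^+ 4 * expR (B1 * `|z|)).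
have LJ : L1 N J by apply: L1Z; apply: L1D => //; exact: L1Z.
have RmJ z : expR (Rm z) <= 1 + Rm z + J z.
  rewrite (le_trans (expR_taylor2 _))// lerD2l.
  rewrite (le_trans (ler_pM (sqr_ge0 _) (expR_ge0 _) (Rm2 z) (_ : _ <= expR (B0 + B1 * `|z|))))//.
    by rewrite ler_expR.
  by rewrite expRD /J le_eqVlt; apply/orP; left; apply/eqP; ring.
have J_le : \int[N]_z J z <= step_cst K * del ^+ 2.
  rewrite EZ; last by apply: L1D => //; exact: L1Z.
  rewrite ED//; last exact: L1Z.
  have dA0 : 0 <= del ^+ 2 * A ^+ 4.
    by apply: mulr_ge0; apply: exprn_ge0 => //; exact: ltW.
  rewrite EZ// /step_cst -/A -/K1 -/Mq -/B0 -/B1 -[leRHS]mulrA.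
  rewrite ler_wpM2l ?mulr_ge0 ?sqr_ge0 ?expR_ge0// [leRHS]mulrDl lerD//.
  rewrite [leRHS]mulrAC [A ^+ 4 * _]mulrC (ler_wpM2l dA0)//.
  rewrite (le_trans I0)// lerD2l ler_wpM2l// ler_wpM2l// ler_expR.
  by rewrite ler_wpM2r ?sqr_ge0// ler_piMr.
have L1Rm : L1 N (fun z => 1 + Rm z) by apply: L1D => //; exact/bmeas_L1/bmeas_cst.
have LeRm : L1 N (fun z => expR (Rm z)).
  rewrite (_ : (fun z => _) = fun z => expR (- Gam0) * expR (gam a z)); first exact: L1Z.
  by apply/funext => z; rewrite /Rm addrC expRD.
have IRm : \int[N]_z Rm z = \int[N]_z gam a z - Gam0.
  by rewrite EB ?E_cst//; exact/bmeas_L1/bmeas_cst.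
have GE : \int[N]_z G z = expR Gam0 * \int[N]_z expR (Rm z).
  rewrite -EG -EZ//; apply: eq_Rintegral => z _.
  by rewrite /Rm -expRD addrC subrK.
have ub : \int[N]_z expR (Rm z) <= 1 + (\int[N]_z Rm z + \int[N]_z J z).
  apply: (le_trans (le_E LeRm (L1D L1Rm LJ) RmJ)).
  rewrite (ED L1Rm LJ) ED//; last exact/bmeas_L1/bmeas_cst.
  by rewrite E_cst addrA.
rewrite -[leRHS]expRK ler_ln ?posrE ?expR_gt0// GE.
apply: (@le_trans _ _ (expR Gam0 * expR (\int[N]_z Rm z + \int[N]_z J z))).
  rewrite ler_wpM2l ?expR_ge0// (le_trans ub)// expR_ge1Dx//.
rewrite -expRD ler_expR IRm; lra.
Qed.

End one_step.

(** * Dynamic programming for controlled Gaussian walks *)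

Section averaging.
Context {R : realType} {d : nat}.
Variables (N : probability (borelV R d) R) (n : nat).
Implicit Types (g : seqV R d -> R) (y : nat -> 'cV[R]_d).

(* Integrates out the last [m] of [n] coordinates. *)
Fixpoint avg g (m : nat) : seqV R d -> R :=
  if m is m'.+1 then fun y => \int[N]_z avg g m' (upd y (n - m) z) else g.

Lemma avg_bmeas g m : bmeas g -> bmeas (avg g m).
Proof.
move=> bg; elim: m => [//|m ih] /=.
exact: (bmeas_freeze_inner N (bmeas_comp ih (measurable_upd (n - m.+1)))).
Qed.

Let upd_bmeas g k y : bmeas g -> bmeas (fun z : borelV R d => g (upd y k z)).
Proof.
move=> bg; apply: bmeas_comp (bmeas_comp bg (measurable_upd k)) (pair1_measurable (y : seqV R d)).
Qed.

Lemma avg_bounds g m (c C : R) : bmeas g -> (forall y, c <= g y <= C) ->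
  forall y, c <= avg g m y <= C.
Proof.
move=> bg gc; elim: m => [//|m ih] y /=.
have L : L1 N (fun z => avg g m (upd y (n - m.+1) z)).
  by apply: bmeas_L1; apply: upd_bmeas; exact: avg_bmeas.
apply/andP; split.
  rewrite -(E_cst N c); apply: le_E => //; first exact/bmeas_L1/bmeas_cst.
  by move=> z; have /andP[] := ih (upd y (n - m.+1) z).
rewrite -[leRHS](E_cst N C); apply: le_E => //; first exact/bmeas_L1/bmeas_cst.
by move=> z; have /andP[] := ih (upd y (n - m.+1) z).
Qed.

Lemma upd_comm y j k w z : j != k -> upd (upd y j w) k z = upd (upd y k z) j w.
Proof.
move=> jk; apply/funext => i; rewrite /upd; case: eqP => [->|//].
by rewrite eq_sym (negbTE jk).
Qed.

Lemma upd_neq y j k z : j != k -> upd y k z j = y j.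
Proof. by move=> /negbTE jk; rewrite /upd jk. Qed.

Lemma upd_id y k : upd y k (y k) = y.
Proof. by apply/funext => i; rewrite /upd; case: eqP => [->|]. Qed.

(** If [p] is a partial gradient of [g], this is the corresponding partial gradient of [avg g m]. *)
Definition avgv (p : seqV R d -> 'cV[R]_d) m : seqV R d -> 'cV[R]_d :=
  fun y => \col_i avg (fun y => p y i 0) m y.

Lemma normv_le (x : 'cV[R]_d) (K : R) : 0 <= K -> (forall i, `|x i 0| <= K) -> `|x| <= K.
Proof.
move=> K0 xK; rewrite [leLHS]mx_normrE; apply: bigmax_le => // -[i j] _ /=.
by rewrite (ord1 j).
Qed.

Lemma avgv_le (p : seqV R d -> 'cV[R]_d) (K : R) m : 0 <= K -> (forall i, bmeas (fun y : seqV R d => p y i 0)) -> (forall y, `|p y| <= K) ->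
  forall y, `|avgv p m y| <= K.
Proof.
move=> K0 bp pK y; apply: normv_le => // i; rewrite mxE ler_norml.
apply: avg_bounds => // y'; rewrite -ler_norml.
exact: le_trans (coordv_norm _ _) (pK y').
Qed.

(** The first-order error is linear in [(g, p)] and is averaged along with them. Since [j < n - m],
    the perturbed coordinate is none of the integrated ones, so [upd] at [j] commutes with the
    integration. The increment [z] stays fixed, so [B] may depend on it. *)
Lemma avg_C11 g (p : seqV R d -> 'cV[R]_d) j (z : 'cV[R]_d) (B : R) m : bmeas g ->
  (forall i, bmeas (fun y : seqV R d => p y i 0)) -> (j < n - m)%N ->
  (forall y, `|g (upd y j (y j + z)) - g y - dotv (p y) z| <= B) ->
  forall y, `|avg g m (upd y j (y j + z)) - avg g m y - dotv (avgv p m y) z| <= B.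
Proof.
move=> bg bp; elim: m => [_ gB y|m ih jm gB y].
  rewrite /= (_ : dotv _ _ = dotv (p y) z)//; apply: eq_bigr => i _.
  by rewrite mxE.
have jm' : (j < n - m)%N by rewrite (leq_trans jm)// leq_sub2l.
have jk : j != (n - m.+1)%N by rewrite ltn_eqF.
set k := (n - m.+1)%N in jk *.
pose D v := avg g m (upd (upd y k v) j (y j + z)) - avg g m (upd y k v) -
  dotv (avgv p m (upd y k v)) z.
have DB v : `|D v| <= B.
  by have := ih jm' gB (upd y k v); rewrite upd_neq.
have Lg w : L1 N (fun v => avg g m (upd (upd y k v) j w)).
  rewrite (_ : (fun v => _) = fun v => avg g m (upd (upd y j w) k v)).
    by apply: bmeas_L1; apply: upd_bmeas; exact: avg_bmeas.
  by apply/funext => v; rewrite upd_comm// eq_sym.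
have Lg' : L1 N (fun v => avg g m (upd y k v)).
  by apply: bmeas_L1; apply: upd_bmeas; exact: avg_bmeas.
have Lp i : L1 N (fun v => avg (fun y => p y i 0) m (upd y k v)).
  by apply: bmeas_L1; apply: upd_bmeas; exact: avg_bmeas.
have Ld : L1 N (fun v => dotv (avgv p m (upd y k v)) z).
  rewrite /dotv; apply: L1_sumI => i.
  rewrite (_ : (fun v => _) = fun v => z i 0 * avg (fun y => p y i 0) m (upd y k v)).
    exact: L1Z.
  by apply/funext => v; rewrite mxE mulrC.
have -> : avg g m.+1 (upd y j (y j + z)) - avg g m.+1 y - dotv (avgv p m.+1 y) z =
    \int[N]_v D v.
  rewrite EB//; last exact: L1B.
  rewrite EB//; congr (_ - _ - _).
    by rewrite /= -/k; apply: eq_Rintegral => v _; rewrite upd_comm.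
  rewrite /dotv E_sumI; last first.
    move=> i; rewrite (_ : (fun v => _) = fun v => z i 0 * avg (fun y => p y i 0) m (upd y k v)).
      exact: L1Z.
    by apply/funext => v; rewrite mxE mulrC.
  apply: eq_bigr => i _; rewrite mxE /= -/k mulrC -EZ//.
  by apply: eq_Rintegral => v _; rewrite mxE mulrC.
have LD : L1 N D by apply: L1B => //; exact: L1B.
rewrite (le_trans (le_normE LD))// -[leRHS](E_cst N B).
by apply: le_E => //; [exact: L1_norm|exact/bmeas_L1/bmeas_cst].
Qed.

(** The case of zero gradient in [avg_C11]. *)
Lemma avg_lip g j (z : 'cV[R]_d) (B : R) m : bmeas g -> (j < n - m)%N ->
  (forall y, `|g (upd y j (y j + z)) - g y| <= B) ->
  forall y, `|avg g m (upd y j (y j + z)) - avg g m y| <= B.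
Proof.
move=> bg jm gB y.
have z0 (x : 'cV[R]_d) : dotv 0 x = 0.
  by rewrite /dotv big1// => i _; rewrite mxE mul0r.
have bp i : bmeas (fun y : seqV R d => (0 : 'cV[R]_d) i 0).
  rewrite (_ : (fun=> _) = fun=> 0); first exact: bmeas_cst.
  by apply/funext => y'; rewrite mxE.
have := @avg_C11 g (fun=> 0) j z B m bg bp jm.
have -> : avgv (fun=> 0) m = fun=> 0.
  apply/funext => y'; apply/matrixP => i k; rewrite mxE [RHS]mxE.
  have b0 y1 : (0 : R) <= (0 : 'cV[R]_d) i 0 <= 0 by rewrite mxE lexx.
  have /andP[h1 h2] := avg_bounds m (bp i) b0 y'.
  by apply/eqP; rewrite eq_le h1 h2.
move=> /(_ _ y); rewrite z0 subr0; apply => y'.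
by rewrite subr0.
Qed.

End averaging.

Lemma measurable_addZ {R : realType} {d} {dT} {T : measurableType dT} (r : R)
    (f g : T -> 'cV[R]_d) :
  measurable_fun [set: T] (f : T -> borelV R d) ->
  measurable_fun [set: T] (g : T -> borelV R d) ->
  measurable_fun [set: T] ((fun x => f x + r *: g x) : T -> borelV R d).
Proof.
move=> mf mg; apply: measurable_funV => // i.
rewrite (_ : (fun x => _) = fun x => f x i 0 + r * g x i 0); last first.
  by apply/funext => x; rewrite !mxE.
apply: measurable_funD; first exact: measurableT_comp (measurable_coordv i) mf.
by apply: measurable_funM => //; exact: measurableT_comp (measurable_coordv i) mg.
Qed.

Section controlled_walk.
Context {R : realType} {d : nat} {disp} {Omega : measurableType disp}.
Variables (P : probability Omega R) (n : nat) (del : R) (N : probability (borelV R d) R).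
Hypotheses (del0 : 0 < del) (gN : gaussV del N).
Variables (F : nat -> set (set Omega)) (xi : nat -> Omega -> 'cV[R]_d).
Hypotheses
  (F_meas : forall k A, <<s F k >> A -> measurable A)
  (F_mono : forall k, <<s F k >> `<=` <<s F k.+1 >>)
  (xi_F : forall k, (k < n)%N ->
    measurable_fun [set: g_sigma_algebraType (F k.+1)] (xi k : _ -> borelV R d))
  (xi_ind : forall k A (B : set (borelV R d)), (k < n)%N -> <<s F k >> A -> measurable B ->
    P (A `&` xi k @^-1` B) = (P A * N B)%E).

Definition Fmeas {dU} {U : measurableType dU} k (f : Omega -> U) :=
  measurable_fun [set: g_sigma_algebraType (F k)] (f : g_sigma_algebraType (F k) -> U).

Lemma Fmeas_setT {dU} {U : measurableType dU} k (f : Omega -> U) : Fmeas k f ->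
  measurable_fun [set: Omega] f.
Proof.
by move=> mf _ B mB; rewrite setTI; apply: (@F_meas k); have := mf measurableT B mB; rewrite setTI.
Qed.

Lemma Fmeas_mono {dU} {U : measurableType dU} k (f : Omega -> U) : Fmeas k f ->
  Fmeas k.+1 f.
Proof. by move=> mf _ B mB; apply: F_mono; exact: mf. Qed.

Section walk.
Variables (alpha : nat -> Omega -> 'cV[R]_d) (K : R).
Hypotheses (alpha_F : forall k, (k < n)%N -> Fmeas k (alpha k : Omega -> borelV R d))
  (alpha_K : forall k w, (k < n)%N -> `|alpha k w| <= K).

(** Records the controlled increments themselves, not their partial sums; entries not yet reached
    are 0. *)
Fixpoint walk k (w : Omega) : nat -> 'cV[R]_d :=
  if k is k'.+1 then upd (walk k' w) k' (xi k' w + del *: alpha k' w) else fun=> 0.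

Lemma walk_ge k w j : (k <= j)%N -> walk k w j = 0.
Proof.
elim: k => [//|k ih] kj /=; rewrite upd_neq ?ih// ?(ltnW kj)//.
by rewrite gtn_eqF.
Qed.

Lemma walkE k w j : walk k w j = if (j < k)%N then xi j w + del *: alpha j w else 0.
Proof.
elim: k => [//|k ih] /=; rewrite /upd; case: eqP => [->|/eqP jk].
  by rewrite ltnSn.
by rewrite ih ltnS [in RHS]leq_eqVlt (negbTE jk).
Qed.

Lemma walk_F k : (k <= n)%N -> Fmeas k (walk k : Omega -> seqV R d).
Proof.
elim: k => [_|k ih kn]; first by apply: measurable_fun_seqV => j; exact: measurable_cst.
have mz := measurable_addZ del (xi_F kn) (Fmeas_mono (alpha_F kn)).
have mp := measurable_fun_pair (Fmeas_mono (ih (ltnW kn))) mz.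
exact: (measurableT_comp (measurable_upd k) mp).
Qed.

(** Conditioning on stage [k]: the past [walk k] and the action [alpha k] are known there, while
    [xi k] is independent of that stage with law [N]. *)
Lemma walk_step (Q : seqV R d -> R) k : (k < n)%N -> bmeas Q ->
  \int[P]_w Q (walk k.+1 w) =
  \int[P]_w \int[N]_z Q (upd (walk k w) k ((z : 'cV[R]_d) + del *: alpha k w)).
Proof.
move=> kn bQ.
pose zeta (w : Omega) : (seqV R d * borelV R d)%type := (walk k w, alpha k w).
have zF : Fmeas k zeta.
  exact: measurable_fun_pair (walk_F (ltnW kn)) (alpha_F kn).
have ind A (B : set (borelV R d)) : measurable A -> measurable B ->
    P (zeta @^-1` A `&` xi k @^-1` B) = (P (zeta @^-1` A) * N B)%E.
  by move=> mA mB; apply: xi_ind => //; have := zF measurableT A mA; rewrite setTI.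
pose H (p : (seqV R d * borelV R d) * borelV R d) : R :=
  Q (upd p.1.1 k ((p.2 : 'cV[R]_d) + del *: (p.1.2 : 'cV[R]_d))).
have bH : bmeas H.
  apply: (bmeas_comp bQ).
  have m1 : measurable_fun setT (fun p : (seqV R d * borelV R d) * borelV R d => p.1.1).
    exact: measurableT_comp measurable_fst measurable_fst.
  have m2 : measurable_fun setT (fun p : (seqV R d * borelV R d) * borelV R d => p.1.2).
    exact: measurableT_comp measurable_snd measurable_fst.
  have m3 := measurable_addZ del measurable_snd m2.
  exact: (measurableT_comp (measurable_upd k) (measurable_fun_pair m1 m3)).
have mxi : measurable_fun [set: Omega] (xi k : Omega -> borelV R d).
  exact: Fmeas_setT (xi_F kn).
exact: (freeze (Fmeas_setT zF) mxi ind bH).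
Qed.

Lemma walk_bmeas (Q : seqV R d -> R) k : (k <= n)%N -> bmeas Q ->
  bmeas (fun w => Q (walk k w)).
Proof. by move=> kn bQ; apply: bmeas_comp bQ (Fmeas_setT (walk_F kn)). Qed.

Lemma alpha_bmeas k : (k < n)%N -> bmeas (fun w => dotv (alpha k w) (alpha k w)).
Proof.
move=> kn; apply: bmeas_sumI => i.
have b : bmeas (fun w => alpha k w i 0).
  split; last by exists K => w; rewrite (le_trans (coordv_norm _ _))// alpha_K.
  exact: Fmeas_setT (measurableT_comp (measurable_coordv i) (alpha_F kn)).
exact: bmeasM.
Qed.

Variables (g : seqV R d -> R) (c C : R).
Hypotheses (mg : measurable_fun setT g) (c0 : 0 < c) (gc : forall y, c <= g y <= C).

Let bg : bmeas g.
Proof.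
split => //; exists C => y; have /andP[h1 h2] := gc y.
by rewrite ger0_norm// (le_trans (ltW c0)).
Qed.

(** Value function at stage [k]: the mean of [g] over the remaining uncontrolled increments. *)
Let U k := avg N n g (n - k).

Let U_step k y : (k < n)%N -> U k y = \int[N]_z U k.+1 (upd y k z).
Proof.
move=> kn; rewrite /U; have -> : (n - k)%N = (n - k.+1).+1 by rewrite subnSK.
by rewrite /= subnSK// subKn// ltnW.
Qed.

Let U_meas k : bmeas (U k). Proof. exact: avg_bmeas. Qed.
Let U_bounds k y : c <= U k y <= C. Proof. exact: avg_bounds. Qed.

Let lnU k : bmeas (fun y => ln (U k y)).
Proof. by apply: (ln_bmeas c0 (C := C)) => [|y]; [have [] := U_meas k|exact: U_bounds]. Qed.

Let Gk k y : measurable_fun setT (fun z : borelV R d => U k.+1 (upd y k z)).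
Proof.
have [m _] := U_meas k.+1.
exact: measurableT_comp (measurableT_comp m (measurable_upd k)) (pair1_measurable (y : seqV R d)).
Qed.

Let step_bmeas k : (k < n)%N ->
  bmeas (fun w => \int[N]_z ln (U k.+1 (upd (walk k w) k ((z : 'cV[R]_d) + del *: alpha k w)))).
Proof.
move=> kn.
pose H (p : (seqV R d * borelV R d) * borelV R d) : R :=
  ln (U k.+1 (upd p.1.1 k ((p.2 : 'cV[R]_d) + del *: (p.1.2 : 'cV[R]_d)))).
have bH : bmeas H.
  apply: (bmeas_comp (lnU k.+1)).
  have m1 : measurable_fun setT (fun p : (seqV R d * borelV R d) * borelV R d => p.1.1).
    exact: measurableT_comp measurable_fst measurable_fst.
  have m2 : measurable_fun setT (fun p : (seqV R d * borelV R d) * borelV R d => p.1.2).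
    exact: measurableT_comp measurable_snd measurable_fst.
  have m3 := measurable_addZ del measurable_snd m2.
  exact: (measurableT_comp (measurable_upd k) (measurable_fun_pair m1 m3)).
have zF : Fmeas k ((fun w => (walk k w, alpha k w)) : Omega -> (seqV R d * borelV R d)%type).
  exact: measurable_fun_pair (walk_F (ltnW kn)) (alpha_F kn).
exact: (bmeas_comp (bmeas_freeze_inner N bH) (Fmeas_setT zF)).
Qed.

Let entropy := \sum_(k < n) \int[P]_w dotv (alpha k w) (alpha k w).

(* Donsker-Varadhan inequality for the controlled random walk. *)
Lemma walk_upper :
  \int[P]_w ln (g (walk n w)) - 2^-1 * del * entropy <= ln (avg N n g n (fun=> 0)).
Proof.
suff H k : (k <= n)%N -> \int[P]_w ln (U k (walk k w)) -
    2^-1 * del * \sum_(j < k) \int[P]_w dotv (alpha j w) (alpha j w) <=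
    ln (avg N n g n (fun=> 0)).
  by have := H n (leqnn n); rewrite /U subnn.
elim: k => [_|k ih kn].
  rewrite big_ord0 mulr0 subr0 /U subn0 (_ : \int[P]_w _ = \int[P]_w (ln (avg N n g n (fun=> 0))))//.
  by rewrite E_cst.
apply: le_trans (ih (ltnW kn)); rewrite big_ord_recr/= mulrDr.
rewrite (walk_step kn (lnU k.+1)).
have La := bmeas_L1 P (alpha_bmeas kn).
have := le_E (L1B (bmeas_L1 P (step_bmeas kn)) (L1Z (2^-1 * del) La))
  (bmeas_L1 P (walk_bmeas (ltnW kn) (lnU k))).
rewrite EB ?EZ//; [|exact/bmeas_L1/step_bmeas|exact: L1Z].
move=> H; suff : (forall w, \int[N]_z ln (U k.+1 (upd (walk k w) k ((z : 'cV[R]_d) + del *: alpha k w))) -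
    2^-1 * del * dotv (alpha k w) (alpha k w) <= ln (U k (walk k w))).
  by move=> /H; lra.
move=> w; rewrite U_step//.
exact: (jensen_shift del0 gN (Gk k (walk k w)) c0 (fun z => U_bounds k.+1 _)).
Qed.

(* Converse, for the feedback control given by the gradient of log U. *)
Variables (p : nat -> seqV R d -> 'cV[R]_d) (L : R).
Hypotheses (del1 : del <= 1) (L0 : 0 <= L)
  (pm : forall j i, (j < n)%N -> bmeas (fun y : seqV R d => p j y i 0))
  (pL : forall j y, (j < n)%N -> `|p j y| <= L)
  (glip : forall j y z, (j < n)%N -> `|g (upd y j (y j + z)) - g y| <= L * `|z|)
  (gC11 : forall j y z, (j < n)%N ->
    `|g (upd y j (y j + z)) - g y - dotv (p j y) z| <= L * `|z| ^+ 2).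
Hypothesis alphaE : forall k w, (k < n)%N ->
  alpha k w = (avg N n g (n - k.+1) (walk k w))^-1 *: avgv N n (p k) (n - k.+1) (walk k w).

Lemma walk_lower :
  ln (avg N n g n (fun=> 0)) - n%:R * (@step_cst R d c C L * del ^+ 2) <=
  \int[P]_w ln (g (walk n w)) - 2^-1 * del * entropy.
Proof.
suff H k : (k <= n)%N -> ln (avg N n g n (fun=> 0)) - k%:R * (@step_cst R d c C L * del ^+ 2) <=
    \int[P]_w ln (U k (walk k w)) -
    2^-1 * del * \sum_(j < k) \int[P]_w dotv (alpha j w) (alpha j w).
  by have := H n (leqnn n); rewrite /U subnn.
elim: k => [_|k ih kn].
  rewrite big_ord0 mulr0 mul0r !subr0 /U subn0 (_ : \int[P]_w _ = \int[P]_w (ln (avg N n g n (fun=> 0))))//.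
  by rewrite E_cst.
have {}ih := ih (ltnW kn); rewrite big_ord_recr/= mulrDr.
rewrite (walk_step kn (lnU k.+1)) -natr1 mulrDl mul1r.
have La := bmeas_L1 P (alpha_bmeas kn).
set e := @step_cst R d c C L * del ^+ 2.
have Lw := bmeas_L1 P (walk_bmeas (ltnW kn) (lnU k)).
have Le := bmeas_L1 P (bmeas_cst e).
have Ls := bmeas_L1 P (step_bmeas kn).
have := le_E (L1B Lw Le) (L1B Ls (L1Z (2^-1 * del) La)).
rewrite (EB Lw Le) (EB Ls (L1Z _ La)) (EZ _ La) E_cst.
move=> H; suff : (forall w, ln (U k (walk k w)) - e <=
    \int[N]_z ln (U k.+1 (upd (walk k w) k ((z : 'cV[R]_d) + del *: alpha k w))) -
    2^-1 * del * dotv (alpha k w) (alpha k w)).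
  by move=> /H; move: ih; rewrite -/e; lra.
move=> w; rewrite U_step//.
(* Coordinate [k] is not yet filled, so the base point 0 of the one-step expansion is the walk
   itself, and [alphaE] is the gradient of the logarithm there. *)
have wk0 : walk k w k = 0 by rewrite walk_ge.
have E0 : upd (walk k w) k 0 = walk k w by rewrite -[X in upd _ _ X]wk0 upd_id.
have kk : (k < n - (n - k.+1))%N by rewrite subKn.
have := shift_reverse del0 gN (Gk k (walk k w)) c0 (fun z => U_bounds k.+1 _)
  (p := avgv N n (p k) (n - k.+1) (walk k w)) del1 (K := L).
rewrite E0 -alphaE//; apply.
- by apply: avgv_le => // [i|y]; [exact: pm|exact: pL].
- move=> z.
  have := @avg_lip _ _ N n _ k z (L * `|z|) (n - k.+1) bg kk (fun y => glip y z kn) (walk k w).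
  by rewrite wk0 add0r.
- move=> z.
  have := @avg_C11 _ _ N n g (p k) k z (L * `|z| ^+ 2) (n - k.+1) bg (fun i => pm i kn) kk
    (fun y => gC11 y z kn) (walk k w).
  by rewrite wk0 add0r.
Qed.

End walk.

Lemma walk0_avg (g : seqV R d -> R) : bmeas g ->
  \int[P]_w g (walk (fun _ _ => 0) n w) = avg N n g n (fun=> 0).
Proof.
move=> bg; have aF k : (k < n)%N -> Fmeas k ((fun=> 0) : Omega -> borelV R d).
  by move=> _; exact: measurable_cst.
suff H k : (k <= n)%N -> \int[P]_w avg N n g (n - k) (walk (fun _ _ => 0) k w) =
    avg N n g n (fun=> 0).
  by have := H n (leqnn n); rewrite subnn.
elim: k => [_|k ih kn]; first by rewrite subn0 (_ : \int[P]_w _ = \int[P]_w (avg N n g n (fun=> 0))) ?E_cst.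
rewrite -(ih (ltnW kn)) (walk_step aF kn (avg_bmeas N n _ bg)).
apply: eq_Rintegral => w _; have -> : (n - k)%N = (n - k.+1).+1 by rewrite subnSK.
rewrite /= subnSK// subKn 1?ltnW//; apply: eq_Rintegral => z _.
by rewrite scaler0 addr0.
Qed.

End controlled_walk.

(** * Brownian motion and its completed filtration *)

Lemma gaussV_unique {R : realType} {d} (del : R) (N1 N2 : probability (borelV R d) R) :
  gaussV del N1 -> gaussV del N2 -> forall B, measurable B -> N1 B = N2 B.
Proof.
move=> g1 g2.
pose G : set (set (borelV R d)) := [set E | exists C : 'I_d -> set R,
  (forall i, measurable (C i)) /\ E = [set x : 'cV[R]_d | forall i, C i (x i 0)]].
have Gm E : G E -> measurable E.
  move=> [C [mC ->]].
  rewrite (_ : [set _ | _] = \bigcap_(i in [set: 'I_d]) (fun u : borelV R d => u i 0) @^-1` C i).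
    apply: fin_bigcap_measurable => // i _.
    by rewrite -[X in measurable X]setTI; apply: measurable_coordv.
  by apply/seteqP; split=> [x Cx i _|x Cx i]; exact: Cx.
have mid : measurable_fun [set: g_sigma_algebraType G]
    (id : g_sigma_algebraType G -> borelV R d).
  apply: measurable_funV => // i _ C mC; rewrite setTI; apply: sub_sigma_algebra.
  exists (fun j => if j == i then C else setT); split; first by move=> j; case: ifP.
  apply/seteqP; split => x /= Cx; last by have := Cx i; rewrite eqxx.
  by move=> j; case: eqP => [->|].
apply: (measure_unique G (fun=> setT)).
- apply/seteqP; split => E.
    by move=> mE; have := mid measurableT E mE; rewrite setTI.
  by apply: smallest_sub; [exact: sigma_algebra_measurable|exact: Gm].
- move=> _ _ [C [mC ->]] [C' [mC' ->]].
  exists (fun i => C i `&` C' i); split => [i|]; first exact: measurableI.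
  apply/seteqP; split => x; last by move=> h; split=> i; have [] := h i.
  by move=> [h h'] i; split; [exact: h|exact: h'].
- by move=> _; exists (fun=> setT); split=> //; apply/seteqP.
- by rewrite bigcup_const.
- by move=> A [C [mC ->]]; exact: etrans (g1 C mC) (esym (g2 C mC)).
- by move=> _; rewrite (le_lt_trans (probability_le1 _ _))// ltry.
Qed.

Section brownian.
Context {R : realType} {d : nat} {disp} {Omega : measurableType disp}.
Variables (P : probability Omega R) (P_complete : measure_is_complete P)
  (W : process R d Omega) (BW : brownian_motion P W).

Notation G := (completed_filtration P W).
Notation GT t := (g_sigma_algebraType (G t)).

Lemma bm_meas t : 0 <= t -> measurable_fun [set: Omega] (W t : Omega -> borelV R d).
Proof. by have [h _ _ _] := BW; exact: h. Qed.

Lemma natural_sub t A : 0 <= t -> natural_filtration W t A -> measurable A.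
Proof.
move=> t0; apply: smallest_sub; first exact: sigma_algebra_measurable.
move=> _ [s [B [/andP[s0 _] mB] ->]].
by rewrite -[X in measurable X]setTI; apply: bm_meas.
Qed.

(** Completeness of [P] enters here: the null sets adjoined to the filtration are events. *)
Lemma filtration_sub t A : 0 <= t -> G t A -> measurable A.
Proof.
move=> t0; apply: smallest_sub; first exact: sigma_algebra_measurable.
by move=> B [/natural_sub|]; [exact|exact: P_complete].
Qed.

Lemma filtration_sigma t : sigma_algebra [set: Omega] (G t).
Proof. exact: smallest_sigma_algebra. Qed.

Lemma filtration_id t : <<s G t >> = G t.
Proof. exact: (sigma_algebra_id (filtration_sigma t)). Qed.

Lemma filtration_measurable t A : 0 <= t -> <<s G t >> A -> measurable A.
Proof. by rewrite filtration_id; exact: filtration_sub. Qed.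

Lemma filtration_mono s t : s <= t -> G s `<=` G t.
Proof.
move=> st; apply: smallest_sub; first exact: filtration_sigma.
move=> A [nA|zA]; apply: sub_sigma_algebra; [left|by right].
move: A nA; apply: smallest_sub; first exact: smallest_sigma_algebra.
move=> _ [u [B [/andP[u0 us] mB] ->]]; apply: sub_sigma_algebra.
by exists u, B => //; rewrite u0 (le_trans us).
Qed.

Lemma bm_adapted s t : 0 <= s -> s <= t ->
  measurable_fun [set: GT t] (W s : GT t -> borelV R d).
Proof.
move=> s0 st _ B mB; rewrite setTI; apply: sub_sigma_algebra; apply: sub_sigma_algebra.
by left; apply: sub_sigma_algebra; exists s, B => //; rewrite s0.
Qed.

Lemma measurable_subV {dT} {T : measurableType dT} (f g : T -> 'cV[R]_d) :
  measurable_fun [set: T] (f : T -> borelV R d) ->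
  measurable_fun [set: T] (g : T -> borelV R d) ->
  measurable_fun [set: T] ((fun x => f x - g x) : T -> borelV R d).
Proof.
move=> mf mg; rewrite (_ : (fun x => _) = fun x => f x + (-1) *: g x).
  exact: measurable_addZ.
by apply/funext => x; rewrite scaleN1r.
Qed.

Lemma bm_inc_meas s t : 0 <= s -> s <= t ->
  measurable_fun [set: Omega] ((fun w => W t w - W s w) : Omega -> borelV R d).
Proof. by move=> s0 st; apply: measurable_subV; apply: bm_meas => //; exact: le_trans st. Qed.

(** Natural events together with null sets are stable under intersection, because meeting a null set
    gives a null set; Dynkin's argument then reaches the completed filtration. *)
Lemma bm_indep s t A (B : set (borelV R d)) : 0 <= s -> s <= t -> G s A -> measurable B ->
  P (A `&` (fun w => W t w - W s w) @^-1` B) =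
  (P A * P ((fun w => (W t w - W s w)%R) @^-1` B))%E.
Proof.
move=> s0 st GA mB; have [_ _ ind _] := BW.
have mE : measurable ((fun w => W t w - W s w) @^-1` B).
  by rewrite -[X in measurable X]setTI; apply: bm_inc_meas.
have GI : setI_closed (natural_filtration W s `|` P.-negligible).
  move=> C D [nC|zC] [nD|zD].
  - by left; apply: (@measurableI _ (g_sigma_algebraType _)).
  - by right; apply: negligibleS zD => x [].
  - by right; apply: negligibleS zC => x [].
  - by right; apply: negligibleS zC => x [].
have Gm : natural_filtration W s `|` P.-negligible `<=` measurable.
  by move=> C [/natural_sub|]; [exact|exact: P_complete].
suff GE C : (natural_filtration W s `|` P.-negligible) C ->
    P (C `&` (fun w => W t w - W s w) @^-1` B) =
    (P C * P ((fun w => (W t w - W s w)%R) @^-1` B))%E.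
  by have [_ e] := indep_sigma GI Gm mE GE GA; exact: e.
move=> [nC|zC]; first exact: ind.
have z0 D : P.-negligible D -> P D = 0%E.
  move=> zD; apply: (proj1 (negligibleP _ _)) => //; exact: P_complete.
have ze : P (C `&` (fun w => W t w - W s w) @^-1` B) = 0%E.
  by apply: z0; apply: negligibleS zC => x [].
by rewrite [LHS]ze z0// mul0e.
Qed.

Lemma bm_inc_gauss s t : 0 <= s -> s < t -> forall (B : 'I_d -> set R),
  (forall i, measurable (B i)) ->
  P ((fun w => W t w - W s w) @^-1` [set x : 'cV[R]_d | forall i, B i (x i 0)]) =
  (\prod_(i < d) normal_prob 0 (Num.sqrt (t - s)) (B i))%E.
Proof. by move=> s0 st B mB; have [_ _ _ h] := BW; exact: h. Qed.

Lemma bm_law (del : R) : 0 < del -> exists N : probability (borelV R d) R,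
  gaussV del N /\ forall (s t : R) (B : set (borelV R d)), 0 <= s -> s < t -> t - s = del -> measurable B ->
    P ((fun w => W t w - W s w) @^-1` B) = N B.
Proof.
move=> del0.
have m s t (s0 : 0 <= s) (st : s <= t) := bm_inc_meas s0 st.
pose N s t (s0 : 0 <= s) (st : s <= t) := distribution P (mfun_Sub (mem_set (m s t s0 st))).
have gN s t (s0 : 0 <= s) (st : s < t) : gaussV (t - s) (N s t s0 (ltW st)).
  by move=> B mB; rewrite -bm_inc_gauss.
exists (N 0 del (lexx 0) (ltW del0)); split.
  by have := gN 0 del (lexx 0) del0; rewrite subr0.
move=> s t B s0 st tsE mB.
have g1 := gN s t s0 st; have g2 := gN 0 del (lexx 0) del0.
rewrite tsE in g1; rewrite subr0 in g2.
exact: (gaussV_unique g1 g2 mB).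
Qed.

Lemma fmeas_setT {dU} {U : measurableType dU} t (f : Omega -> U) : 0 <= t ->
  measurable_fun [set: GT t] (f : GT t -> U) -> measurable_fun [set: Omega] f.
Proof.
move=> t0 mf _ B mB; rewrite setTI; apply: (@filtration_measurable t) => //.
by have := mf measurableT B mB; rewrite setTI.
Qed.

Lemma fmeas_mono {dU} {U : measurableType dU} s t (f : Omega -> U) : s <= t ->
  measurable_fun [set: GT s] (f : GT s -> U) -> measurable_fun [set: GT t] (f : GT t -> U).
Proof.
move=> st mf _ B mB; have := mf measurableT B mB.
rewrite /measurable/= !filtration_id; exact: filtration_mono.
Qed.

Local Notation mu := (@lebesgue_measure R).

(** [progressively_measurable] with an arbitrary target, so that coordinates and functions of a
    process fall under the same notion. *)
Definition progr {dU} {U : measurableType dU} (f : R -> Omega -> U) :=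
  forall t : R, 0 <= t -> measurable_fun (`[0, t] `*` [set: GT t])
    ((fun p => f p.1 p.2) : R * GT t -> U).

Lemma progr_comp {dU dV} {U : measurableType dU} {V : measurableType dV}
  (f : R -> Omega -> U) (h : U -> V) : measurable_fun setT h -> progr f ->
  progr (fun s w => h (f s w)).
Proof. by move=> mh pf t t0; apply: measurableT_comp mh (pf t t0). Qed.

Lemma progr_coord (w : process R d Omega) i : progressively_measurable G w ->
  progr (fun s o => w s o i 0).
Proof.
by move=> pw; apply: (@progr_comp _ _ (borelV R d) _ w (fun x : borelV R d => x i 0));
  [exact: measurable_coordv|exact: pw].
Qed.

Lemma progrV (f : R -> Omega -> 'cV[R]_d) : (forall i, progr (fun s w => f s w i 0)) ->
  progr (f : R -> Omega -> borelV R d).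
Proof.
move=> pf t t0; apply: measurable_funV => [|i]; last exact: pf.
exact: measurableX.
Qed.

Lemma progrD (f g : R -> Omega -> R) : progr f -> progr g ->
  progr (fun s w => f s w + g s w).
Proof. by move=> pf pg t t0; apply: measurable_funD; [exact: pf|exact: pg]. Qed.

Lemma progrM (f g : R -> Omega -> R) : progr f -> progr g ->
  progr (fun s w => f s w * g s w).
Proof. by move=> pf pg t t0; apply: measurable_funM; [exact: pf|exact: pg]. Qed.

Lemma progr_cst (r : R) : progr (fun _ _ => r).
Proof. by move=> t t0; exact: measurable_cst. Qed.

Lemma progr_sum (I : Type) (s : seq I) (f : I -> R -> Omega -> R) :
  (forall i, progr (f i)) -> progr (fun t w => \sum_(i <- s) f i t w).
Proof. by move=> pf t t0; apply: measurable_sum => i; exact: pf. Qed.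

Lemma progr_sqnormv (a : process R d Omega) : (forall i, progr (fun s w => a s w i 0)) ->
  progr (fun s w => sqnormv (a s w)).
Proof. by move=> pa; apply: progr_sum => i; exact: progrM. Qed.

Lemma progr_section {dU} {U : measurableType dU} (f : R -> Omega -> U) (t : R) w :
  0 <= t -> progr f -> measurable_fun `[0, t] (f ^~ w).
Proof.
move=> t0 pf.
have mp : measurable_fun setT ((fun s => (s, w)) : R -> (R * GT t)%type).
  exact: pair2_measurable.
apply: (@measurable_comp _ _ _ _ _ _ (`[0, t] `*` [set: GT t])
  (fun p : R * GT t => f p.1 p.2) `[0, t] (fun s : R => (s, w))).
- exact: measurableX.
- by move=> _ [s /= st <-]; split.
- exact: pf.
- exact: measurable_funTS.
Qed.

(** Tonelli's theorem over [GT t], for the integrand extended by 0 outside the strip over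
    [[0, t]]. *)
Lemma progr_ge0_int (h : R -> Omega -> \bar R) (t : R) : 0 <= t -> progr h ->
  (forall s w, 0 <= h s w)%E ->
  measurable_fun [set: GT t] ((fun w => \int[mu]_(s in `[0%R, t]) h s w)%E : GT t -> \bar R).
Proof.
move=> t0 ph h0.
pose D : set (R * GT t) := `[0, t] `*` [set: GT t].
pose H (p : GT t * measurableTypeR R) : \bar R := ((fun q : R * GT t => h q.1 q.2) \_ D) (p.2, p.1).
have mH : measurable_fun setT H.
  apply: (measurableT_comp (f := (fun q : R * GT t => h q.1 q.2) \_ D)); last exact: measurable_swap.
  have mD : measurable D by exact: measurableX.
  exact: (proj1 (measurable_restrictT _ mD) (ph t t0)).
rewrite (_ : (fun w => _) = fubini_F mu H).
  apply: measurable_fun_fubini_tonelli_F => // p; rewrite /H patchE.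
  by case: ifP.
apply/funext => w; rewrite /fubini_F [LHS]integral_mkcond; apply: eq_integral => s _.
rewrite /H !patchE/=; congr (if _ then _ else _).
by apply/idP/idP => /set_mem; rewrite inE//; case.
Qed.

Lemma progr_int (f : R -> Omega -> R) (t : R) : 0 <= t -> progr f ->
  measurable_fun [set: GT t] ((fun w => \int[mu]_(s in `[0, t]) f s w) : GT t -> R).
Proof.
move=> t0 pf; rewrite /Rintegral; apply: measurableT_comp => //.
under eq_fun do rewrite integralE.
have pfE : progr (fun s w => (f s w)%:E) by apply: progr_comp pf; exact: EFin_measurable.
apply: emeasurable_funB.
  apply: (@progr_ge0_int (fun s w => (EFin \o f ^~ w)^\+ s)%E) => // u u0.
  have h := measurable_funepos (pfE u u0).
  by apply: eq_measurable_fun h => p _; rewrite !funeposE.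
apply: (@progr_ge0_int (fun s w => (EFin \o f ^~ w)^\- s)%E) => // u u0.
have h := measurable_funeneg (pfE u u0).
by apply: eq_measurable_fun h => p _; rewrite !funenegE.
Qed.

(** Pathwise limit of the processes sampled at the last grid point of mesh [1 / (n + 1)] not after
    [s]. Sampling from the left keeps the sampled value measurable for [G t] whenever [s <= t]. *)
Lemma continuous_progr (f : R -> Omega -> R) :
  (forall t, 0 <= t -> measurable_fun [set: GT t] (f t : GT t -> R)) ->
  (forall w, {within `[0, +oo[, continuous (f ^~ w)}) -> progr f.
Proof.
move=> af cf t t0.
pose fl n (s : R) : R := (Num.truncn (s * n.+1%:R))%:R / n.+1%:R.
have mD : measurable (`[0, t] `*` [set: GT t] : set (R * GT t)) by exact: measurableX.
have n0 n : 0 < n.+1%:R :> R by rewrite ltr0n.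
have flP n s : 0 <= s -> 0 <= fl n s <= s /\ s < fl n s + n.+1%:R^-1.
  move=> s0; have /andP[h1 h2] := truncn_itv (mulr_ge0 s0 (ltW (n0 n))).
  rewrite /fl divr_ge0 ?(ltW (n0 n))//= ler_pdivrMr// h1; split=> //.
  by rewrite -[X in _ + X]mul1r -mulrDl natr1 ltr_pdivlMr.
apply: (@measurable_fun_cvg _ _ _ _ (fun n (p : R * GT t) => f (fl n p.1) p.2)) => [n|p [/= p1 _]].
  pose E k : set (R * GT t) := (`[0, t] `*` [set: GT t]) `&`
    (`[k%:R / n.+1%:R, k.+1%:R / n.+1%:R[ `*` [set: GT t]).
  have mE k : measurable (E k) by apply: measurableI => //; exact: measurableX.
  have DE : `[0, t] `*` [set: GT t] = \bigcup_k E k.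
    apply/seteqP; split => [p [/= p1 _]|p [k _ []//]].
    move: p1; rewrite in_itv/= => /andP[p0 p1].
    exists (Num.truncn (p.1 * n.+1%:R)) => //; split; split => //=.
      by rewrite in_itv/= p0.
    have [/andP[h1 h2] h3] := flP n p.1 p0.
    by rewrite in_itv/= h2/= (lt_le_trans h3)// -[X in _ + X <= _]mul1r -mulrDl natr1.
  rewrite DE; apply/measurable_fun_bigcup => // k.
  have [kt|kt] := leP (k%:R / n.+1%:R) t; last first.
    rewrite (_ : E k = set0); first exact: measurable_fun_set0.
    apply/seteqP; split => // p [[/= + _] [/= + _]].
    rewrite !in_itv/= => /andP[_ h1] /andP[h2 _].
    by move: (lt_le_trans kt h2); rewrite ltNge h1.
  apply: (eq_measurable_fun (fun p : R * GT t => f (k%:R / n.+1%:R) p.2)).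
    move=> p /set_mem[_ [/= + _]]; rewrite in_itv/= => /andP[h1 h2].
    congr (f _ _); rewrite /fl; congr (_%:R / _); apply/esym; apply: truncn_def.
    by rewrite -ler_pdivrMr// -ltr_pdivlMr// h1.
  apply: measurable_funTS; apply: measurableT_comp (measurable_snd).
  have k0 : 0 <= k%:R / n.+1%:R :> R by rewrite divr_ge0// ltW.
  exact: fmeas_mono kt (af _ k0).
move: p1; rewrite in_itv/= => /andP[p0 p1].
have /subspace_continuousP/(_ p.1) fc := cf p.2.
have {}fc : f ^~ p.2 @ within `[0, +oo[ (nbhs p.1) --> f p.1 p.2.
  by apply: fc; rewrite /= in_itv/= p0.
apply: (@cvg_comp _ _ _ (fun n => fl n p.1) (f ^~ p.2)) fc.
move=> U /= pU.
have : \forall y \near p.1, `[0, +oo[%classic y -> U y by exact: pU.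
move=> /nbhs_ballP[e /= e0 eU].
have [N _ HN] := near_infty_natSinv_lt (PosNum e0).
exists N => // n /= Nn; have [/andP[h1 h2] h3] := flP n p.1 p0.
apply: eU; last by rewrite /= in_itv/= h1.
rewrite /ball/= ger0_norm ?subr_ge0//.
have h4 : n.+1%:R^-1 < e by exact: HN n Nn.
by rewrite ltrBlDl (lt_trans h3)// ltrD2l.
Qed.

End brownian.

(** * The dyadic time grid *)

Lemma negligible_E0 {dT} {T : measurableType dT} {R : realType}
    (m : {finite_measure set T -> \bar R}) (f : T -> R) : measurable_fun setT f ->
  {ae m, forall x, f x = 0} -> \int[m]_x f x = 0.
Proof.
move=> mf f0; rewrite /Rintegral (_ : (\int[m]_x (f x)%:E)%E = 0%E)//.
rewrite -(integral0 m setT).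
apply: ae_eq_integral => //; first exact/measurable_EFinP.
by apply: filterS f0 => x /= -> _.
Qed.

Lemma le_E_ae {dT} {T : measurableType dT} {R : realType}
    (m : {finite_measure set T -> \bar R}) (f g : T -> R) : L1 m f -> L1 m g ->
  {ae m, forall x, f x <= g x} -> \int[m]_x f x <= \int[m]_x g x.
Proof.
move=> f1 g1 fg; pose h x := Num.max (f x - g x) 0.
have mfg := L1_meas (L1B f1 g1).
have mh : measurable_fun setT h by apply: measurable_maxr => //; exact: measurable_cst.
have h1 : L1 m h.
  apply: (L1_dom mh (L1_norm (L1B f1 g1))) => x; rewrite /h /Num.max.
  by case: ifP; rewrite ?normr0.
rewrite -[leRHS]addr0 -(negligible_E0 (m := m) mh).
  rewrite -ED//; apply: le_E => //; first exact: L1D.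
  by move=> x; rewrite /h -lerBlDl le_max lexx.
by apply: filterS fg => x fgx; rewrite /h max_r// subr_le0.
Qed.

Lemma fine_L1 {dT} {T : measurableType dT} {R : realType}
    (m : {finite_measure set T -> \bar R}) (h : T -> \bar R) :
  measurable_fun setT h -> (forall x, 0 <= h x)%E -> (\int[m]_x h x < +oo)%E ->
  [/\ L1 m (fun x => fine (h x)), (\int[m]_x fine (h x))%:E = (\int[m]_x h x)%E
   & {ae m, forall x, h x \is a fin_num}].
Proof.
move=> mh h0 hoo.
have ih : m.-integrable setT h.
  by apply/integrableP; split => //; under eq_integral do rewrite gee0_abs//.
have ah : {ae m, forall x, h x \is a fin_num}.
  by apply: filterS (integrable_ae measurableT ih) => x; exact.
have mf : measurable_fun setT (fun x => fine (h x)) by exact: measurableT_comp.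
have e : (\int[m]_x (fine (h x))%:E = \int[m]_x h x)%E.
  apply: ae_eq_integral => //; first exact/measurable_EFinP.
  by apply: filterS ah => x hx _; rewrite fineK.
have L : L1 m (fun x => fine (h x)).
  apply/integrableP; split; first exact/measurable_EFinP.
  by under eq_integral => x _ do rewrite /= ger0_norm ?fine_ge0//; rewrite e.
by split => //; rewrite -EFinE.
Qed.

Section domain_integrals.
Context {R : realType}.
Local Notation mu := (@lebesgue_measure R).
Implicit Types (D : set (measurableTypeR R)) (f g : R -> R).

Definition iL D f := mu.-integrable D (EFin \o f).

Lemma iL_meas D f : iL D f -> measurable_fun D f.
Proof. by move=> /integrableP[/measurable_EFinP]. Qed.

Lemma iLD D f g : measurable D -> iL D f -> iL D g -> iL D (fun s => f s + g s).
Proof.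
move=> mD f1 g1; have := integrableD mD f1 g1.
by rewrite /iL; congr (integrable _ _ _).
Qed.

Lemma iLZ D (r : R) f : measurable D -> iL D f -> iL D (fun s => r * f s).
Proof. by move=> mD f1; exact: (integrableZl mD r f1). Qed.

Lemma iLB D f g : measurable D -> iL D f -> iL D g -> iL D (fun s => f s - g s).
Proof.
move=> mD f1 g1; have := integrableB mD f1 g1.
by rewrite /iL; congr (integrable _ _ _).
Qed.

Lemma iL_dom D f g : measurable D -> measurable_fun D f -> iL D g ->
  (forall s, D s -> `|f s| <= g s) -> iL D f.
Proof.
move=> mD mf g1 fg; apply: (le_integrable mD _ _ g1); first exact/measurable_EFinP.
move=> x Dx /=; rewrite lee_fin (le_trans (fg x Dx))//; exact: ler_norm.
Qed.

Lemma iL_norm D f : measurable D -> iL D f -> iL D (fun s => `|f s|).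
Proof.
move=> mD f1; apply: (le_integrable mD _ _ f1) => [|x Dx] /=; last by rewrite normr_id.
by apply/measurable_EFinP; apply: measurableT_comp => //; exact: iL_meas.
Qed.

Lemma iL_S D D' f : measurable D -> measurable D' -> D' `<=` D -> iL D f -> iL D' f.
Proof. by move=> mD mD' DD; exact: integrableS. Qed.

Lemma iL_bound (u v : bool) (s t M : R) f (D := [set` Interval (BSide u s) (BSide v t)]) :
  measurable_fun D f -> (forall x, D x -> `|f x| <= M) -> iL D f.
Proof.
move=> mf fM; apply: measurable_bounded_integrable => //.
- exact: measurable_itv.
- have := @lebesgue_measure_itv R (Interval (BSide u s) (BSide v t)) => /= ->.
  by case: ifP; rewrite ltry.
- by exists M; split; [exact: num_real|] => r Mr x Dx /=; rewrite (le_trans (fM x Dx))// ltW.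
Qed.

Lemma iL_cst (u v : bool) (s t r : R) : iL [set` Interval (BSide u s) (BSide v t)] (fun=> r).
Proof. by apply: (@iL_bound _ _ _ _ `|r|). Qed.

Lemma int_cst (s t r : R) : s <= t -> \int[mu]_(_ in `]s, t]) r = r * (t - s).
Proof.
move=> st; rewrite Rintegral_cst//; congr (r * _).
rewrite [X in fine X](_ : _ = (t - s)%:E)//; apply: etrans (lebesgue_measure_itv _) _.
rewrite /= lte_fin; case: ltP => [_//|ts].
have -> : s = t by apply/eqP; rewrite eq_le st ts.
by rewrite subrr.
Qed.

Lemma int_cst0 (t r : R) : 0 <= t -> \int[mu]_(_ in `[0, t]) r = r * t.
Proof.
move=> st; rewrite Rintegral_cst//; congr (r * _).
rewrite [X in fine X](_ : _ = t%:E)//; apply: etrans (lebesgue_measure_itv _) _.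
rewrite /= lte_fin; case: ltP => [_|ts]; first by rewrite oppr0 addr0.
by have -> : t = 0 by apply/eqP; rewrite eq_le st ts.
Qed.

Lemma int0_diff (s t T : R) f : 0 <= s -> s <= t -> t <= T -> iL `[0, T] f ->
  \int[mu]_(u in `[0, t]) f u - \int[mu]_(u in `[0, s]) f u = \int[mu]_(u in `]s, t]) f u.
Proof.
move=> s0 st tT fi; apply: Rintegral_itvB; rewrite ?bnd_simp//.
apply: iL_S fi => // x /=; rewrite !in_itv/= => /andP[-> /=] xt; exact: le_trans tT.
Qed.

Lemma sub_itvoc (s t T : R) : 0 <= s -> t <= T -> `]s, t]%classic `<=` `[0, T]%classic.
Proof.
move=> s0 tT x /=; rewrite !in_itv/= => /andP[sx xt].
by rewrite (le_trans s0 (ltW sx)) (le_trans xt).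
Qed.

(* Expand the square of [f] minus its mean. *)
Lemma cauchy_itv (s t : R) f : s < t -> iL `]s, t] f -> iL `]s, t] (fun u => f u ^+ 2) ->
  (\int[mu]_(u in `]s, t]) f u) ^+ 2 <= (t - s) * \int[mu]_(u in `]s, t]) (f u ^+ 2).
Proof.
move=> st f1 f2; set I := \int[mu]_(u in `]s, t]) f u.
have ts : 0 < t - s by rewrite subr_gt0.
have mD : measurable (`]s, t]%classic : set (measurableTypeR R)) by [].
pose c := I / (t - s).
have : 0 <= \int[mu]_(u in `]s, t]) (f u ^+ 2 - ((2 * c) * f u - c ^+ 2)).
  by apply: Rintegral_ge0 => u _; have := sqr_ge0 (f u - c); rewrite sqrrB mulr2n; lra.
rewrite RintegralB//; last by apply: iLB => //; [exact: iLZ|exact: iL_cst].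
rewrite RintegralB//; [|exact: iLZ|exact: iL_cst].
rewrite RintegralZl// (int_cst _ (ltW st)) -/I => h.
have cE : I = c * (t - s) by rewrite /c divfK// gt_eqF.
move: h; rewrite cE; set J := Rintegral _ _ _; nra.
Qed.

End domain_integrals.

Section time_grid.
Context {R : realType} {d : nat} (T : R).
Hypothesis T0 : 0 < T.

Definition dl m : R := T / (2 ^ m)%:R.
Definition tk m k : R := k%:R * dl m.

Let p0 m : 0 < (2 ^ m)%:R :> R. Proof. by rewrite ltr0n expn_gt0. Qed.

Lemma dl_gt0 m : 0 < dl m. Proof. by rewrite divr_gt0. Qed.

Lemma dl_cvg0 : dl m @[m --> \oo] --> 0.
Proof.
rewrite -[X in _ --> X](mulr0 T); apply: cvgMr; rewrite -[X in X @ _]/(fun m => (2 ^ m)%:R^-1).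
rewrite (_ : (fun m => _) = fun m => (2^-1 : R) ^+ m).
  by apply: cvg_expr; rewrite ger0_norm//; lra.
by apply/funext => m; rewrite natrX exprVn.
Qed.

Lemma tk0 m : tk m 0 = 0. Proof. by rewrite /tk mul0r. Qed.

Lemma tkT m : tk m (2 ^ m) = T.
Proof. by rewrite /tk /dl mulrCA divff ?mulr1// gt_eqF. Qed.

Lemma tkS m k : tk m k.+1 = tk m k + dl m.
Proof. by rewrite /tk -natr1 mulrDl mul1r. Qed.

Lemma tk_ge0 m k : 0 <= tk m k.
Proof. by rewrite mulr_ge0// ltW// dl_gt0. Qed.

Lemma tk_mono m k l : (k <= l)%N -> tk m k <= tk m l.
Proof. by move=> kl; rewrite ler_wpM2r ?ler_nat// ltW// dl_gt0. Qed.

Lemma tk_lt m k : tk m k < tk m k.+1.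
Proof. by rewrite tkS ltrDl dl_gt0. Qed.

Lemma tk_leT m k : (k <= 2 ^ m)%N -> tk m k <= T.
Proof. by move=> km; rewrite -[leRHS](tkT m) tk_mono. Qed.

Lemma tk_refine m j k : tk (m + j) (k * 2 ^ j) = tk m k.
Proof.
rewrite /tk /dl expnD !natrM invfM; field; rewrite ?lt0r_neq0//.
Qed.

(** The padding by 0 from [2 ^ m] on makes [ref_incr] an equality of whole sequences. *)
Definition incr {Omega : Type} (V : R -> Omega -> 'cV[R]_d) m (w : Omega) : nat -> 'cV[R]_d :=
  fun k => if (k < 2 ^ m)%N then V (tk m k.+1) w - V (tk m k) w else 0.

(* Passage of increments to a coarser grid. *)
Definition ref j (y : nat -> 'cV[R]_d) : nat -> 'cV[R]_d :=
  fun k => \sum_(l < 2 ^ j) y (k * 2 ^ j + l)%N.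

Lemma ref_incr {Omega : Type} (V : R -> Omega -> 'cV[R]_d) m j w :
  ref j (incr V (m + j) w) = incr V m w.
Proof.
apply/funext => k; rewrite /ref /incr.
have jj : (0 < 2 ^ j)%N by rewrite expn_gt0.
have [km|km] := ltnP k (2 ^ m); last first.
  rewrite big1// => l _; rewrite ltnNge expnD.
  by rewrite (leq_trans (leq_mul km (leqnn (2 ^ j))))// leq_addr.
rewrite (eq_bigr (fun l : 'I_(2 ^ j) => V (tk (m + j) (k * 2 ^ j + l).+1) w -
   V (tk (m + j) (k * 2 ^ j + l)%N) w)); last first.
  move=> l _; rewrite ifT// expnD.
  rewrite (leq_trans (n := (k.+1 * 2 ^ j)%N))//; last by rewrite leq_mul2r km orbT.
  by rewrite mulSn addnC ltn_add2r.
rewrite -(big_mkord xpredT (fun l => V (tk (m + j) (k * 2 ^ j + l).+1) w -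
   V (tk (m + j) (k * 2 ^ j + l)%N) w)).
under eq_bigr do rewrite -addnS.
rewrite (telescope_sumr (fun l => V (tk (m + j) (k * 2 ^ j + l)) w))// addn0.
by rewrite -mulSnr !tk_refine.
Qed.

Lemma measurable_ref j : measurable_fun [set: seqV R d]
  (ref j : seqV R d -> seqV R d).
Proof.
apply: measurable_fun_seqV => k; apply: measurable_funV => // i.
rewrite (_ : (fun y => _) = fun y : seqV R d => \sum_(l < 2 ^ j) y (k * 2 ^ j + l)%N i 0).
  by apply: measurable_sum => l; exact: measurable_seqV_coordi.
by apply/funext => y; rewrite summxE.
Qed.

(** The right-hand side sees the first [n] entries only, so this also says that [g] depends on
    nothing else. *)
Definition lipS n (L : R) (g : seqV R d -> R) :=
  forall y y' : seqV R d, `|g y - g y'| <= L * \sum_(k < n) `|y k - y' k|.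

End time_grid.

Section grid_walks.
Context {R : realType} {d : nat} {disp} {Omega : measurableType disp}.
Variables (P : probability Omega R) (P_complete : measure_is_complete P)
  (W : process R d Omega) (BW : brownian_motion P W) (T : R) (T0 : 0 < T).

Notation G := (completed_filtration P W).
Notation GT t := (g_sigma_algebraType (G t)).
Local Notation mu := (@lebesgue_measure R).
Local Notation tk := (tk T).
Local Notation dl := (dl T).

Lemma measurable_incr (V : process R d Omega) m :
  (forall t, 0 <= t -> measurable_fun setT (V t : Omega -> borelV R d)) ->
  measurable_fun setT (incr T V m : Omega -> seqV R d).
Proof.
move=> mV; apply: measurable_fun_seqV => k; rewrite /incr.
case: (k < 2 ^ m)%N; last exact: measurable_cst.
by apply: measurable_subV; apply: mV; exact: tk_ge0.
Qed.

Lemma measurable_incrW m : measurable_fun setT (incr T W m : Omega -> seqV R d).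
Proof. by apply: measurable_incr => t t0; exact: bm_meas BW _ t0. Qed.

Definition cwalk m (alpha : nat -> Omega -> 'cV[R]_d) (w : Omega) : nat -> 'cV[R]_d :=
  fun k => if (k < 2 ^ m)%N then incr T W m w k + dl m *: alpha k w else 0.

Let F m k := G (tk m k).
Let xi m k w := incr T W m w k.

Let F_meas m k A : <<s F m k >> A -> measurable A.
Proof. exact: (filtration_measurable P_complete BW (tk_ge0 T0 m k)). Qed.

Let F_mono m k : <<s F m k >> `<=` <<s F m k.+1 >>.
Proof. by rewrite /F !filtration_id; apply: filtration_mono; rewrite ltW// tk_lt. Qed.

Let xi_F m k : (k < 2 ^ m)%N ->
  measurable_fun [set: g_sigma_algebraType (F m k.+1)] (xi m k : _ -> borelV R d).
Proof.
move=> km; rewrite /xi /incr km; apply: measurable_subV; apply: bm_adapted => //;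
  by rewrite ?tk_ge0// ltW// tk_lt.
Qed.

Let xi_ind (N : probability (borelV R d) R) m :
  (forall (s t : R) (B : set (borelV R d)), 0 <= s -> s < t -> t - s = dl m -> measurable B ->
    P ((fun w => W t w - W s w) @^-1` B) = N B) ->
  forall k A (B : set (borelV R d)), (k < 2 ^ m)%N -> <<s F m k >> A -> measurable B ->
    P (A `&` xi m k @^-1` B) = (P A * N B)%E.
Proof.
move=> NE k A B km GA mB; rewrite filtration_id in GA.
have e := NE (tk m k) (tk m k.+1) B (tk_ge0 T0 m k) (tk_lt T0 m k) _ mB.
rewrite -e; last by rewrite tkS addrAC subrr add0r.
have := bm_indep P_complete BW (tk_ge0 T0 m k) (ltW (tk_lt T0 m k)) GA mB.
by rewrite /xi /incr km.
Qed.

Let walk_cwalk m alpha w : walk (dl m) (xi m) alpha (2 ^ m) w = cwalk m alpha w.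
Proof. by apply/funext => k; rewrite walkE. Qed.

Let avg_incr (N : probability (borelV R d) R) m g :
  (forall (s t : R) (B : set (borelV R d)), 0 <= s -> s < t -> t - s = dl m -> measurable B ->
    P ((fun w => W t w - W s w) @^-1` B) = N B) ->
  bmeas g -> avg N (2 ^ m) g (2 ^ m) (fun=> 0) = \int[P]_w g (incr T W m w).
Proof.
move=> NE bg; rewrite -(walk0_avg (dl m) (@F_meas m) (@F_mono m) (@xi_F m) (xi_ind NE) bg).
apply: eq_Rintegral => w _; rewrite walk_cwalk; congr g; apply/funext => k.
by rewrite /cwalk /incr scaler0 addr0; case: (k < 2 ^ m)%N.
Qed.

Lemma grid_upper m (alpha : nat -> Omega -> 'cV[R]_d) (K : R) (g : seqV R d -> R) (c C : R) :
  (forall k, (k < 2 ^ m)%N -> measurable_fun [set: GT (tk m k)] (alpha k : GT (tk m k) -> borelV R d)) ->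
  (forall k w, (k < 2 ^ m)%N -> `|alpha k w| <= K) ->
  measurable_fun setT g -> 0 < c -> (forall y, c <= g y <= C) ->
  \int[P]_w ln (g (cwalk m alpha w)) -
    2^-1 * dl m * \sum_(k < 2 ^ m) \int[P]_w sqnormv (alpha k w) <=
  ln (\int[P]_w g (incr T W m w)).
Proof.
move=> aF aK mg c0 gc.
have [N [gN NE]] := bm_law BW (dl_gt0 T0 m).
have bg : bmeas g.
  split => //; exists C => y; have /andP[h1 h2] := gc y.
  by rewrite ger0_norm// (le_trans (ltW c0)).
have := walk_upper (dl_gt0 T0 m) gN (@F_meas m) (@F_mono m) (@xi_F m) (xi_ind NE) aF aK mg c0 gc.
rewrite (avg_incr NE bg).
by under eq_Rintegral do rewrite walk_cwalk.
Qed.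

(* The control is the gradient of the logarithm of the conditional expectation. *)
Lemma grid_lower m (g : seqV R d -> R) (c C L : R) (p : nat -> seqV R d -> 'cV[R]_d) :
  measurable_fun setT g -> 0 < c -> (forall y, c <= g y <= C) -> dl m <= 1 -> 0 <= L ->
  (forall j i, (j < 2 ^ m)%N -> bmeas (fun y : seqV R d => p j y i 0)) ->
  (forall j y, (j < 2 ^ m)%N -> `|p j y| <= L) ->
  (forall j y z, (j < 2 ^ m)%N -> `|g (upd y j (y j + z)) - g y| <= L * `|z|) ->
  (forall j y z, (j < 2 ^ m)%N ->
    `|g (upd y j (y j + z)) - g y - dotv (p j y) z| <= L * `|z| ^+ 2) ->
  exists alpha : nat -> Omega -> 'cV[R]_d, [/\
    forall k, (k < 2 ^ m)%N -> measurable_fun [set: GT (tk m k)] (alpha k : GT (tk m k) -> borelV R d),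
    forall k w, (k < 2 ^ m)%N -> `|alpha k w| <= c^-1 * L &
    ln (\int[P]_w g (incr T W m w)) - (2 ^ m)%:R * (@step_cst R d c C L * dl m ^+ 2) <=
    \int[P]_w ln (g (cwalk m alpha w)) -
      2^-1 * dl m * \sum_(k < 2 ^ m) \int[P]_w sqnormv (alpha k w)].
Proof.
move=> mg c0 gc d1 L0 pm pL glip gC11.
have [N [gN NE]] := bm_law BW (dl_gt0 T0 m).
have bg : bmeas g.
  split => //; exists C => y; have /andP[h1 h2] := gc y.
  by rewrite ger0_norm// (le_trans (ltW c0)).
set n := (2 ^ m)%N in pm pL glip gC11 *.
pose A k (y : seqV R d) : 'cV[R]_d := (avg N n g (n - k.+1) y)^-1 *: avgv N n (p k) (n - k.+1) y.
(* Feedback looks circular, the action depending on the walk and the walk on the action. [S] is the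
   walk built with its own feedback, and [wS] identifies it with [walk] for the resulting
   [alpha]. *)
pose S := fix S k (w : Omega) : nat -> 'cV[R]_d :=
  if k is k'.+1 then upd (S k' w) k' (xi m k' w + dl m *: A k' (S k' w)) else fun=> 0.
have avgc k y : c <= avg N n g k y <= C by exact: avg_bounds.
have mA k : (k < n)%N -> measurable_fun [set: seqV R d] (A k : seqV R d -> borelV R d).
  move=> kn; apply: measurable_funV => // i.
  (* The inverse of a positive function is written as [exp (- ln)], whose measurability is
     immediate. *)
  rewrite (_ : (fun y => _) = fun y : seqV R d => expR (- ln (avg N n g (n - k.+1) y)) *
      avg N n (fun y => p k y i 0) (n - k.+1) y).
    have [mU _] := avg_bmeas N n (n - k.+1) bg.
    have [mp _] := avg_bmeas N n (n - k.+1) (pm k i kn).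
    have [ml _] := ln_bmeas c0 mU (avgc _).
    apply: measurable_funM => //; apply: measurableT_comp => //.
    exact: measurableT_comp.
  apply/funext => y; rewrite /A !mxE expRN lnK// posrE.
  by have /andP[h _] := avgc (n - k.+1)%N y; exact: lt_le_trans h.
pose alpha k w := A k (S k w).
have wS k w : walk (dl m) (xi m) alpha k w = S k w by elim: k => //= k ->.
have SF k : (k <= n)%N -> Fmeas (F m) k (S k : Omega -> seqV R d).
  elim: k => [_|k ih kn]; first by apply: measurable_fun_seqV => j; exact: measurable_cst.
  have iS := ih (ltnW kn).
  have mAS : Fmeas (F m) k ((fun w => A k (S k w)) : Omega -> borelV R d).
    exact: measurableT_comp (mA k kn) iS.
  have mz := measurable_addZ (dl m) (xi_F kn) (Fmeas_mono (@F_mono m) mAS).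
  have mp := measurable_fun_pair (Fmeas_mono (@F_mono m) iS) mz.
  exact: (measurableT_comp (measurable_upd k) mp).
have aF k : (k < n)%N -> Fmeas (F m) k (alpha k : Omega -> borelV R d).
  by move=> kn; exact: measurableT_comp (mA k kn) (SF k (ltnW kn)).
have aK k w : (k < n)%N -> `|alpha k w| <= c^-1 * L.
  move=> kn; have /andP[h _] := avgc (n - k.+1)%N (S k w).
  have u0 := lt_le_trans c0 h.
  rewrite normrZ ger0_norm ?invr_ge0 ?(ltW u0)//; apply: ler_pM => //.
  - by rewrite invr_ge0 ltW.
  - by rewrite lef_pV2.
  - by apply: avgv_le => // [i|y]; [exact: pm|exact: pL].
exists alpha; split => //.
have := walk_lower (dl_gt0 T0 m) gN (@F_meas m) (@F_mono m) (@xi_F m) (xi_ind NE) aF aK mg c0 gc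
  d1 L0 pm pL glip gC11.
rewrite (avg_incr NE bg) => h.
rewrite (_ : (fun w => ln (g (cwalk m alpha w))) =
  fun w => ln (g (walk (dl m) (xi m) alpha n w))); last first.
  by apply/funext => w; rewrite walk_cwalk.
by apply: h => k w kn; rewrite wS.
Qed.

End grid_walks.

(** * Truncation and energy of controls *)

Section truncation.
Context {R : realType}.
Variable K : R.
Hypothesis K0 : 0 < K.

Definition trunc (r : R) : R := if `|r| <= K then r else 0.

Lemma trunc_norm r : `|trunc r| <= K.
Proof. by rewrite /trunc; case: ifP => // _; rewrite normr0 ltW. Qed.

Lemma trunc_le r : `|trunc r| <= `|r|.
Proof. by rewrite /trunc; case: ifP => // _; rewrite normr0. Qed.

Lemma trunc_sqr r : trunc r ^+ 2 <= r ^+ 2.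
Proof. by rewrite -real_normK ?num_real// -[leRHS]real_normK ?num_real// lerXn2r ?nnegrE// trunc_le. Qed.

(** Nothing is lost unless [|r| > K], and there [|r| <= r^2 / K]. Integrated in time, the error is
    controlled by the energy. *)
Lemma trunc_dist r : `|r - trunc r| <= K^-1 * r ^+ 2.
Proof.
rewrite /trunc; case: ifPn => [_|]; first by rewrite subrr normr0 mulr_ge0 ?sqr_ge0// invr_ge0 ltW.
rewrite -ltNge subr0 => Kr; rewrite mulrC ler_pdivlMr// -[leRHS]real_normK ?num_real//.
by rewrite expr2 ler_wpM2l// ltW.
Qed.

Lemma measurable_trunc : measurable_fun setT trunc.
Proof.
apply: measurable_fun_ifT => //.
by apply: measurable_fun_ler; [exact: normr_measurable|exact: measurable_cst].
Qed.

End truncation.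

Section energy.
Context {R : realType} {d : nat} {disp} {Omega : measurableType disp}.
Variables (P : probability Omega R) (P_complete : measure_is_complete P)
  (W : process R d Omega) (BW : brownian_motion P W) (T : R) (T0 : 0 < T).

Notation G := (completed_filtration P W).
Notation GT t := (g_sigma_algebraType (G t)).
Local Notation mu := (@lebesgue_measure R).

Definition energy (a : process R d Omega) w := \int[mu]_(s in `[0, T]) sqnormv (a s w).

Lemma sqnormv_ge0 (x : 'cV[R]_d) : 0 <= sqnormv x.
Proof. exact: dotvv_ge0. Qed.

Lemma sqnormv_coord (x : 'cV[R]_d) i : x i 0 ^+ 2 <= sqnormv x.
Proof.
rewrite /sqnormv /dotv (bigD1 i)//= -expr2 lerDl sumr_ge0// => j _.
by rewrite -expr2 sqr_ge0.
Qed.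

Lemma progr_sqnormvE (a : process R d Omega) : (forall i, progr P W (fun s w => a s w i 0)) ->
  progr P W (fun s w => (sqnormv (a s w))%:E).
Proof.
move=> pa; apply: (progr_comp (h := EFin)) (progr_sqnormv pa).
exact: EFin_measurable.
Qed.

Lemma energy_L1 (a : process R d Omega) : (forall i, progr P W (fun s w => a s w i 0)) ->
  (\int[P]_w \int[mu]_(s in `[0%R, T]) (sqnormv (a s w))%:E < +oo)%E ->
  [/\ L1 P (energy a),
    (\int[P]_w energy a w)%:E = (\int[P]_w \int[mu]_(s in `[0%R, T]) (sqnormv (a s w))%:E)%E
  & {ae P, forall w, iL `[0, T] (fun s => sqnormv (a s w))}].
Proof.
move=> pa ea; have pE := progr_sqnormvE pa.
have mI : measurable_fun setT (fun w => \int[mu]_(s in `[0%R, T]) (sqnormv (a s w))%:E)%E.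
  apply: (fmeas_setT P_complete BW (ltW T0)); apply: (progr_ge0_int (ltW T0) pE).
  by move=> s w; rewrite lee_fin sqnormv_ge0.
have [|L e f] := fine_L1 mI _ ea.
  by move=> w; apply: integral_ge0 => s _; rewrite lee_fin sqnormv_ge0.
split => //; apply: filterS f => w fw; apply/integrableP; split.
  apply/measurable_EFinP; exact: (progr_section w (ltW T0) (progr_sqnormv pa)).
rewrite -ge0_fin_numE; last exact: integral_ge0.
under eq_integral => s _ do rewrite /= ger0_norm ?sqnormv_ge0//.
exact: fw.
Qed.

Lemma iL_coord (a : process R d Omega) w i : measurable_fun `[0, T] (fun s => a s w i 0) ->
  iL `[0, T] (fun s => sqnormv (a s w)) ->
  iL `[0, T] (fun s => a s w i 0) /\ iL `[0, T] (fun s => a s w i 0 ^+ 2).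
Proof.
move=> ma sa; have mD : measurable (`[0, T]%classic : set (measurableTypeR R)) by [].
have i2 : iL `[0, T] (fun s => a s w i 0 ^+ 2).
  apply: (iL_dom mD _ sa) => [|s _]; first exact: measurable_funX.
  by rewrite ger0_norm ?sqr_ge0// sqnormv_coord.
split=> //; apply: (iL_dom mD ma (iLD mD (iL_cst _ _ _ _ 1) i2)) => s _.
by rewrite -(real_normK (num_real (a s w i 0))); have := sqr_ge0 (`|a s w i 0| - 1); nra.
Qed.

Lemma integralv_meas (a : process R d Omega) t : 0 <= t ->
  (forall i, progr P W (fun s w => a s w i 0)) ->
  measurable_fun [set: GT t] ((fun w => integralv t (a ^~ w)) : GT t -> borelV R d).
Proof.
move=> t0 pa; apply: measurable_funV => // i.
rewrite (_ : (fun w => _) = fun w => \int[mu]_(s in `[0, t]) a s w i 0).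
  exact: progr_int t0 (pa i).
by apply/funext => w; rewrite mxE.
Qed.

Lemma integralv_neg (t : R) (f : R -> 'cV[R]_d) : t <= 0 -> integralv t f = 0.
Proof.
move=> t0; apply/matrixP => i j; rewrite !mxE.
have [->|t1] := eqVneq t 0; first by rewrite set_itv1 Rintegral_set1.
by rewrite set_itv_ge ?Rintegral_set0// bnd_simp -ltNge lt_neqAle t1.
Qed.

End energy.

(** * Entropy inequalities for functionals of the increments *)

Section bounds.
Context {R : realType}.
Local Notation mu := (@lebesgue_measure R).

Lemma int_bound (s t K : R) (f : R -> R) : s <= t -> measurable_fun `]s, t] f ->
  (forall x, `]s, t]%classic x -> `|f x| <= K) -> `|\int[mu]_(x in `]s, t]) f x| <= K * (t - s).
Proof.
move=> st mf fK; have mD : measurable (`]s, t]%classic : set (measurableTypeR R)) by [].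
have f1 : iL `]s, t] f by apply: iL_bound fK.
apply: le_trans (le_normr_Rintegral mD f1) _; rewrite -int_cst//.
by apply: le_Rintegral => //; [exact: iL_norm|exact: iL_cst].
Qed.

Lemma int_sumI (D : set (measurableTypeR R)) (I : Type) (r : seq I) (f : I -> R -> R) :
  measurable D -> (forall i, iL D (f i)) ->
  \int[mu]_(x in D) (\sum_(i <- r) f i x) = \sum_(i <- r) \int[mu]_(x in D) f i x /\
  iL D (fun x => \sum_(i <- r) f i x).
Proof.
move=> mD fi; elim: r => [|i r [ihE ihL]].
  under eq_Rintegral do rewrite big_nil; rewrite big_nil; split.
    by rewrite Rintegral_cst// mul0r.
  rewrite (_ : (fun x => _) = fun=> 0); first by rewrite /iL; exact: integrable0.
  by apply/funext => x; rewrite big_nil.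
have e : (fun x => \sum_(j <- i :: r) f j x) = fun x => f i x + \sum_(j <- r) f j x.
  by apply/funext => x; rewrite big_cons.
rewrite e big_cons; split; last exact: iLD.
by rewrite (RintegralD mD (fi i) ihL) -ihE.
Qed.

End bounds.

Section entropy_upper.
Context {R : realType} {d : nat} {disp} {Omega : measurableType disp}.
Variables (P : probability Omega R) (P_complete : measure_is_complete P)
  (W : process R d Omega) (BW : brownian_motion P W) (T : R) (T0 : 0 < T).

Notation G := (completed_filtration P W).
Notation GT t := (g_sigma_algebraType (G t)).
Local Notation mu := (@lebesgue_measure R).
Local Notation tk := (tk T).
Local Notation dl := (dl T).

Definition shifted (a : process R d Omega) (t : R) (w : Omega) : 'cV[R]_d :=
  W t w + integralv t (a ^~ w).

Lemma shifted_meas (a : process R d Omega) t : (forall i, progr P W (fun s w => a s w i 0)) -> 0 <= t ->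
  measurable_fun [set: GT t] (shifted a t : GT t -> borelV R d).
Proof.
move=> pa t0; rewrite (_ : shifted a t = fun w => W t w + 1 *: integralv t (a ^~ w)).
  by apply: measurable_addZ; [exact: bm_adapted|exact: integralv_meas].
by apply/funext => w; rewrite scale1r.
Qed.

Lemma shifted_incr_meas (a : process R d Omega) m : (forall i, progr P W (fun s w => a s w i 0)) ->
  measurable_fun setT (incr T (shifted a) m : Omega -> seqV R d).
Proof.
move=> pa; apply: (measurable_incr T0) => t t0.
exact: (fmeas_setT P_complete BW t0 (shifted_meas pa t0)).
Qed.

Variables (a : process R d Omega).
Hypotheses (pa : forall i, progr P W (fun s w => a s w i 0))
  (ea : (\int[P]_w \int[mu]_(s in `[0%R, T]) (sqnormv (a s w))%:E < +oo)%E).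

Section level.
Variables (K : R) (K0 : 0 < K) (M : nat).

Let b : process R d Omega := fun s w => \col_i trunc K (a s w i 0).

Let bE s w i : b s w i 0 = trunc K (a s w i 0). Proof. by rewrite mxE. Qed.

Let pb i : progr P W (fun s w => b s w i 0).
Proof.
rewrite (_ : (fun s w => _) = fun s w => trunc K (a s w i 0)).
  exact: (progr_comp (measurable_trunc K) (pa i)).
by apply/funext => s; apply/funext => w; rewrite bE.
Qed.

Let mb (s t : R) w i : 0 <= s -> 0 <= t -> measurable_fun `]s, t] (fun u => b u w i 0).
Proof.
move=> s0 t0; apply: (measurable_funS _ (sub_itvoc s0 (lexx t))) => //.
exact: (progr_section w t0 (pb i)).
Qed.

Let b_iL t w i : 0 <= t -> iL `[0, t] (fun u => b u w i 0).
Proof.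
move=> t0; apply: (iL_bound (M := K)); first exact: (progr_section w t0 (pb i)).
by move=> u _; rewrite bE trunc_norm.
Qed.

Let b_diff s t w i : 0 <= s -> s <= t ->
  integralv t (b ^~ w) i 0 - integralv s (b ^~ w) i 0 = \int[mu]_(u in `]s, t]) b u w i 0.
Proof.
move=> s0 st; rewrite !mxE; apply: (int0_diff s0 st (lexx t)).
by apply: b_iL; exact: le_trans st.
Qed.

(** Mean of the truncated control over the preceding cell. The delay by one cell makes the action
    known at the start of the cell where it is used; the first action is 0. *)
Let alpha k w : 'cV[R]_d := if k is k'.+1
  then (dl M)^-1 *: (integralv (tk M k) (b ^~ w) - integralv (tk M k') (b ^~ w)) else 0.

Let alphaE k w i : alpha k.+1 w i 0 = (dl M)^-1 * \int[mu]_(u in `]tk M k, tk M k.+1]) b u w i 0.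
Proof. by rewrite -b_diff ?tk_ge0// ?ltW ?tk_lt// /alpha !mxE. Qed.

Let dl_neq0 : dl M != 0. Proof. by rewrite gt_eqF// dl_gt0. Qed.

Let alpha_F k : measurable_fun [set: GT (tk M k)] (alpha k : GT (tk M k) -> borelV R d).
Proof.
case: k => [|k]; first exact: measurable_cst.
rewrite (_ : alpha k.+1 = fun w => 0 + (dl M)^-1 *:
    (integralv (tk M k.+1) (b ^~ w) - integralv (tk M k) (b ^~ w))); last first.
  by apply/funext => w; rewrite add0r.
apply: measurable_addZ; first exact: measurable_cst.
apply: measurable_subV; first by apply: integralv_meas => //; exact: tk_ge0.
apply: (fmeas_mono (ltW (tk_lt T0 M k))).
by apply: integralv_meas => //; exact: tk_ge0.
Qed.

Let alpha_K k w : `|alpha k w| <= K.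
Proof.
apply: normv_le => [|i]; first exact: ltW.
case: k => [|k]; first by rewrite mxE normr0 ltW.
have := @int_bound _ (tk M k) (tk M k.+1) K (fun u => b u w i 0) (ltW (tk_lt T0 M k)).
move=> /(_ (mb _ _ (tk_ge0 T0 M k) (tk_ge0 T0 M k.+1))) h.
rewrite alphaE normrM ger0_norm ?invr_ge0 ?(ltW (dl_gt0 T0 M))// mulrC ler_pdivrMr ?dl_gt0//.
apply: le_trans (h _) _; first by move=> u _; rewrite bE trunc_norm.
by rewrite tkS addrAC subrr add0r.
Qed.

(** Averaging does not increase the energy, by Cauchy-Schwarz on each cell, nor does truncation. The
    sum telescopes in [Q], one cell behind because of the delay. *)
Let alpha_energy w : iL `[0, T] (fun s => sqnormv (a s w)) ->
  dl M * \sum_(k < 2 ^ M) sqnormv (alpha k w) <= energy T a w.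
Proof.
move=> ia; pose Q t := \int[mu]_(s in `[0, t]) sqnormv (a s w).
have Q0 t : 0 <= Q t by apply: Rintegral_ge0 => s _; exact: sqnormv_ge0.
have z0 : sqnormv (0 : 'cV[R]_d) = 0.
  by rewrite /sqnormv /dotv big1// => i _; rewrite mxE mul0r.
have step k : (k < 2 ^ M)%N -> dl M * sqnormv (alpha k.+1 w) <= Q (tk M k.+1) - Q (tk M k).
  move=> kM; have k1T : tk M k.+1 <= T by exact: tk_leT.
  rewrite (int0_diff (tk_ge0 T0 M k) (ltW (tk_lt T0 M k)) k1T ia).
  have mD : measurable (`]tk M k, tk M k.+1]%classic : set (measurableTypeR R)) by [].
  have sD := sub_itvoc (tk_ge0 T0 M k) k1T.
  have mT : measurable (`[0, T]%classic : set (measurableTypeR R)) by [].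
  have ic i := iL_coord (progr_section w (ltW T0) (pa i)) ia.
  have [->] := @int_sumI R _ _ (index_enum 'I_d) (fun i s => a s w i 0 * a s w i 0) mD
    (fun i => iL_S mT mD sD (proj2 (ic i))).
  move=> _; rewrite /sqnormv /dotv mulr_sumr; apply: ler_sum => i _.
  have db : iL `]tk M k, tk M k.+1] (fun u => b u w i 0).
    by apply: (iL_S _ mD sD) => //; exact: b_iL (ltW T0).
  have db2 : iL `]tk M k, tk M k.+1] (fun u => b u w i 0 ^+ 2).
    apply: (iL_bound (M := K ^+ 2)) => [|u _].
      by apply: measurable_funX; exact: mb (tk_ge0 T0 M k) (tk_ge0 T0 M k.+1).
    by rewrite normrX lerXn2r ?nnegrE// ?(ltW K0)// bE trunc_norm.
  have := cauchy_itv (tk_lt T0 M k) db db2; rewrite tkS addrAC subrr add0r -tkS => h.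
  rewrite alphaE; set I := Rintegral _ _ _ in h *.
  have -> : dl M * ((dl M)^-1 * I * ((dl M)^-1 * I)) = (dl M)^-1 * I ^+ 2 by field.
  rewrite mulrC ler_pdivrMr ?dl_gt0// mulrC; apply: (le_trans h).
  rewrite ler_wpM2l ?(ltW (dl_gt0 T0 M))//; apply: le_Rintegral => //.
    exact: (iL_S mT mD sD (proj2 (ic i))).
  by move=> u _; rewrite -expr2 bE trunc_sqr.
have H k : (k <= 2 ^ M)%N -> dl M * \sum_(j < k) sqnormv (alpha j w) <= Q (tk M k.-1).
  elim: k => [_|[|k] ih kM]; first by rewrite big_ord0 mulr0.
    by rewrite big_ord_recr big_ord0/= z0 addr0 mulr0.
  rewrite big_ord_recr/= mulrDr.
  have /= := ih (ltnW kM); have := step k (ltnW kM); rewrite /=; lra.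
apply: le_trans (H _ (leqnn _)) _.
have n0 : ((2 ^ M).-1 <= 2 ^ M)%N by rewrite leq_pred.
rewrite -subr_ge0 (int0_diff (tk_ge0 T0 M _) _ (lexx T) ia) ?tk_leT//.
by apply: Rintegral_ge0 => s _; exact: sqnormv_ge0.
Qed.

(** The continuous-time path whose grid increments are the walk under [alpha]: its drift is delayed
    by one mesh. For [t < dl M] the integral runs to a negative time and is 0. *)
Let V' (t : R) w := W t w + integralv (t - dl M) (b ^~ w).

Let cwalkE w : cwalk W T M alpha w = incr T V' M w.
Proof.
apply/funext => k; rewrite /cwalk /incr; case: ifP => // kM.
rewrite kM /V' opprD addrACA; congr (_ + _).
rewrite tkS addrK; case: k kM => [|k] kM /=.
  rewrite tk0 sub0r !integralv_neg ?lexx ?oppr_le0 ?(ltW (dl_gt0 T0 M))//.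
  by rewrite subrr scaler0.
by rewrite scalerA divff// scale1r tkS addrK.
Qed.

(** The delay costs at most [K dl M], the truncated control being bounded by [K]; the truncation
    costs [K^-1] times the energy. *)
Let V'_dist w t : iL `[0, T] (fun s => sqnormv (a s w)) -> 0 <= t -> t <= T ->
  `|shifted a t w - V' t w| <= K * dl M + K^-1 * energy T a w.
Proof.
move=> ia t0 tT; have en0 : 0 <= energy T a w by apply: Rintegral_ge0 => s _; exact: sqnormv_ge0.
have dM0 := ltW (dl_gt0 T0 M).
apply: normv_le => [|i]; first by rewrite addr_ge0// mulr_ge0// ?invr_ge0 ltW.
have mt : measurable (`[0, t]%classic : set (measurableTypeR R)) by [].
have mT : measurable (`[0, T]%classic : set (measurableTypeR R)) by [].
have st : `[0, t]%classic `<=` `[0, T]%classic.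
  by move=> x /=; rewrite !in_itv/= => /andP[-> /=] xt; exact: le_trans tT.
have [ia1 ia2] := iL_coord (progr_section w (ltW T0) (pa i)) ia.
rewrite /shifted /V' opprD addrACA subrr add0r.
rewrite [X in `|X|](_ : _ = (integralv t (a ^~ w) i 0 - integralv t (b ^~ w) i 0) +
  (integralv t (b ^~ w) i 0 - integralv (t - dl M) (b ^~ w) i 0)); last first.
  by rewrite !mxE addrA subrK.
apply: le_trans (ler_normD _ _) _; rewrite addrC; apply: lerD.
  have [td|td] := leP (dl M) t.
    rewrite b_diff ?subr_ge0 ?gerBl//.
    have := @int_bound _ (t - dl M) t K (fun u => b u w i 0).
    rewrite opprB addrCA subrr addr0; apply; first by rewrite gerBl.
      by apply: mb => //; rewrite subr_ge0.
    by move=> u _; rewrite bE trunc_norm.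
  rewrite (@integralv_neg _ _ (t - dl M)) ?subr_le0 ?(ltW td)// [X in _ - X]mxE subr0.
  have -> : integralv t (b ^~ w) i 0 = integralv t (b ^~ w) i 0 - integralv 0 (b ^~ w) i 0.
    by rewrite (@integralv_neg _ _ 0)// [X in _ - X]mxE subr0.
  rewrite b_diff//.
  have := @int_bound _ 0 t K (fun u => b u w i 0) t0 (mb w i (lexx 0) t0).
  move=> /(_ (fun u _ => _)) h; apply: le_trans (h _) _.
    by move=> u; rewrite bE trunc_norm.
  by rewrite subr0 ler_wpM2l ?(ltW K0)// (ltW td).
rewrite !mxE -RintegralB//; [|exact: (iL_S mT mt st ia1)|exact: b_iL].
apply: le_trans (le_normr_Rintegral mt _) _.
  by apply: iLB => //; [exact: (iL_S mT mt st ia1)|exact: b_iL].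
apply: (@le_trans _ _ (\int[mu]_(s in `[0, t]) (K^-1 * sqnormv (a s w)))).
  apply: le_Rintegral => //.
  - apply: iL_norm => //; apply: iLB => //; [exact: (iL_S mT mt st ia1)|exact: b_iL].
  - by apply: iLZ => //; exact: iL_S ia.
  - move=> s _; rewrite bE; apply: le_trans (trunc_dist K0 _) _.
    by rewrite ler_wpM2l ?invr_ge0 ?(ltW K0)// sqnormv_coord.
rewrite RintegralZl//; last exact: iL_S ia.
rewrite ler_wpM2l ?invr_ge0 ?(ltW K0)//.
rewrite -subr_ge0 (int0_diff t0 tT (lexx T) ia).
by apply: Rintegral_ge0 => s _; exact: sqnormv_ge0.
Qed.

(** The grid inequality on the fine grid [M] for [H] read through [ref j], followed by the
    replacement of [V'] by the shifted path. The constant counts two endpoints for each of the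
    [2 ^ m] coarse increments. *)
Lemma entropy_level m j (H : seqV R d -> R) (C L : R) : M = (m + j)%N ->
  measurable_fun setT H -> (forall y, `|H y| <= C) -> 0 <= L -> lipS (2 ^ m) L H ->
  \int[P]_w H (incr T (shifted a) m w) - 2^-1 * \int[P]_w energy T a w <=
  ln (\int[P]_w expR (H (incr T W m w))) +
    L * (2 ^ m)%:R * 2 * (K * dl M + K^-1 * \int[P]_w energy T a w).
Proof.
move=> MmJ mH HC L0 HL; have [eL _ eae] := energy_L1 P_complete BW T0 pa ea.
pose g (y : seqV R d) := expR (H (ref j y)).
have mg : measurable_fun setT g.
  apply: measurableT_comp => //; exact: (measurableT_comp mH (measurable_ref j)).
have gb y : expR (- C) <= g y <= expR C.
  by rewrite /g !ler_expR -ler_norml.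
have := grid_upper P_complete BW T0 (fun k _ => @alpha_F k) (fun k w _ => alpha_K k w) mg
  (expR_gt0 _) gb.
have refM (V : process R d Omega) w : ref j (incr T V M w) = incr T V m w.
  by rewrite [X in incr T V X]MmJ ref_incr.
rewrite (_ : (fun w => ln (g (cwalk W T M alpha w))) = fun w => H (incr T V' m w)); last first.
  by apply/funext => w; rewrite /g expRK cwalkE refM.
rewrite (_ : (fun w => g (incr T W M w)) = fun w => expR (H (incr T W m w))); last first.
  by apply/funext => w; rewrite /g refM.
have aL k : L1 P (fun w => sqnormv (alpha k w)).
  apply: bmeas_L1; apply: bmeas_sumI => i.
  have bk : bmeas (fun w => alpha k w i 0).
    split; last by exists K => w; rewrite (le_trans (coordv_norm _ _))// alpha_K.
    apply: (fmeas_setT P_complete BW (tk_ge0 T0 M k)).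
    exact: measurableT_comp (measurable_coordv i) (@alpha_F k).
  exact: bmeasM.
have en : dl M * \sum_(k < 2 ^ M) \int[P]_w sqnormv (alpha k w) <= \int[P]_w energy T a w.
  have -> : \sum_(k < 2 ^ M) \int[P]_w sqnormv (alpha k w) =
      \int[P]_w \sum_(k < 2 ^ M) sqnormv (alpha k w).
    by apply/esym; exact: (E_sum (n := (2 ^ M)%N) (fun k _ => aL k)).
  have sL : L1 P (fun w => \sum_(k < 2 ^ M) sqnormv (alpha k w)).
    exact: (L1_sum (n := (2 ^ M)%N) (fun k _ => aL k)).
  rewrite -EZ//.
  apply: le_E_ae => //; first exact: L1Z.
  by apply: filterS eae => w; exact: alpha_energy.
have mV' : measurable_fun setT (incr T V' m : Omega -> seqV R d).
  rewrite -(_ : (fun w => ref j (cwalk W T M alpha w)) = incr T V' m); last first.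
    by apply/funext => w; rewrite cwalkE refM.
  apply: measurableT_comp (measurable_ref j) _; apply: measurable_fun_seqV => k.
  rewrite /cwalk; case: (k < _)%N; last exact: measurable_cst.
  apply: measurable_addZ; last first.
    exact: (fmeas_setT P_complete BW (tk_ge0 T0 M k) (@alpha_F k)).
  exact: measurableT_comp (measurable_seqV_coord k) (measurable_incrW BW T0 M).
have HV' : L1 P (fun w => H (incr T V' m w)).
  by apply: bmeas_L1; apply: (bmeas_comp _ mV'); split => //; exists C.
have HV : L1 P (fun w => H (incr T (shifted a) m w)).
  by apply: bmeas_L1; apply: (bmeas_comp _ (shifted_incr_meas m pa)); split => //; exists C.
have sub4 (z1 z2 z3 z4 : 'cV[R]_d) : z1 - z2 - (z3 - z4) = z1 - z3 - (z2 - z4).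
  by rewrite opprD addrACA -opprD.
set c1 := L * (2 ^ m)%:R * 2.
have : \int[P]_w H (incr T (shifted a) m w) <=
    \int[P]_w (H (incr T V' m w) + (c1 * (K * dl M) + (c1 * K^-1) * energy T a w)).
  have Lc : L1 P (fun w => c1 * (K * dl M) + c1 / K * energy T a w).
    by apply: L1D; [exact/bmeas_L1/bmeas_cst|exact: L1Z].
  apply: le_E_ae => //; first exact: L1D.
  apply: filterS eae => w iw; rewrite -lerBlDl.
  apply: le_trans (ler_norm _) _; apply: le_trans (HL _ _) _.
  rewrite -mulrA -mulrDr /c1 -!mulrA ler_wpM2l//.
  rewrite (_ : (2 ^ m)%:R * _ = \sum_(k < 2 ^ m) (2 * (K * dl M + K^-1 * energy T a w))); last first.
    by rewrite sumr_const card_ord -[RHS]mulr_natl.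
  apply: ler_sum => k _; rewrite /incr ltn_ord.
  have tB l : (l <= 2 ^ m)%N -> `|shifted a (tk m l) w - V' (tk m l) w| <= K * dl M + K^-1 * energy T a w.
    by move=> lm; apply: V'_dist => //; [exact: tk_ge0|exact: tk_leT].
  rewrite [X in `|X|](_ : _ = (shifted a (tk m k.+1) w - V' (tk m k.+1) w) -
     (shifted a (tk m k) w - V' (tk m k) w)); last exact: sub4.
  apply: le_trans (ler_normB _ _) _; rewrite mulr_natl mulr2n.
  by apply: lerD; apply: tB => //; rewrite ltnW.
rewrite ED//; last by apply: L1D; [exact/bmeas_L1/bmeas_cst|exact: L1Z].
rewrite ED; [|exact/bmeas_L1/bmeas_cst|exact: L1Z].
rewrite E_cst EZ//; move: en.
set x1 := \int[P]_w H _; set x2 := \int[P]_w H _; set x3 := \int[P]_w energy _ _ _.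
set x4 := \sum_(_ < _) _; set x5 := ln _.
move: (dl M) => D; move: (K^-1) => K'; clearbody c1 x1 x2 x3 x4 x5; lra.
Qed.

End level.

(** The truncation level [K] is taken large to absorb [K^-1] times the energy, then the mesh small
    compared with [1 / K]. The Lipschitz constant disappears from the conclusion, so it may later be
    as large as it likes. *)
Lemma entropy_upper m (H : seqV R d -> R) (C L : R) :
  measurable_fun setT H -> (forall y, `|H y| <= C) -> 0 <= L -> lipS (2 ^ m) L H ->
  \int[P]_w H (incr T (shifted a) m w) - 2^-1 * \int[P]_w energy T a w <=
  ln (\int[P]_w expR (H (incr T W m w))).
Proof.
move=> mH HC L0 HL; apply/ler_addgt0Pr => e e0.
set c1 := L * (2 ^ m)%:R * 2; set E := \int[P]_w energy T a w.
have c10 : 0 <= c1 by rewrite !mulr_ge0.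
have E0 : 0 <= E by apply: E_ge0 => w; apply: Rintegral_ge0 => s _; exact: sqnormv_ge0.
pose K := 2 * c1 * E / e + 1.
have K0 : 0 < K by rewrite ltr_wpDl// divr_ge0// ?mulr_ge0// ltW.
have h1 : c1 * (K^-1 * E) <= e / 2.
  rewrite mulrCA mulrC ler_pdivrMr// /K mulrDr mulr1.
  have -> : e / 2 * (2 * c1 * E / e) = c1 * E by field; rewrite gt_eqF.
  by rewrite lerDl divr_ge0// ltW.
have p0 : 0 < c1 * K + 1 by rewrite ltr_wpDl// mulr_ge0// ltW.
have /cvgrPdist_lt/(_ (e / 2 / (c1 * K + 1))) := dl_cvg0 T.
have e2 : 0 < e / 2 / (c1 * K + 1) by rewrite !divr_gt0.
move=> /(_ e2)[N _ HN].
have := entropy_level K0 (M := (m + N)%N) (j := N) erefl mH HC L0 HL.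
have := HN (m + N)%N (leq_addl _ _); rewrite sub0r normrN (ger0_norm (ltW (dl_gt0 T0 _))).
rewrite ltr_pdivlMr// -/c1 -/E => h2 h3.
apply: (le_trans h3); rewrite lerD2l mulrDr.
have d0 := dl_gt0 T0 (m + N)%N.
have h4 : c1 * (K * dl (m + N)) <= e / 2.
  apply: ltW; apply: le_lt_trans h2; rewrite mulrDr mulr1 mulrA mulrC lerDl ltW//.
by rewrite [leRHS](splitr e); apply: lerD.
Qed.

End entropy_upper.

(** * Functionals of class C^{1,1} of the increments *)

Section nice_functions.
Context {R : realType} {d : nat}.
Implicit Types (F H : seqV R d -> R) (L : R).

(** A single constant bounds the function, its Lipschitz seminorm, the partial gradients [p] and the
    second-order errors. The expansion is in one entry at a time, which is the form that dynamic
    programming uses. *)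
Definition nice L n F := [/\ measurable_fun setT F, forall y, `|F y| <= L, lipS n L F &
  exists p : nat -> seqV R d -> 'cV[R]_d, forall k, (k < n)%N ->
    [/\ forall i, bmeas (fun y : seqV R d => p k y i 0), forall y, `|p k y| <= L &
     forall y z, `|F (upd y k (y k + z)) - F y - dotv (p k y) z| <= L * `|z| ^+ 2]].

Lemma nice_L0 L n F : nice L n F -> 0 <= L.
Proof. by case=> _ FL _ _; apply: le_trans (FL (fun=> 0)). Qed.

Lemma dotv0l (x : 'cV[R]_d) : dotv 0 x = 0.
Proof. by rewrite /dotv big1// => i _; rewrite mxE mul0r. Qed.

Lemma dotvDl (x y z : 'cV[R]_d) : dotv (x + y) z = dotv x z + dotv y z.
Proof. by rewrite /dotv -big_split/=; apply: eq_bigr => i _; rewrite mxE mulrDl. Qed.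

Lemma nice_cst n (r : R) : nice `|r| n (fun=> r).
Proof.
split => [|y|y y'|].
- exact: measurable_cst.
- by [].
- by rewrite subrr normr0 mulr_ge0// sumr_ge0.
- exists (fun _ _ => 0) => k kn; split => [i|y|y z].
  + rewrite (_ : (fun=> _) = fun=> 0); first exact: bmeas_cst.
    by apply/funext => y; rewrite mxE.
  + by rewrite normr0.
  + by rewrite subrr sub0r normrN dotv0l normr0 mulr_ge0// sqr_ge0.
Qed.

Lemma niceD L L' n F H : nice L n F -> nice L' n H -> nice (L + L') n (fun y => F y + H y).
Proof.
move=> [mF FL Fl [p Fp]] [mH HL Hl [q Hq]]; split.
- exact: measurable_funD.
- by move=> y; rewrite (le_trans (ler_normD _ _))// lerD.
- move=> y y'; rewrite opprD addrACA (le_trans (ler_normD _ _))// mulrDl.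
  by apply: lerD; [exact: Fl|exact: Hl].
- exists (fun k y => p k y + q k y) => k kn.
  have [bp pL pC] := Fp k kn; have [bq qL qC] := Hq k kn; split.
  + move=> i; rewrite (_ : (fun y => _) = fun y : seqV R d => p k y i 0 + q k y i 0).
      exact: bmeasD.
    by apply/funext => y; rewrite mxE.
  + by move=> y; rewrite (le_trans (ler_normD _ _))// lerD.
  + move=> y z; rewrite dotvDl; move: (pC y z) (qC y z).
    set P := dotv (p k y) z; set Q := dotv (q k y) z => h1 h2.
    rewrite [X in `|X|](_ : _ = (F (upd y k (y k + z)) - F y - P) +
      (H (upd y k (y k + z)) - H y - Q)); last by ring.
    by rewrite (le_trans (ler_normD _ _))// mulrDl lerD.
Qed.

Lemma lipS_upd n L F y k (z : 'cV[R]_d) : (k < n)%N -> lipS n L F ->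
  `|F (upd y k (y k + z)) - F y| <= L * `|z|.
Proof.
move=> kn /(_ (upd y k (y k + z)) y)/le_trans; apply.
rewrite (bigD1 (Ordinal kn))//= big1 => [|i ik].
  by rewrite addr0 /upd eqxx addrAC subrr add0r.
rewrite upd_neq ?subrr ?normr0//; exact: contra ik.
Qed.

(** The factor 3: the second-order error of a product is the two weighted errors plus the product of
    the increments, each at most [L L' |z|^2]. *)
Lemma niceM L L' n F H : nice L n F -> nice L' n H ->
  nice (L * L' *+ 3 ) n (fun y => F y * H y).
Proof.
move=> nF nH; have L0 := nice_L0 nF; have L0' := nice_L0 nH.
move: nF nH => [mF FL Fl [p Fp]] [mH HL Hl [q Hq]].
have LL0 := mulr_ge0 L0 L0'; split.
- exact: measurable_funM.
- move=> y; rewrite normrM; apply: (@le_trans _ _ (L * L')); first by rewrite ler_pM.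
  by rewrite mulrS lerDl mulrn_wge0.
- move=> y y'; have -> : F y * H y - F y' * H y' = F y * (H y - H y') + H y' * (F y - F y') by ring.
  set S := \sum_(_ < _) _; have S0 : 0 <= S by apply: sumr_ge0.
  apply: (@le_trans _ _ (L * (L' * S) + L' * (L * S))).
    rewrite (le_trans (ler_normD _ _))// !normrM.
    by apply: lerD; apply: ler_pM => //.
  by have := mulr_ge0 LL0 S0; lra.
- exists (fun k y => F y *: q k y + H y *: p k y) => k kn.
  have [bp pL pC] := Fp k kn; have [bq qL qC] := Hq k kn; split.
  + move=> i; rewrite (_ : (fun y => _) = fun y : seqV R d => F y * q k y i 0 + H y * p k y i 0).
      by apply: bmeasD; apply: bmeasM => //; split => //; [exists L|exists L'].
    by apply/funext => y; rewrite !mxE.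
  + move=> y; apply: (@le_trans _ _ (L * L' + L' * L)).
      by rewrite (le_trans (ler_normD _ _))// !normrZ lerD// ler_pM.
    by lra.
  + move=> y z; have hF := lipS_upd y z kn Fl; have hH := lipS_upd y z kn Hl.
    rewrite dotvDl !dotvZl; move: (pC y z) (qC y z) hF hH.
    set F' := F _; set H' := H (upd _ _ _); set P := dotv (p k y) z; set Q := dotv (q k y) z.
    have -> : F' * H' - F y * H y - (F y * Q + H y * P) =
      F y * (H' - H y - Q) + H y * (F' - F y - P) + (F' - F y) * (H' - H y) by ring.
    move=> h1 h2 h3 h4; apply: (@le_trans _ _ (L * (L' * `|z| ^+ 2) + L' * (L * `|z| ^+ 2) + (L * `|z|) * (L' * `|z|))).
      rewrite (le_trans (ler_normD _ _))// lerD//; last by rewrite normrM ler_pM.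
      rewrite (le_trans (ler_normD _ _))// !normrM lerD// ler_pM//.
    by rewrite le_eqVlt; apply/orP; left; apply/eqP; ring.
Qed.

Lemma ref_upd j y k (z : 'cV[R]_d) : ref j (upd y k (y k + z)) =
  upd (ref j y) (k %/ 2 ^ j)%N (ref j y (k %/ 2 ^ j)%N + z).
Proof.
have j0 : (0 < 2 ^ j)%N by rewrite expn_gt0.
apply/funext => l; rewrite /ref {2}/upd; case: eqP => [->|lk].
  pose r := Ordinal (ltn_pmod k j0).
  rewrite (bigD1 r)//= [in RHS](bigD1 r)//= -divn_eq /upd eqxx addrAC; congr (_ + _ + _).
  apply: eq_bigr => i ir; rewrite ifF//; apply/negbTE; apply: contra ir.
  by rewrite {2}(divn_eq k (2 ^ j)) eqn_add2l.
apply: eq_bigr => i _; rewrite upd_neq//; apply/eqP => ki; apply: lk.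
by rewrite -ki divnMDl// divn_small// addn0.
Qed.

(** Moving one fine increment moves exactly one coarse increment by the same amount ([ref_upd]), so
    the constant [L] is kept. This is why refining the grid sends the total loss of the feedback
    control to 0. *)
Lemma nice_ref j L m F : nice L (2 ^ m) F -> nice L (2 ^ (m + j)) (fun y => F (ref j y)).
Proof.
move=> nF; have L0 := nice_L0 nF; move: nF => [mF FL Fl [p Fp]].
have j0 : (0 < 2 ^ j)%N by rewrite expn_gt0.
split => //.
- exact: measurableT_comp mF (measurable_ref j).
- move=> y y'; apply: le_trans (Fl _ _) _; rewrite ler_wpM2l//.
  pose G k := `|y k - y' k|; rewrite (_ : \sum_(k < 2 ^ (m + j)) _ =
      \sum_(k < 2 ^ m) \sum_(l < 2 ^ j) G (k * 2 ^ j + l)%N).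
    apply: ler_sum => k _; rewrite /ref -sumrB; exact: ler_norm_sum.
  rewrite -(big_mkord xpredT G) expnD.
  elim: (2 ^ m)%N => [|n ih]; first by rewrite mul0n big_geq// big_ord0.
  rewrite big_ord_recr/= -ih mulSnr (big_cat_nat (leq0n _) (leq_addr _ _))/=; congr (_ + _).
  rewrite -{1}[(n * 2 ^ j)%N]add0n big_addn addKn big_mkord.
  by apply: eq_bigr => i _; rewrite addnC.
- exists (fun k y => p (k %/ 2 ^ j)%N (ref j y)) => k kn.
  have kn' : (k %/ 2 ^ j < 2 ^ m)%N by rewrite ltn_divLR// -expnD.
  have [bp pL pC] := Fp _ kn'; split => // [i|y z].
    exact: (bmeas_comp (bp i) (measurable_ref j)).
  by rewrite ref_upd; exact: pC.
Qed.

End nice_functions.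

(** * Piecewise constant controls *)

Section simple_controls.
Context {R : realType} {d : nat} {disp} {Omega : measurableType disp}.
Variables (P : probability Omega R) (P_complete : measure_is_complete P)
  (W : process R d Omega) (BW : brownian_motion P W) (T : R) (T0 : 0 < T).

Notation G := (completed_filtration P W).
Notation GT t := (g_sigma_algebraType (G t)).
Local Notation mu := (@lebesgue_measure R).
Local Notation tk := (tk T).
Local Notation dl := (dl T).

Lemma admissible_energy (w : process R d Omega) : admissible P W w ->
  (\int[P]_o \int[mu]_(s in `[0%R, T]) (sqnormv (w s o))%:E < +oo)%E.
Proof.
move=> [_ /(_ T T0)]; set X := (\int[P]_o _)%E.
have X0 : (0 <= X)%E.
  by apply: integral_ge0 => o _; apply: integral_ge0 => s _; rewrite lee_fin sqnormv_ge0.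
by move: X0; case: X => [r _|_|//]; rewrite ?ltry// gt0_muley ?ltxx// lte_fin invr_gt0.
Qed.

Variables (M : nat) (alpha : nat -> Omega -> 'cV[R]_d) (K : R).
Hypotheses (K0 : 0 <= K) (aF : forall k, (k < 2 ^ M)%N ->
    measurable_fun [set: GT (tk M k)] (alpha k : GT (tk M k) -> borelV R d))
  (aK : forall k w, (k < 2 ^ M)%N -> `|alpha k w| <= K).

(** The cells are open on the left and cover []0, T]], so the control vanishes at time 0 and after
    [T]. *)
Definition simple_control : process R d Omega :=
  fun s w => \sum_(k < 2 ^ M) \1_(`]tk M k, tk M k.+1]%classic) s *: alpha k w.

Lemma simple_control_progr i : progr P W (fun s w => simple_control s w i 0).
Proof.
rewrite (_ : (fun s w => _) = fun s w => \sum_(k < 2 ^ M)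
    \1_(`]tk M k, tk M k.+1]%classic) s * alpha k w i 0); last first.
  apply/funext => s; apply/funext => w; rewrite summxE.
  by apply: eq_bigr => k _; rewrite mxE.
apply: progr_sum => k t t0; have [kt|tk'] := leP (tk M k) t; last first.
  apply: (eq_measurable_fun (fun _ : R * GT t => 0 : R)); last exact: measurable_cst.
  move=> p /set_mem[/= + _]; rewrite in_itv/= => /andP[p0 p1].
  rewrite indicE memNset ?mul0r//= in_itv/= => /andP[h _].
  by have := lt_le_trans h p1; rewrite ltNge (ltW tk').
apply: measurable_funM.
  apply: measurable_funTS; apply: measurableT_comp measurable_fst.
  exact: measurable_indic.
have ma : measurable_fun [set: GT t] ((fun w => alpha k w i 0) : GT t -> R).
  apply: (fmeas_mono kt); exact: measurableT_comp (measurable_coordv i) (aF (ltn_ord k)).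
exact: measurable_funTS (measurableT_comp ma measurable_snd).
Qed.

Lemma simple_control_bound s w i : `|simple_control s w i 0| <= (2 ^ M)%:R * K.
Proof.
rewrite summxE; apply: le_trans (ler_norm_sum _ _ _) _.
apply: (@le_trans _ _ (\sum_(k < 2 ^ M) K)); last by rewrite sumr_const card_ord [leRHS]mulr_natl.
apply: ler_sum => k _; rewrite mxE normrM -[leRHS]mul1r ler_pM//.
  by rewrite indicE; case: (_ \in _); rewrite ?normr1// normr0.
exact: le_trans (coordv_norm _ _) (aK w (ltn_ord k)).
Qed.

Let B : R := d%:R * ((2 ^ M)%:R * K) ^+ 2.

Lemma simple_control_sqnormv s w : sqnormv (simple_control s w) <= B.
Proof.
rewrite /sqnormv /dotv; apply: (@le_trans _ _ (\sum_(i < d) ((2 ^ M)%:R * K) ^+ 2)).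
  apply: ler_sum => i _; rewrite -expr2 -real_normK ?num_real//.
  by rewrite lerXn2r ?nnegrE ?simple_control_bound ?mulr_ge0.
by rewrite sumr_const card_ord /B [leRHS]mulr_natl.
Qed.

Lemma simple_control_admissible : admissible P W simple_control.
Proof.
split; first by apply: progrV => i; exact: simple_control_progr.
move=> t t0; have B0 : 0 <= B by rewrite mulr_ge0// sqr_ge0.
have h : (\int[P]_w \int[mu]_(s in `[0%R, t]) (sqnormv (simple_control s w))%:E <= (B * t)%:E)%E.
  apply: (@le_trans _ _ (\int[P]_w (B * t)%:E)%E); last first.
    by rewrite integral_cst// [X in (_ * X)%E]probability_setT mule1.
  apply: ge0_le_integral => //.
  - by move=> w _; apply: integral_ge0 => s _; rewrite lee_fin sqnormv_ge0.
  - apply: (fmeas_setT P_complete BW (ltW t0)).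
    apply: (progr_ge0_int (ltW t0) (progr_sqnormvE simple_control_progr)).
    by move=> s w; rewrite lee_fin sqnormv_ge0.
  move=> w _; apply: (@le_trans _ _ (\int[mu]_(s in `[0%R, t]) B%:E)%E).
    apply: ge0_le_integral => //.
    - by move=> s _; rewrite lee_fin sqnormv_ge0.
    - by apply/measurable_EFinP; exact: (progr_section w (ltW t0) (progr_sqnormv simple_control_progr)).
    - by move=> s _; rewrite lee_fin simple_control_sqnormv.
  rewrite -[X in (X <= _)%E]/(\int[mu]_(s in `[0%R, t]) cst B%:E s)%E integral_cst//.
  rewrite [X in (_ * X)%E](_ : _ = t%:E)//.
  by apply: etrans (lebesgue_measure_itv _) _; rewrite /= lte_fin t0 sube0.
by rewrite (le_lt_trans (lee_wpmul2l _ h))// -?EFinM ?ltry// lee_fin invr_ge0 ltW.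
Qed.

Lemma simple_controlE k s w : (k < 2 ^ M)%N -> `]tk M k, tk M k.+1]%classic s ->
  simple_control s w = alpha k w.
Proof.
move=> kM ks; rewrite /simple_control (bigD1 (Ordinal kM))//= big1 => [|l lk].
  by rewrite addr0 indicE mem_set// scale1r.
rewrite indicE memNset ?scale0r// => ls; move: ks ls; rewrite /= !in_itv/=.
move=> /andP[h1 h2] /andP[h3 h4].
have : (l != k :> nat) by exact: contra lk.
rewrite neq_ltn => /orP[lt|lt].
  by have := lt_le_trans h1 (le_trans h4 (tk_mono T0 M lt)); rewrite ltxx.
by have := lt_le_trans h3 (le_trans h2 (tk_mono T0 M lt)); rewrite ltxx.
Qed.

Let sc_iL t w i : 0 <= t -> iL `[0, t] (fun s => simple_control s w i 0).
Proof.
move=> t0; apply: (iL_bound (M := (2 ^ M)%:R * K)).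
  exact: progr_section w t0 (simple_control_progr i).
by move=> s _; exact: simple_control_bound.
Qed.

Lemma simple_control_int k w : (k < 2 ^ M)%N ->
  integralv (tk M k.+1) (simple_control ^~ w) - integralv (tk M k) (simple_control ^~ w) =
  dl M *: alpha k w.
Proof.
move=> kM; apply/matrixP => i o; rewrite (ord1 o) !mxE.
rewrite (int0_diff (tk_ge0 T0 M k) (ltW (tk_lt T0 M k)) (lexx _) (sc_iL _ _ (tk_ge0 T0 M _))).
have -> : \int[mu]_(u in `]tk M k, tk M k.+1]) simple_control u w i 0 =
    \int[mu]_(u in `]tk M k, tk M k.+1]) alpha k w i 0.
  by apply: eq_Rintegral => s /set_mem ks; rewrite (simple_controlE _ kM ks).
rewrite int_cst; last by rewrite ltW// tk_lt.
by rewrite tkS addrAC subrr add0r mulrC.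
Qed.

Lemma cwalk_simple w : cwalk W T M alpha w = incr T (shifted W simple_control) M w.
Proof.
apply/funext => k; rewrite /cwalk /incr; case: ifP => // kM; rewrite kM.
by rewrite /shifted opprD addrACA simple_control_int.
Qed.

Lemma energy_simple w : energy T simple_control w =
  dl M * \sum_(k < 2 ^ M) sqnormv (alpha k w).
Proof.
have iS t : 0 <= t -> iL `[0, t] (fun s => sqnormv (simple_control s w)).
  move=> t0; apply: (iL_bound (M := B)).
    exact: progr_section w t0 (progr_sqnormv simple_control_progr).
  by move=> s _; rewrite ger0_norm ?sqnormv_ge0// simple_control_sqnormv.
have H k : (k <= 2 ^ M)%N -> \int[mu]_(s in `[0, tk M k]) sqnormv (simple_control s w) =
    dl M * \sum_(j < k) sqnormv (alpha j w).
  elim: k => [_|k ih kM]; first by rewrite big_ord0 mulr0 tk0 set_itv1 Rintegral_set1.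
  rewrite big_ord_recr/= mulrDr -(ih (ltnW kM)); apply/eqP; rewrite -subr_eq addrC.
  rewrite addrC subr_eq addrC -subr_eq; apply/eqP.
  rewrite (int0_diff (tk_ge0 T0 M k) (ltW (tk_lt T0 M k)) (lexx _) (iS _ (tk_ge0 T0 M _))).
  have -> : \int[mu]_(u in `]tk M k, tk M k.+1]) sqnormv (simple_control u w) =
      \int[mu]_(u in `]tk M k, tk M k.+1]) sqnormv (alpha k w).
    by apply: eq_Rintegral => s /set_mem ks; rewrite (simple_controlE _ kM ks).
  rewrite int_cst; last by rewrite ltW// tk_lt.
  by rewrite tkS addrAC subrr add0r mulrC.
by have := H _ (leqnn _); rewrite tkT.
Qed.

End simple_controls.

Section entropy_lower.
Context {R : realType} {d : nat} {disp} {Omega : measurableType disp}.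
Variables (P : probability Omega R) (P_complete : measure_is_complete P)
  (W : process R d Omega) (BW : brownian_motion P W) (T : R) (T0 : 0 < T).
Local Notation dl := (dl T).

(** The loss over [2 ^ (m + j)] steps is [T S dl], where [S] depends on [C] and [L] but not on the
    refinement [j]; the mesh is refined until this is below [e]. *)
Lemma entropy_lower m (g : seqV R d -> R) (C L e : R) : nice L (2 ^ m) g ->
  (forall y, 1 <= g y <= C) -> 0 < e -> exists2 w, admissible P W w &
  ln (\int[P]_o g (incr T W m o)) - e <=
  \int[P]_o ln (g (incr T (shifted W w) m o)) - 2^-1 * \int[P]_o energy T w o.
Proof.
move=> ng gC e0; have L0 := nice_L0 ng.
set S := @step_cst R d 1 C L.
have p0 : 0 < T * `|S| + e by rewrite ltr_wpDl// mulr_ge0// ltW.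
(* The minimum with 1 meets the requirement that the mesh be at most 1 in the one-step estimate. *)
pose eta := Num.min 1 (e / (T * `|S| + e)).
have eta0 : 0 < eta by rewrite lt_min ltr01 divr_gt0.
have /cvgrPdist_lt/(_ _ eta0)[j _ Hj] := dl_cvg0 T.
have := Hj (m + j)%N (leq_addl _ _); rewrite sub0r normrN (ger0_norm (ltW (dl_gt0 T0 _))).
rewrite lt_min => /andP[/ltW d1 d2].
have [mg _ gl [p gp]] := nice_ref j ng.
have [||||alpha [aF aK h]] := grid_lower P_complete BW T0 (m := (m + j)%N) (L := L)
    (p := p) mg ltr01 (fun y => gC (ref j y)) d1 L0.
- by move=> k i km; have [h _ _] := gp k km; exact: h.
- by move=> k y km; have [_ h _] := gp k km; exact: h.
- by move=> k y z km; exact: (lipS_upd y z km gl).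
- by move=> k y z km; have [_ _ h] := gp k km; exact: h.
have l0 : 0 <= 1^-1 * L by rewrite mulr_ge0.
exists (simple_control T (m + j) alpha).
  exact: (simple_control_admissible P_complete BW l0 aF aK).
have refM (V : process R d Omega) w : ref j (incr T V (m + j) w) = incr T V m w.
  exact: ref_incr.
move: h; rewrite (_ : (fun w => g (ref j (incr T W (m + j) w))) = fun w => g (incr T W m w)); last first.
  by apply/funext => w; rewrite refM.
rewrite (_ : (fun w => ln (g (ref j (cwalk W T (m + j) alpha w)))) =
  fun w => ln (g (incr T (shifted W (simple_control T (m + j) alpha)) m w))); last first.
  by apply/funext => w; rewrite (cwalk_simple T0 aF aK) refM.
have -> : \int[P]_o energy T (simple_control T (m + j) alpha) o =
    dl (m + j) * \sum_(k < 2 ^ (m + j)) \int[P]_w sqnormv (alpha k w).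
  rewrite (_ : (fun o => _) = fun o => dl (m + j) * \sum_(k < 2 ^ (m + j)) sqnormv (alpha k o)); last first.
    by apply/funext => w; rewrite (energy_simple T0 l0 aF aK).
  have aL k : (k < 2 ^ (m + j))%N -> L1 P (fun w => sqnormv (alpha k w)).
    move=> km; apply: bmeas_L1; apply: bmeas_sumI => i.
    have bk : bmeas (fun w => alpha k w i 0).
      split; last by exists (1^-1 * L) => w; rewrite (le_trans (coordv_norm _ _))// aK.
      apply: (fmeas_setT P_complete BW (tk_ge0 T0 (m + j) k)).
      exact: measurableT_comp (measurable_coordv i) (aF k km).
    exact: bmeasM.
  rewrite EZ; last exact: (L1_sum aL).
  by congr (_ * _); exact: (E_sum aL).
set x1 := ln _; set x2 := \int[P]_w _; set x3 := \sum_(_ < _) _ => h.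
have h2 : (2 ^ (m + j))%:R * (S * dl (m + j) ^+ 2) <= e.
  have -> : (2 ^ (m + j))%:R * (S * dl (m + j) ^+ 2) = T * S * dl (m + j).
    by have := tkT T (m + j); rewrite /tk; move: (dl (m + j)) => D <-; ring.
  move: d2; rewrite ltr_pdivlMr// => d2; apply: le_trans (ltW d2).
  rewrite mulrC ler_pM2l ?dl_gt0//; apply: (@le_trans _ _ (T * `|S|)).
    by rewrite ler_pM2l// ler_norm.
  by rewrite lerDl ltW.
move: h h2; rewrite -/S; move: (_%:R * _) => D.
by rewrite !mulrA; clearbody x1 x2 x3; lra.
Qed.

End entropy_lower.

(** * Density of cylinder functionals *)

Section nice_density.
Context {R : realType} {d : nat} {disp} {Omega : measurableType disp}.
Variables (P : probability Omega R) (P_complete : measure_is_complete P)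
  (W : process R d Omega) (BW : brownian_motion P W) (T : R) (T0 : 0 < T).

Notation G := (completed_filtration P W).
Notation GT t := (g_sigma_algebraType (G t)).
Local Notation tk := (tk T).
Local Notation dl := (dl T).

Lemma grid_cell m (s : R) : 0 < s -> s <= T ->
  exists2 k, (k < 2 ^ m)%N & tk m k < s <= tk m k.+1.
Proof.
move=> s0 sT; have : exists k, s <= tk m k by exists (2 ^ m)%N; rewrite tkT.
move=> /ex_minnP[[|k] sk kmin]; first by move: sk; rewrite tk0 leNgt s0.
have km : (k < 2 ^ m)%N by apply: kmin; rewrite tkT.
exists k => //; rewrite sk andbT ltNge; apply/negP => /kmin.
by rewrite ltnn.
Qed.

Lemma grid_approx m (s : R) : 0 <= s -> s <= T ->
  exists2 k, (k <= 2 ^ m)%N & tk m k <= s <= tk m k + dl m.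
Proof.
move=> s0 sT; have [s1|s1] := ltP 0 s.
  by have [k km /andP[h1 h2]] := grid_cell m s1 sT; exists k; [exact: ltnW|rewrite ltW// -tkS].
exists 0%N => //; have -> : s = 0 by apply/eqP; rewrite eq_le s1.
by rewrite tk0 lexx add0r ltW// dl_gt0.
Qed.

Definition cylinder : set (Omega -> R) := [set f | exists m L (F : seqV R d -> R),
  [/\ nice L (2 ^ m) F, forall y, 0 <= F y <= 1 & f = fun w => F (incr T W m w)]].

Lemma nice_incr_meas m L (F : seqV R d -> R) : nice L (2 ^ m) F ->
  measurable_fun setT (fun w => F (incr T W m w)).
Proof. by move=> [mF _ _ _]; exact: measurableT_comp mF (measurable_incrW BW T0 m). Qed.

Lemma nice_refine m j L (F : seqV R d -> R) : nice L (2 ^ m) F ->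
  nice L (2 ^ (m + j)) (fun y => F (ref j y)) /\
  (fun w => F (incr T W m w)) = (fun w => F (ref j (incr T W (m + j) w))).
Proof.
by move=> nF; split; [exact: nice_ref|apply/funext => w; rewrite ref_incr].
Qed.

Let A_meas f : cylinder f -> measurable_fun setT f.
Proof. by move=> [m [L [F [nF _ ->]]]]; exact: nice_incr_meas nF. Qed.

Let A_ge0 f x : cylinder f -> 0 <= f x.
Proof. by move=> [m [L [F [_ F01 ->]]]]; have /andP[] := F01 (incr T W m x). Qed.

Let A_le1 f x : cylinder f -> f x <= 1.
Proof. by move=> [m [L [F [_ F01 ->]]]]; have /andP[] := F01 (incr T W m x). Qed.

Let A0 : cylinder (fun=> 0).
Proof.
exists 0%N, `|0 : R|, (fun=> 0); split => //; first exact: nice_cst.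
by move=> _; rewrite lexx ler01.
Qed.

Let AC f : cylinder f -> cylinder (fun x => 1 - f x).
Proof.
move=> [m [L [F [nF F01 ->]]]].
have := niceD (nice_cst (2 ^ m) 1) (niceM (nice_cst (2 ^ m) (-1)) nF).
set L' := _ + _ => n1; exists m, L', (fun y => 1 + -1 * F y); split => //.
  by move=> y; have := F01 y; lra.
by apply/funext => w; rewrite mulN1r.
Qed.

Let AM f g : cylinder f -> cylinder g -> cylinder (fun x => f x * g x).
Proof.
move=> [m [L [F [nF F01 ->]]]] [m' [L' [F' [nF' F01' ->]]]].
have [n1 e1] := nice_refine m' nF; have [n2 e2] := nice_refine m nF'.
rewrite addnC in n2 e2; have := niceM n1 n2; set L1 := _ *+ 3 => n3.
exists (m + m')%N, L1, (fun y => F (ref m' y) * F' (ref m y)); split => //.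
  move=> y; have /andP[a b] := F01 (ref m' y); have /andP[a' b'] := F01' (ref m y).
  by rewrite mulr_ge0// mulr_ile1.
by apply/funext => w; rewrite (congr1 (@^~ w) e1) (congr1 (@^~ w) e2).
Qed.

(** A smooth version of the indicator that coordinate [i] of [W] exceeds [a] at the grid time
    [tk m k], the position being recovered as the sum of the first [k] increments. *)
Let level (i : 'I_d) (n a : R) m k : seqV R d -> R :=
  fun y => psi (n * (\sum_(l < 2 ^ m | (l < k)%N) y l i 0 - a)).

Let nice_level (i : 'I_d) (n a : R) m k : 0 <= n ->
  nice (1 + 2 * n + 3 * n ^+ 2) (2 ^ m) (level i n a m k).
Proof.
move=> n0; set L := _ + _ + _.
have n2 := sqr_ge0 n; have L1 : 1 <= L by rewrite /L; lra.
have mS : measurable_fun setT (fun y : seqV R d => \sum_(l < 2 ^ m | (l < k)%N) y l i 0).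
  rewrite (_ : (fun y => _) = fun y : seqV R d =>
     \sum_(l < 2 ^ m) (if (l < k)%N then y l i 0 else 0)).
    apply: measurable_sum => l; case: (l < k)%N; last exact: measurable_cst.
    exact: measurable_seqV_coordi.
  by apply/funext => y; rewrite big_mkcond.
have mnS : measurable_fun setT (fun y : seqV R d => n * (\sum_(l < 2 ^ m | (l < k)%N) y l i 0 - a)).
  apply: measurable_funM; first exact: measurable_cst.
  by apply: measurable_funB => //; exact: measurable_cst.
have cont (f : R -> R) K : (forall u v, `|f v - f u| <= K * `|v - u|) -> measurable_fun setT f.
  move=> fK; apply: continuous_measurable_fun => u; apply/cvgrPdist_lt => e e0.
  have K0 : 0 < `|K| + 1 by rewrite ltr_wpDl.
  near=> v; rewrite distrC; apply: le_lt_trans (fK u v) _.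
  apply: (@le_lt_trans _ _ ((`|K| + 1) * `|v - u|)).
    by rewrite ler_wpM2r// (le_trans (ler_norm _))// lerDl.
  rewrite mulrC -ltr_pdivlMr// distrC; near: v.
  by apply: (@cvgr_dist_lt _ _ _ (nbhs u) _ id u) => //; rewrite divr_gt0.
have mpsi := cont psi 2 psi_lip.
have mdpsi : measurable_fun setT (@dpsi R).
  rewrite /dpsi; apply: measurable_fun_ifT => //.
  - by apply: measurable_fun_ler; [exact: measurable_id|exact: measurable_cst].
  - apply: measurable_funM; first by apply: measurable_funM => //; exact: measurable_cst.
    rewrite (_ : (fun x => _) = fun x : R => expR (- ln ((1 + x ^+ 2) ^+ 2))).
      apply: measurableT_comp => //; apply: measurableT_comp => //.
      apply: measurableT_comp => //; apply: measurable_funX; apply: measurable_funD => //.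
    by apply/funext => x; rewrite expRN lnK// posrE exprn_gt0// ltr_pwDl// sqr_ge0.
split.
- exact: measurableT_comp.
- by move=> y; rewrite ger0_norm ?psi_ge0// (le_trans (psi_le1 _)).
- move=> y y'; rewrite /level; apply: le_trans (psi_lip _ _) _.
  set S := \sum_(_ < _) `|_|; have S0 : 0 <= S by apply: sumr_ge0.
  rewrite -mulrBr normrM (ger0_norm n0) opprB addrA subrK.
  apply: (@le_trans _ _ (2 * n * S)); last by rewrite /L; nra.
  rewrite mulrA ler_wpM2l ?mulr_ge0// -sumrB (le_trans (ler_norm_sum _ _ _))//.
  rewrite big_mkcond/= /S; apply: ler_sum => l _; case: ifP => // _.
  by rewrite (_ : y l i 0 - y' l i 0 = (y l - y' l) i 0) ?coordv_norm// !mxE.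
- exists (fun l y => if (l < k)%N then
     (dpsi (n * (\sum_(l < 2 ^ m | (l < k)%N) y l i 0 - a)) * n) *: axis i 1 else 0) => l lm.
  have aE (j : 'I_d) : (axis i 1 : 'cV[R]_d) j 0 = (j == i)%:R :> R.
    by rewrite mxE; case: (j == i).
  have d1 (y : seqV R d) : `|dpsi (n * (\sum_(l0 < 2 ^ m | (l0 < k)%N) y l0 i 0 - a)) * n| <= L.
    rewrite normrM (ger0_norm n0); apply: (@le_trans _ _ (1 * n)).
      by rewrite ler_wpM2r// dpsi_bound.
    by rewrite /L; lra.
  split.
  + move=> j; split.
      case: (l < k)%N; last first.
        rewrite (_ : (fun y => _) = fun=> 0); first exact: measurable_cst.
        by apply/funext => y; rewrite mxE.
      rewrite (_ : (fun y => _) = fun y : seqV R d => dpsi (n * (\sum_(l < 2 ^ m | (l < k)%N) y l i 0 - a)) * n * (j == i)%:R).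
        apply: measurable_funM; last exact: measurable_cst.
        apply: measurable_funM; last exact: measurable_cst.
        exact: measurableT_comp.
      by apply/funext => y; rewrite mxE aE.
    exists L => y; case: (l < k)%N; last by rewrite mxE normr0 (le_trans _ L1).
    rewrite mxE aE normrM; apply: le_trans (d1 y).
    by rewrite ler_piMr// normr_nat; case: (j == i).
  + move=> y; apply: normv_le => [|j]; first by rewrite (le_trans _ L1).
    case: (l < k)%N; last by rewrite mxE normr0 (le_trans _ L1).
    rewrite mxE aE normrM; apply: le_trans (d1 y).
    by rewrite ler_piMr// normr_nat; case: (j == i).
  + move=> y z; rewrite /level; set S := \sum_(_ < _ | _) y _ i 0.
    have -> : \sum_(l0 < 2 ^ m | (l0 < k)%N) upd y l (y l + z) l0 i 0 =
        S + (l < k)%N%:R * z i 0.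
      rewrite /S; case: (boolP (l < k)%N) => lk /=.
        rewrite (bigD1 (Ordinal lm))//= [in RHS](bigD1 (Ordinal lm))//= /upd eqxx mxE mul1r addrAC.
        congr (_ + _ + _); apply: eq_bigr => o /andP[_ /negbTE ol].
        by rewrite ifF//; apply/negbTE/negP => /eqP e; move: ol => /eqP; apply; apply: ord_inj.
      rewrite mul0r addr0; apply: eq_bigr => o ok; rewrite upd_neq//.
      by apply: contraNneq lk => <-.
    have := psi_C11 (n * (S - a)) (n * (S + (l < k)%N%:R * z i 0 - a)).
    have -> : n * (S + (l < k)%N%:R * z i 0 - a) - n * (S - a) = n * ((l < k)%N%:R * z i 0) by ring.
    have -> : dotv (if (l < k)%N then (dpsi (n * (S - a)) * n) *: axis i 1 else 0) z =
        dpsi (n * (S - a)) * (n * ((l < k)%N%:R * z i 0)).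
      case: (l < k)%N; last by rewrite dotv0l mul0r !mulr0.
      by rewrite dotvZl mul1r dotv_axis mul1r mulrA.
    move=> h; apply: le_trans h _.
    have zi : z i 0 ^+ 2 <= `|z| ^+ 2.
      by rewrite -(real_normK (num_real (z i 0))) lerXn2r ?nnegrE// coordv_norm.
    have z2 := sqr_ge0 `|z|; have zi0 := sqr_ge0 (z i 0).
    apply: (@le_trans _ _ (3 * n ^+ 2 * `|z| ^+ 2)); last by rewrite /L; nra.
    case: (l < k)%N; last by rewrite mul0r mulr0 expr0n mulr0 !mulr_ge0.
    by rewrite mul1r exprMn mulrA ler_wpM2l// mulr_ge0.
Unshelve. all: end_near. Qed.

Let appr := approximable P cylinder.

Let W_path : {ae P, forall w, W 0 w = 0 /\ {within `[0, +oo[, continuous (W ^~ w)}}.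
Proof. by have [_ h _ _] := BW. Qed.

Let psi_meas (n a : R) (f : Omega -> R) : 0 <= n -> measurable_fun setT f ->
  bmeas (fun w => psi (n * (f w - a))).
Proof.
move=> n0 mf; split; last first.
  by exists 1 => w; rewrite ger0_norm ?psi_ge0// psi_le1.
have mg : measurable_fun setT (fun w => n * (f w - a)).
  apply: measurable_funM; first exact: measurable_cst.
  by apply: measurable_funB => //; exact: measurable_cst.
apply: measurableT_comp mg; rewrite /psi; apply: measurable_fun_ifT => //.
- by apply: measurable_fun_ler; [exact: measurable_id|exact: measurable_cst].
- apply: measurable_funM; first exact: measurable_funX.
  rewrite (_ : (fun x => _) = fun x : R => expR (- ln (1 + x ^+ 2))).
    apply: measurableT_comp => //; apply: measurableT_comp => //.
    by apply: measurableT_comp => //; apply: measurable_funD => //; exact: measurable_funX.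
  by apply/funext => x; rewrite expRN lnK// posrE ltr_pwDl// sqr_ge0.
Qed.

Let mWi s i : 0 <= s -> measurable_fun setT (fun w => W s w i 0).
Proof. by move=> s0; exact: measurableT_comp (measurable_coordv i) (bm_meas BW s0). Qed.

Let level_cylinder (i : 'I_d) (n : nat) (a : R) m k : (k <= 2 ^ m)%N ->
  exists2 f, cylinder f & {ae P, forall w, f w = psi (n%:R * (W (tk m k) w i 0 - a))}.
Proof.
move=> km; have nl := nice_level i a m k (ler0n R n).
exists (fun w => level i n%:R a m k (incr T W m w)).
  exists m, (1 + 2 * n%:R + 3 * n%:R ^+ 2), (level i n%:R a m k); split => //.
  by move=> y; rewrite psi_ge0 psi_le1.
apply: filterS W_path => w [W0 _]; rewrite /level; congr (psi (_ * (_ - _))).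
transitivity ((\sum_(l < 2 ^ m | (l < k)%N) incr T W m w l) i 0); first by rewrite summxE.
rewrite -(big_ord_widen_cond (2 ^ m)%N xpredT)//.
rewrite (eq_bigr (fun l : 'I_k => W (tk m l.+1) w - W (tk m l) w)); last first.
  by move=> l _; rewrite /incr (leq_trans (ltn_ord l) km).
rewrite -(big_mkord xpredT (fun l => W (tk m l.+1) w - W (tk m l) w)).
by rewrite (telescope_sumr (fun l => W (tk m l) w))// tk0 W0 subr0.
Qed.

(** Dyadic times tending to [s], and continuity of almost every path. *)
Let level_approx (i : 'I_d) (n : nat) (a s e : R) : 0 <= s -> s <= T -> 0 < e ->
  exists2 f, cylinder f & \int[P]_w `|f w - psi (n%:R * (W s w i 0 - a))| <= e.
Proof.
move=> s0 sT e0.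
have /choice[k kP] : forall m, exists k, (k <= 2 ^ m)%N /\ tk m k <= s <= tk m k + dl m.
  by move=> m; have [k km h] := grid_approx m s0 sT; exists k.
have tks : (fun m => tk m (k m)) @ \oo --> s.
  apply/cvgrPdist_lt => z z0; have /cvgrPdist_lt/(_ _ z0)[N _ HN] := dl_cvg0 T.
  exists N => // m /= Nm; have := HN m Nm; have [_ /andP[h1 h2]] := kP m.
  rewrite sub0r normrN (ger0_norm (ltW (dl_gt0 T0 m))) ger0_norm ?subr_ge0//.
  by apply: le_lt_trans; rewrite lerBlDl.
have cv : (fun m => \int[P]_w `|psi (n%:R * (W (tk m (k m)) w i 0 - a)) -
    psi (n%:R * (W s w i 0 - a))|) @ \oo --> \int[P]_w (0 : R).
  apply: (@bounded_cvg_E _ _ _ P _ _ 1).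
  - move=> m; have [//] := bmeas_norm (bmeasB (psi_meas a (ler0n R n) (mWi i (tk_ge0 T0 m (k m)))) (psi_meas a (ler0n R n) (mWi i s0))).
  - exact: measurable_cst.
  - move=> m w; rewrite normr_id.
    set u := psi _; set v := psi _; have u0 : 0 <= u <= 1 by rewrite psi_ge0 psi_le1.
    have v0 : 0 <= v <= 1 by rewrite psi_ge0 psi_le1.
    by rewrite ler_norml; lra.
  apply: filterS W_path => w [_ cW].
  have cWs : (fun m => W (tk m (k m)) w i 0) @ \oo --> W s w i 0.
    have /subspace_continuousP/(_ s) fc := cW.
    have {}fc : (W ^~ w) @ within `[0, +oo[ (nbhs s) --> W s w.
      by apply: fc; rewrite /= in_itv/= s0.
    have c2 : (fun m => W (tk m (k m)) w) @ \oo --> W s w.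
      apply: cvg_comp fc => U /= sU; have := tks _ sU => -[N _ HN].
      by exists N => // m Nm; apply: HN => //=; rewrite in_itv/= tk_ge0.
    exact: (cvg_comp _ _ c2 (@coord_continuous R d 1 i 0 (W s w))).
  apply/cvgrPdist_le => z z0.
  have n1 : 0 < 2 * n%:R + 1 :> R by rewrite ltr_wpDl// mulr_ge0.
  have /cvgrPdist_lt/(_ (z / (2 * n%:R + 1))) := cWs.
  move=> /(_ (divr_gt0 z0 n1))[N _ HN]; exists N => // m Nm.
  rewrite sub0r normrN normr_id; apply: le_trans (psi_lip _ _) _.
  rewrite -mulrBr opprB addrA subrK normrM (ger0_norm (ler0n R n)) mulrA.
  have := HN m Nm; rewrite /= distrC ltr_pdivlMr// => h.
  apply: le_trans (ltW h); rewrite mulrC ler_wpM2l// lerDl.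
  by [].
have c0 : \int[P]_w (0 : R) = 0 by rewrite E_cst.
move: cv; rewrite c0 => /cvgrPdist_le/(_ e e0)[N _ /(_ N (leqnn _))/=].
have [f Af fe] := level_cylinder i n a (proj1 (kP N)).
rewrite sub0r normrN ger0_norm; last by apply: E_ge0.
move=> h; exists f => //; apply: le_trans h.
have bl := bmeasB (psi_meas a (ler0n R n) (mWi i (tk_ge0 T0 N (k N)))) (psi_meas a (ler0n R n) (mWi i s0)).
apply: le_E_ae.
- apply: bmeas_L1; apply: bmeas_norm; apply: bmeasB; last exact: (psi_meas a (ler0n R n) (mWi i s0)).
  split; first exact: A_meas.
  by exists 1 => w; rewrite ger0_norm ?A_ge0// A_le1.
- exact/bmeas_L1/bmeas_norm.
- by apply: filterS fe => w ->.
Qed.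

Let appr_halfspace (i : 'I_d) (a s : R) : 0 <= s -> s <= T ->
  appr [set w | a < W s w i 0].
Proof.
move=> s0 sT; have mB : measurable [set w | a < W s w i 0].
  rewrite (_ : [set w | _] = (fun w => W s w i 0) @^-1` `]a, +oo[%classic).
    by rewrite -[X in measurable X]setTI; apply: mWi.
  by apply/seteqP; split => w /=; rewrite in_itv/= andbT.
split => // e e0; have e2 : 0 < e / 2 by rewrite divr_gt0.
have cv : (fun n => \int[P]_w `|psi (n%:R * (W s w i 0 - a)) - \1_[set w | a < W s w i 0] w|)
    @ \oo --> \int[P]_w (0 : R).
  have b n := bmeasB (psi_meas a (ler0n R n) (mWi i s0)) (bmeas_indic (R := R) mB).
  apply: (@bounded_cvg_E _ _ _ P _ _ 1).
  - by move=> n; have [] := bmeas_norm (b n).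
  - exact: measurable_cst.
  - move=> n w; rewrite normr_id; set u := psi _.
    have u0 : 0 <= u <= 1 by rewrite psi_ge0 psi_le1.
    by rewrite indicE; case: (_ \in _) => /=; rewrite ler_norml; lra.
  apply: aeW => w; have := @psi_cvg R (W s w i 0 - a); rewrite subr_gt0 => h.
  rewrite indicE (_ : (w \in _) = (a < W s w i 0)); last first.
    by apply/idP/idP => [/set_mem//|h']; exact: mem_set.
  apply/cvgrPdist_le => z z0; move: h => /cvgrPdist_le/(_ z z0)[N _ HN].
  by exists N => // n Nn; rewrite sub0r normrN normr_id distrC; exact: HN.
have c0 : \int[P]_w (0 : R) = 0 by rewrite E_cst.
move: cv; rewrite c0 => /cvgrPdist_le/(_ _ e2)[N _ /(_ N (leqnn _))/=].
rewrite sub0r normrN ger0_norm; last by apply: E_ge0.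
have [f Af fe] := level_approx i N a s0 sT e2 => h; exists f => //.
have bf : bmeas f.
  by split; [exact: A_meas|exists 1 => w; rewrite ger0_norm ?A_ge0// A_le1].
have bp := psi_meas a (ler0n R N) (mWi i s0).
have bi := bmeas_indic (R := R) mB.
apply: (@le_trans _ _ (\int[P]_w (`|f w - psi (N%:R * (W s w i 0 - a))| +
    `|psi (N%:R * (W s w i 0 - a)) - \1_[set w | a < W s w i 0] w|))).
  apply: le_E.
  - by apply: bmeas_L1; apply: bmeas_norm; exact: bmeasB.
  - by apply: bmeas_L1; apply: bmeasD; apply: bmeas_norm; exact: bmeasB.
  - by move=> w; rewrite -[X in `|X - \1__ _|](subrK (psi (N%:R * (W s w i 0 - a)))) -addrA ler_normD.
rewrite ED; [|by apply: bmeas_L1; apply: bmeas_norm; exact: bmeasB..].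
by rewrite [leRHS](splitr e) lerD.
Qed.

(** Sets approximable in mean form a sigma-algebra. It contains the null sets, approximated by 0,
    and the events [W_s in B]: these are generated by half-spaces, for which a steep sigmoid at a
    dyadic time near [s] gives the approximation. *)
Lemma filtration_approximable A : G T A -> approximable P cylinder A.
Proof.
apply: (approximable_sigma A_meas A_ge0 A_le1 A0 AC AM) => {}A [|zA]; last first.
  have mA : measurable A by exact: P_complete.
  split => // e e0; exists (fun=> 0) => //.
  rewrite negligible_E0 ?ltW//.
    by apply: measurableT_comp => //; apply: measurable_funB => //.
  have [N [mN N0 AN]] := zA; exists N; split => // w /= h; apply: AN; apply: contrapT => nA.
  by apply: h; rewrite indicE memNset// subr0 normr0.
move: A; apply: (approximable_sigma A_meas A_ge0 A_le1 A0 AC AM) => _ [s [B [/andP[s0 sT] mB] ->]].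
pose HW : set (set Omega) := [set A | exists (i : 'I_d) (a : R), A = [set w | a < W s w i 0]].
apply: (approximable_sigma A_meas A_ge0 A_le1 A0 AC AM (G := HW)).
  by move=> _ [i [a ->]]; exact: appr_halfspace.
have mW : measurable_fun [set: g_sigma_algebraType HW]
    (W s : g_sigma_algebraType HW -> g_sigma_algebraType (@halfspaces R d)).
  apply: (@measurability _ _ _ (g_sigma_algebraType (@halfspaces R d)) _ _ (@halfspaces R d)) => //.
  move=> _ [_ [i [a ->]] <-]; rewrite setTI; apply: sub_sigma_algebra.
  by exists i, a.
by have := mW measurableT B (borelV_halfspaces mB); rewrite setTI.
Qed.

(** Layer cake again; the finitely many layers, each given on its own grid, are brought to a common
    refinement. *)
Lemma nice_dense (f : Omega -> R) (M e : R) : measurable_fun [set: GT T] (f : GT T -> R) ->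
  0 < M -> (forall w, 0 <= f w <= M) -> 0 < e -> exists m L (F : seqV R d -> R),
  [/\ nice L (2 ^ m) F, forall y, 0 <= F y <= M &
    \int[P]_w `|F (incr T W m w) - f w| <= e].
Proof.
move=> mf M0 fM e0.
have fa c : 0 <= c -> approximable P cylinder [set w | c < f w].
  move=> _; apply: filtration_approximable.
  rewrite (_ : [set x | _] = f @^-1` `]c, +oo[%classic).
    by have := mf measurableT _ (measurable_itv `]c, +oo[); rewrite setTI /measurable/= filtration_id.
  by apply/seteqP; split => w /=; rewrite in_itv/= andbT.
have [n [F [n0 AF Fe]]] := approximable_fun A_meas A_ge0 A_le1 M0
    (fmeas_setT P_complete BW (ltW T0) mf) fM fa e0.
have H k : (k <= n)%N -> exists m L (S : seqV R d -> R), [/\ nice L (2 ^ m) S,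
    forall y, 0 <= S y <= k%:R & (fun w => \sum_(i < k) F i w) = (fun w => S (incr T W m w))].
  elim: k => [_|k ih kn].
    exists 0%N, `|0 : R|, (fun=> 0); split; first exact: nice_cst.
      by move=> y; rewrite lexx.
    by apply/funext => w; rewrite big_ord0.
  have [m [L [S [nS Sk SE]]]] := ih (ltnW kn).
  have [m' [L' [F' [nF' F01' FE']]]] := AF k kn.
  have [n1 e1] := nice_refine m' nS; have [n2 e2] := nice_refine m nF'.
  rewrite addnC in n2 e2; have := niceD n1 n2; set L1 := _ + _ => n3.
  exists (m + m')%N, L1, (fun y => S (ref m' y) + F' (ref m y)); split => //.
    move=> y; have /andP[a b] := Sk (ref m' y); have /andP[a' b'] := F01' (ref m y).
    by rewrite addr_ge0//= -natr1 lerD.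
  apply/funext => w; rewrite big_ord_recr/= FE' (congr1 (@^~ w) SE).
  by rewrite (congr1 (@^~ w) e1) (congr1 (@^~ w) e2).
have [m [L [S [nS Sn SE]]]] := H n (leqnn n).
have := niceM (nice_cst (2 ^ m) (M / n%:R)) nS; set L1 := _ *+ 3 => n1.
have n0' : 0 < n%:R :> R by rewrite ltr0n.
exists m, L1, (fun y => M / n%:R * S y); split => //.
  move=> y; have /andP[a b] := Sn y.
  by rewrite mulr_ge0 ?divr_ge0 ?(ltW M0)//= mulrAC ler_pdivrMr// ler_pM2l.
apply: le_trans Fe; rewrite (_ : (fun w => `|M / n%:R * S _ - _|) =
  fun w => `|M / n%:R * \sum_(i < n) F i w - f w|)//.
by apply/funext => w; rewrite (congr1 (@^~ w) SE).
Qed.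

End nice_density.

(** * Occupation measures and moments of solutions *)

Section uniform_time.
Context {R : realType} {d : nat} {disp} {Omega : measurableType disp}.
Variables (P : probability Omega R) (P_complete : measure_is_complete P)
  (W : process R d Omega) (BW : brownian_motion P W) (T : R) (T0 : 0 < T).

Notation G := (completed_filtration P W).
Notation GT t := (g_sigma_algebraType (G t)).
Local Notation mu := (@lebesgue_measure R).

Definition clip (s : R) : R := Num.min T (Num.max 0 s).

Lemma clip_itv s : 0 <= clip s <= T.
Proof. by rewrite /clip le_min (ltW T0) le_max lexx ge_min lexx. Qed.

Lemma clip_id s : 0 <= s -> s <= T -> clip s = s.
Proof. by move=> s0 sT; rewrite /clip max_r// min_r. Qed.

(** Progressive measurability speaks of [[0, T]] only; clipping the time gives a function measurable
    on the whole product space, unchanged for times in [[0, T]]. *)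
Definition at_time {U : Type} (f : R -> Omega -> U) (p : Omega * measurableTypeR R) : U :=
  f (clip p.2) p.1.

(* The scenario together with an independent time uniform on [0, T]. *)
Definition QT : probability (Omega * measurableTypeR R)%type R :=
  (P \x uniform_prob T0)%E.

Lemma at_time_meas {dU} {U : measurableType dU} (f : R -> Omega -> U) : progr P W f ->
  measurable_fun setT (at_time f).
Proof.
move=> pf.
have mc : measurable_fun setT (fun p : Omega * measurableTypeR R => clip p.2 : R).
  apply: (measurable_minr (f := cst T)); first exact: measurable_cst.
  by apply: (measurable_maxr (f := cst 0)); [exact: measurable_cst|exact: measurable_snd].
have mi : measurable_fun [set: Omega] (id : Omega -> GT T).
  move=> _ B mB; rewrite setTI; exact: (filtration_measurable P_complete BW (ltW T0) mB).
have mi' : measurable_fun setT (fun p : Omega * measurableTypeR R => p.1 : GT T).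
  exact: measurableT_comp mi measurable_fst.
have mp := measurable_fun_pair mc mi'.
apply: (@measurable_comp _ _ _ _ _ _ (`[0, T] `*` [set: GT T])
  (fun p : R * GT T => f p.1 p.2) setT (fun p : Omega * measurableTypeR R => (clip p.2, p.1 : GT T))) => //.
- exact: measurableX.
- by move=> _ [p _ <-]; split => //=; rewrite in_itv/= clip_itv.
- exact: pf (ltW T0).
Qed.

Lemma at_time_int (f : R -> Omega -> R) : progr P W f -> (forall s w, 0 <= f s w) ->
  (\int[QT]_p (at_time f p)%:E =
   (T^-1)%:E * \int[P]_w \int[mu]_(s in `[0%R, T]) (f s w)%:E)%E.
Proof.
move=> pf f0; have mF : measurable_fun setT (EFin \o at_time f).
  by apply/measurable_EFinP; exact: at_time_meas pf.
have F0 p : (0 <= (EFin \o at_time f) p)%E by rewrite lee_fin /at_time.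
rewrite /QT; apply: etrans (fubini_tonelli1 _ mF F0) _.
rewrite -ge0_integralZl//; last 3 first.
- apply: (fmeas_setT P_complete BW (ltW T0)); apply: (progr_ge0_int (ltW T0)).
    by apply: (progr_comp (h := EFin)) pf; exact: EFin_measurable.
  by move=> s w; rewrite lee_fin.
- by move=> w _; apply: integral_ge0 => s _; rewrite lee_fin.
- by rewrite lee_fin invr_ge0 ltW.
apply: eq_integral => w _; rewrite /fubini_F integral_uniform//; last first.
  exact: measurableT_comp mF (pair1_measurable w).
rewrite subr0; congr (_ * _)%E; apply: eq_integral => s /set_mem.
by rewrite /= in_itv/= => /andP[s0 sT]; rewrite /at_time/= clip_id.
Qed.

Lemma at_time_L1 (f : R -> Omega -> R) : progr P W f -> (forall s w, 0 <= f s w) ->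
  (\int[P]_w \int[mu]_(s in `[0%R, T]) (f s w)%:E < +oo)%E ->
  L1 QT (at_time f) /\
  (\int[P]_w \int[mu]_(s in `[0%R, T]) (f s w)%:E = (T * \int[QT]_p at_time f p)%:E)%E.
Proof.
move=> pf f0 fo; have e := at_time_int pf f0; set X := (\int[P]_w _)%E in fo e *.
have X0 : (0 <= X)%E.
  by apply: integral_ge0 => w _; apply: integral_ge0 => s _; rewrite lee_fin.
have XE : X = (fine X)%:E by rewrite fineK// ge0_fin_numE.
have L : L1 QT (at_time f).
  apply/integrableP; split; first by apply/measurable_EFinP; exact: at_time_meas pf.
  under eq_integral => p _ do rewrite /= ger0_norm ?f0//.
  by rewrite e XE -EFinM ltry.
split => //; rewrite EFinM -EFinE// e muleA -EFinM divff ?mul1e//.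
by rewrite gt_eqF.
Qed.

Lemma at_time_fin (f : R -> Omega -> R) : progr P W f -> (forall s w, 0 <= f s w) ->
  L1 QT (at_time f) -> (\int[P]_w \int[mu]_(s in `[0%R, T]) (f s w)%:E < +oo)%E.
Proof.
move=> pf f0 L; have := at_time_int pf f0; rewrite EFinE//.
set X := (\int[P]_w _)%E; have X0 : (0 <= X)%E.
  by apply: integral_ge0 => w _; apply: integral_ge0 => s _; rewrite lee_fin.
by move: X0; case: X => [r _ _|_|//]; rewrite ?ltry// gt0_muley// lte_fin invr_gt0.
Qed.

Lemma energy_QT (a : process R d Omega) : (forall i, progr P W (fun s w => a s w i 0)) ->
  L1 QT (at_time (fun s w => sqnormv (a s w))) ->
  (\int[P]_w \int[mu]_(s in `[0%R, T]) (sqnormv (a s w))%:E < +oo)%E /\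
  \int[P]_w energy T a w = T * \int[QT]_p at_time (fun s w => sqnormv (a s w)) p.
Proof.
move=> pa L; have ps := progr_sqnormv pa.
have s0 s w : 0 <= sqnormv (a s w) by exact: sqnormv_ge0.
have fo := at_time_fin ps s0 L; split => //.
have [_ e1 _] := energy_L1 P_complete BW T0 pa fo.
have [_ e2] := at_time_L1 ps s0 fo.
by apply: EFin_inj; rewrite e1 e2.
Qed.

Lemma within_coord (A : set R) (f : R -> 'cV[R]_d) i : {within A, continuous f} ->
  {within A, continuous (fun s => f s i 0)}.
Proof.
move=> cf s; apply: (@cvg_comp _ _ _ f (fun x : 'cV[R]_d => x i 0) _ _ _ (cf s)).
exact: coord_continuous.
Qed.

(* The path is only almost surely continuous; off the exceptional set it is replaced by 0. *)
Lemma bm_modification : exists W' : process R d Omega,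
  [/\ forall i, progr P W (fun s w => W' s w i 0),
    {ae P, forall w, forall s, W' s w = W s w} & forall w, W' 0 w = 0].
Proof.
have [_ [N [mN N0 hN]] _ _] := BW.
pose W' : process R d Omega := fun s w => if w \in N then 0 else W s w.
have good w : w \notin N -> W 0 w = 0 /\ {within `[0, +oo[, continuous (W ^~ w)}.
  by move=> wN; apply: contrapT => h; move/negP: wN; apply; apply: mem_set; exact: hN.
exists W'; split.
- move=> i; apply: continuous_progr => [t t0|w].
    rewrite (_ : (fun w => _) = fun w => if w \in N then 0 else W t w i 0); last first.
      by apply/funext => w; rewrite /W'; case: ifP => // _; rewrite mxE.
    apply: measurable_fun_ifT; [|exact: measurable_cst|]; last first.
      apply: (measurableT_comp (f := fun x : borelV R d => x i 0)); first exact: measurable_coordv.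
      exact: bm_adapted.
    apply: (measurable_fun_bool true); rewrite setTI.
    rewrite (_ : _ @^-1` _ = N); last by apply/seteqP; split => w /=; [move/set_mem|move/mem_set].
    apply: sub_sigma_algebra; apply: sub_sigma_algebra; right.
    by exists N; split.
  rewrite /W'; case: (boolP (w \in N)) => [_|/good[_ cW]].
    by apply: continuous_subspaceT => u; exact: cvg_cst.
  exact: within_coord.
- have aeN : {ae P, forall w, w \notin N}.
    by exists N; split => // w /= /negP; rewrite negbK => /set_mem.
  by apply: filterS aeN => w /negbTE wN s; rewrite /W' wN.
- move=> w; rewrite /W'; case: (boolP (w \in N)) => // wN.
  by have [] := good w wN.
Qed.

Lemma normv_sqnormv (x : 'cV[R]_d) : sqnormv x <= d%:R * `|x| ^+ 2.
Proof.
rewrite /sqnormv /dotv; apply: (@le_trans _ _ (\sum_(i < d) `|x| ^+ 2)).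
  apply: ler_sum => i _; rewrite -expr2 -real_normK ?num_real//.
  by rewrite lerXn2r ?nnegrE// coordv_norm.
by rewrite sumr_const card_ord [leRHS]mulr_natl.
Qed.

(** Comes from [y^2 <= 4 e^y] for [y >= 0] and the exponential moment of the norm. *)
Definition bm_second_moment : R := d%:R * (4 * (1 + d%:R * (2 * expR (2^-1 * T)))).

Lemma bm_moment s : 0 <= s -> s <= T ->
  (\int[P]_w (sqnormv (W s w))%:E <= bm_second_moment%:E)%E.
Proof.
move=> s0 sT.
have B0 : 0 <= bm_second_moment.
  by rewrite /bm_second_moment !mulr_ge0// ?addr_ge0// !mulr_ge0// expR_ge0.
have [_ W_path _ _] := BW.
have m0 := bm_meas BW s0; have m00 := bm_meas BW (lexx 0).
have mW : measurable_fun setT (fun w => (sqnormv (W s w - W 0 w))%:E).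
  apply/measurable_EFinP; apply: measurable_sum => i.
  have h := measurableT_comp (measurable_coordv i) (bm_inc_meas BW (lexx 0) s0).
  exact: (measurable_funM h h).
have mWs : measurable_fun setT (fun w => (sqnormv (W s w))%:E).
  apply/measurable_EFinP; apply: measurable_sum => i.
  have h := measurableT_comp (measurable_coordv i) m0.
  exact: (measurable_funM h h).
have -> : (\int[P]_w (sqnormv (W s w))%:E = \int[P]_w (sqnormv (W s w - W 0 w))%:E)%E.
  by apply: ae_eq_integral => //; apply: filterS W_path => w [-> _] _; rewrite subr0.
have [s1|s1] := ltP 0 s; last first.
  have -> : s = 0 by apply/eqP; rewrite eq_le s0 s1.
  under eq_integral => w _ do rewrite subrr.
  rewrite (_ : sqnormv (0 : 'cV[R]_d) = 0) ?integral0 ?lee_fin//.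
  by rewrite /sqnormv dotv0l.
have [N [gN NE]] := bm_law BW s1.
have LN := gauss_exp_norm s1 gN (@ler01 R).
pose V : {mfun Omega >-> borelV R d} := mfun_Sub (mem_set (bm_inc_meas BW (lexx 0) s0)).
have mq : measurable_fun setT (fun x : borelV R d => (sqnormv (x : 'cV[R]_d))%:E).
  apply/measurable_EFinP; apply: measurable_sum => i.
  by apply: measurable_funM; exact: measurable_coordv.
have -> : (\int[P]_w (sqnormv (W s w - W 0 w))%:E = \int[N]_x (sqnormv (x : 'cV[R]_d))%:E)%E.
  transitivity (\int[distribution P V]_x (sqnormv (x : 'cV[R]_d))%:E)%E.
    by rewrite ge0_integral_distribution// => x; rewrite lee_fin sqnormv_ge0.
  apply: eq_measure_integral => B mB _; have := NE 0 s B (lexx 0) s1 (subr0 s) mB.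
  exact.
have [L1e e] := LN.
have Lb := L1Z (d%:R * 4) L1e.
apply: (@le_trans _ _ (\int[N]_x (d%:R * 4 * expR (1 * `|x : 'cV[R]_d|))%:E)%E).
  apply: ge0_le_integral => //.
  - by move=> x _; rewrite lee_fin sqnormv_ge0.
  - by apply/measurable_EFinP; exact: (L1_meas Lb).
  move=> x _; rewrite lee_fin (le_trans (normv_sqnormv _))// -mulrA ler_wpM2l//.
  rewrite mul1r; have := normr_ge0 (x : 'cV[R]_d); move: `|_| => y y0.
  have := expR_ge1Dx (y / 2); have -> : expR y = expR (y / 2) ^+ 2.
    by rewrite expr2 -expRD -splitr.
  have := expR_ge0 (y / 2); nra.
rewrite EFinE// lee_fin EZ// /bm_second_moment -mulrA ler_wpM2l// ler_wpM2l//.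
apply: (le_trans e); rewrite expr1n mulr1 lerD2l ler_wpM2l// ler_wpM2l// ler_expR.
by rewrite ler_wpM2l// invr_ge0.
Qed.

(** Tonelli in the other order: the moment bound holds at each fixed time, uniformly on [[0, T]]. *)
Lemma bm_QT (W' : process R d Omega) : (forall i, progr P W (fun s w => W' s w i 0)) ->
  {ae P, forall w, forall s, W' s w = W s w} ->
  L1 QT (at_time (fun s w => sqnormv (W' s w))).
Proof.
move=> pW' WW'; have ps := progr_sqnormv pW'.
have mF : measurable_fun setT (EFin \o at_time (fun s w => sqnormv (W' s w))).
  by apply/measurable_EFinP; exact: at_time_meas ps.
apply/integrableP; split => //.
under eq_integral => p _ do rewrite /= ger0_norm ?sqnormv_ge0//.
have F0 p : (0 <= (EFin \o at_time (fun s w => sqnormv (W' s w))) p)%E.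
  by rewrite lee_fin sqnormv_ge0.
rewrite /QT [X in (X < _)%E](fubini_tonelli2 _ mF F0).
apply: (@le_lt_trans _ _ (\int[uniform_prob T0]_s bm_second_moment%:E)%E); last first.
  by rewrite integral_cst// [X in (_ * X)%E]probability_setT mule1 ltry.
apply: ge0_le_integral => //.
- by move=> s _; exact: integral_ge0.
- exact: measurable_fun_fubini_tonelli_G.
move=> s _; have /andP[c0 cT] := clip_itv s.
rewrite /fubini_G (_ : (\int[P]_x _ = \int[P]_w (sqnormv (W (clip s) w))%:E)%E).
  exact: bm_moment.
apply: ae_eq_integral => //.
- exact: measurableT_comp mF (pair2_measurable s).
- apply/measurable_EFinP; apply: measurable_sum => i.
  have h := measurableT_comp (measurable_coordv i) (bm_meas BW c0).
  exact: (measurable_funM h h).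
- by apply: filterS WW' => w ww _; rewrite /at_time/= ww.
Qed.

End uniform_time.

(** * Gronwall's inequality and second moments of solutions *)

Section gronwall.
Context {R : realType} (T : R).
Hypothesis T0 : 0 < T.
Local Notation mu := (@lebesgue_measure R).
Local Notation tk := (tk T).
Local Notation dl := (dl T).

Lemma cauchy0 t (f : R -> R) : 0 <= t -> iL `[0, t] f -> iL `[0, t] (fun u => f u ^+ 2) ->
  (\int[mu]_(u in `[0, t]) f u) ^+ 2 <= t * \int[mu]_(u in `[0, t]) (f u ^+ 2).
Proof.
move=> t0 f1 f2; have [t1|t1] := ltP 0 t; last first.
  have -> : t = 0 by apply/eqP; rewrite eq_le t0 t1.
  by rewrite set_itv1 !Rintegral_set1 mul0r expr0n.
have e (g : R -> R) : iL `[0, t] g ->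
    \int[mu]_(u in `[0, t]) g u = \int[mu]_(u in `]0, t]) g u.
  by move=> ig; rewrite -(int0_diff (lexx 0) t0 (lexx t) ig) set_itv1 Rintegral_set1 subr0.
rewrite !e//; have := @cauchy_itv R 0 t f t1; rewrite subr0; apply.
  by apply: (iL_S _ _ (sub_itvoc (lexx 0) (lexx t))).
by apply: (iL_S _ _ (sub_itvoc (lexx 0) (lexx t))).
Qed.

(** Cell by cell on a grid so fine that [K dl <= 1/2]: the mass accumulated up to the end of a cell
    is absorbed on the left, so [Gr + 2 Z] at most doubles per cell. This gives 2 to the power
    [2 ^ m + 1], uniformly in [q] and [z]. *)
Lemma gronwall (K : R) : 0 <= K -> exists2 c, 0 <= c & forall q z : R -> R,
  iL `[0, T] q -> iL `[0, T] z -> (forall t, 0 <= q t) -> (forall t, 0 <= z t) ->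
  (forall t, 0 <= t -> t <= T -> q t <= z t + K * \int[mu]_(u in `[0, t]) q u) ->
  \int[mu]_(u in `[0, T]) q u <= c * \int[mu]_(u in `[0, T]) z u.
Proof.
move=> K0; have p0 : 0 < 2 * K + 1 by rewrite ltr_wpDl// mulr_ge0.
have /cvgrPdist_lt/(_ (2 * K + 1)^-1) := dl_cvg0 T.
rewrite invr_gt0 => /(_ p0)[m _ /(_ m (leqnn _))/=].
rewrite sub0r normrN (ger0_norm (ltW (dl_gt0 T0 _))) => dm.
have Kd : 2 * (K * dl m) <= 1.
  have d0 := dl_gt0 T0 m; have : dl m * (2 * K + 1) <= 1 by rewrite -ler_pdivlMr// mul1r ltW.
  by nra.
exists ((2 ^ (2 ^ m).+1)%:R) => // q z iq iz q0 z0 qz.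
set Z := \int[mu]_(u in `[0, T]) z u.
pose Gr t := \int[mu]_(u in `[0, t]) q u.
have Gr0 t : 0 <= Gr t by apply: Rintegral_ge0.
have mT : measurable (`[0, T]%classic : set (measurableTypeR R)) by [].
have Gmono s t : 0 <= s -> s <= t -> t <= T -> Gr s <= Gr t.
  move=> s0 st tT; rewrite -subr_ge0 /Gr (int0_diff s0 st tT iq).
  by apply: Rintegral_ge0.
have Z0 : 0 <= Z by apply: Rintegral_ge0.
have step k : (k < 2 ^ m)%N -> Gr (tk m k.+1) <= 2 * Gr (tk m k) + 2 * Z.
  move=> km; have k0 := tk_ge0 T0 m k; have kl := tk_lt T0 m k.
  have kT : tk m k.+1 <= T by exact: tk_leT.
  have mD : measurable (`]tk m k, tk m k.+1]%classic : set (measurableTypeR R)) by [].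
  have sD := sub_itvoc k0 kT.
  have h : Gr (tk m k.+1) - Gr (tk m k) <= Z + K * Gr (tk m k.+1) * dl m.
    rewrite /Gr (int0_diff k0 (ltW kl) kT iq) -/(Gr _).
    apply: (@le_trans _ _ (\int[mu]_(u in `]tk m k, tk m k.+1]) (z u + K * Gr (tk m k.+1)))).
      apply: le_Rintegral => //.
      - exact: iL_S iq.
      - by apply: iLD => //; [exact: iL_S iz|exact: iL_cst].
      - move=> u; rewrite /= in_itv/= => /andP[ku uk]; have u0 := le_trans k0 (ltW ku).
        apply: le_trans (qz u u0 (le_trans uk kT)) _.
        by rewrite lerD2l ler_wpM2l// Gmono.
    rewrite RintegralD//; [|exact: iL_S iz|exact: iL_cst].
    have tkd : tk m k.+1 - tk m k = dl m by rewrite tkS addrAC subrr add0r.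
    rewrite int_cst ?(ltW kl)// tkd lerD2r -(int0_diff k0 (ltW kl) kT iz).
    apply: (@le_trans _ _ (\int[mu]_(u in `[0, tk m k.+1]) z u)).
      by rewrite lerBlDr lerDl; apply: Rintegral_ge0.
    rewrite -subr_ge0 /Z (int0_diff (tk_ge0 T0 m k.+1) kT (lexx T) iz).
    by apply: Rintegral_ge0.
  have := Gr0 (tk m k.+1); nra.
have H k : (k <= 2 ^ m)%N -> Gr (tk m k) + 2 * Z <= (2 ^ k.+1)%:R * Z.
  elim: k => [_|k ih km].
    by rewrite tk0 /Gr set_itv1 Rintegral_set1 add0r.
  have := ih (ltnW km); have := step k km.
  rewrite [(2 ^ k.+2)%N]expnS natrM -[2%:R * _ * Z]mulrA; lra.
have := H _ (leqnn _); rewrite tkT /Gr; lra.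
Qed.

End gronwall.

Section solutions.
Context {R : realType} {d : nat} {disp} {Omega : measurableType disp}.
Variables (P : probability Omega R) (P_complete : measure_is_complete P)
  (W : process R d Omega) (BW : brownian_motion P W) (T : R) (T0 : 0 < T).
Local Notation mu := (@lebesgue_measure R).

Variables (beta : 'cV[R]_d -> 'cV[R]_d) (Cb : R) (sg : 'I_d -> R) (x : 'cV[R]_d).
Hypotheses (beta_meas : measurable_fun [set: borelV R d] (beta : borelV R d -> borelV R d))
  (Cb0 : 0 <= Cb) (beta_growth : forall y i, beta y i 0 ^+ 2 <= Cb * (1 + sqnormv y)).

Section paths.
Variable X : process R d Omega.
Hypotheses (pX : forall i, progr P W (fun s o => X s o i 0))
  (cX : forall o, {within `[0, +oo[, continuous (X ^~ o)}).

Lemma progr_beta i : progr P W (fun s o => beta (X s o) i 0).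
Proof.
apply: (@progr_comp _ _ _ _ _ _ _ _ (borelV R d) _ X (fun y : borelV R d => beta y i 0)).
  exact: measurableT_comp (measurable_coordv i) beta_meas.
exact: progrV.
Qed.

Lemma path_iL o i : iL `[0, T] (fun s => X s o i 0 ^+ 2).
Proof.
have cXi : {within `[0, T], continuous (fun s => X s o i 0)}.
  apply: within_coord; apply: continuous_subspaceW (@cX o) => s /=.
  by rewrite !in_itv/= => /andP[-> _].
apply: continuous_compact_integrable; first exact: segment_compact.
by move=> s; exact: (cvgM (cXi s) (cXi s)).
Qed.

Lemma path_sqnormv_iL o : iL `[0, T] (fun s => sqnormv (X s o)).
Proof.
have mT : measurable (`[0, T]%classic : set (measurableTypeR R)) by [].
by have [_ h] := int_sumI (index_enum 'I_d) mT (fun i => path_iL o i).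
Qed.

Lemma beta_iL o i : iL `[0, T] (fun s => beta (X s o) i 0) /\
  iL `[0, T] (fun s => beta (X s o) i 0 ^+ 2).
Proof.
have mT : measurable (`[0, T]%classic : set (measurableTypeR R)) by [].
have mb := progr_section o (ltW T0) (progr_beta i).
have i2 : iL `[0, T] (fun s => beta (X s o) i 0 ^+ 2).
  apply: (iL_dom mT _ (iLZ Cb mT (iLD mT (iL_cst _ _ _ _ 1) (path_sqnormv_iL o)))) => [|s _].
    exact: measurable_funX.
  by rewrite ger0_norm ?sqr_ge0.
split => //; apply: (iL_dom mT mb (iLD mT (iL_cst _ _ _ _ 1) i2)) => s _.
by rewrite -(real_normK (num_real (beta (X s o) i 0))); have := sqr_ge0 (`|beta (X s o) i 0| - 1); nra.
Qed.

End paths.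

(* dX = sg (beta(X) dt + w dt + dW) with a diagonal matrix sg. *)
Definition solution (w X : process R d Omega) : Prop :=
  [/\ forall i, progr P W (fun s o => X s o i 0),
      forall o, {within `[0, +oo[, continuous (X ^~ o)} &
      {ae P, forall o, forall t, 0 <= t -> t <= T -> forall i, X t o i 0 = x i 0 +
        sg i * (\int[mu]_(u in `[0, t]) beta (X u o) i 0 +
                \int[mu]_(u in `[0, t]) w u o i 0 + W t o i 0)}].

Variables (w X : process R d Omega).
Hypotheses (pw : forall i, progr P W (fun s o => w s o i 0))
  (ew : (\int[P]_o \int[mu]_(s in `[0%R, T]) (sqnormv (w s o))%:E < +oo)%E)
  (solX : solution w X).

Let S : R := \sum_i sg i ^+ 2.

Let sgS i : sg i ^+ 2 <= S.
Proof. by rewrite /S (bigD1 i)//= lerDl sumr_ge0// => j _; rewrite sqr_ge0. Qed.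

(** Squaring the equation and applying Cauchy-Schwarz to the integrals gives a linear integral
    inequality for [|X|^2] along almost every path, where its time integral is finite by continuity.
    Gronwall's constant does not depend on the path, so the bound [B] is affine in the energies of
    the control and of the Brownian path, which have finite mean. *)
Lemma solution_moment : L1 (QT P T0) (at_time T (fun s o => sqnormv (X s o))).
Proof.
have S0 : 0 <= S by apply: sumr_ge0 => i _; exact: sqr_ge0.
have [pX cX eX] := solX.
have [W' [pW' WW' _]] := bm_modification BW.
have LW := bm_QT P_complete BW T0 pW' WW'.
have [eW _] := energy_QT P_complete BW pW' LW.
have [enW _ aeW] := energy_L1 P_complete BW T0 pW' eW.
have [enw _ aew] := energy_L1 P_complete BW T0 pw ew.
pose K := 4 * S * (d%:R * (T * Cb)).
have K0 : 0 <= K by rewrite !mulr_ge0// ltW.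
have [c c0 gr] := gronwall T0 K0.
pose K1 := 4 * sqnormv x + K * T.
have K10 : 0 <= K1 by rewrite addr_ge0 ?mulr_ge0 ?sqnormv_ge0// ltW.
pose B o := c * ((K1 + 4 * S * (T * energy T w o)) * T + 4 * S * energy T W' o).
have en0 a o : 0 <= energy T a o by apply: Rintegral_ge0 => s _; exact: sqnormv_ge0.
have B0 o : 0 <= B o.
  apply: mulr_ge0 => //; apply: addr_ge0; last by rewrite !mulr_ge0.
  apply: mulr_ge0; last exact: ltW.
  by apply: addr_ge0 => //; rewrite !mulr_ge0// ltW.
have BL : L1 P B.
  rewrite (_ : B = fun o => (c * K1 * T + (c * 4 * S * T * T) * energy T w o) +
     (c * 4 * S) * energy T W' o); last by apply/funext => o; rewrite /B; ring.
  by apply: L1D; [apply: L1D; [exact/bmeas_L1/bmeas_cst|exact: L1Z]|exact: L1Z].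
have psX := progr_sqnormv pX.
suff bound : (\int[P]_o \int[mu]_(s in `[0%R, T]) (sqnormv (X s o))%:E < +oo)%E.
  by have [] := at_time_L1 P_complete BW T0 psX (fun s o => sqnormv_ge0 _) bound.
apply: (@le_lt_trans _ _ (\int[P]_o (B o)%:E)%E); last by rewrite EFinE// ltry.
apply: ae_ge0_le_integral => //.
- by move=> o _; apply: integral_ge0 => s _; rewrite lee_fin sqnormv_ge0.
- apply: (fmeas_setT P_complete BW (ltW T0)).
  apply: (progr_ge0_int (ltW T0) (progr_sqnormvE pX)).
  by move=> s o; rewrite lee_fin sqnormv_ge0.
- by move=> o _; rewrite lee_fin.
- by apply/measurable_EFinP; exact: L1_meas BL.
have aeG : {ae P, forall o, [/\ forall t, 0 <= t -> t <= T -> forall i, X t o i 0 = x i 0 +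
        sg i * (\int[mu]_(u in `[0, t]) beta (X u o) i 0 +
                \int[mu]_(u in `[0, t]) w u o i 0 + W t o i 0),
      iL `[0, T] (fun s => sqnormv (w s o)), iL `[0, T] (fun s => sqnormv (W' s o)) &
      forall s, W' s o = W s o]}.
  by apply: filterS (filterI (filterI eX aew) (filterI aeW WW')) => o [[h1 h2] [h3 h4]]; split.
apply: filterS aeG => o [eqX iw iW WE] _.
have iX := @path_sqnormv_iL X cX o.
rewrite -[X in (X <= _)%E]fineK; last exact: (integrable_fin_num _ iX).
rewrite lee_fin.
have mT : measurable (`[0, T]%classic : set (measurableTypeR R)) by [].
pose z t := (K1 + 4 * S * (T * energy T w o)) + 4 * S * sqnormv (W' t o).
have iz : iL `[0, T] z by apply: iLD => //; [exact: iL_cst|exact: iLZ].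
apply: le_trans (gr (fun s => sqnormv (X s o)) z iX iz _ _ _) _.
- by move=> t; exact: sqnormv_ge0.
- move=> t; rewrite /z; apply: addr_ge0; last by rewrite !mulr_ge0// sqnormv_ge0.
  by rewrite addr_ge0// !mulr_ge0// ltW.
- move=> t t0 tT.
  have mt : measurable (`[0, t]%classic : set (measurableTypeR R)) by [].
  have st : `[0, t]%classic `<=` `[0, T]%classic.
    by move=> u /=; rewrite !in_itv/= => /andP[-> /=] ut; exact: le_trans tT.
  pose Q := \int[mu]_(u in `[0, t]) sqnormv (X u o).
  have Q0 : 0 <= Q by apply: Rintegral_ge0 => u _; exact: sqnormv_ge0.
  have wi i := iL_coord (progr_section o (ltW T0) (pw i)) iw.
  have bi i : (\int[mu]_(u in `[0, t]) beta (X u o) i 0) ^+ 2 <= T * Cb * (T + Q).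
    have [b1 b2] := @beta_iL X pX cX o i.
    apply: le_trans (cauchy0 t0 (iL_S mT mt st b1) (iL_S mT mt st b2)) _.
    rewrite -mulrA; apply: ler_pM => //; first by apply: Rintegral_ge0 => u _; exact: sqr_ge0.
    apply: (@le_trans _ _ (\int[mu]_(u in `[0, t]) (Cb * (1 + sqnormv (X u o))))).
      apply: le_Rintegral => //; first exact: iL_S b2.
      by apply: iLZ => //; apply: iLD => //; [exact: iL_cst|exact: iL_S iX].
    have i1 : iL `[0, t] (fun u => 1 + sqnormv (X u o)).
      by apply: iLD => //; [exact: iL_cst|exact: iL_S iX].
    rewrite RintegralZl// RintegralD//; [|exact: iL_cst|exact: iL_S iX].
    by rewrite int_cst0// mul1r ler_wpM2l// lerD2r.
  have wi2 i : (\int[mu]_(u in `[0, t]) w u o i 0) ^+ 2 <=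
      T * \int[mu]_(u in `[0, T]) (w u o i 0 * w u o i 0).
    have [w1 w2] := wi i.
    apply: le_trans (cauchy0 t0 (iL_S mT mt st w1) (iL_S mT mt st w2)) _.
    apply: ler_pM => //; first by apply: Rintegral_ge0 => u _; exact: sqr_ge0.
    rewrite -subr_ge0 (int0_diff t0 tT (lexx T) w2).
    by apply: Rintegral_ge0 => u _; exact: sqr_ge0.
  have [enE _] := int_sumI (index_enum 'I_d) mT (fun i => proj2 (wi i)).
  have sq4 (a b e f : R) : (a + (b + e + f)) ^+ 2 <= 4 * (a ^+ 2 + b ^+ 2 + e ^+ 2 + f ^+ 2).
    have := sqr_ge0 (a - b); have := sqr_ge0 (a - e); have := sqr_ge0 (a - f).
    have := sqr_ge0 (b - e); have := sqr_ge0 (b - f); have := sqr_ge0 (e - f); nra.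
  apply: (@le_trans _ _ (\sum_i (4 * (x i 0 * x i 0) + 4 * S * (T * Cb * (T + Q)) +
      4 * S * (T * \int[mu]_(u in `[0, T]) (w u o i 0 * w u o i 0)) +
      4 * S * (W' t o i 0 * W' t o i 0)))).
    apply: ler_sum => i _; rewrite -expr2 (eqX t t0 tT i) WE -[x i 0 * _]expr2 -[W t o i 0 * _]expr2.
    have := sq4 (x i 0) (sg i * \int[mu]_(u in `[0, t]) beta (X u o) i 0)
      (sg i * \int[mu]_(u in `[0, t]) w u o i 0) (sg i * W t o i 0).
    rewrite -!mulrDr !exprMn => h0; apply: (le_trans h0).
    have := sgS i; have := sqr_ge0 (sg i); have := wi2 i; have := bi i.
    have := sqr_ge0 (\int[mu]_(u in `[0, t]) w u o i 0).
    have := sqr_ge0 (\int[mu]_(u in `[0, t]) beta (X u o) i 0).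
    have := sqr_ge0 (W t o i 0).
    set a1 := W t o i 0 ^+ 2; set a2 := _ ^+ 2; set a3 := (\int[mu]_(u in `[0, t]) w u o i 0) ^+ 2.
    set a4 := sg i ^+ 2; set a5 := T * Cb * (T + Q); set a6 := T * _.
    move=> h1 h2 h3 h4 h5 h6 h7.
    have k2 : a4 * a2 <= S * a5 by apply: ler_pM.
    have k3 : a4 * a3 <= S * a6 by apply: ler_pM.
    have k1 : a4 * a1 <= S * a1 by apply: ler_wpM2r.
    by rewrite /a5 /a6 in k2 k3 *; nra.
  rewrite !big_split/= -!mulr_sumr -!enE sumr_const card_ord -/(sqnormv x).
  rewrite /z /K1 /K -/Q /energy /sqnormv /dotv -mulr_natl.
  set a1 := \sum_i _; set a2 := Rintegral _ _ _; set a3 := \sum_i _.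
  by rewrite le_eqVlt; apply/orP; left; apply/eqP; ring.
rewrite /z RintegralD//; [|exact: iL_cst|exact: iLZ].
rewrite int_cst0 ?(ltW T0)// RintegralZl//.
Qed.

End solutions.

(** * Comparison with the Euler scheme of a Lipschitz drift *)

Section frozen_drift.
Context {R : realType} {d : nat} {disp} {Omega : measurableType disp}.
Variables (P : probability Omega R) (P_complete : measure_is_complete P)
  (W : process R d Omega) (BW : brownian_motion P W) (T : R) (T0 : 0 < T).
Notation G := (completed_filtration P W).
Notation GT t := (g_sigma_algebraType (G t)).
Local Notation mu := (@lebesgue_measure R).
Local Notation tk := (tk T).
Local Notation dl := (dl T).

Lemma progr_adapted (f : R -> Omega -> R) t : 0 <= t -> progr P W f ->
  measurable_fun [set: GT t] (f t : GT t -> R).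
Proof.
move=> t0 pf; have mp : measurable_fun [set: GT t] ((fun o => (t, o)) : GT t -> (R * GT t)%type).
  exact: pair1_measurable.
apply: (@measurable_comp _ _ _ _ _ _ (`[0, t] `*` [set: GT t])
  (fun p : R * GT t => f p.1 p.2) setT (fun o : GT t => (t, o))) => //.
- exact: measurableX.
- by move=> _ [z _ <-]; split; rewrite //= in_itv/= t0 lexx.
- exact: pf.
Qed.

Variables (beta : 'cV[R]_d -> 'cV[R]_d) (Cb : R) (sg : 'I_d -> R) (x : 'cV[R]_d).
Hypotheses (beta_meas : measurable_fun [set: borelV R d] (beta : borelV R d -> borelV R d))
  (Cb0 : 0 <= Cb) (beta_growth : forall y i, beta y i 0 ^+ 2 <= Cb * (1 + sqnormv y)).
Variables (c : 'cV[R]_d -> 'cV[R]_d) (Lc Kc : R) (M : nat).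
Hypotheses (Lc0 : 0 <= Lc) (cL : forall i, lipschitzv Lc (fun y => c y i 0))
  (cK : forall y, `|c y| <= Kc).

Definition grid (X : process R d Omega) (o : Omega) : nat -> 'cV[R]_d := fun k => X (tk M k) o.

(** The encoding as a [simple_control] provides progressive measurability and the exact integral
    over each cell. *)
Definition step_drift (X : process R d Omega) : process R d Omega :=
  simple_control T M (fun k o => c (X (tk M k) o)).

Definition drift_error (X : process R d Omega) : process R d Omega :=
  fun s o => beta (X s o) - step_drift X s o.

(* The Euler scheme with drift [c] driven by the increments [y]. *)
Fixpoint euler (y : seqV R d) (k : nat) : 'cV[R]_d :=
  if k is k'.+1 then
    euler y k' + \col_i (sg i * (y k' i 0 + dl M * c (euler y k') i 0))
  else x.

Let Kc0 : 0 <= Kc. Proof. exact: le_trans (cK 0). Qed.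

Let c_meas : measurable_fun [set: borelV R d] (c : borelV R d -> borelV R d).
Proof. by apply: measurable_funV => // i; exact: lipschitz_measurable (cL i). Qed.

Lemma euler_meas : measurable_fun [set: seqV R d] (euler : seqV R d -> seqV R d).
Proof.
apply: measurable_fun_seqV; elim => [|k ih]; first exact: measurable_cst.
apply: measurable_funV => // i.
rewrite (_ : (fun y => _) = fun y : seqV R d =>
  euler y k i 0 + sg i * (y k i 0 + dl M * c (euler y k) i 0)); last first.
  by apply/funext => y /=; rewrite !mxE.
apply: measurable_funD; first exact: measurableT_comp (measurable_coordv i) ih.
apply: measurable_funM; first exact: measurable_cst.
apply: measurable_funD; first exact: measurable_seqV_coordi.
apply: measurable_funM; first exact: measurable_cst.
by apply: measurableT_comp (measurable_coordv i) _; exact: measurableT_comp c_meas ih.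
Qed.

(** The constant is produced by a discrete Gronwall recursion and depends on the grid. This is
    harmless: it only serves to make the entropy inequality applicable. *)
Lemma euler_lip : exists2 L, 0 <= L & forall (y y' : seqV R d) k, (k <= 2 ^ M)%N ->
  `|euler y k - euler y' k| <= L * \sum_(l < 2 ^ M) `|y l - y' l|.
Proof.
pose s := \sum_i `|sg i|; have s0 : 0 <= s by apply: sumr_ge0.
have ss i : `|sg i| <= s by rewrite /s (bigD1 i)//= lerDl sumr_ge0.
have dm0 := ltW (dl_gt0 T0 M).
pose L := fix L k : R := if k is k'.+1 then L k' + s * (1 + dl M * (Lc * L k')) else 0.
have L0 k : 0 <= L k.
  by elim: k => //= k ih; rewrite addr_ge0// mulr_ge0// addr_ge0// (mulr_ge0 dm0)// mulr_ge0.
have Lmono k l : (k <= l)%N -> L k <= L l.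
  move=> kl; rewrite -(subnK kl); elim: (l - k)%N => // n ih.
  apply: (le_trans ih); by rewrite /= lerDl mulr_ge0// addr_ge0// (mulr_ge0 dm0)// mulr_ge0.
exists (L (2 ^ M)%N) => // y y'; set S := \sum_(_ < _) _.
have S0 : 0 <= S by apply: sumr_ge0.
suff H k : (k <= 2 ^ M)%N -> `|euler y k - euler y' k| <= L k * S.
  move=> k kM; apply: le_trans (H k kM) _; rewrite ler_wpM2r//; exact: Lmono.
elim: k => [_|k ih kM]; first by rewrite /= subrr normr0 mul0r.
have {}ih := ih (ltnW kM).
have yk : `|y k - y' k| <= S by rewrite /S (bigD1 (Ordinal kM))//= lerDl sumr_ge0.
rewrite /= opprD addrACA (le_trans (ler_normD _ _))// mulrDl lerD//.
apply: normv_le => [|i]; first by rewrite mulr_ge0// mulr_ge0// addr_ge0// (mulr_ge0 dm0)// mulr_ge0.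
rewrite !mxE -mulrBr normrM -[leRHS]mulrA; apply: ler_pM => //.
rewrite opprD addrACA -mulrBr (le_trans (ler_normD _ _))// mulrDl mul1r lerD//.
  apply: le_trans yk; rewrite (_ : y k i 0 - _ = (y k - y' k) i 0) ?coordv_norm//.
  by rewrite !mxE.
rewrite normrM (ger0_norm dm0) -[leRHS]mulrA; apply: ler_wpM2l => //.
by apply: le_trans (cL i _ _) _; rewrite -mulrA ler_wpM2l.
Qed.

Variables (w X : process R d Omega).
Hypotheses (pw : forall i, progr P W (fun s o => w s o i 0))
  (ew : (\int[P]_o \int[mu]_(s in `[0%R, T]) (sqnormv (w s o))%:E < +oo)%E)
  (solX : solution P W T beta sg x w X).

Let pX : forall i, progr P W (fun s o => X s o i 0).
Proof. by have [] := solX. Qed.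

Let cX_F k : (k < 2 ^ M)%N -> measurable_fun [set: GT (tk M k)]
  ((fun o => c (X (tk M k) o)) : GT (tk M k) -> borelV R d).
Proof.
move=> kM; apply: measurableT_comp c_meas _.
by apply: measurable_funV => // i; exact: (progr_adapted (tk_ge0 T0 M k) (pX i)).
Qed.

Let cX_K k o : (k < 2 ^ M)%N -> `|c (X (tk M k) o)| <= Kc.
Proof. by []. Qed.

Lemma step_drift_progr i : progr P W (fun s o => step_drift X s o i 0).
Proof. exact: (simple_control_progr cX_F). Qed.

Lemma drift_errorE s o i : drift_error X s o i 0 = beta (X s o) i 0 - step_drift X s o i 0.
Proof.
have subvE (A B : 'cV[R]_d) : (A - B) i 0 = A i 0 - B i 0 by rewrite !mxE.
exact: subvE.
Qed.

Lemma drift_error_progr i : progr P W (fun s o => drift_error X s o i 0).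
Proof.
rewrite (_ : (fun s o => _) = fun s o => beta (X s o) i 0 + -1 * step_drift X s o i 0).
  have pb : progr P W (fun s o => beta (X s o) i 0) by exact: (@progr_beta _ _ _ _ P W beta beta_meas X pX).
  have ps : progr P W (fun s o => step_drift X s o i 0) by exact: step_drift_progr.
  apply: progrD; first exact: pb.
  apply: progrM; last exact: ps.
  exact: progr_cst.
by apply/funext => s; apply/funext => o; rewrite drift_errorE mulN1r.
Qed.

Lemma drift_error_L1 : L1 (QT P T0) (at_time T (fun s o => sqnormv (drift_error X s o))).
Proof.
have mX := solution_moment P_complete BW T0 beta_meas Cb0 beta_growth pw ew solX.
pose B : R := d%:R * ((2 ^ M)%:R * Kc) ^+ 2.
apply: (L1_dom (at_time_meas P_complete BW T0 (progr_sqnormv drift_error_progr))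
  (L1D (bmeas_L1 _ (bmeas_cst (2 * d%:R * Cb + 2 * B))) (L1Z (2 * d%:R * Cb) mX))) => p.
rewrite ger0_norm ?sqnormv_ge0//; rewrite /at_time; set s := clip T p.2; set o := p.1.
have h1 : sqnormv (step_drift X s o) <= B by exact: (simple_control_sqnormv T Kc0 cX_K).
have h2 : sqnormv (beta (X s o)) <= d%:R * (Cb * (1 + sqnormv (X s o))).
  apply: (@le_trans _ _ (\sum_(i < d) (Cb * (1 + sqnormv (X s o))))).
    by apply: ler_sum => i _; rewrite -expr2.
  by rewrite sumr_const card_ord [leRHS]mulr_natl.
have h3 : sqnormv (drift_error X s o) <= 2 * sqnormv (beta (X s o)) + 2 * sqnormv (step_drift X s o).
  rewrite /sqnormv /dotv !mulr_sumr -big_split/=; apply: ler_sum => i _.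
  rewrite drift_errorE.
  have := sqr_ge0 (beta (X s o) i 0 + step_drift X s o i 0); nra.
by apply: (le_trans h3); move: h1 h2; lra.
Qed.

Definition full_drift : process R d Omega := fun s o => w s o + drift_error X s o.

Lemma full_driftE s o i : full_drift s o i 0 = w s o i 0 + drift_error X s o i 0.
Proof. by rewrite mxE. Qed.

Lemma full_drift_progr i : progr P W (fun s o => full_drift s o i 0).
Proof.
rewrite (_ : (fun s o => _) = fun s o => w s o i 0 + drift_error X s o i 0).
  by apply: progrD => //; exact: drift_error_progr.
by apply/funext => s; apply/funext => o; rewrite full_driftE.
Qed.

(** [(a + b)^2 <= (1 + th) a^2 + (1 + 1 / th) b^2], the difference being [(th a - b)^2 / th]. With
    an error energy of at most [th^2], both corrections are of order [th]. *)
Lemma full_drift_energy (th : R) : 0 < th ->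
  (\int[P]_o \int[mu]_(s in `[0%R, T]) (sqnormv (full_drift s o))%:E < +oo)%E /\
  \int[P]_o energy T full_drift o <= (1 + th) * \int[P]_o energy T w o +
    (1 + th^-1) * \int[P]_o energy T (drift_error X) o.
Proof.
move=> th0; have Le := drift_error_L1.
have [Lw _] := at_time_L1 P_complete BW T0 (progr_sqnormv pw) (fun s o => sqnormv_ge0 _) ew.
have h p : at_time T (fun s o => sqnormv (full_drift s o)) p <=
    (1 + th) * at_time T (fun s o => sqnormv (w s o)) p +
    (1 + th^-1) * at_time T (fun s o => sqnormv (drift_error X s o)) p.
  rewrite /at_time; set s := clip T p.2; set o := p.1.
  rewrite /sqnormv /dotv !mulr_sumr -big_split/=; apply: ler_sum => i _.
  rewrite full_driftE; move: (w s o i 0) (drift_error X s o i 0) => a b.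
  rewrite -subr_ge0 (_ : _ - _ = th^-1 * (th * a - b) ^+ 2).
    by rewrite mulr_ge0 ?sqr_ge0// invr_ge0 ltW.
  by field; rewrite gt_eqF.
have LR := L1D (L1Z (1 + th) Lw) (L1Z (1 + th^-1) Le).
have La : L1 (QT P T0) (at_time T (fun s o => sqnormv (full_drift s o))).
  apply: (L1_dom (at_time_meas P_complete BW T0 (progr_sqnormv full_drift_progr)) LR) => p.
  by rewrite ger0_norm ?sqnormv_ge0.
have [fo e1] := energy_QT P_complete BW full_drift_progr La.
have [_ e2] := energy_QT P_complete BW pw Lw.
have [_ e3] := energy_QT P_complete BW drift_error_progr Le.
split => //; rewrite e1 e2 e3 (mulrCA (1 + th)) (mulrCA (1 + th^-1)) -mulrDr.
rewrite ler_pM2l// -EZ// -[_ * \int[_]_p at_time T (fun s o => sqnormv (drift_error X s o)) p]EZ// -ED; [|exact: L1Z..].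
exact: le_E.
Qed.

Lemma grid_euler : {ae P, forall o, forall k, (k <= 2 ^ M)%N ->
  grid X o k = euler (incr T (shifted W full_drift) M o) k}.
Proof.
have [_ cX eX] := solX; have [_ _ aew] := energy_L1 P_complete BW T0 pw ew.
have [_ [W0N [mW0 PW0 hW0]] _ _] := BW.
have aeW : {ae P, forall o, W 0 o = 0}.
  by exists W0N; split => // o /= h; apply: hW0 => -[].
apply: filterS (filterI (filterI eX aew) aeW) => o [[eqX iw] W0].
elim => [_|k ih kM].
  apply/matrixP => i j; rewrite (ord1 j) /grid tk0 (eqX 0 (lexx 0) (ltW T0)).
  by rewrite set_itv1 !Rintegral_set1 W0 mxE !addr0 mulr0 addr0.
have {}ih := ih (ltnW kM); rewrite /= -ih; apply/matrixP => i j; rewrite (ord1 j) [RHS]mxE [X in _ + X]mxE.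
have k0 := tk_ge0 T0 M k; have k1 := tk_ge0 T0 M k.+1.
have kT : tk M k.+1 <= T by exact: tk_leT.
have kl := ltW (tk_lt T0 M k); have kT' := le_trans kl kT.
rewrite /grid (eqX _ k1 kT) (eqX _ k0 kT') /incr kM /shifted.
have mk t : measurable (`[0, t]%classic : set (measurableTypeR R)) by [].
have sT t : t <= T -> `[0, t]%classic `<=` `[0, T]%classic.
  by move=> tT u /=; rewrite !in_itv/= => /andP[-> /=] ut; exact: le_trans tT.
have [w1 _] := iL_coord (progr_section o (ltW T0) (pw i)) iw.
have [b1 _] := @beta_iL _ _ _ _ P W T T0 beta Cb beta_meas beta_growth X pX cX o i.
have s1 : iL `[0, T] (fun s => step_drift X s o i 0).
  apply: (iL_bound (M := (2 ^ M)%:R * Kc)).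
    exact: progr_section o (ltW T0) (step_drift_progr i).
  by move=> s _; exact: (simple_control_bound T cX_K).
have int_full t : 0 <= t -> t <= T -> integralv t (full_drift ^~ o) i 0 =
    \int[mu]_(u in `[0, t]) w u o i 0 + (\int[mu]_(u in `[0, t]) beta (X u o) i 0 -
    integralv t (step_drift X ^~ o) i 0).
  move=> t0 tT; rewrite !mxE.
  have w1' := iL_S (mk T) (mk t) (sT t tT) w1.
  have b1' := iL_S (mk T) (mk t) (sT t tT) b1.
  have s1' := iL_S (mk T) (mk t) (sT t tT) s1.
  rewrite -RintegralB// -RintegralD//; last exact: iLB.
  by apply: eq_Rintegral => u _; rewrite full_driftE drift_errorE.
have sc : integralv (tk M k.+1) (step_drift X ^~ o) i 0 - integralv (tk M k) (step_drift X ^~ o) i 0 =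
    dl M * c (X (tk M k) o) i 0.
  have := simple_control_int T0 cX_F cX_K o kM.
  by move=> /(congr1 (fun v : 'cV[R]_d => v i 0)); rewrite !mxE.
have mx4 (A B C D : 'cV[R]_d) : (A + B - (C + D)) i 0 = A i 0 + B i 0 - (C i 0 + D i 0).
  by rewrite !mxE.
by rewrite mx4 !int_full// -sc; ring.
Qed.

Lemma incr_full_drift : {ae P, forall o,
  \sum_(k < 2 ^ M) `|incr T (shifted W full_drift) M o k - incr T (shifted W w) M o k| <=
  \int[mu]_(s in `[0, T]) \sum_i `|drift_error X s o i 0|}.
Proof.
have [eo _] := energy_QT P_complete BW drift_error_progr drift_error_L1.
have [_ _ aee] := energy_L1 P_complete BW T0 drift_error_progr eo.
have [_ _ aew] := energy_L1 P_complete BW T0 pw ew.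
apply: filterS (filterI aee aew) => o [ie iw].
have ei i := proj1 (iL_coord (progr_section o (ltW T0) (drift_error_progr i)) ie).
have wi i := proj1 (iL_coord (progr_section o (ltW T0) (pw i)) iw).
have mT : measurable (`[0, T]%classic : set (measurableTypeR R)) by [].
pose h s := \sum_i `|drift_error X s o i 0|.
have [_ ih] := int_sumI (index_enum 'I_d) mT (fun i => iL_norm mT (ei i)).
pose Q t := \int[mu]_(s in `[0, t]) h s.
apply: (@le_trans _ _ (\sum_(k < 2 ^ M) (Q (tk M k.+1) - Q (tk M k)))); last first.
  rewrite -(big_mkord xpredT (fun k => Q (tk M k.+1) - Q (tk M k))).
  rewrite (telescope_sumr (fun k => Q (tk M k)))// tkT tk0 /Q.
  by rewrite set_itv1 Rintegral_set1 subr0.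
apply: ler_sum => -[k kM] _ /=; rewrite /incr kM /shifted.
have k0 := tk_ge0 T0 M k; have k1 := tk_ge0 T0 M k.+1.
have kT : tk M k.+1 <= T by exact: tk_leT.
have kl := ltW (tk_lt T0 M k); have kT' := le_trans kl kT.
have mD : measurable (`]tk M k, tk M k.+1]%classic : set (measurableTypeR R)) by [].
have sD := sub_itvoc k0 kT.
rewrite /Q (int0_diff k0 kl kT ih).
have hk := iL_S mT mD sD ih.
apply: normv_le => [|i]; first by apply: Rintegral_ge0 => s _; exact: sumr_ge0.
have fi : iL `[0, T] (fun s => full_drift s o i 0).
  have := iLD mT (wi i) (ei i); congr (iL _ _).
  by apply/funext => s; rewrite full_driftE.
rewrite [X in `|X|](_ : _ = \int[mu]_(s in `]tk M k, tk M k.+1]) drift_error X s o i 0); last first.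
  have e3 : \int[mu]_(s in `]tk M k, tk M k.+1]) drift_error X s o i 0 =
      \int[mu]_(s in `]tk M k, tk M k.+1]) full_drift s o i 0 -
      \int[mu]_(s in `]tk M k, tk M k.+1]) w s o i 0.
    rewrite -RintegralB//; [|exact: (iL_S mT mD sD fi)|exact: (iL_S mT mD sD (wi i))].
    by apply: eq_Rintegral => s _; rewrite full_driftE addrAC subrr add0r.
  rewrite e3 -(int0_diff k0 kl kT fi) -(int0_diff k0 kl kT (wi i)) !mxE; ring.
apply: le_trans (le_normr_Rintegral mD (iL_S mT mD sD (ei i))) _.
apply: le_Rintegral => //; first by apply: iL_norm => //; exact: (iL_S mT mD sD (ei i)).
by move=> s _; rewrite /h (bigD1 i)//= lerDl sumr_ge0.
Qed.

(* By the arithmetic-geometric inequality [|r| <= th + r^2 / th]. *)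
Lemma incr_full_drift_le (th : R) : 0 < th -> {ae P, forall o,
  \sum_(k < 2 ^ M) `|incr T (shifted W full_drift) M o k - incr T (shifted W w) M o k| <=
  T * d%:R * th + th^-1 * energy T (drift_error X) o}.
Proof.
move=> th0; have [eo _] := energy_QT P_complete BW drift_error_progr drift_error_L1.
have [_ _ aee] := energy_L1 P_complete BW T0 drift_error_progr eo.
apply: filterS (filterI aee incr_full_drift) => o [ie h]; apply: (le_trans h).
have ei i := proj1 (iL_coord (progr_section o (ltW T0) (drift_error_progr i)) ie).
have mT : measurable (`[0, T]%classic : set (measurableTypeR R)) by [].
have [_ ih] := int_sumI (index_enum 'I_d) mT (fun i => iL_norm mT (ei i)).
apply: (@le_trans _ _ (\int[mu]_(s in `[0, T]) (d%:R * th + th^-1 * sqnormv (drift_error X s o)))).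
  apply: le_Rintegral => //; first by apply: iLD => //; [exact: iL_cst|exact: iLZ].
  move=> s _; apply: (@le_trans _ _ (\sum_(i < d) (th + th^-1 * (drift_error X s o i 0 * drift_error X s o i 0)))).
    apply: ler_sum => i _; move: (drift_error X s o i 0) => r.
    have e : th * (th + th^-1 * (r * r)) = th ^+ 2 + `|r| ^+ 2.
      by rewrite real_normK ?num_real//; field; rewrite gt_eqF.
    rewrite -(ler_pM2l th0) e.
    by have := sqr_ge0 (`|r| - th); have := sqr_ge0 th; have := sqr_ge0 `|r|; nra.
  by rewrite big_split/= -mulr_sumr sumr_const card_ord lerD2r mulr_natl.
rewrite RintegralD//; [|exact: iL_cst|exact: iLZ].
rewrite int_cst0 ?(ltW T0)// RintegralZl//.
by rewrite le_eqVlt; apply/orP; left; apply/eqP; rewrite /energy; ring.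
Qed.

End frozen_drift.

(** * From one solution to another through the Euler scheme *)

Section comparison.
Context {R : realType} {d : nat} {disp} {Omega : measurableType disp}.
Variables (P : probability Omega R) (P_complete : measure_is_complete P)
  (W : process R d Omega) (BW : brownian_motion P W) (T : R) (T0 : 0 < T).
Local Notation mu := (@lebesgue_measure R).
Local Notation tk := (tk T).
Local Notation dl := (dl T).

Lemma expR_lip (C a b : R) : a <= C -> b <= C -> `|expR a - expR b| <= expR C * `|a - b|.
Proof.
wlog ab : a b / a <= b.
  move=> H aC bC; have [/H|/ltW/H] := leP a b; first exact.
  by rewrite distrC (distrC a); exact.
move=> aC bC; rewrite ler0_norm ?subr_le0 ?ler_expR// ler0_norm ?subr_le0// !opprB.
apply: (@le_trans _ _ (expR b * (b - a))); last first.
  by rewrite ler_wpM2r ?subr_ge0// ler_expR.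
have := expR_ge1Dx (a - b); rewrite expRB ler_pdivlMr ?expR_gt0//; lra.
Qed.

Lemma expRN_le (u b : R) : 0 <= u -> u ^+ 2 <= b -> expR (- u) <= - u + (b + 1).
Proof.
move=> u0 ub; suff : expR (- u) <= 1 - u + u ^+ 2 by lra.
have := expR_ge1Dx u; have := expR_gt0 u => e0 e1.
rewrite expRN -div1r ler_pdivrMr//.
apply: (@le_trans _ _ ((1 - u + u ^+ 2) * (1 + u))).
  have -> : (1 - u + u ^+ 2) * (1 + u) = 1 + u ^+ 3 by ring.
  by rewrite lerDl exprn_ge0.
by rewrite ler_wpM2l//; have := sqr_ge0 (u - 1); nra.
Qed.

Let arith_upper (x1 x2 x3 x4 x6 e l D th : R) : x1 <= x2 + l * (D * th) ->
  x3 <= (1 + th) * x4 + e -> e <= 2 * th -> x2 - 2^-1 * x3 <= x6 ->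
  x1 - 2^-1 * x4 <= x6 + (l * D + 2^-1 * x4 + 1) * th.
Proof. lra. Qed.

Let arith_lower (x1 x2 x3 x5 x6 e K l D th : R) : 0 < th ->
  - (th * x1) - 2^-1 * x6 <= x5 -> x5 <= - (th * x2) + th ^+ 2 * K ^+ 2 ->
  x6 <= (1 + 1) * e -> e <= th ^+ 2 -> x1 <= x3 + K * (l * (D * th)) ->
  x2 <= x3 + (1 + K ^+ 2 + K * (l * D)) * th.
Proof.
move=> th0 h1 h2 h3 h4 h5; rewrite -(ler_pM2l th0).
have h6 : th * x1 <= th * (x3 + K * (l * (D * th))) by rewrite ler_pM2l.
lra.
Qed.

Let arith_bound (a b C : R) : `|a| <= C -> `|b| <= C -> - (2 * C) <= a + b.
Proof. rewrite !ler_norml; lra. Qed.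

Lemma shifted0 (M : nat) : incr T (shifted W (fun _ _ => 0)) M = incr T W M.
Proof.
have s0 t o : shifted W (fun _ _ => 0) t o = W t o.
  rewrite /shifted (_ : integralv _ _ = 0) ?addr0//.
  by apply/matrixP => i j; rewrite !mxE Rintegral_cst// mul0r.
by apply/funext => o; apply/funext => k; rewrite /incr !s0.
Qed.

Lemma zero_control_energy : (\int[P]_o \int[mu]_(s in `[0%R, T])
    (sqnormv ((fun _ _ => 0 : 'cV[R]_d) s o))%:E < +oo)%E.
Proof.
under eq_integral => o _.
  under eq_integral do rewrite /sqnormv dotv0l.
  rewrite integral0; over.
by rewrite integral0 ltry.
Qed.

Lemma zero_control_progr i : progr P W (fun s o => ((fun _ _ => 0) : process R d Omega) s o i 0).
Proof.
rewrite (_ : (fun s o => _) = fun _ _ => 0); first exact: progr_cst.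
by apply/funext => s; apply/funext => o; rewrite mxE.
Qed.

Variables (beta : 'cV[R]_d -> 'cV[R]_d) (Cb : R) (sg : 'I_d -> R) (x : 'cV[R]_d).
Hypotheses (beta_meas : measurable_fun [set: borelV R d] (beta : borelV R d -> borelV R d))
  (Cb0 : 0 <= Cb) (beta_growth : forall y i, beta y i 0 ^+ 2 <= Cb * (1 + sqnormv y)).
Variables (c : 'cV[R]_d -> 'cV[R]_d) (Lc Kc : R) (M : nat).
Hypotheses (Lc0 : 0 <= Lc) (cL : forall i, lipschitzv Lc (fun y => c y i 0))
  (cK : forall y, `|c y| <= Kc).
Variables (F1 F2 : seqV R d -> R) (C L1' L2 : R).
Hypotheses (mF1 : measurable_fun setT F1) (mF2 : measurable_fun setT F2)
  (F1C : forall y, `|F1 y| <= C) (F2C : forall y, `|F2 y| <= C)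
  (L10 : 0 <= L1') (L20 : 0 <= L2) (F1L : lipS (2 ^ M) L1' F1) (F2L : lipS (2 ^ M) L2 F2).
Variable th : R.
Hypotheses (th0 : 0 < th) (th1 : th <= 1).

Local Notation eul := (euler T sg x c M).
(** [F1] reads the state at grid times and [F2] the driving increments; through the Euler map both
    become functionals of the same increments. *)
Let F (y : seqV R d) : R := F1 (eul y) + F2 y.

Let C0 : 0 <= C. Proof. exact: le_trans (F1C (fun=> 0)). Qed.

Let mF : measurable_fun setT F.
Proof.
apply: measurable_funD => //; apply: measurableT_comp mF1 _.
exact: (euler_meas T sg x M cL).
Qed.

Let FC y : `|F y| <= 2 * C.
Proof. by rewrite (le_trans (ler_normD _ _))// mulr2n mulrDl !mul1r lerD. Qed.

Let F_lip : exists2 L, 0 <= L & lipS (2 ^ M) L F.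
Proof.
have [Le Le0 HL] := euler_lip T0 sg x M Lc0 cL.
exists (L1' * ((2 ^ M)%:R * Le) + L2); first by rewrite addr_ge0// !mulr_ge0.
move=> y y'; rewrite /F opprD addrACA (le_trans (ler_normD _ _))// mulrDl lerD//.
apply: le_trans (F1L _ _) _; rewrite -mulrA ler_wpM2l// -mulrA.
apply: (@le_trans _ _ (\sum_(k < 2 ^ M) (Le * \sum_(l < 2 ^ M) `|y l - y' l|))).
  by apply: ler_sum => k _; apply: HL; exact: ltnW.
by rewrite sumr_const card_ord [leRHS]mulr_natl.
Qed.

Let bF : bmeas F. Proof. by split => //; exists (2 * C). Qed.

Section one_solution.
Variables (w X : process R d Omega).
Hypotheses (pw : forall i, progr P W (fun s o => w s o i 0))
  (ew : (\int[P]_o \int[mu]_(s in `[0%R, T]) (sqnormv (w s o))%:E < +oo)%E)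
  (solX : solution P W T beta sg x w X)
  (err : \int[P]_o energy T (drift_error T beta c M X) o <= th ^+ 2).

Local Notation fd := (full_drift T beta c M w X).

Let S_meas : measurable_fun setT (incr T (shifted W fd) M : Omega -> seqV R d).
Proof.
apply: (shifted_incr_meas P_complete BW T0) => i.
exact: (full_drift_progr T0 beta_meas M cL pw solX).
Qed.

Lemma eta_meas : measurable_fun setT (incr T (shifted W w) M : Omega -> seqV R d).
Proof. exact: (shifted_incr_meas P_complete BW T0). Qed.

Lemma grid_meas : measurable_fun setT (grid T M X : Omega -> seqV R d).
Proof.
apply: measurable_fun_seqV => k; apply: measurable_funV => // i.
have [pX _ _] := solX; have k0 := tk_ge0 T0 M k.
exact: (fmeas_setT P_complete BW k0 (progr_adapted k0 (pX i))).
Qed.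

Let diff_L1 : L1 P (fun o => T * d%:R * th + th^-1 * energy T (drift_error T beta c M X) o).
Proof.
have Le := drift_error_L1 P_complete BW T0 beta_meas Cb0 beta_growth M cL cK pw ew solX.
have pe i := drift_error_progr T0 beta_meas M cL solX i.
have [eo _] := energy_QT P_complete BW pe Le.
have [eL _ _] := energy_L1 P_complete BW T0 pe eo.
by apply: L1D; [exact/bmeas_L1/bmeas_cst|exact: L1Z].
Qed.

Let diff_le : \int[P]_o (T * d%:R * th + th^-1 * energy T (drift_error T beta c M X) o) <=
  (T * d%:R + 1) * th.
Proof.
have Le := drift_error_L1 P_complete BW T0 beta_meas Cb0 beta_growth M cL cK pw ew solX.
have pe i := drift_error_progr T0 beta_meas M cL solX i.
have [eo _] := energy_QT P_complete BW pe Le.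
have [eL _ _] := energy_L1 P_complete BW T0 pe eo.
rewrite ED; [|exact/bmeas_L1/bmeas_cst|exact: L1Z].
by rewrite E_cst EZ// mulrDl mul1r lerD2l mulrC ler_pdivrMr// -expr2.
Qed.

(** The part [F1] is transferred exactly by [grid_euler]; only [F2] feels the drift error. Hence the
    later constants involve [L2] but neither the Lipschitz constant of [F1] nor that of the
    scheme. *)
Let exchange : {ae P, forall o, `|F (incr T (shifted W fd) M o) -
    (F1 (grid T M X o) + F2 (incr T (shifted W w) M o))| <=
  L2 * (T * d%:R * th + th^-1 * energy T (drift_error T beta c M X) o)}.
Proof.
have ge := grid_euler P_complete BW T0 beta_meas beta_growth M cL cK pw ew solX.
have ie := incr_full_drift_le P_complete BW T0 beta_meas Cb0 beta_growth M cL cK pw ew solX th0.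
apply: filterS (filterI ge ie) => o [eg ei].
rewrite /F opprD addrACA (le_trans (ler_normD _ _))//.
have -> : `|F1 (eul (incr T (shifted W fd) M o)) - F1 (grid T M X o)| = 0.
  apply/eqP; rewrite eq_le normr_ge0 andbT; apply: le_trans (F1L _ _) _.
  rewrite big1 ?mulr0// => k _; rewrite eg ?subrr ?normr0//.
  exact: ltnW.
by rewrite add0r; apply: le_trans (F2L _ _) _; rewrite ler_wpM2l.
Qed.

(** The entropy inequality along the full drift, corrected by [exchange] in the functional and by
    [full_drift_energy] in the cost. *)
Lemma upper_one :
  \int[P]_o (F1 (grid T M X o) + F2 (incr T (shifted W w) M o)) -
    2^-1 * \int[P]_o energy T w o <=
  ln (\int[P]_o expR (F (incr T W M o))) +
    (L2 * (T * d%:R + 1) + 2^-1 * \int[P]_o energy T w o + 1) * th.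
Proof.
have [L L0 FL] := F_lip.
have pf i : progr P W (fun s o => fd s o i 0).
  exact: (full_drift_progr T0 beta_meas M cL pw solX).
have [ef efle] := full_drift_energy P_complete BW T0 beta_meas Cb0 beta_growth M cL cK pw ew solX th0.
have := entropy_upper P_complete BW T0 pf ef mF FC L0 FL.
have b1 : bmeas (fun o => F (incr T (shifted W fd) M o)) := bmeas_comp bF S_meas.
have b2 : bmeas (fun o => F1 (grid T M X o) + F2 (incr T (shifted W w) M o)).
  apply: bmeasD.
    by apply: (bmeas_comp (f := F1)) grid_meas; split => //; exists C.
  by apply: (bmeas_comp (f := F2)) eta_meas; split => //; exists C.
have h : \int[P]_o (F1 (grid T M X o) + F2 (incr T (shifted W w) M o)) <=
    \int[P]_o F (incr T (shifted W fd) M o) + L2 * ((T * d%:R + 1) * th).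
  apply: (@le_trans _ _ (\int[P]_o (F (incr T (shifted W fd) M o) +
     L2 * (T * d%:R * th + th^-1 * energy T (drift_error T beta c M X) o)))).
    apply: le_E_ae; [exact: (bmeas_L1 P b2)|exact: (L1D (bmeas_L1 P b1) (L1Z L2 diff_L1))|].
    by apply: filterS exchange => o; rewrite ler_norml => /andP[h _]; move: h; rewrite lerNl opprB lerBlDl.
  rewrite (ED (bmeas_L1 P b1) (L1Z L2 diff_L1)).
  by rewrite lerD2l EZ// ler_wpM2l.
have en0 : 0 <= \int[P]_o energy T w o.
  by apply: E_ge0 => o; apply: Rintegral_ge0 => s _; exact: sqnormv_ge0.
have h2 : (1 + th^-1) * \int[P]_o energy T (drift_error T beta c M X) o <= 2 * th.
  apply: (@le_trans _ _ ((1 + th^-1) * th ^+ 2)).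
    by rewrite ler_wpM2l// addr_ge0// invr_ge0 ltW.
  have -> : (1 + th^-1) * th ^+ 2 = th ^+ 2 + th by field; rewrite gt_eqF.
  by rewrite mulr2n mulrDl mul1r lerD2r expr2 ler_piMr// ltW.
by move=> h3; exact: (arith_upper h efle h2 h3).
Qed.

(* The entropy inequality for [- th * exp F], expanded to first order in th. *)
Lemma lower_one : (forall s o, w s o = 0) ->
  \int[P]_o expR (F (incr T W M o)) <=
  \int[P]_o expR (F1 (grid T M X o) + F2 (incr T W M o)) +
    (1 + expR (2 * C) ^+ 2 + expR (2 * C) * (L2 * (T * d%:R + 1))) * th.
Proof.
move=> w0.
have wE : w = fun _ _ => 0 by apply/funext => s; apply/funext => o; exact: w0.
have en0 : \int[P]_o energy T w o = 0.
  rewrite (_ : (fun o => energy T w o) = fun=> 0) ?E_cst//.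
  apply/funext => o; rewrite /energy; under eq_Rintegral do rewrite w0 /sqnormv dotv0l.
  by rewrite Rintegral_cst// mul0r.
have [L L0 FL] := F_lip.
have pf i : progr P W (fun s o => fd s o i 0).
  exact: (full_drift_progr T0 beta_meas M cL pw solX).
have [ef efle] := full_drift_energy P_complete BW T0 beta_meas Cb0 beta_growth M cL cK pw ew solX ltr01.
pose H (y : seqV R d) := - (th * expR (F y)).
have FC' y : F y <= 2 * C by exact: le_trans (ler_norm _) (FC y).
have mH : measurable_fun setT H.
  have [m _] := bmeasN (bmeasZ th (bmeas_expR bF)); exact: m.
have HC y : `|H y| <= expR (2 * C).
  rewrite normrN ger0_norm ?mulr_ge0 ?expR_ge0 ?(ltW th0)//.
  by apply: (@le_trans _ _ (1 * expR (F y))); rewrite ?ler_wpM2r ?expR_ge0// mul1r ler_expR.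
have HL : lipS (2 ^ M) (expR (2 * C) * L) H.
  move=> y y'; rewrite /H -opprD normrN -mulrBr normrM (ger0_norm (ltW th0)).
  apply: (@le_trans _ _ (1 * `|expR (F y) - expR (F y')|)); first by rewrite ler_wpM2r.
  rewrite mul1r -mulrA; apply: le_trans (expR_lip (FC' y) (FC' y')) _.
  by rewrite ler_wpM2l ?expR_ge0.
have := entropy_upper P_complete BW T0 pf ef mH HC (mulr_ge0 (expR_ge0 _) L0) HL.
have bS : bmeas (fun o => expR (F (incr T (shifted W fd) M o))).
  exact: (bmeas_comp (bmeas_expR bF) S_meas).
have bxi : bmeas (fun o => expR (F (incr T W M o))).
  exact: (bmeas_comp (bmeas_expR bF) (measurable_incrW BW T0 M)).
rewrite /H EN; last by apply: L1Z; exact: bmeas_L1.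
rewrite EZ; last exact: bmeas_L1.
(* [ln y <= y - 1] and [exp (- u) <= 1 - u + u^2] keep the linear term and leave an error of order
   [th^2]. After division by [th] all errors, the energy included, are of order [th]. *)
have e1 : ln (\int[P]_o expR (- (th * expR (F (incr T W M o))))) <=
    - (th * \int[P]_o expR (F (incr T W M o))) + th ^+ 2 * expR (2 * C) ^+ 2.
  have bH : bmeas (fun o => expR (- (th * expR (F (incr T W M o))))).
    exact/bmeas_expR/bmeasN/bmeasZ.
  have pos : 0 < \int[P]_o expR (- (th * expR (F (incr T W M o)))).
    apply: (@lt_le_trans _ _ (\int[P]_o expR (- expR (2 * C)))).
      by rewrite E_cst expR_gt0.
    apply: le_E; [exact/bmeas_L1/bmeas_cst|exact: bmeas_L1|move=> o].
    by rewrite ler_expR; have := HC (incr T W M o); rewrite ler_norml => /andP[].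
  apply: le_trans (ln_le_sub1 pos) _; rewrite lerBlDr.
  have b3 : bmeas (fun o => - (th * expR (F (incr T W M o))) + (th ^+ 2 * expR (2 * C) ^+ 2 + 1)).
    by apply: bmeasD; [exact/bmeasN/bmeasZ|exact: bmeas_cst].
  apply: (@le_trans _ _ (\int[P]_o (- (th * expR (F (incr T W M o))) + (th ^+ 2 * expR (2 * C) ^+ 2 + 1)))).
    apply: le_E; [exact: bmeas_L1|exact: bmeas_L1|move=> o].
    set u := th * _; have u0 : 0 <= u by rewrite mulr_ge0 ?expR_ge0 ?ltW.
    have u2 : u ^+ 2 <= th ^+ 2 * expR (2 * C) ^+ 2.
      rewrite /u exprMn ler_wpM2l ?sqr_ge0// lerXn2r ?nnegrE ?expR_ge0//.
      by rewrite ler_expR.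
    exact: expRN_le.
  rewrite ED; [|exact/bmeas_L1/bmeasN/bmeasZ|exact/bmeas_L1/bmeas_cst].
  rewrite EN; last exact/bmeas_L1/bmeasZ.
  rewrite EZ; last exact: bmeas_L1.
  by rewrite E_cst addrA.
have b2 : bmeas (fun o => F1 (grid T M X o) + F2 (incr T W M o)).
  apply: bmeasD.
    by apply: (bmeas_comp (f := F1)) grid_meas; split => //; exists C.
  by apply: (bmeas_comp (f := F2)) (measurable_incrW BW T0 M); split => //; exists C.
have e2 : \int[P]_o expR (F (incr T (shifted W fd) M o)) <=
    \int[P]_o expR (F1 (grid T M X o) + F2 (incr T W M o)) +
    expR (2 * C) * (L2 * ((T * d%:R + 1) * th)).
  apply: (@le_trans _ _ (\int[P]_o (expR (F1 (grid T M X o) + F2 (incr T W M o)) +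
     (expR (2 * C) * L2) * (T * d%:R * th + th^-1 * energy T (drift_error T beta c M X) o)))).
    apply: le_E_ae; [exact: bmeas_L1|apply: L1D; [exact/bmeas_L1/bmeas_expR|exact: L1Z]|].
    apply: filterS exchange => o; rewrite wE shifted0 => h.
    rewrite -lerBlDl; apply: le_trans (ler_norm _) _; rewrite -mulrA.
    apply: le_trans (expR_lip (FC' _) _) _; last by rewrite ler_wpM2l ?expR_ge0.
    apply: le_trans (lerD (le_trans (ler_norm _) (F1C _)) (le_trans (ler_norm _) (F2C _))) _.
    by rewrite mulr2n mulrDl !mul1r.
  rewrite ED; [|exact/bmeas_L1/bmeas_expR|exact: L1Z].
  rewrite lerD2l EZ// -mulrA ler_wpM2l ?expR_ge0// ler_wpM2l//.
move: efle; rewrite en0 mulr0 add0r invr1 => efle h.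
exact: (arith_lower th0 h e1 efle err e2).
Qed.

End one_solution.

(** The error of [lower_one], magnified by the bound [exp (2 C)] on the inverse of the exponential
    mean when the logarithm is taken, plus the error of [upper_one]. *)
Definition comparison_cst (En : R) : R :=
  (1 + expR (2 * C) ^+ 2 + expR (2 * C) * (L2 * (T * d%:R + 1))) * expR (2 * C) +
  (L2 * (T * d%:R + 1) + 2^-1 * En + 1).

(** [X] and [X0] are never compared directly. [upper_one] bounds the functional of [X] by the Euler
    scheme driven by [W] alone, and [lower_one] returns from that scheme to [X0]. *)
Lemma comparison (w X X0 : process R d Omega) :
  (forall i, progr P W (fun s o => w s o i 0)) ->
  (\int[P]_o \int[mu]_(s in `[0%R, T]) (sqnormv (w s o))%:E < +oo)%E ->
  solution P W T beta sg x w X -> solution P W T beta sg x (fun _ _ => 0) X0 ->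
  \int[P]_o energy T (drift_error T beta c M X) o <= th ^+ 2 ->
  \int[P]_o energy T (drift_error T beta c M X0) o <= th ^+ 2 ->
  \int[P]_o (F1 (grid T M X o) + F2 (incr T (shifted W w) M o)) -
    2^-1 * \int[P]_o energy T w o <=
  ln (\int[P]_o expR (F1 (grid T M X0 o) + F2 (incr T W M o))) +
    comparison_cst (\int[P]_o energy T w o) * th.
Proof.
move=> pw ew solX solX0 eX eX0.
have h1 := upper_one pw ew solX eX.
have h2 := lower_one zero_control_progr zero_control_energy solX0 eX0 (fun _ _ => erefl).
apply: (le_trans h1); rewrite /comparison_cst [X in _ <= _ + X]mulrDl [leRHS]addrA lerD2r.
set A := \int[P]_o expR (F1 _ + F2 _) in h2 *; set B := _ + _ + _ in h2 *.
have b2 : bmeas (fun o => F1 (grid T M X0 o) + F2 (incr T W M o)).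
  apply: bmeasD.
    by apply: (bmeas_comp (f := F1)) (grid_meas solX0); split => //; exists C.
  by apply: (bmeas_comp (f := F2)) (measurable_incrW BW T0 M); split => //; exists C.
have Age : expR (- (2 * C)) <= A.
  rewrite -[leLHS](E_cst P); apply: le_E; [exact/bmeas_L1/bmeas_cst|exact/bmeas_L1/bmeas_expR|move=> o].
  by rewrite ler_expR; exact: arith_bound (F1C _) (F2C _).
have A0 : 0 < A := lt_le_trans (expR_gt0 _) Age.
have B0 : 0 <= B by rewrite /B addr_ge0 ?addr_ge0 ?sqr_ge0// mulr_ge0 ?expR_ge0// mulr_ge0// addr_ge0 ?mulr_ge0 ?(ltW T0).
have x0 : 0 < \int[P]_o expR (F (incr T W M o)).
  apply: (@lt_le_trans _ _ (\int[P]_o expR (- (2 * C)))); first by rewrite E_cst expR_gt0.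
  apply: le_E; [exact/bmeas_L1/bmeas_cst|exact/bmeas_L1/(bmeas_comp (bmeas_expR bF) (measurable_incrW BW T0 M))|move=> o].
  by rewrite ler_expR; have := FC (incr T W M o); rewrite ler_norml => /andP[].
apply: (@le_trans _ _ (ln (A + B * th))).
  by rewrite ler_ln// posrE// ltr_wpDr// mulr_ge0// ltW.
have -> : A + B * th = A * (1 + B * th / A) by field; rewrite gt_eqF.
have p1 : 0 < 1 + B * th / A by rewrite ltr_pwDl// divr_ge0 ?mulr_ge0 ?(ltW th0) ?(ltW A0).
rewrite lnM// lerD2l; apply: le_trans (ln_le_sub1 p1) _.
rewrite addrAC subrr add0r ler_pdivrMr//.
have AK : 1 <= expR (2 * C) * A.
  by rewrite -(ler_pM2l (expR_gt0 (- (2 * C)))) mulr1 mulrA -expRD addNr expR0 mul1r.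
rewrite [leRHS](_ : _ = B * th * (expR (2 * C) * A)); last by ring.
by rewrite ler_peMr// mulr_ge0// ltW.
Qed.

End comparison.

(** * Lipschitz approximation of drift and cost *)

Lemma dominated_cvg_E {dT} {X : measurableType dT} {R : realType}
    (m : {finite_measure set X -> \bar R}) (f : nat -> X -> R) (g h : X -> R) :
  (forall n, measurable_fun setT (f n)) -> measurable_fun setT g -> L1 m h ->
  (forall n x, `|f n x| <= h x) -> {ae m, forall x, f n x @[n --> \oo] --> g x} ->
  \int[m]_x f n x @[n --> \oo] --> \int[m]_x g x.
Proof.
move=> mf mg mh fh fg.
have [] := @dominated_convergence _ _ _ m setT measurableT
  (fun n => EFin \o f n) (EFin \o g) (EFin \o h) _ _ _ mh _.
- by move=> n; exact/measurable_EFinP.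
- exact/measurable_EFinP.
- by apply: filterS fg => x fx _; apply: cvg_EFin => //; exact: nearW.
- by apply: aeW => x n _ /=; rewrite lee_fin.
move=> ig _ fi; apply: fine_cvg; rewrite fineK; last exact: integrable_fin_num ig.
exact: fi.
Qed.

(** Turns approximation in mean into approximation in mean square: for functions bounded by [K],
    [(v - b)^2 <= 2 K |v - b|]. *)
Lemma sqr_split {R : realType} (a b v K : R) : `|v| <= K -> `|b| <= K ->
  (a - v) ^+ 2 <= 2 * (a - b) ^+ 2 + 4 * K * `|v - b|.
Proof.
move=> vK bK; have h3 : (v - b) ^+ 2 <= 2 * K * `|v - b|.
  rewrite -(real_normK (num_real (v - b))) expr2 ler_wpM2r//.
  by rewrite (le_trans (ler_normB _ _))// mulr2n mulrDl mul1r lerD.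
have : (a - v) ^+ 2 <= 2 * (a - b) ^+ 2 + 2 * (v - b) ^+ 2.
  by have := sqr_ge0 ((a - b) + (v - b)); rewrite !expr2; lra.
by move: h3; set w := `|_|; lra.
Qed.

Section finite_sum_of_measures.
Context {dT} {X : measurableType dT} {R : realType}.
Variables m1 m2 : {finite_measure set X -> \bar R}.

(** Density in mean under the sum of two occupation measures yields one Lipschitz function that is
    good under both. *)
Definition finite_add (A : set X) : \bar R := (m1 A + m2 A)%E.

Let m12 : {measure set X -> \bar R} := msum (fun n => if n is 0%N then m1 else m2) 2.

Let m12E : finite_add = m12.
Proof. by apply/funext => A; exact/esym/measure_addE. Qed.

Let finite_add0 : finite_add set0 = 0%E.
Proof. by rewrite m12E measure0. Qed.

Let finite_add_ge0 A : (0 <= finite_add A)%E.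
Proof. by rewrite m12E measure_ge0. Qed.

Let finite_add_sigma : semi_sigma_additive finite_add.
Proof. rewrite m12E; exact: measure_semi_sigma_additive. Qed.

HB.instance Definition _ := isMeasure.Build _ _ _ finite_add
  finite_add0 finite_add_ge0 finite_add_sigma.

Let finite_add_fin : fin_num_fun finite_add.
Proof. by move=> A mA; rewrite /finite_add fin_numD !fin_num_measure. Qed.

HB.instance Definition _ := Measure_isFinite.Build _ _ _ finite_add finite_add_fin.

Definition finite_measure_add : {finite_measure set X -> \bar R} := finite_add.

Lemma finite_measure_add_ge (f : X -> R) : bmeas f -> (forall y, 0 <= f y) ->
  \int[m1]_y f y <= \int[finite_measure_add]_y f y /\
  \int[m2]_y f y <= \int[finite_measure_add]_y f y.
Proof.
move=> bf f0; have L m := bmeas_L1 m bf.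
have e : \int[finite_measure_add]_y f y = \int[m1]_y f y + \int[m2]_y f y.
  apply: EFin_inj; rewrite EFinD -!EFinE//.
  rewrite (eq_measure_integral m12) => [|A _ _]; last by rewrite -m12E.
  apply: ge0_integral_measure_add => //; last by apply/measurable_EFinP; case: bf.
  by move=> y _; rewrite lee_fin.
by rewrite e lerDl lerDr !E_ge0.
Qed.

End finite_sum_of_measures.

Section time_discretization.
Context {R : realType} {d : nat} {disp} {Omega : measurableType disp}.
Variables (P : probability Omega R) (P_complete : measure_is_complete P)
  (W : process R d Omega) (BW : brownian_motion P W) (T : R) (T0 : 0 < T).
Local Notation mu := (@lebesgue_measure R).
Local Notation tk := (tk T).
Local Notation dl := (dl T).
Local Notation Q := (QT P T0).

Definition sstep M (f : 'cV[R]_d -> R) (X : process R d Omega) (s : R) (o : Omega) : R :=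
  \sum_(k < 2 ^ M) \1_(`]tk M k, tk M k.+1]%classic) s * f (X (tk M k) o).

Lemma sstepE M f X s o k : (k < 2 ^ M)%N -> tk M k < s <= tk M k.+1 ->
  sstep M f X s o = f (X (tk M k) o).
Proof.
move=> kM /andP[h1 h2]; rewrite /sstep (bigD1 (Ordinal kM))//= big1 => [|l lk].
  by rewrite addr0 indicE mem_set ?mul1r//= in_itv/= h1.
rewrite indicE memNset ?mul0r//= in_itv/= => /andP[h3 h4].
have : (l != k :> nat) by exact: contra lk.
rewrite neq_ltn => /orP[lt|lt].
  by have := lt_le_trans h1 (le_trans h4 (tk_mono T0 M lt)); rewrite ltxx.
by have := lt_le_trans h3 (le_trans h2 (tk_mono T0 M lt)); rewrite ltxx.
Qed.

Lemma sstep_le M f X s o K : 0 <= K -> (forall y, `|f y| <= K) -> `|sstep M f X s o| <= K.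
Proof.
move=> K0 fK; have [[k [kM ks]]|nk] := pselect (exists k, (k < 2 ^ M)%N /\ tk M k < s <= tk M k.+1).
  by rewrite (sstepE _ _ _ kM ks).
rewrite /sstep big1 ?normr0// => k _; rewrite indicE memNset ?mul0r//= in_itv/= => ks.
by apply: nk; exists k; split.
Qed.

Lemma sstep_progr M f (X : process R d Omega) : measurable_fun [set: borelV R d] (f : borelV R d -> R) ->
  (forall i, progr P W (fun s o => X s o i 0)) -> progr P W (sstep M f X).
Proof.
move=> mf pX; apply: progr_sum => k t t0; have [kt|tk'] := leP (tk M k) t; last first.
  apply: (eq_measurable_fun (fun _ : R * g_sigma_algebraType (completed_filtration P W t) => 0 : R)); last exact: measurable_cst.
  move=> p /set_mem[/= + _]; rewrite in_itv/= => /andP[p0 p1].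
  rewrite indicE memNset ?mul0r//= in_itv/= => /andP[h _].
  by have := lt_le_trans h p1; rewrite ltNge (ltW tk').
apply: measurable_funM.
  apply: measurable_funTS; apply: measurableT_comp measurable_fst.
  exact: measurable_indic.
have ma : measurable_fun [set: g_sigma_algebraType (completed_filtration P W t)]
    ((fun w => f (X (tk M k) w)) : g_sigma_algebraType (completed_filtration P W t) -> R).
  apply: (fmeas_mono kt); apply: measurableT_comp mf _.
  by apply: measurable_funV => // i; exact: (progr_adapted (tk_ge0 T0 M k) (pX i)).
exact: measurable_funTS (measurableT_comp ma measurable_snd).
Qed.

Lemma sstep_meas M f (X : process R d Omega) :
  measurable_fun [set: borelV R d] (f : borelV R d -> R) ->
  (forall i, progr P W (fun s o => X s o i 0)) ->
  measurable_fun setT (at_time T (sstep M f X) : Omega * measurableTypeR R -> R).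
Proof.
by move=> mf pX; apply: (at_time_meas P_complete BW T0); exact: sstep_progr.
Qed.

Lemma sstep_int M f X o : \int[mu]_(s in `[0, T]) sstep M f X s o =
  \sum_(k < 2 ^ M) dl M * f (X (tk M k) o).
Proof.
have mT : measurable (`[0, T]%classic : set (measurableTypeR R)) by [].
have mI k : measurable (`]tk M k, tk M k.+1]%classic : set (measurableTypeR R)) by [].
have i1 k : iL `[0, T] (\1_(`]tk M k, tk M k.+1]%classic) : R -> R).
  apply: (iL_bound (M := 1)) => [|s _].
    by apply: measurable_funTS; exact: measurable_indic.
  by rewrite indicE; case: (_ \in _); rewrite ?normr1// normr0.
have iF (k : 'I_(2 ^ M)) :
    iL `[0, T] (fun s => \1_(`]tk M k, tk M k.+1]%classic) s * f (X (tk M k) o)).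
  have := iLZ (f (X (tk M k) o)) mT (i1 k); congr (iL _ _).
  by apply/funext => s; rewrite mulrC.
have [-> _] := int_sumI (index_enum 'I_(2 ^ M)) mT iF.
apply: eq_bigr => k _; rewrite mulrC.
under eq_Rintegral do rewrite mulrC.
rewrite RintegralZl//; [|exact: i1]; congr (_ * _).
rewrite /Rintegral integral_indic// setIidl; last first.
  exact: sub_itvoc (tk_ge0 T0 M k) (tk_leT T0 (ltn_ord k)).
rewrite [X in fine X](_ : _ = (tk M k.+1 - tk M k)%:E).
  by rewrite /= tkS addrAC subrr add0r.
by apply: etrans (lebesgue_measure_itv _) _; rewrite /= lte_fin (tk_lt T0 M k) EFinB.
Qed.

(** At time 0 a step process has the default value 0 instead of [f (X_0)]; the uniform law does not
    charge the times that [clip] sends there. *)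
Lemma time_pos : {ae Q, forall p, 0 < p.2}.
Proof.
have mN : measurable (`]-oo, 0]%classic : set (measurableTypeR R)) by [].
exists (setT `*` `]-oo, 0]%classic); split.
- exact: measurableX.
- rewrite /QT [LHS](product_measure1E _ _ measurableT mN).
  rewrite [X in (_ * X)%E](_ : _ = 0%E) ?mule0//.
  apply: etrans (integral_uniform_pdf _ _ _) _.
  rewrite (_ : _ `&` _ = [set 0]) ?integral_set1//.
  apply/seteqP; split => s /=; rewrite !in_itv/=.
    by move=> [s0 /andP[s1 _]]; apply/eqP; rewrite eq_le s0.
  by move=> ->; rewrite !lexx (ltW T0).
- by move=> p /= /negP; rewrite -leNgt => h; split; rewrite //= in_itv/=.
Qed.

Section processes.
Variable X : process R d Omega.
Hypotheses (pX : forall i, progr P W (fun s o => X s o i 0))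
  (cX : forall o, {within `[0, +oo[, continuous (X ^~ o)}).

Lemma comp_progr (f : 'cV[R]_d -> R) : measurable_fun [set: borelV R d] (f : borelV R d -> R) ->
  progr P W (fun s o => f (X s o)).
Proof.
move=> mf; apply: (@progr_comp _ _ _ _ _ _ _ _ (borelV R d) _ X f) => //.
exact: progrV.
Qed.

(** Continuity of paths: the left end of the cell containing [t] tends to [t]. *)
Lemma sstep_cvg (f : 'cV[R]_d -> R) (L K : R) : 0 <= L -> lipschitzv L f -> 0 <= K ->
  (forall y, `|f y| <= K) ->
  \int[Q]_p `|at_time T (sstep M f X) p - at_time T (fun s o => f (X s o)) p| @[M --> \oo] --> 0.
Proof.
move=> L0 fL K0 fK; have mf := lipschitz_measurable fL.
have b1 M : bmeas (at_time T (sstep M f X) : Omega * measurableTypeR R -> R).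
  split; first exact: (sstep_meas _ mf pX).
  by exists K => p; exact: sstep_le.
have b2 : bmeas (at_time T (fun s o => f (X s o)) : Omega * measurableTypeR R -> R).
  split; first exact: (at_time_meas P_complete BW T0 (comp_progr mf)).
  by exists K => p; exact: fK.
rewrite -(E_cst Q 0); apply: (@bounded_cvg_E _ _ _ Q _ _ (K + K)).
- by move=> M; have [] := bmeas_norm (bmeasB (b1 M) b2).
- exact: measurable_cst.
- move=> M p; rewrite normr_id (le_trans (ler_normB _ _))// lerD//.
    exact: sstep_le.
  exact: fK.
apply: (negligibleS _ time_pos); apply: subsetC; move=> [w s] /= s0; rewrite /at_time/=.
have /andP[c0 cT] := clip_itv T0 s.
have c1 : 0 < clip T s by rewrite /clip lt_min T0 lt_max s0 orbT.
set t := clip T s in c0 cT c1 *.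
have /choice[k kP] : forall M, exists k, (k < 2 ^ M)%N /\ tk M k < t <= tk M k.+1.
  by move=> M; have [k km h] := grid_cell M c1 cT; exists k.
have tks : (fun M => tk M (k M)) @ \oo --> t.
  apply/cvgrPdist_lt => z z0; have /cvgrPdist_lt/(_ _ z0)[N _ HN] := dl_cvg0 T.
  exists N => // m /= Nm; have := HN m Nm; have [_ /andP[h1 h2]] := kP m.
  rewrite sub0r normrN (ger0_norm (ltW (dl_gt0 T0 m))) ger0_norm ?subr_ge0 ?(ltW h1)//.
  by apply: le_lt_trans; rewrite lerBlDl -tkS.
have fc : (X ^~ w) @ within `[0, +oo[ (nbhs t) --> X t w.
  by move: t c0 {cT c1 kP tks} => t c0; have /subspace_continuousP := @cX w; apply; rewrite /= in_itv/= c0.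
have c2 : (fun M => X (tk M (k M)) w) @ \oo --> X t w.
  apply: cvg_comp fc => U /= sU; have := tks _ sU => -[N _ HN].
  by exists N => // m Nm; apply: HN => //=; rewrite in_itv/= tk_ge0.
apply/cvgrPdist_le => z z0; have L1 : 0 < L + 1 by rewrite ltr_wpDl.
have /cvgrPdist_lt/(_ (z / (L + 1)) (divr_gt0 z0 L1))[N _ HN] := c2.
exists N => // M NM; rewrite sub0r normrN normr_id.
have [kM ks] := kP M; rewrite (sstepE _ _ _ kM ks).
apply: le_trans (fL _ _) _; rewrite distrC.
have := HN M NM; rewrite /= ltr_pdivlMr// => h; apply: le_trans (ltW h).
by rewrite mulrC ler_wpM2l// lerDl.
Qed.

End processes.

Variables X1 X2 : process R d Omega.
Hypotheses (pX1 : forall i, progr P W (fun s o => X1 s o i 0))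
  (cX1 : forall o, {within `[0, +oo[, continuous (X1 ^~ o)})
  (pX2 : forall i, progr P W (fun s o => X2 s o i 0))
  (cX2 : forall o, {within `[0, +oo[, continuous (X2 ^~ o)}).

Lemma state_meas (X : process R d Omega) : (forall i, progr P W (fun s o => X s o i 0)) ->
  measurable_fun setT (at_time T X : Omega * measurableTypeR R -> borelV R d).
Proof.
move=> pX; apply: (@at_time_meas _ _ _ _ P P_complete W BW T T0 _ (borelV R d) X).
exact: progrV.
Qed.

(* Lusin-type approximation under the occupation measures of both processes. *)
Lemma step_approx (g : 'cV[R]_d -> R) (K e : R) :
  measurable_fun [set: borelV R d] (g : borelV R d -> R) -> 0 < K ->
  (forall y, 0 <= g y <= K) -> 0 < e ->
  exists (f : 'cV[R]_d -> R) (L : R), [/\ 0 <= L, lipschitzv L f, forall y, 0 <= f y <= K &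
  exists M0, forall M, (M0 <= M)%N ->
   \int[Q]_p `|at_time T (sstep M f X1) p - at_time T (fun s o => g (X1 s o)) p| <= e /\
   \int[Q]_p `|at_time T (sstep M f X2) p - at_time T (fun s o => g (X2 s o)) p| <= e].
Proof.
move=> mg K0 gK e0; have e2 : 0 < e / 2 by rewrite divr_gt0.
pose V1 := mfun_Sub (mem_set (state_meas pX1)).
pose V2 := mfun_Sub (mem_set (state_meas pX2)).
pose nu := finite_measure_add (distribution Q V1) (distribution Q V2).
have [f [L [L0 fL fK fe]]] := lipschitz_dense nu K0 mg gK e2.
exists f, L; split => //.
have mf := lipschitz_measurable fL.
have norm01 (h : 'cV[R]_d -> R) y : 0 <= h y <= K -> `|h y| <= K.
  by move=> /andP[h0 hK]; rewrite ger0_norm.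
have bf : bmeas (f : borelV R d -> R) by split => //; exists K => y; exact: norm01.
have bg : bmeas (g : borelV R d -> R) by split => //; exists K => y; exact: norm01.
have bfg := bmeas_norm (bmeasB bf bg).
have [h1 h2] := finite_measure_add_ge (distribution Q V1) (distribution Q V2) bfg (fun y => normr_ge0 _).
have tr (X : process R d Omega) (pX : forall i, progr P W (fun s o => X s o i 0))
    (cX : forall o, {within `[0, +oo[, continuous (X ^~ o)}) :
    \int[distribution Q (mfun_Sub (mem_set (state_meas pX)))]_y `|f y - g y| <= e / 2 ->
    exists M0, forall M, (M0 <= M)%N ->
   \int[Q]_p `|at_time T (sstep M f X) p - at_time T (fun s o => g (X s o)) p| <= e.
  move=> hfg; have c := sstep_cvg pX cX L0 fL (ltW K0) (fun y => norm01 f y (fK y)).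
  have /cvgrPdist_le/(_ _ e2)[M0 _ HM] := c; exists M0 => M MM.
  have := HM M MM; rewrite /= sub0r normrN ger0_norm; last by apply: E_ge0.
  move=> h3; have b1 : bmeas (at_time T (sstep M f X) : Omega * measurableTypeR R -> R).
    split; first exact: (sstep_meas _ mf pX).
    by exists K => p; apply: sstep_le => [|y]; [exact: ltW|exact: norm01].
  have bff : bmeas (at_time T (fun s o => f (X s o)) : Omega * measurableTypeR R -> R).
    exact: bmeas_comp bf (state_meas pX).
  have bgg : bmeas (at_time T (fun s o => g (X s o)) : Omega * measurableTypeR R -> R).
    exact: bmeas_comp bg (state_meas pX).
  have h4 : \int[Q]_p `|at_time T (fun s o => f (X s o)) p - at_time T (fun s o => g (X s o)) p| <= e / 2.
    apply: le_trans hfg; rewrite le_eqVlt; apply/orP; left; apply/eqP.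
    rewrite /Rintegral ge0_integral_distribution//.
    by apply/measurable_EFinP; case: bfg.
  apply: (@le_trans _ _ (\int[Q]_p (`|at_time T (sstep M f X) p - at_time T (fun s o => f (X s o)) p| +
      `|at_time T (fun s o => f (X s o)) p - at_time T (fun s o => g (X s o)) p|))).
    apply: le_E.
    - by apply: bmeas_L1; apply: bmeas_norm; exact: bmeasB.
    - by apply: bmeas_L1; apply: bmeasD; apply: bmeas_norm; exact: bmeasB.
    - by move=> p; rewrite -[X in `|X - at_time _ (fun _ _ => g _) _|](subrK (at_time T (fun s o => f (X s o)) p)) -addrA ler_normD.
  rewrite ED; [|by apply: bmeas_L1; apply: bmeas_norm; exact: bmeasB..].
  by rewrite [leRHS](splitr e) lerD.
have [M1 H1] := tr X1 pX1 cX1 (le_trans h1 fe).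
have [M2 H2] := tr X2 pX2 cX2 (le_trans h2 fe).
exists (maxn M1 M2) => M; rewrite geq_max => /andP[MM1 MM2].
by split; [exact: H1|exact: H2].
Qed.

Lemma trunc_cvg (X : process R d Omega) (g : 'cV[R]_d -> R) :
  (forall i, progr P W (fun s o => X s o i 0)) ->
  measurable_fun [set: borelV R d] (g : borelV R d -> R) ->
  L1 Q (at_time T (fun s o => g (X s o) ^+ 2)) ->
  \int[Q]_p at_time T (fun s o => (g (X s o) - trunc n%:R (g (X s o))) ^+ 2) p @[n --> \oo] --> 0.
Proof.
move=> pX mg Lg; rewrite -(E_cst Q 0).
have mgX : measurable_fun setT (at_time T (fun s o => g (X s o)) : Omega * measurableTypeR R -> R).
  exact: measurableT_comp mg (state_meas pX).
apply: (dominated_cvg_E _ _ Lg).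
- move=> n; apply: measurable_funX; apply: measurable_funB => //.
  exact: measurableT_comp (measurable_trunc n%:R) mgX.
- exact: measurable_cst.
- move=> n p; rewrite ger0_norm ?sqr_ge0// /at_time; set r := g _.
  rewrite /trunc; case: ifP => _; last by rewrite subr0.
  by rewrite subrr expr0n sqr_ge0.
apply: aeW => p; rewrite /at_time; set r := g _.
apply: cvg_near_cst; have [N HN] : exists N : nat, `|r| <= N%:R.
  by exists (Num.truncn `|r|).+1; rewrite ltW// truncnS_gt.
exists N => // n /= Nn; rewrite /trunc ifT ?subrr ?expr0n//.
by rewrite (le_trans HN)// ler_nat.
Qed.

(** [g] is first truncated, with mean-square error [e / 4]. The truncation, raised by [K] to lie in
    [[0, 2 K]], is approximated in mean to within [e / (8 K)], which [sqr_split] turns into a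
    mean-square error; the two add up as [2 (e / 4) + 4 K (e / (8 K)) = e]. *)
Lemma step_approx2 (g : 'cV[R]_d -> R) (e : R) :
  measurable_fun [set: borelV R d] (g : borelV R d -> R) ->
  L1 Q (at_time T (fun s o => g (X1 s o) ^+ 2)) ->
  L1 Q (at_time T (fun s o => g (X2 s o) ^+ 2)) -> 0 < e ->
  exists (f : 'cV[R]_d -> R) (L K : R), [/\ 0 <= L, 0 <= K, lipschitzv L f, forall y, `|f y| <= K &
  exists M0, forall M, (M0 <= M)%N ->
   \int[Q]_p at_time T (fun s o => (g (X1 s o) - sstep M f X1 s o) ^+ 2) p <= e /\
   \int[Q]_p at_time T (fun s o => (g (X2 s o) - sstep M f X2 s o) ^+ 2) p <= e].
Proof.
move=> mg Lg1 Lg2 e0; have e4 : 0 < e / 4 by rewrite divr_gt0.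
have /cvgrPdist_le/(_ _ e4)[N1 _ H1] := trunc_cvg pX1 mg Lg1.
have /cvgrPdist_le/(_ _ e4)[N2 _ H2] := trunc_cvg pX2 mg Lg2.
pose n := (maxn N1 N2).+1; pose K : R := n%:R.
have K0 : 0 < K by rewrite ltr0n.
have mt : measurable_fun [set: borelV R d] ((fun y => trunc K (g y)) : borelV R d -> R).
  exact: measurableT_comp (measurable_trunc K) mg.
have tK y : `|trunc K (g y)| <= K by exact: trunc_norm.
have [||||f [L [L0 fL fK [M0 HM]]]] := step_approx (g := fun y => trunc K (g y) + K) (K := 2 * K) (e := e / (8 * K)).
- by apply: measurable_funD => //; exact: measurable_cst.
- by rewrite mulr_gt0.
- by move=> y; have := tK y; rewrite ler_norml; lra.
- by rewrite divr_gt0// mulr_gt0.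
have f'K y : `|f y - K| <= K by have := fK y; rewrite ler_norml; lra.
have f'L : lipschitzv L (fun y => f y - K).
  by move=> y y'; rewrite opprB addrA subrK; exact: fL.
exists (fun y => f y - K), L, K; split => //.
exists M0 => M MM; have [h1 h2] := HM M MM.
have tr (X : process R d Omega) : (forall i, progr P W (fun s o => X s o i 0)) ->
    L1 Q (at_time T (fun s o => g (X s o) ^+ 2)) ->
    \int[Q]_p `|at_time T (sstep M f X) p - at_time T (fun s o => trunc K (g (X s o)) + K) p| <= e / (8 * K) ->
    \int[Q]_p at_time T (fun s o => (g (X s o) - trunc K (g (X s o))) ^+ 2) p <= e / 4 ->
    \int[Q]_p at_time T (fun s o => (g (X s o) - sstep M (fun y => f y - K) X s o) ^+ 2) p <= e.
  move=> pX Lg k1 k2.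
  have mf := lipschitz_measurable fL; have mf' := lipschitz_measurable f'L.
  have mgX : measurable_fun setT (at_time T (fun s o => g (X s o)) : Omega * measurableTypeR R -> R).
    exact: measurableT_comp mg (state_meas pX).
  have mtX : measurable_fun setT (at_time T (fun s o => trunc K (g (X s o))) : Omega * measurableTypeR R -> R).
    exact: measurableT_comp mt (state_meas pX).
  have ms : measurable_fun setT (at_time T (sstep M (fun y => f y - K) X) : Omega * measurableTypeR R -> R).
    exact: (sstep_meas _ mf' pX).
  have bsf : bmeas (at_time T (sstep M f X) : Omega * measurableTypeR R -> R).
    split; first exact: (sstep_meas _ mf pX).
    exists (2 * K) => p; apply: sstep_le => [|y]; first by rewrite mulr_ge0// ltW.
    by have /andP[f0 f1] := fK y; rewrite ger0_norm.
  have btK : bmeas (at_time T (fun s o => trunc K (g (X s o)) + K) : Omega * measurableTypeR R -> R).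
    apply: bmeasD (bmeas_cst K); split => //; exists K => p; exact: tK.
  have La : L1 Q (at_time T (fun s o => (g (X s o) - trunc K (g (X s o))) ^+ 2)).
    apply: (L1_dom _ Lg) => [|p]; first by apply: measurable_funX; exact: measurable_funB.
    rewrite ger0_norm ?sqr_ge0// /at_time; set r := g _.
    rewrite /trunc; case: ifP => _; last by rewrite subr0.
    by rewrite subrr expr0n sqr_ge0.
  have Lb : L1 Q (fun p => `|at_time T (sstep M f X) p - at_time T (fun s o => trunc K (g (X s o)) + K) p|).
    by apply: bmeas_L1; apply: bmeas_norm; exact: bmeasB.
  have LL := L1D (L1Z 2 La) (L1Z (4 * K) Lb).
  apply: (@le_trans _ _ (\int[Q]_p (2 * at_time T (fun s o => (g (X s o) - trunc K (g (X s o))) ^+ 2) p +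
      4 * K * `|at_time T (sstep M f X) p - at_time T (fun s o => trunc K (g (X s o)) + K) p|))).
    apply: le_E_ae => //.
      have m0 : measurable_fun setT (at_time T (fun s o => (g (X s o) - sstep M (fun y => f y - K) X s o) ^+ 2) : Omega * measurableTypeR R -> R).
        by apply: measurable_funX; exact: measurable_funB.
      apply: (L1_dom m0 (L1D (L1Z 2 Lg) (bmeas_L1 _ (bmeas_cst (2 * K ^+ 2))))) => p.
      rewrite ger0_norm ?sqr_ge0// /at_time.
      have := @sstep_le M (fun y => f y - K) X (clip T p.2) p.1 K (ltW K0) f'K.
      set a := g _; set b := sstep _ _ _ _ _ => bK.
      have : b ^+ 2 <= K ^+ 2 by rewrite -(real_normK (num_real b)) lerXn2r ?nnegrE ?(ltW K0).
      by have := sqr_ge0 (a + b); nra.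
    apply: (negligibleS _ time_pos); apply: subsetC; move=> [w s] /= s0; rewrite /at_time/=.
    have /andP[c0 cT] := clip_itv T0 s.
    have c1 : 0 < clip T s by rewrite /clip lt_min T0 lt_max s0 orbT.
    set t := clip T s in c0 cT c1 *.
    have [k kM ks] := grid_cell M c1 cT.
    rewrite !(sstepE _ _ _ kM ks); have := tK (X t w); have := f'K (X (tk M k) w).
    set a := g _; set b := trunc _ _; set u := f _ => u1 b1.
    by rewrite (addrC b) [- (K + b)]opprD addrA; exact: sqr_split.
  rewrite ED; [|exact: L1Z..]; rewrite !EZ//.
  have -> : e = 2 * (e / 4) + 4 * K * (e / (8 * K)) by field; rewrite gt_eqF.
  by rewrite lerD// ler_wpM2l// mulr_ge0// ltW.
split.
- apply: tr => //; have := H1 n; rewrite /= sub0r normrN ger0_norm.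
    by apply; rewrite ltnW// ltnS leq_max leqnn.
  by apply: E_ge0 => p; exact: sqr_ge0.
- apply: tr => //; have := H2 n; rewrite /= sub0r normrN ger0_norm.
    by apply; rewrite ltnW// ltnS leq_max leqnn orbT.
  by apply: E_ge0 => p; exact: sqr_ge0.
Qed.

End time_discretization.

Lemma normv_sum {R : realType} {d : nat} (x : 'cV[R]_d) : `|x| <= \sum_i `|x i 0|.
Proof.
rewrite [leLHS]mx_normrE; apply: bigmax_le; first exact: sumr_ge0.
by move=> [i j] _ /=; rewrite (ord1 j) (bigD1 i)//= lerDl sumr_ge0.
Qed.

Section drift_approximation.
Context {R : realType} {d : nat} {disp} {Omega : measurableType disp}.
Variables (P : probability Omega R) (P_complete : measure_is_complete P)
  (W : process R d Omega) (BW : brownian_motion P W) (T : R) (T0 : 0 < T).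
Local Notation mu := (@lebesgue_measure R).
Local Notation Q := (QT P T0).
Variables (beta : 'cV[R]_d -> 'cV[R]_d) (Cb : R) (sg : 'I_d -> R) (x : 'cV[R]_d).
Hypotheses (beta_meas : measurable_fun [set: borelV R d] (beta : borelV R d -> borelV R d))
  (Cb0 : 0 <= Cb) (beta_growth : forall y i, beta y i 0 ^+ 2 <= Cb * (1 + sqnormv y)).

Lemma beta_coord_meas i : measurable_fun [set: borelV R d] ((fun y => beta y i 0) : borelV R d -> R).
Proof. exact: measurableT_comp (measurable_coordv i) beta_meas. Qed.

Section one.
Variables (w X : process R d Omega).
Hypotheses (pw : forall i, progr P W (fun s o => w s o i 0))
  (ew : (\int[P]_o \int[mu]_(s in `[0%R, T]) (sqnormv (w s o))%:E < +oo)%E)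
  (solX : solution P W T beta sg x w X).

Let sol_progr : forall i, progr P W (fun s o => X s o i 0).
Proof. by case: solX. Qed.

Lemma beta_sqr_L1 i : L1 Q (at_time T (fun s o => beta (X s o) i 0 ^+ 2)).
Proof.
have LX := solution_moment P_complete BW T0 beta_meas Cb0 beta_growth pw ew solX.
have m : measurable_fun setT (at_time T (fun s o => beta (X s o) i 0 ^+ 2) : Omega * measurableTypeR R -> R).
  apply: measurable_funX.
  exact: measurableT_comp (beta_coord_meas i) (state_meas P_complete BW T0 sol_progr).
apply: (L1_dom m (L1Z Cb (L1D (bmeas_L1 _ (bmeas_cst 1)) LX))) => p.
by rewrite ger0_norm ?sqr_ge0//; exact: beta_growth.
Qed.

Lemma drift_error_energy (c : 'cV[R]_d -> 'cV[R]_d) Lc Kc M : (forall i, lipschitzv Lc (fun y => c y i 0)) ->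
  (forall y, `|c y| <= Kc) ->
  \int[P]_o energy T (drift_error T beta c M X) o = T * \sum_i \int[Q]_p
    at_time T (fun s o => (beta (X s o) i 0 - sstep T M (fun y => c y i 0) X s o) ^+ 2) p.
Proof.
move=> cL cK; have L := drift_error_L1 P_complete BW T0 beta_meas Cb0 beta_growth M cL cK pw ew solX.
have pe : forall i, progr P W (fun s o => drift_error T beta c M X s o i 0).
  by apply: (drift_error_progr T0 beta_meas); first exact: cL; exact: solX.
have [_ ->] := energy_QT P_complete BW pe L; congr (T * _).
have eE s o i : drift_error T beta c M X s o i 0 = beta (X s o) i 0 - sstep T M (fun y => c y i 0) X s o.
  rewrite drift_errorE; congr (_ - _); rewrite /step_drift /simple_control summxE.
  by apply: eq_bigr => k _; rewrite mxE.
have LS (i : 'I_d) : L1 Q (fun p => at_time T (fun s o => (beta (X s o) i 0 - sstep T M (fun y => c y i 0) X s o) ^+ 2) p).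
  have m : measurable_fun setT (at_time T (fun s o => (beta (X s o) i 0 - sstep T M (fun y => c y i 0) X s o) ^+ 2) : Omega * measurableTypeR R -> R).
    apply: measurable_funX; apply: measurable_funB.
      exact: measurableT_comp (beta_coord_meas i) (state_meas P_complete BW T0 sol_progr).
    exact: (sstep_meas P_complete BW T0 M (lipschitz_measurable (cL i)) sol_progr).
  apply: (L1_dom m L) => p; rewrite ger0_norm ?sqr_ge0// /at_time -eE.
  by rewrite /sqnormv /dotv (bigD1 i)//= -expr2 lerDl sumr_ge0// => j _; rewrite -expr2 sqr_ge0.
rewrite -(E_sumI (index_enum 'I_d) LS); apply: eq_Rintegral => p _.
by rewrite /at_time /sqnormv /dotv; apply: eq_bigr => i _; rewrite eE expr2.
Qed.

End one.

Variables (w1 X1 w2 X2 : process R d Omega).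
Hypotheses (pw1 : forall i, progr P W (fun s o => w1 s o i 0))
  (ew1 : (\int[P]_o \int[mu]_(s in `[0%R, T]) (sqnormv (w1 s o))%:E < +oo)%E)
  (solX1 : solution P W T beta sg x w1 X1)
  (pw2 : forall i, progr P W (fun s o => w2 s o i 0))
  (ew2 : (\int[P]_o \int[mu]_(s in `[0%R, T]) (sqnormv (w2 s o))%:E < +oo)%E)
  (solX2 : solution P W T beta sg x w2 X2).

Lemma drift_approx (e : R) : 0 < e -> exists (c : 'cV[R]_d -> 'cV[R]_d) (Lc Kc : R),
  [/\ 0 <= Lc, forall i, lipschitzv Lc (fun y => c y i 0), forall y, `|c y| <= Kc &
  exists M0, forall M, (M0 <= M)%N ->
    \int[P]_o energy T (drift_error T beta c M X1) o <= e /\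
    \int[P]_o energy T (drift_error T beta c M X2) o <= e].
Proof.
move=> e0; have [pX1 cX1 _] := solX1; have [pX2 cX2 _] := solX2.
have Td : 0 < T * (d%:R + 1) by rewrite mulr_gt0// ltr_wpDl.
(* The accuracy is shared among the [d] coordinates; the added 1 keeps the denominator positive for
   [d = 0]. *)
pose e' := e / (T * (d%:R + 1)).
have e'0 : 0 < e' by rewrite divr_gt0.
have : forall i, exists q : ('cV[R]_d -> R) * R * R * nat,
  [/\ 0 <= q.1.1.2, 0 <= q.1.2, lipschitzv q.1.1.2 q.1.1.1, forall y, `|q.1.1.1 y| <= q.1.2 &
   forall M, (q.2 <= M)%N ->
   \int[Q]_p at_time T (fun s o => (beta (X1 s o) i 0 - sstep T M q.1.1.1 X1 s o) ^+ 2) p <= e' /\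
   \int[Q]_p at_time T (fun s o => (beta (X2 s o) i 0 - sstep T M q.1.1.1 X2 s o) ^+ 2) p <= e'].
  move=> i.
  have [f [L [K [L0 K0 fL fK [M0 H]]]]] := step_approx2 P_complete BW pX1 cX1 pX2 cX2
    (beta_coord_meas i) (beta_sqr_L1 pw1 ew1 solX1 i) (beta_sqr_L1 pw2 ew2 solX2 i) e'0.
  by exists (f, L, K, M0).
move=> /choice[q qP].
pose c y : 'cV[R]_d := \col_i (q i).1.1.1 y.
have cE i : (fun y => c y i 0) = (q i).1.1.1 by apply/funext => y; rewrite mxE.
pose Lc := \sum_i (q i).1.1.2; pose Kc := \sum_i (q i).1.2.
have Lc0 : 0 <= Lc by apply: sumr_ge0 => i _; have [] := qP i.
have cL i : lipschitzv Lc (fun y => c y i 0).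
  rewrite cE; have [l0 _ h _ _] := qP i; apply: lipschitzv_weaken h.
  by rewrite /Lc (bigD1 i)//= lerDl sumr_ge0// => j _; have [] := qP j.
have cK y : `|c y| <= Kc.
  by apply: le_trans (normv_sum _) _; apply: ler_sum => i _; rewrite mxE; have [_ _ _ h _] := qP i.
exists c, Lc, Kc; split => //; exists (\max_(i < d) (q i).2)%N => M MM.
have arith (a : 'I_d -> R) : (forall i, a i <= e') -> T * \sum_i a i <= e.
  move=> ae; rewrite mulrC -ler_pdivlMr//.
  apply: (@le_trans _ _ (\sum_(i < d) e')); first exact: ler_sum.
  rewrite sumr_const card_ord -mulr_natl /e' invfM mulrA mulrA ler_pdivrMr ?ltr_wpDl//.
  have eT : 0 <= e / T by rewrite divr_ge0// ltW.
  by rewrite -mulrA mulrC [leRHS]mulrDr mulr1 lerDl.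
have E1 := drift_error_energy pw1 ew1 solX1 M cL cK.
have E2 := drift_error_energy pw2 ew2 solX2 M cL cK.
rewrite {}E1 {}E2.
have Mi i : ((q i).2 <= M)%N by apply: leq_trans MM; exact: (leq_bigmax i).
split; apply: arith => i; rewrite cE; have [_ _ _ _ h] := qP i; by have [] := h M (Mi i).
Qed.

End drift_approximation.

Lemma dl_sum {R : realType} (T : R) M : (2 ^ M)%:R * dl T M = T.
Proof. by rewrite /dl mulrC divfK// pnatr_eq0 expn_eq0. Qed.

Section running_cost.
Context {R : realType} {d : nat} {disp} {Omega : measurableType disp}.
Variables (P : probability Omega R) (P_complete : measure_is_complete P)
  (W : process R d Omega) (BW : brownian_motion P W) (T : R) (T0 : 0 < T).
Local Notation mu := (@lebesgue_measure R).
Local Notation Q := (QT P T0).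
Local Notation dl := (dl T).

Definition riemann (rho : 'cV[R]_d -> R) M (z : nat -> 'cV[R]_d) : R :=
  \sum_(k < 2 ^ M) dl M * rho (z k).

Definition cost_int (g : 'cV[R]_d -> R) (X : process R d Omega) (o : Omega) : R :=
  \int[mu]_(s in `[0, T]) g (X s o).

Lemma riemann_grid rho M (X : process R d Omega) o : riemann rho M (grid T M X o) =
  \int[mu]_(s in `[0, T]) sstep T M rho X s o.
Proof. by rewrite (sstep_int T0). Qed.

Lemma riemann_itv rho K M z : (forall y, 0 <= rho y <= K) -> 0 <= riemann rho M z <= T * K.
Proof.
move=> rK; have d0 := ltW (dl_gt0 T0 M); rewrite /riemann sumr_ge0/= => [|k _]; last first.
  by rewrite mulr_ge0//; case/andP: (rK (z k)).
rewrite -[X in X * K](dl_sum T M) -mulrA mulr_natl -[X in _ *+ X](card_ord (2 ^ M)) -sumr_const.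
by apply: ler_sum => k _; rewrite ler_wpM2l//; case/andP: (rK (z k)).
Qed.

Lemma riemann_lipS rho L M : lipschitzv L rho -> lipS (2 ^ M) (dl M * L) (riemann rho M).
Proof.
move=> rL y y'; rewrite /riemann -sumrB; apply: le_trans (ler_norm_sum _ _ _) _.
rewrite mulr_sumr; apply: ler_sum => k _; rewrite -mulrBr normrM (gtr0_norm (dl_gt0 T0 M)) -mulrA.
by rewrite ler_wpM2l ?(ltW (dl_gt0 T0 M)).
Qed.

Lemma riemann_meas rho L M : lipschitzv L rho -> measurable_fun [set: seqV R d] (riemann rho M : seqV R d -> R).
Proof.
move=> rL; apply: measurable_sum => k; apply: measurable_funM; first exact: measurable_cst.
exact: measurableT_comp (lipschitz_measurable rL) (measurable_seqV_coord k).
Qed.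

Variables (g : 'cV[R]_d -> R) (K : R).
Hypotheses (mg : measurable_fun [set: borelV R d] (g : borelV R d -> R)) (K0 : 0 < K)
  (gK : forall y, 0 <= g y <= K).
Variable X : process R d Omega.
Hypothesis pX : forall i, progr P W (fun s o => X s o i 0).

Let pg : progr P W (fun s o => g (X s o)).
Proof. exact: comp_progr. Qed.

Lemma cost_iL o : iL `[0, T] (fun s => g (X s o)).
Proof.
apply: (iL_bound (M := K)) => [|s _].
  exact: (@progr_section _ _ _ _ P W _ _ (fun s o => g (X s o)) T o (ltW T0) pg).
by case/andP: (gK (X s o)) => h1 h2; rewrite ger0_norm.
Qed.

Lemma cost_int_meas : measurable_fun [set: g_sigma_algebraType (completed_filtration P W T)]
  (cost_int g X : g_sigma_algebraType (completed_filtration P W T) -> R).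
Proof. exact: (progr_int (ltW T0) pg). Qed.

Lemma cost_int_itv o : 0 <= cost_int g X o <= T * K.
Proof.
have g0 s : 0 <= g (X s o) by case/andP: (gK (X s o)).
rewrite /cost_int Rintegral_ge0//=; rewrite mulrC -int_cst0 ?(ltW T0)//.
apply: le_Rintegral => //; [exact: cost_iL|exact: iL_cst|].
by move=> s _; case/andP: (gK (X s o)).
Qed.

Lemma cost_int_bmeas : bmeas (cost_int g X).
Proof.
split; first exact: (fmeas_setT P_complete BW (ltW T0) cost_int_meas).
by exists (T * K) => o; case/andP: (cost_int_itv o) => h1 h2; rewrite ger0_norm.
Qed.

Lemma riemann_bmeas rho L M : lipschitzv L rho -> (forall y, 0 <= rho y <= K) ->
  bmeas (fun o => riemann rho M (grid T M X o)).
Proof.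
move=> rL rK; have pr : forall i, progr P W (fun s o => X s o i 0) by [].
split; last first.
  by exists (T * K) => o; case/andP: (riemann_itv M (grid T M X o) rK) => h1 h2; rewrite ger0_norm.
rewrite (_ : (fun o => _) = fun o => \int[mu]_(s in `[0, T]) sstep T M rho X s o); last first.
  by apply/funext => o; exact: riemann_grid.
apply: (fmeas_setT P_complete BW (ltW T0)); apply: (progr_int (ltW T0)).
exact: (@sstep_progr _ _ _ _ P W T T0 M rho X (lipschitz_measurable rL) pX).
Qed.

(** The Riemann sum is the exact integral of the step process, so the error is at most the time
    integral of the pointwise one, whose mean is [T] times a mean under [QT]. *)
Lemma cost_approx rho L M : lipschitzv L rho -> (forall y, 0 <= rho y <= K) ->
  \int[P]_o `|riemann rho M (grid T M X o) - cost_int g X o| <=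
  T * \int[Q]_p `|at_time T (sstep T M rho X) p - at_time T (fun s o => g (X s o)) p|.
Proof.
move=> rL rK; have mr := lipschitz_measurable rL.
have ps : progr P W (sstep T M rho X) by exact: (@sstep_progr _ _ _ _ P W T T0 M rho X mr pX).
pose D s o := `|sstep T M rho X s o - g (X s o)|.
have pD : progr P W D.
  move=> t t0; apply: (measurableT_comp (f := fun r : R => `|r|)) => //.
  by apply: measurable_funB; [exact: ps|exact: pg].
have D0 s o : 0 <= D s o by exact: normr_ge0.
have sK s o : `|sstep T M rho X s o| <= K.
  by apply: (sstep_le T0) => [|y]; [exact: ltW|case/andP: (rK y) => h1 h2; rewrite ger0_norm].
have DK s o : D s o <= 2 * K.
  rewrite (le_trans (ler_normB _ _))// mulr2n mulrDl mul1r lerD//.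
  by case/andP: (gK (X s o)) => h1 h2; rewrite ger0_norm.
have iD o : iL `[0, T] (D ^~ o).
  apply: (iL_bound (M := 2 * K)) => [|s _]; last by rewrite ger0_norm.
  exact: (@progr_section _ _ _ _ P W _ _ D T o (ltW T0) pD).
have is_ o : iL `[0, T] (fun s => sstep T M rho X s o).
  apply: (iL_bound (M := K)) => [|s _]; last exact: sK.
  exact: (@progr_section _ _ _ _ P W _ _ (sstep T M rho X) T o (ltW T0) ps).
have bI : bmeas (fun o => \int[mu]_(s in `[0, T]) D s o).
  split.
    by apply: (fmeas_setT P_complete BW (ltW T0)); exact: (progr_int (ltW T0) pD).
  exists (2 * K * T) => o; rewrite ger0_norm ?Rintegral_ge0// -int_cst0 ?(ltW T0)//.
  by apply: le_Rintegral => //; [exact: iD|exact: iL_cst].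
have e o : (\int[mu]_(s in `[0%R, T]) (D s o)%:E = (\int[mu]_(s in `[0, T]) D s o)%:E)%E.
  by rewrite /Rintegral fineK//; exact: integrable_fin_num (iD o).
have eP : (\int[P]_o \int[mu]_(s in `[0%R, T]) (D s o)%:E =
    (\int[P]_o \int[mu]_(s in `[0, T]) D s o)%:E)%E.
  by under eq_integral => o _ do rewrite e; rewrite EFinE//; exact: bmeas_L1.
have [|_ h] := @at_time_L1 _ _ _ _ P P_complete W BW T T0 D pD D0; first by rewrite eP ltry.
have -> : T * \int[Q]_p `|at_time T (sstep T M rho X) p - at_time T (fun s o => g (X s o)) p| =
    \int[P]_o \int[mu]_(s in `[0, T]) D s o.
  by apply: EFin_inj; rewrite -eP h.
apply: le_E; [|exact: bmeas_L1|].
  by apply/bmeas_L1/bmeas_norm/bmeasB; [exact: riemann_bmeas rL rK|exact: cost_int_bmeas].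
move=> o; rewrite riemann_grid /cost_int -RintegralB//; [|exact: is_|exact: cost_iL].
by apply: le_normr_Rintegral => //; apply: iLB => //; exact: cost_iL.
Qed.

End running_cost.

(** * The variational formula at a fixed horizon *)

Lemma ln_leD {R : realType} (a b r : R) : 1 <= b -> 0 <= r -> a <= b + r -> 0 < a ->
  ln a <= ln b + r.
Proof.
move=> b1 r0 ab a0; have b0 : 0 < b by exact: lt_le_trans b1.
have br : 0 < b + r by rewrite ltr_wpDr.
apply: (@le_trans _ _ (ln (b + r))); first by rewrite ler_ln.
have -> : b + r = b * (1 + r / b) by rewrite mulrDr mulr1 mulrC divfK// gt_eqF.
have q0 : 0 <= r / b by rewrite divr_ge0// ltW.
rewrite lnM ?posrE ?ltr_wpDr// lerD2l; apply: (@le_trans _ _ (r / b)).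
  by apply: le_ln1Dx; apply: lt_le_trans q0; rewrite ltrN10.
by rewrite ler_pdivrMr// ler_peMr.
Qed.

Lemma ln_dist {R : realType} (a b : R) : 1 <= a -> 1 <= b -> `|ln a - ln b| <= `|a - b|.
Proof.
wlog ab : a b / b <= a.
  by move=> H a1 b1; have [ba|/ltW ab] := leP b a; [|rewrite distrC [leRHS]distrC]; exact: H.
move=> a1 b1; have [a0 b0] : 0 < a /\ 0 < b by split; exact: lt_le_trans ltr01 _.
rewrite !ger0_norm ?subr_ge0 ?ler_ln ?posrE// lerBlDl; apply: ln_leD => //.
  by rewrite subr_ge0.
by rewrite addrC subrK.
Qed.

Lemma le_small {R : realType} (A B D : R) :
  (forall th, 0 < th -> th <= 1 -> A <= B + D * th) -> A <= B.
Proof.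
move=> H; apply/ler_addgt0Pr => e e0; have D1 : 0 < `|D| + 1 by rewrite ltr_wpDl.
pose th := Num.min 1 (e / (`|D| + 1)).
have t0 : 0 < th by rewrite lt_min ltr01 divr_gt0.
have t1 : th <= 1 by rewrite ge_min lexx.
have t2 : th <= e / (`|D| + 1) by rewrite ge_min lexx orbT.
apply: le_trans (H th t0 t1) _; rewrite lerD2l.
apply: (@le_trans _ _ ((`|D| + 1) * th)).
  by rewrite ler_wpM2r ?(ltW t0)// (le_trans (ler_norm D))// lerDl.
by rewrite mulrC -ler_pdivlMr.
Qed.

Section exponential_mean.
Context {disp} {Omega : measurableType disp} {R : realType} (P : probability Omega R).

Lemma E_expR_ge1 (b : Omega -> R) : bmeas b -> (forall o, 0 <= b o) ->
  1 <= \int[P]_o expR (b o).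
Proof.
move=> bb b0; rewrite -[leLHS](E_cst P); apply: le_E; [exact/bmeas_L1/bmeas_cst|exact/bmeas_L1/bmeas_expR|].
by move=> o; rewrite -expR0 ler_expR.
Qed.

Lemma E_expR_gt0 (b : Omega -> R) : bmeas b -> 0 < \int[P]_o expR (b o).
Proof.
move=> bb; have [_ [K bK]] := bb; apply: (lt_le_trans (expR_gt0 (- K))).
rewrite -[leLHS](E_cst P); apply: le_E; [exact/bmeas_L1/bmeas_cst|exact/bmeas_L1/bmeas_expR|].
by move=> o; rewrite ler_expR; have := bK o; rewrite ler_norml => /andP[].
Qed.

Lemma ln_E_le (a b : Omega -> R) C : bmeas a -> bmeas b -> (forall o, a o <= C) ->
  (forall o, 0 <= b o <= C) ->
  ln (\int[P]_o expR (a o)) <= ln (\int[P]_o expR (b o)) + expR C * \int[P]_o `|a o - b o|.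
Proof.
move=> ba bb aC bC; have bd := bmeas_norm (bmeasB ba bb).
apply: ln_leD.
- by apply: E_expR_ge1 => // o; case/andP: (bC o).
- by rewrite mulr_ge0 ?expR_ge0// E_ge0.
- have La := bmeas_L1 P (bmeas_expR ba); have Lb := bmeas_L1 P (bmeas_expR bb).
  have Ld := bmeas_L1 P bd.
  rewrite -EZ// -ED//; last exact: L1Z.
  apply: le_E => //; first by apply: L1D => //; exact: L1Z.
  move=> o; rewrite -lerBlDl; apply: le_trans (ler_norm _) _.
  by apply: expR_lip => //; case/andP: (bC o).
- exact: E_expR_gt0.
Qed.

End exponential_mean.

Lemma dist_double {R : realType} (h r p : R) : `|2 * h - r - p| <= 2 * `|h - p| + `|r - p|.
Proof.
have -> : 2 * h - r - p = 2 * (h - p) - (r - p) by lra.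
by apply: le_trans (ler_normB _ _) _; rewrite normrM (ger0_norm (ler0n _ 2)).
Qed.

Lemma arith_upper {R : realType} (a r En l1 l2 D C th : R) : a <= r + th ->
  l1 <= l2 + C * th -> r - En <= l1 + D * th -> a - En <= l2 + (1 + C + D) * th.
Proof. by rewrite !mulrDl mul1r; lra. Qed.

Lemma arith_lower {R : realType} (A B H En a r l C D eta th : R) :
  A <= B + eta -> B - eta <= H - 2^-1 * En -> r <= a + th ->
  2 * H - r - 2^-1 * En <= l + D * th -> l <= A + C * (2 * eta + th) ->
  A - (4 + 2 * C) * eta <= a - 2^-1 * En + (C + D + 1) * th.
Proof. by rewrite !mulrDl mulrDr mul1r; lra. Qed.

Section variational_bounds.
Context {R : realType} {d : nat} {disp} {Omega : measurableType disp}.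
Variables (P : probability Omega R) (P_complete : measure_is_complete P)
  (W : process R d Omega) (BW : brownian_motion P W) (T : R) (T0 : 0 < T).
Local Notation mu := (@lebesgue_measure R).
Local Notation Q := (QT P T0).
Variables (beta : 'cV[R]_d -> 'cV[R]_d) (Cb : R) (sg : 'I_d -> R) (x : 'cV[R]_d).
Hypotheses (beta_meas : measurable_fun [set: borelV R d] (beta : borelV R d -> borelV R d))
  (Cb0 : 0 <= Cb) (beta_growth : forall y i, beta y i 0 ^+ 2 <= Cb * (1 + sqnormv y)).
Variables (g : 'cV[R]_d -> R) (K : R).
Hypotheses (mg : measurable_fun [set: borelV R d] (g : borelV R d -> R)) (K0 : 0 < K)
  (gK : forall y, 0 <= g y <= K).
Variable X0 : process R d Omega.
Hypothesis solX0 : solution P W T beta sg x (fun _ _ => 0) X0.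

Let pX0 : forall i, progr P W (fun s o => X0 s o i 0).
Proof. by case: solX0. Qed.

(** One drift, one cost and one grid serve both [X] and [X0]. The grid is [m + j] so that a
    functional fixed beforehand on the grid [m] can be read on it. *)
Lemma discretize (w X : process R d Omega) (m : nat) (e : R) :
  (forall i, progr P W (fun s o => w s o i 0)) ->
  (\int[P]_o \int[mu]_(s in `[0%R, T]) (sqnormv (w s o))%:E < +oo)%E ->
  solution P W T beta sg x w X -> 0 < e ->
  exists (c : 'cV[R]_d -> 'cV[R]_d) (Lc Kc : R) (rho : 'cV[R]_d -> R) (Lr : R) (j : nat),
  [/\ 0 <= Lc, forall i, lipschitzv Lc (fun y => c y i 0), forall y, `|c y| <= Kc,
      0 <= Lr & lipschitzv Lr rho /\ forall y, 0 <= rho y <= K] /\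
  [/\ \int[P]_o energy T (drift_error T beta c (m + j) X) o <= e,
      \int[P]_o energy T (drift_error T beta c (m + j) X0) o <= e,
      \int[P]_o `|riemann T rho (m + j) (grid T (m + j) X o) - cost_int T g X o| <= e &
      \int[P]_o `|riemann T rho (m + j) (grid T (m + j) X0 o) - cost_int T g X0 o| <= e].
Proof.
move=> pw ew solX e0; have [pX cX _] := solX; have [_ cX0 _] := solX0.
have ew0 : (\int[P]_o \int[mu]_(s in `[0%R, T]) (sqnormv ((fun _ _ => 0 : 'cV[R]_d) s o))%:E < +oo)%E
  by exact: zero_control_energy.
 have pw0 := @zero_control_progr R d disp Omega P W.
have [c [Lc [Kc [Lc0 cL cK [M1 H1]]]]] :=
  drift_approx P_complete BW T0 beta_meas Cb0 beta_growth pw ew solX pw0 ew0 solX0 e0.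
have eT : 0 < e / T by rewrite divr_gt0.
have [rho [Lr [Lr0 rL rK [M2 H2]]]] := step_approx P_complete BW T0 pX cX pX0 cX0 mg K0 gK eT.
exists c, Lc, Kc, rho, Lr, (maxn M1 M2); split; first by [].
have [|e1 e2] := H1 (m + maxn M1 M2)%N.
  by rewrite (leq_trans (leq_maxl _ _) (leq_addl _ _)).
have [|e3 e4] := H2 (m + maxn M1 M2)%N.
  by rewrite (leq_trans (leq_maxr _ _) (leq_addl _ _)).
have eE : e = T * (e / T) by rewrite mulrC divfK// gt_eqF.
split => //.
- apply: le_trans (cost_approx P_complete BW T0 mg K0 gK pX _ rL rK) _.
  by rewrite [leRHS]eE ler_wpM2l// ltW.
- apply: le_trans (cost_approx P_complete BW T0 mg K0 gK pX0 _ rL rK) _.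
  by rewrite [leRHS]eE ler_wpM2l// ltW.
Qed.

Local Notation TK := (T * K).
Let TK0 : 0 <= TK. Proof. by rewrite mulr_ge0// ltW. Qed.

Let bPhi (X : process R d Omega) : (forall i, progr P W (fun s o => X s o i 0)) ->
  bmeas (cost_int T g X).
Proof. move=> pX; exact: (cost_int_bmeas P_complete BW T0 mg gK pX). Qed.

Let Phi_itv (X : process R d Omega) o : (forall i, progr P W (fun s o => X s o i 0)) ->
  0 <= cost_int T g X o <= TK.
Proof. move=> pX; exact: (cost_int_itv T0 mg gK pX). Qed.

Let riemann_norm (rho : 'cV[R]_d -> R) M z : (forall y, 0 <= rho y <= K) -> `|riemann T rho M z : R| <= TK.
Proof. by move=> rK; case/andP: (riemann_itv T0 M z rK) => h1 h2; rewrite ger0_norm. Qed.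

Lemma sqr_le1 (th : R) : 0 < th -> th <= 1 -> th ^+ 2 <= th.
Proof. by move=> t0 t1; rewrite expr2 ger_pMr. Qed.

(** [comparison] with [F1] the Riemann sum of the cost and [F2 = 0], then [th] to 0; the constant
    [D] does not involve the functions produced by [discretize]. *)
Lemma bounded_upper (w X : process R d Omega) :
  (forall i, progr P W (fun s o => w s o i 0)) ->
  (\int[P]_o \int[mu]_(s in `[0%R, T]) (sqnormv (w s o))%:E < +oo)%E ->
  solution P W T beta sg x w X ->
  \int[P]_o cost_int T g X o - 2^-1 * \int[P]_o energy T w o <=
  ln (\int[P]_o expR (cost_int T g X0 o)).
Proof.
move=> pw ew solX; have [pX _ _] := solX.
pose En := \int[P]_o energy T w o.
pose D := @comparison_cst R d T TK 0 En.
apply: (@le_small _ _ _ (1 + expR TK + D)) => th t0 t1.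
have [c [Lc [Kc [rho [Lr [j [[Lc0 cL cK Lr0 [rL rK]] [e1 e2 e3 e4]]]]]]]] :=
  discretize 0 pw ew solX (exprn_gt0 2 t0).
move: e1 e2 e3 e4; rewrite add0n => e1 e2 e3 e4.
have dL0 : 0 <= dl T j * Lr by rewrite mulr_ge0// ltW// dl_gt0.
pose Z : seqV R d -> R := fun=> 0.
have mZ : measurable_fun [set: seqV R d] Z by exact: measurable_cst.
have ZC y : `|Z y| <= TK by rewrite normr0.
have ZL : lipS (2 ^ j) 0 Z by move=> y y'; rewrite subrr normr0 mul0r.
have h := comparison P_complete BW T0 beta_meas Cb0 beta_growth Lc0 cL cK
  (riemann_meas T j rL) mZ (fun y => riemann_norm j y rK) ZC dL0 (lexx 0)
  (riemann_lipS T0 j rL) ZL t0 t1 pw ew solX solX0 e1 e2.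
have bR := riemann_bmeas P_complete BW T0 pX j rL rK.
have bR0 := riemann_bmeas P_complete BW T0 pX0 j rL rK.
have k1 : \int[P]_o cost_int T g X o <= \int[P]_o riemann T rho j (grid T j X o) + th.
  rewrite -lerBlDl; apply: le_trans (ler_norm _) _; rewrite distrC.
  apply: le_trans (le_distE (bmeas_L1 P bR) (bmeas_L1 P (bPhi pX))) _.
  exact: le_trans e3 (sqr_le1 t0 t1).
have k2 : ln (\int[P]_o expR (riemann T rho j (grid T j X0 o))) <=
    ln (\int[P]_o expR (cost_int T g X0 o)) + expR TK * th.
  apply: le_trans (ln_E_le P bR0 (bPhi pX0) _ (fun o => Phi_itv o pX0)) _.
    by move=> o; apply: le_trans (ler_norm _) (riemann_norm _ _ rK).
  by rewrite lerD2l ler_wpM2l ?expR_ge0// (le_trans e4)// sqr_le1.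
have k3 : \int[P]_o riemann T rho j (grid T j X o) - 2^-1 * En <=
    ln (\int[P]_o expR (riemann T rho j (grid T j X0 o))) + D * th.
  move: h; under eq_Rintegral do rewrite addr0.
  by under [in X in ln X]eq_Rintegral do rewrite addr0.
exact: arith_upper k1 k2 k3.
Qed.

Lemma bounded_lower (Xs : process R d Omega -> process R d Omega) (e : R) :
  (forall w, admissible P W w -> solution P W T beta sg x w (Xs w)) -> 0 < e ->
  exists2 w, admissible P W w &
  ln (\int[P]_o expR (cost_int T g X0 o)) - e <=
  \int[P]_o cost_int T g (Xs w) o - 2^-1 * \int[P]_o energy T w o.
Proof.
move=> solXs e0; have bP0 := bPhi pX0; pose B := expR TK.
have B0 : 0 < B by exact: expR_gt0.
pose CH := ln (1 + B); have CH0 : 0 <= CH by rewrite ln_ge0// lerDl ltW.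
pose C := 2 * CH + TK.
have C40 : 0 < 4 + 2 * expR C by rewrite ltr_pwDl// mulr_ge0// expR_ge0.
(* The 4: two losses of [eta] separate [ln E e^Phi] from the value of [w] for [H], and they count
   twice because of the factor 2 in 2 H - Phi. The [2 * expR C]: along the uncontrolled motion 2 H -
   Phi is within [2 eta] of Phi in mean, and [exp C] transfers this to the logarithm. *)
pose eta := e / (4 + 2 * expR C); have eta0 : 0 < eta by rewrite divr_gt0.
have eB o : 0 <= expR (cost_int T g X0 o) - 1 <= B.
  have /andP[p0 p1] := Phi_itv o pX0; rewrite subr_ge0 -[X in X <= _]expR0 ler_expR p0/=.
  by rewrite lerBlDr (le_trans (_ : _ <= B)) ?ler_expR// lerDl.
have mf : measurable_fun [set: g_sigma_algebraType (completed_filtration P W T)]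
    ((fun o => expR (cost_int T g X0 o) - 1) : g_sigma_algebraType (completed_filtration P W T) -> R).
  apply: measurable_funB; last exact: measurable_cst.
  apply: measurableT_comp; first exact: measurable_expR.
  exact: (cost_int_meas T0 mg pX0).
(* What is approximated is [e^Phi - 1], which is nonnegative, so that [G = 1 + F] stays at least 1.
   On [[1, +oo[] the logarithm is 1-Lipschitz, and [H = ln G] inherits the error [eta]. *)
have [m [L [F [nF FB Fe]]]] := nice_dense P_complete BW T0 mf B0 eB eta0.
pose G y := 1 + F y.
have nG : nice (1 + L) (2 ^ m) G.
  by have := niceD (nice_cst (2 ^ m) 1) nF; rewrite normr1.
have GB y : 1 <= G y <= 1 + B by have /andP[f0 f1] := FB y; rewrite lerDl f0 lerD2l.
have [w aw lw] := entropy_lower P_complete BW T0 nG GB eta0.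
exists w => //; have solX := solXs w aw; set X := Xs w in solX *.
have [pX _ _] := solX.
have pw i : progr P W (fun s o => w s o i 0) by apply: progr_coord; case: aw.
have ew := admissible_energy T0 aw.
pose En := \int[P]_o energy T w o; pose H y := ln (G y).
have H_itv y : 0 <= H y <= CH.
  have /andP[g1 g2] := GB y; rewrite /H ln_ge0//= ler_ln ?posrE//.
    exact: lt_le_trans ltr01 g1.
  by rewrite ltr_pwDl// ltW.
have [mG _ _ _] := nG.
have mH : measurable_fun [set: seqV R d] (H : seqV R d -> R).
  exact: measurableT_comp (@measurable_ln R) mG.
have bG : bmeas (fun o => G (incr T W m o)).
  apply: (bmeas_comp (f := G)) (measurable_incrW BW T0 m); split => //.
  by exists (1 + B) => y; have /andP[g1 g2] := GB y; rewrite ger0_norm// (le_trans ler01).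
have bH : bmeas (fun o => H (incr T W m o)).
  apply: (bmeas_comp (f := H)) (measurable_incrW BW T0 m); split => //.
  by exists CH => y; have /andP[g1 g2] := H_itv y; rewrite ger0_norm.
have bHs : bmeas (fun o => H (incr T (shifted W w) m o)).
  apply: (bmeas_comp (f := H)); last by apply: (shifted_incr_meas P_complete BW T0).
  by split => //; exists CH => y; have /andP[g1 g2] := H_itv y; rewrite ger0_norm.
have GE : \int[P]_o `|G (incr T W m o) - expR (cost_int T g X0 o)| <= eta.
  apply: le_trans Fe; rewrite le_eqVlt; apply/orP; left; apply/eqP.
  by apply: eq_Rintegral => o _; rewrite /G opprB addrA [F _ + 1]addrC.
have be := bmeas_expR bP0.
have k1 : ln (\int[P]_o expR (cost_int T g X0 o)) <= ln (\int[P]_o G (incr T W m o)) + eta.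
  apply: ln_leD; [|exact: ltW| |exact: E_expR_gt0].
    rewrite -[leLHS](E_cst P); apply: le_E; [exact/bmeas_L1/bmeas_cst|exact: bmeas_L1|].
    by move=> o; case/andP: (GB (incr T W m o)).
  rewrite -lerBlDl; apply: le_trans (ler_norm _) _; rewrite distrC.
  exact: le_trans (le_distE (bmeas_L1 P bG) (bmeas_L1 P be)) GE.
have k2 : \int[P]_o `|H (incr T W m o) - cost_int T g X0 o| <= eta.
  apply: le_trans GE; apply: le_E.
  - by apply/bmeas_L1/bmeas_norm/bmeasB.
  - by apply/bmeas_L1/bmeas_norm/bmeasB.
  - move=> o; rewrite -[X in `|_ - X|]expRK; apply: ln_dist.
      by case/andP: (GB (incr T W m o)).
    by rewrite -expR0 ler_expR; case/andP: (Phi_itv o pX0).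
have TKC : TK <= C by rewrite lerDr mulr_ge0.
pose D := @comparison_cst R d T C (2 * (1 + L)) En.
suff : ln (\int[P]_o expR (cost_int T g X0 o)) - (4 + 2 * expR C) * eta <=
    \int[P]_o cost_int T g X o - 2^-1 * En.
  by rewrite /eta [_ * (e / _)]mulrC divfK// gt_eqF.
(* [w], [H] and [D] are fixed from here on; only the scale [th] of the discretization errors
   varies. *)
apply: (@le_small _ _ _ (expR C + D + 1)) => th t0 t1.
have [c [Lc [Kc [rho [Lr [j [[Lc0 cL cK Lr0 [rL rK]] [e1 e2 e3 e4]]]]]]]] :=
  discretize m pw ew solX (exprn_gt0 2 t0).
set M := (m + j)%N in e1 e2 e3 e4.
have bR := riemann_bmeas P_complete BW T0 pX M rL rK.
have bR0 := riemann_bmeas P_complete BW T0 pX0 M rL rK.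
pose F1 y := - riemann T rho M y; pose F2 y := 2 * H (ref j y).
have mF1 : measurable_fun [set: seqV R d] (F1 : seqV R d -> R).
  rewrite (_ : F1 = fun y : seqV R d => -1 * riemann T rho M y); last first.
    by apply/funext => y; rewrite mulN1r.
  apply: measurable_funM; [exact: measurable_cst|exact: (riemann_meas T M rL)].
have mF2 : measurable_fun [set: seqV R d] (F2 : seqV R d -> R).
  apply: measurable_funM; first exact: measurable_cst.
  exact: measurableT_comp mH (measurable_ref j).
have F1C y : `|F1 y| <= C by rewrite normrN (le_trans (riemann_norm M y rK)).
have F2C y : `|F2 y| <= C.
  have /andP[h1 h2] := H_itv (ref j y); rewrite ger0_norm ?mulr_ge0//.
  by rewrite (@le_trans _ _ (2 * CH)) ?ler_wpM2l// lerDl.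
have dL0 : 0 <= dl T M * Lr by rewrite mulr_ge0// ltW// dl_gt0.
have L0 : 0 <= 2 * (1 + L) by rewrite mulr_ge0// (nice_L0 nG).
have F1L : lipS (2 ^ M) (dl T M * Lr) F1.
  move=> y y'; rewrite /F1 /= opprK addrC distrC; exact: (riemann_lipS T0 M rL).
have [_ _ GL _] := nice_ref j nG.
have F2L : lipS (2 ^ M) (2 * (1 + L)) F2.
  move=> y y'; rewrite /F2 -mulrBr normrM ger0_norm// -[leRHS]mulrA ler_wpM2l//.
  apply: le_trans (GL y y'); apply: ln_dist.
    by case/andP: (GB (ref j y)).
  by case/andP: (GB (ref j y')).
have h := comparison P_complete BW T0 beta_meas Cb0 beta_growth Lc0 cL cK
  mF1 mF2 F1C F2C dL0 L0 F1L F2L t0 t1 pw ew solX solX0 e1 e2.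
have k3 : \int[P]_o riemann T rho M (grid T M X o) <= \int[P]_o cost_int T g X o + th.
  rewrite -lerBlDl; apply: le_trans (ler_norm _) _.
  apply: le_trans (le_distE (bmeas_L1 P bR) (bmeas_L1 P (bPhi pX))) _.
  exact: le_trans e3 (sqr_le1 t0 t1).
pose J o := 2 * H (incr T W m o) - riemann T rho M (grid T M X0 o).
have bJ : bmeas J by apply: bmeasB => //; exact: bmeasZ.
have k4 : 2 * \int[P]_o H (incr T (shifted W w) m o) - \int[P]_o riemann T rho M (grid T M X o) -
    2^-1 * En <= ln (\int[P]_o expR (J o)) + D * th.
  move: h; rewrite /F1 /F2 /M; under eq_Rintegral do rewrite ref_incr addrC.
  under [in X in ln X]eq_Rintegral do rewrite ref_incr addrC.
  rewrite EB; [|exact/bmeas_L1/bmeasZ|exact: bmeas_L1].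
  by rewrite EZ//; exact: bmeas_L1.
have k5 : ln (\int[P]_o expR (J o)) <= ln (\int[P]_o expR (cost_int T g X0 o)) +
    expR C * (2 * eta + th).
  apply: le_trans (ln_E_le (C := C) P bJ bP0 _ _) _.
  - move=> o; have /andP[r0 _] := riemann_itv T0 M (grid T M X0 o) rK.
    have /andP[_ h2] := H_itv (incr T W m o).
    rewrite lerBlDr (@le_trans _ _ C)//; last by rewrite lerDl.
    by rewrite (@le_trans _ _ (2 * CH)) ?ler_wpM2l// lerDl.
  - by move=> o; have /andP[-> p1] := Phi_itv o pX0; rewrite (le_trans p1).
  rewrite lerD2l ler_wpM2l ?expR_ge0//.
  apply: (@le_trans _ _ (\int[P]_o (2 * `|H (incr T W m o) - cost_int T g X0 o| +
      `|riemann T rho M (grid T M X0 o) - cost_int T g X0 o|))).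
    apply: le_E.
    - by apply/bmeas_L1/bmeas_norm/bmeasB.
    - apply/bmeas_L1/bmeasD; first exact/bmeasZ/bmeas_norm/bmeasB.
      exact/bmeas_norm/bmeasB.
    - by move=> o; exact: dist_double.
  rewrite ED; [|exact/bmeas_L1/bmeasZ/bmeas_norm/bmeasB|exact/bmeas_L1/bmeas_norm/bmeasB].
  rewrite EZ; last exact/bmeas_L1/bmeas_norm/bmeasB.
  by apply: lerD; [rewrite ler_wpM2l|exact: le_trans e4 (sqr_le1 t0 t1)].
exact: (arith_lower k1 lw k3 k4 k5).
Qed.

End variational_bounds.

(** * The controlled model *)

Lemma Rintegral_sum {dT} {T : measurableType dT} {R : realType} (m : {measure set T -> \bar R})
    (D : set T) (I : Type) (r : seq I) (f : I -> T -> R) : measurable D ->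
  (forall i, m.-integrable D (EFin \o f i)) ->
  \int[m]_(x in D) (\sum_(i <- r) f i x) = \sum_(i <- r) \int[m]_(x in D) f i x.
Proof.
move=> mD fi; rewrite /Rintegral; under eq_integral do rewrite -sumEFin.
rewrite (integral_sum mD fi) (eq_bigr (fun i => (\int[m]_(x in D) f i x)%:E)).
  by rewrite sumEFin.
by move=> i _; rewrite /Rintegral fineK//; exact: integrable_fin_num (fi i).
Qed.

Lemma half_double {R : realType} (a : R) : 2^-1 * (a + a) = a.
Proof. by lra. Qed.

Section model.
Context {R : realType} {d : nat}.
Variables (lambda mu gamma : 'I_d -> R) (ell kappa : 'cV[R]_d) (v : SM_control R d).
Hypotheses (lambda_gt0 : forall i, 0 < lambda i) (mu_gt0 : forall i, 0 < mu i)
  (gamma_gt0 : forall i, 0 < gamma i) (kappa_ge0 : forall i, 0 <= kappa i 0).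
Implicit Types (y u : 'cV[R]_d).

Lemma dotv_ones_meas : measurable_fun [set: borelV R d] (dotv ones : borelV R d -> R).
Proof.
apply: measurable_sum => i; apply: measurable_funM; first exact: measurable_cst.
exact: measurable_coordv.
Qed.

Lemma simplex_meas : measurable (simplex : set (borelV R d)).
Proof.
rewrite (_ : simplex =
    (\bigcap_(i in [set: 'I_d]) ((fun u : borelV R d => u i 0) @^-1` `[0, +oo[%classic))
    `&` ((dotv ones : borelV R d -> R) @^-1` [set 1])); last first.
  apply/seteqP; split => [u [u0 u1]|u [u0 u1]]; split => //=.
    by move=> i _ /=; rewrite in_itv/= andbT.
  by move=> i; have /= := u0 i I; rewrite in_itv/= andbT.
apply: measurableI.
  apply: fin_bigcap_measurable => [|i _]; first exact: finite_finset.
  rewrite -[X in measurable X]setTI; exact: measurable_coordv.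
by rewrite -[X in measurable X]setTI; exact: dotv_ones_meas.
Qed.

Lemma simplex_le1 u i : simplex u -> 0 <= u i 0 <= 1.
Proof.
move=> [u0 u1]; rewrite u0 -u1 /dotv (bigD1 i)//= mxE mul1r lerDl.
by apply: sumr_ge0 => j _; rewrite mxE mul1r.
Qed.

(* The mean action prescribed at [y]: drift and cost are affine in the control. *)
Definition mean_control y : 'cV[R]_d := relaxedv v (fun _ u => u) y.

Let L_bound y (f : 'cV[R]_d -> R) (K : R) :
  measurable_fun [set: borelV R d] (f : borelV R d -> R) ->
  (forall u, simplex u -> `|f u| <= K) ->
  (v y).-integrable simplex (EFin \o (f : borelV R d -> R)).
Proof.
move=> mf fK; apply: measurable_bounded_integrable.
- exact: simplex_meas.
- by have := SM_simplex v y => /= ->; rewrite ltry.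
- exact: measurable_funTS.
- exists K; split; first exact: num_real.
  by move=> z z1 u us; apply: le_trans (ltW z1); exact: fK.
Qed.

Let L_coord y i : (v y).-integrable simplex (EFin \o (fun u : borelV R d => u i 0)).
Proof.
apply: (@L_bound _ _ 1); first exact: measurable_coordv.
by move=> u /simplex_le1 -/(_ i)/andP[u0 u1] /=; rewrite ger0_norm.
Qed.

Let L_cst y r : (v y).-integrable simplex (EFin \o (fun _ : borelV R d => r)).
Proof. by apply: (@L_bound _ _ `|r|); first exact: measurable_cst. Qed.

Let int_cst_simplex y r : \int[v y]_(u in simplex) r = r.
Proof.
rewrite Rintegral_cst; last exact: simplex_meas.
by have := SM_simplex v y => /= ->; rewrite mulr1.
Qed.

Lemma relaxed_affine (a b : 'cV[R]_d -> R) y i :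
  relaxed v (fun y u => a y + b y * u i 0) y = a y + b y * mean_control y i 0.
Proof.
rewrite /mean_control mxE /relaxed RintegralD.
- by rewrite int_cst_simplex RintegralZl//; exact: simplex_meas.
- exact: simplex_meas.
- exact: L_cst.
- exact: (integrableZl simplex_meas (b y) (L_coord y i)).
Qed.

Lemma mean_control_itv y i : 0 <= mean_control y i 0 <= 1.
Proof.
rewrite /mean_control mxE /relaxed Rintegral_ge0/=; last first.
  by move=> u /simplex_le1 -/(_ i)/andP[].
rewrite -[leRHS](int_cst_simplex y); apply: le_Rintegral => //.
- exact: simplex_meas.
- by move=> u /simplex_le1 -/(_ i)/andP[].
Qed.

Lemma mean_control_meas i :
  measurable_fun [set: borelV R d] ((fun y => mean_control y i 0) : borelV R d -> R).
Proof.
rewrite (_ : (fun y => _) = fun y : borelV R d =>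
    fine (\int[v y]_u ((u i 0)%:E * (\1_simplex u)%:E)%E)); last first.
  apply/funext => y; rewrite /mean_control mxE /relaxed /Rintegral; congr fine.
  rewrite integral_mkcond; apply: eq_integral => u _; rewrite patchE indicE.
  by case: ifP => _; rewrite ?mule1 ?mule0.
apply: measurableT_comp => //.
(* On the simplex [u_i] equals [|u_i|], and the indicator removes the rest: the integrand becomes
   nonnegative everywhere, as the measurability of kernel integrals requires. *)
rewrite (_ : (fun y => _) = fun y : borelV R d =>
    (\int[v y]_u (`|u i 0| * \1_simplex u)%:E)%E); last first.
  apply/funext => y; apply: eq_integral => u _; rewrite -EFinM indicE.
  case: (boolP (u \in simplex)) => [/set_mem/simplex_le1 -/(_ i)/andP[u0 _]|_].
    by rewrite ger0_norm.
  by rewrite !mulr0.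
apply: (@measurable_fun_integral_kernel _ _ (borelV R d) (borelV R d) R (fun y => v y)).
- by move=> U mU; exact: measurable_kernel.
- by move=> u; rewrite lee_fin mulr_ge0.
- apply/measurable_EFinP; apply: measurable_funM.
    by apply: (measurableT_comp (f := fun r : R => `|r|)) => //; exact: measurable_coordv.
  by apply: measurable_indic; exact: simplex_meas.
Qed.

Lemma relaxed_driftE y i : relaxedv v (drift ell mu gamma) y i 0 =
  (ell i 0 - mu i * y i 0) + queue y * (mu i - gamma i) * mean_control y i 0.
Proof.
have <- := relaxed_affine (fun y => ell i 0 - mu i * y i 0) (fun y => queue y * (mu i - gamma i)) y i.
rewrite mxE /relaxed; apply: eq_Rintegral => u _.
by rewrite /drift !mul_diag_mx !mxE; ring.
Qed.

Lemma relaxed_costE y : relaxed v (cost kappa) y =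
  queue y * dotv kappa (mean_control y).
Proof.
rewrite /dotv mulr_sumr.
rewrite (_ : relaxed v _ y = \int[v y]_(u in simplex) (\sum_i queue y * (kappa i 0 * u i 0))); last first.
  apply: eq_Rintegral => u _; rewrite /cost /dotv; apply: eq_bigr => i _.
  by rewrite mxE mulrCA.
have LI i : (v y).-integrable simplex (fun u : borelV R d => (queue y * (kappa i 0 * u i 0))%:E).
  rewrite (_ : (fun u => _) = fun u : borelV R d => ((queue y * kappa i 0)%:E * (u i 0)%:E)%E).
    exact: (integrableZl simplex_meas (queue y * kappa i 0) (L_coord y i)).
  by apply/funext => u; rewrite -EFinM mulrA.
rewrite (Rintegral_sum (index_enum 'I_d) simplex_meas LI).
apply: eq_bigr => i _.
rewrite mulrA -[RHS]add0r -(relaxed_affine (fun=> 0) (fun y => queue y * kappa i 0)).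
by apply: eq_Rintegral => u _; rewrite add0r mulrA.
Qed.

Lemma queue_meas : measurable_fun [set: borelV R d] (queue : borelV R d -> R).
Proof. by apply: measurable_maxr; [exact: dotv_ones_meas|exact: measurable_cst]. Qed.

Lemma queue_ge0 y : 0 <= queue y.
Proof. by rewrite /queue le_max lexx orbT. Qed.

(** Cauchy-Schwarz, by [2 |y_i| |y_j| <= y_i^2 + y_j^2] in the double sum. *)
Lemma queue_sqr y : queue y ^+ 2 <= d%:R * sqnormv y.
Proof.
have h : queue y <= \sum_i `|y i 0|.
  rewrite /queue ge_max sumr_ge0// andbT; apply: ler_sum => i _.
  by rewrite mxE mul1r ler_norm.
have h2 : queue y ^+ 2 <= (\sum_i `|y i 0|) ^+ 2.
  by rewrite lerXn2r ?nnegrE ?queue_ge0// sumr_ge0.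
apply: (le_trans h2); rewrite expr2 mulr_suml.
have -> : d%:R * sqnormv y = \sum_(i < d) \sum_(j < d) 2^-1 * (y i 0 ^+ 2 + y j 0 ^+ 2).
  under eq_bigr => i _ do rewrite -mulr_sumr big_split/= sumr_const card_ord.
  rewrite -mulr_sumr big_split/= sumrMnl sumr_const card_ord.
  have -> : sqnormv y = \sum_i y i 0 ^+ 2 by apply: eq_bigr => i _; rewrite expr2.
  by rewrite mulr_natl; exact/esym/half_double.
apply: ler_sum => i _; rewrite mulr_sumr; apply: ler_sum => j _.
rewrite -(real_normK (num_real (y i 0))) -(real_normK (num_real (y j 0))).
by have := sqr_ge0 (`|y i 0| - `|y j 0|); rewrite !expr2; lra.
Qed.

Lemma cost_meas : measurable_fun [set: borelV R d] (relaxed v (cost kappa) : borelV R d -> R).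
Proof.
rewrite (_ : relaxed v (cost kappa) = fun y => queue y * \sum_i kappa i 0 * mean_control y i 0); last first.
  by apply/funext => y; exact: relaxed_costE.
apply: measurable_funM; first exact: queue_meas.
apply: measurable_sum => i; apply: measurable_funM; first exact: measurable_cst.
exact: mean_control_meas.
Qed.

Lemma cost_ge0 y : 0 <= relaxed v (cost kappa) y.
Proof.
rewrite relaxed_costE mulr_ge0 ?queue_ge0//; apply: sumr_ge0 => i _.
by rewrite mulr_ge0//; case/andP: (mean_control_itv y i).
Qed.

Lemma cost_growth y :
  relaxed v (cost kappa) y <= (d%:R + 1) * (\sum_i kappa i 0) * (1 + sqnormv y).
Proof.
have k0 : 0 <= \sum_i kappa i 0 by exact: sumr_ge0.
have s0 := sqnormv_ge0 y; have d0 : 0 <= d%:R :> R by [].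
have qle : queue y <= (d%:R + 1) * (1 + sqnormv y).
  have h : queue y <= 1 + queue y ^+ 2 by have := sqr_ge0 (2 * queue y - 1); rewrite !expr2; lra.
  apply: (le_trans h); apply: (@le_trans _ _ (1 + d%:R * sqnormv y)).
    by rewrite lerD2l queue_sqr.
  by rewrite mulrDl mul1r mulrDr mulr1; lra.
rewrite relaxed_costE mulrAC; apply: ler_pM => //; first exact: queue_ge0.
  by apply: sumr_ge0 => i _; rewrite mulr_ge0//; case/andP: (mean_control_itv y i).
by apply: ler_sum => i _; rewrite ler_piMr//; case/andP: (mean_control_itv y i).
Qed.

Definition sigma i : R := Num.sqrt (2 * lambda i).

Lemma sigma_gt0 i : 0 < sigma i.
Proof. by rewrite sqrtr_gt0 mulr_gt0. Qed.

(** Division by [sigma] puts the equation in the form with [sigma] in front of drift, control and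
    noise alike, so that a drift error can be read as a control. *)
Definition scaled_drift y : 'cV[R]_d :=
  \col_i ((sigma i)^-1 * relaxedv v (drift ell mu gamma) y i 0).

Lemma scaled_driftE y i :
  scaled_drift y i 0 = (sigma i)^-1 * relaxedv v (drift ell mu gamma) y i 0.
Proof. by rewrite [LHS]mxE. Qed.

Definition drift_cst : R := \sum_i
  (sigma i)^-1 ^+ 2 * (3 * (ell i 0 ^+ 2 + mu i ^+ 2 + d%:R * (mu i - gamma i) ^+ 2)).

Lemma drift_cst_term i : 0 <=
  (sigma i)^-1 ^+ 2 * (3 * (ell i 0 ^+ 2 + mu i ^+ 2 + d%:R * (mu i - gamma i) ^+ 2)).
Proof.
rewrite mulr_ge0 ?sqr_ge0// mulr_ge0// addr_ge0//.
  by rewrite addr_ge0 ?sqr_ge0.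
by rewrite mulr_ge0// sqr_ge0.
Qed.

Lemma drift_cst_ge0 : 0 <= drift_cst.
Proof. by apply: sumr_ge0 => i _; exact: drift_cst_term. Qed.

Lemma scaled_drift_meas :
  measurable_fun [set: borelV R d] (scaled_drift : borelV R d -> borelV R d).
Proof.
apply: measurable_funV => // i.
rewrite (_ : (fun y => _) = fun y : borelV R d => (sigma i)^-1 * ((ell i 0 - mu i * y i 0) +
    queue y * (mu i - gamma i) * mean_control y i 0)); last first.
  by apply/funext => y; rewrite scaled_driftE relaxed_driftE.
apply: measurable_funM; first exact: measurable_cst.
apply: measurable_funD.
  apply: measurable_funB; first exact: measurable_cst.
  by apply: measurable_funM; [exact: measurable_cst|exact: measurable_coordv].
apply: measurable_funM; last exact: mean_control_meas.
by apply: measurable_funM; [exact: queue_meas|exact: measurable_cst].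
Qed.

Lemma sqr_sum3 (a b c : R) : (a - b + c) ^+ 2 <= 3 * (a ^+ 2 + b ^+ 2 + c ^+ 2).
Proof.
have := sqr_ge0 (a + b); have := sqr_ge0 (a - c); have := sqr_ge0 (b + c).
by rewrite !expr2; lra.
Qed.

Lemma growth_arith (l m g y q c s N : R) : c <= 1 -> 0 <= c -> y ^+ 2 <= s -> q ^+ 2 <= N * s ->
  0 <= N ->
  l ^+ 2 + (m * y) ^+ 2 + (q * g * c) ^+ 2 <= (l ^+ 2 + m ^+ 2 + N * g ^+ 2) * (1 + s).
Proof.
move=> c1 c0 ys qs N0.
have s0 : 0 <= s by apply: le_trans ys; exact: sqr_ge0.
have h1 : (m * y) ^+ 2 <= m ^+ 2 * s by rewrite exprMn ler_wpM2l// sqr_ge0.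
have h2 : (q * g * c) ^+ 2 <= N * g ^+ 2 * s.
  rewrite !exprMn; apply: (@le_trans _ _ (q ^+ 2 * g ^+ 2)).
    by apply: ler_piMr; [rewrite mulr_ge0 ?sqr_ge0|rewrite exprn_ile1].
  by rewrite [leRHS]mulrAC ler_wpM2r// sqr_ge0.
have h3 : 0 <= l ^+ 2 * s by rewrite mulr_ge0// sqr_ge0.
have h4 : 0 <= N * g ^+ 2 by rewrite mulr_ge0// sqr_ge0.
have h5 := sqr_ge0 m; rewrite mulrDr mulr1 !mulrDl.
by move: h1 h2 h3 h4 h5; lra.
Qed.

Lemma scaled_drift_growth y i : scaled_drift y i 0 ^+ 2 <= drift_cst * (1 + sqnormv y).
Proof.
have s0 := sqnormv_ge0 y.
apply: (@le_trans _ _ ((sigma i)^-1 ^+ 2 *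
    (3 * (ell i 0 ^+ 2 + mu i ^+ 2 + d%:R * (mu i - gamma i) ^+ 2)) * (1 + sqnormv y))); last first.
  rewrite ler_wpM2r ?addr_ge0// /drift_cst (bigD1 i)//= lerDl.
  by apply: sumr_ge0 => j _; exact: drift_cst_term.
rewrite scaled_driftE relaxed_driftE exprMn -[leRHS]mulrA ler_wpM2l ?sqr_ge0//.
apply: le_trans (sqr_sum3 _ _ _) _; rewrite -[leRHS]mulrA ler_wpM2l//.
have /andP[c0 c1] := mean_control_itv y i.
apply: growth_arith => //; last exact: queue_sqr.
by rewrite /sqnormv /dotv (bigD1 i)//= -expr2 lerDl sumr_ge0// => j _; rewrite -expr2 sqr_ge0.
Qed.

Section solves.
Context {disp} {Omega : measurableType disp}.
Variables (P : probability Omega R) (P_complete : measure_is_complete P)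
  (W : process R d Omega) (BW : brownian_motion P W) (T : R) (T0 : 0 < T).
Local Notation leb := (@lebesgue_measure R).

Lemma solves_solution (w X : process R d Omega) (x : 'cV[R]_d) :
  (forall i, progr P W (fun s o => w s o i 0)) ->
  (\int[P]_o \int[leb]_(s in `[0%R, T]) (sqnormv (w s o))%:E < +oo)%E ->
  solves_SDE P W (relaxedv v (drift ell mu gamma)) (Sigma lambda) w x X ->
  solution P W T scaled_drift sigma x w X.
Proof.
move=> pw ew [aX cX eX].
have pX i : progr P W (fun s o => X s o i 0).
  apply: continuous_progr => [t t0|o]; last exact: within_coord.
  exact: measurableT_comp (measurable_coordv i) (aX t t0).
have [_ _ aew] := energy_L1 P_complete BW T0 pw ew.
split => //; apply: filterS (filterI eX aew) => o [eo iw] t t0 tT i.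
have mT : measurable (`[0, T]%classic : set (measurableTypeR R)) by [].
have mt : measurable (`[0, t]%classic : set (measurableTypeR R)) by [].
have st : `[0, t]%classic `<=` `[0, T]%classic.
  by move=> u /=; rewrite !in_itv/= => /andP[-> /=] ut; exact: le_trans tT.
have [w1 _] := iL_coord (progr_section o (ltW T0) (pw i)) iw.
have [b1 _] := beta_iL T0 scaled_drift_meas scaled_drift_growth pX cX o i.
have {}w1 := iL_S mT mt st w1; have {}b1 := iL_S mT mt st b1.
have addvE (A B : 'cV[R]_d) : (A + B) i 0 = A i 0 + B i 0 by rewrite mxE.
rewrite (eo t t0) !addvE -addrA; congr (_ + _).
have SE (u : 'cV[R]_d) : (Sigma lambda *m u) i 0 = sigma i * u i 0.
  by rewrite /Sigma mul_diag_mx !mxE.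
rewrite SE [RHS]mulrDr; congr (_ + _).
rewrite -RintegralD// -RintegralZl//; last exact: iLD.
rewrite mxE; apply: eq_Rintegral => s _; rewrite addvE SE mulrDr; congr (_ + _).
by rewrite scaled_driftE mulrA mulfV ?mul1r// gt_eqF// sigma_gt0.
Qed.

End solves.
End model.

Lemma int_min_cvg {R : realType} (T : R) (f : R -> R) : iL `[0, T] f -> (forall s, 0 <= f s) ->
  \int[@lebesgue_measure R]_(s in `[0, T]) Num.min (f s) n.+1%:R @[n --> \oo] -->
  \int[@lebesgue_measure R]_(s in `[0, T]) f s.
Proof.
move=> fi f0; have mT : measurable (`[0, T]%classic : set (measurableTypeR R)) by [].
have mf := iL_meas fi.
have [] := @dominated_convergence _ _ _ (@lebesgue_measure R) `[0, T]%classic mT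
  (fun n s => (Num.min (f s) n.+1%:R)%:E) (EFin \o f) (EFin \o f) _ _ _ fi _.
- move=> n; apply/measurable_EFinP; apply: measurable_minr => //; exact: measurable_cst.
- exact/measurable_EFinP.
- apply: aeW => s _ /=; apply: cvg_near_cst; exists (Num.truncn (f s)) => // n /= sn.
  congr EFin; apply/min_idPl; apply: (@le_trans _ _ (Num.truncn (f s)).+1%:R).
    by rewrite ltW// truncnS_gt.
  by rewrite ler_nat ltnS.
- apply: aeW => s n _ /=; rewrite lee_fin ger0_norm ?ge_min ?lexx//.
  by rewrite le_min f0 ler0n.
move=> ig _ h; apply: fine_cvg; rewrite fineK; last exact: integrable_fin_num ig.
exact: h.
Qed.

Lemma limf_esup_eq_near {R : realType} (f g : R -> \bar R) (F : set_system R) :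
  Filter F -> (\forall x \near F, f x = g x) -> limf_esup f F = limf_esup g F.
Proof.
move=> FF; have H (h k : R -> \bar R) : (\forall x \near F, h x = k x) ->
    (limf_esup h F <= limf_esup k F)%E.
  move=> hk; rewrite /limf_esup; apply: le_ereal_inf_tmp => _ [V FV <-].
  apply: (@le_trans _ _ (ereal_sup (h @` (V `&` [set x | h x = k x])))).
    by apply: ereal_inf_lbound; exists (V `&` [set x | h x = k x]) => //; exact: filterI.
  apply: ereal_sup_le => _ [y [Vy hy] <-]; exists y => //.
move=> fg; apply/eqP; rewrite eq_le !H//.
by apply: filterS fg.
Qed.

Section fixed_horizon.
Context {R : realType} {d : nat} {disp} {Omega : measurableType disp}.
Variables (P : probability Omega R) (P_complete : measure_is_complete P)
  (W : process R d Omega) (BW : brownian_motion P W) (T : R) (T0 : 0 < T).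
Local Notation mu := (@lebesgue_measure R).
Local Notation Q := (QT P T0).
Variables (beta : 'cV[R]_d -> 'cV[R]_d) (Cb : R) (sg : 'I_d -> R) (x : 'cV[R]_d).
Hypotheses (beta_meas : measurable_fun [set: borelV R d] (beta : borelV R d -> borelV R d))
  (Cb0 : 0 <= Cb) (beta_growth : forall y i, beta y i 0 ^+ 2 <= Cb * (1 + sqnormv y)).
Variables (r : 'cV[R]_d -> R) (Cr : R).
Hypotheses (mr : measurable_fun [set: borelV R d] (r : borelV R d -> R))
  (r0 : forall y, 0 <= r y) (r_growth : forall y, r y <= Cr * (1 + sqnormv y)).

Definition rmin n y : R := Num.min (r y) n.+1%:R.

Let rmin_meas n : measurable_fun [set: borelV R d] (rmin n : borelV R d -> R).
Proof. by apply: measurable_minr => //; exact: measurable_cst. Qed.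

Let rmin_itv n y : 0 <= rmin n y <= n.+1%:R.
Proof. by rewrite /rmin le_min r0 ler0n ge_min lexx orbT. Qed.

Let rmin_le n y : rmin n y <= r y.
Proof. by rewrite ge_min lexx. Qed.

Section one.
Variables (w X : process R d Omega).
Hypotheses (pw : forall i, progr P W (fun s o => w s o i 0))
  (ew : (\int[P]_o \int[mu]_(s in `[0%R, T]) (sqnormv (w s o))%:E < +oo)%E)
  (solX : solution P W T beta sg x w X).

Let pX : forall i, progr P W (fun s o => X s o i 0).
Proof. by case: solX. Qed.

Let pr : progr P W (fun s o => r (X s o)).
Proof. exact: comp_progr. Qed.

Lemma running_iL o : iL `[0, T] (fun s => r (X s o)).
Proof.
have mT : measurable (`[0, T]%classic : set (measurableTypeR R)) by [].
have [_ cX _] := solX; have h := @path_sqnormv_iL _ _ _ _ T X cX o.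
apply: (iL_dom mT _ (iLZ Cr mT (iLD mT (iL_cst _ _ _ _ 1) h))) => [|s _].
  exact: (@progr_section _ _ _ _ P W _ _ (fun s o => r (X s o)) T o (ltW T0) pr).
by rewrite ger0_norm.
Qed.

Lemma cost_min_le n o : cost_int T (rmin n) X o <= cost_int T r X o.
Proof.
apply: le_Rintegral => //; [|exact: running_iL].
exact: (cost_iL T0 (rmin_meas n) (rmin_itv n) pX).
Qed.

Lemma cost_min_mono m n o : (m <= n)%N -> cost_int T (rmin m) X o <= cost_int T (rmin n) X o.
Proof.
move=> mn; apply: le_Rintegral => //.
- exact: (cost_iL T0 (rmin_meas m) (rmin_itv m) pX).
- exact: (cost_iL T0 (rmin_meas n) (rmin_itv n) pX).
- by move=> s _; rewrite /rmin le_min !ge_min lexx/= ler_nat ltnS mn orbT.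
Qed.

Lemma cost_min_cvg o : cost_int T (rmin n) X o @[n --> \oo] --> cost_int T r X o.
Proof. by apply: int_min_cvg => //; exact: running_iL. Qed.

Lemma running_meas : measurable_fun setT (cost_int T r X).
Proof.
by apply: (fmeas_setT P_complete BW (ltW T0)); exact: (progr_int (ltW T0) pr).
Qed.

Lemma cost_L1 : L1 P (cost_int T r X).
Proof.
have LX := solution_moment P_complete BW T0 beta_meas Cb0 beta_growth pw ew solX.
have Lr : L1 Q (at_time T (fun s o => r (X s o))).
  have m : measurable_fun setT (at_time T (fun s o => r (X s o)) : Omega * measurableTypeR R -> R).
    exact: measurableT_comp mr (state_meas P_complete BW T0 pX).
  apply: (L1_dom m (L1Z Cr (L1D (bmeas_L1 _ (bmeas_cst 1)) LX))) => p.
  by rewrite ger0_norm /at_time.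
have fo := at_time_fin P_complete BW pr (fun s o => r0 (X s o)) Lr.
have mh : measurable_fun setT (fun o => \int[mu]_(s in `[0%R, T]) (r (X s o))%:E)%E.
  apply: (fmeas_setT P_complete BW (ltW T0)); apply: progr_ge0_int (ltW T0) _ _.
    by apply: (progr_comp (h := EFin)) pr; exact: EFin_measurable.
  by move=> s o; rewrite lee_fin.
have [|L _ _] := fine_L1 mh _ fo; last exact: L.
by move=> o; apply: integral_ge0 => s _; rewrite lee_fin.
Qed.

Lemma E_cost_min_cvg :
  \int[P]_o cost_int T (rmin n) X o @[n --> \oo] --> \int[P]_o cost_int T r X o.
Proof.
apply: (dominated_cvg_E (h := cost_int T r X)).
- by move=> n; have [] := cost_int_bmeas P_complete BW T0 (rmin_meas n) (rmin_itv n) pX.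
- exact: running_meas.
- exact: cost_L1.
- move=> n o; rewrite ger0_norm; first exact: cost_min_le.
  by case/andP: (cost_int_itv T0 (rmin_meas n) (rmin_itv n) pX o).
- by apply: aeW => o; exact: cost_min_cvg.
Qed.

(** Both parts are integrable, the cost by its at most quadratic growth and the second moment of
    [X], so the penalized average is a difference of finite means. *)
Lemma penalized_averageE : penalized_average P r w X T =
  (T^-1 * (\int[P]_o cost_int T r X o - 2^-1 * \int[P]_o energy T w o))%:E.
Proof.
have [Le _ aee] := energy_L1 P_complete BW T0 pw ew.
have Lc := cost_L1; have Lh := L1Z 2^-1 Le.
have Lt := L1Z T^-1 (L1B Lc Lh).
rewrite -EZ -?EB -?EZ -?EFinE//; last exact: L1B.
rewrite /penalized_average unlock; apply: ae_eq_integral => //.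
- apply/measurable_EFinP; apply: measurable_funM; first exact: measurable_cst.
  apply: (fmeas_setT P_complete BW (ltW T0)).
  apply: (@progr_int _ _ _ _ P W (fun t o => r (X t o) - 2^-1 * sqnormv (w t o)) T (ltW T0)).
  move=> t t0; apply: measurable_funB; first exact: pr.
  apply: measurable_funM; first exact: measurable_cst.
  exact: (progr_sqnormv pw).
- by apply/measurable_EFinP; exact: L1_meas Lt.
apply: filterS aee => o iw _; congr EFin; congr (_ * _).
have mT : measurable (`[0, T]%classic : set (measurableTypeR R)) by [].
by rewrite RintegralB//; [rewrite RintegralZl//|exact: running_iL|exact: iLZ].
Qed.

End one.

Variables (X0 : process R d Omega) (Xs : process R d Omega -> process R d Omega).
Hypotheses (solX0 : solution P W T beta sg x (fun _ _ => 0) X0)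
  (solXs : forall w, admissible P W w -> solution P W T beta sg x w (Xs w)).

(** The bounded formula for the truncated costs [rmin n], with [n] to infinity. The exponential mean
    [A] may be infinite, so both inequalities are taken in the extended line. In the upper one the
    mean costs converge for each [w]; in the lower one [rmin n <= r] only improves the value of the
    control found for [rmin n]. *)
Lemma fixed_horizon :
  ((T^-1)%:E * lne 'E_P[(fun o => expR (\int[mu]_(t in `[0, T]) r (X0 t o)))%R])%E =
  ereal_sup [set penalized_average P r w (Xs w) T | w in admissible P W].
Proof.
have ew0 : (\int[P]_o \int[mu]_(s in `[0%R, T]) (sqnormv ((fun _ _ => 0 : 'cV[R]_d) s o))%:E < +oo)%E
  by exact: zero_control_energy.
have pw0 := @zero_control_progr R d disp Omega P W.
have [pX0 _ _] := solX0.
have bn n := cost_int_bmeas P_complete BW T0 (rmin_meas n) (rmin_itv n) pX0.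
have n0 n : 0 < n.+1%:R :> R by rewrite ltr0n.
pose l n := ln (\int[P]_o expR (cost_int T (rmin n) X0 o)).
rewrite unlock; set A : \bar R := (\int[P]_o _)%E.
have AE n : ((\int[P]_o expR (cost_int T (rmin n) X0 o))%:E <= A)%E.
  rewrite -EFinE; last exact/bmeas_L1/bmeas_expR.
  apply: ge0_le_integral => //.
  - by apply/measurable_EFinP; have [] := bmeas_expR (bn n).
  - apply/measurable_EFinP; apply: measurableT_comp; first exact: measurable_expR.
    exact: (running_meas solX0).
  - by move=> o _; rewrite lee_fin ler_expR; exact: (cost_min_le solX0).
have Epos n : 0 < \int[P]_o expR (cost_int T (rmin n) X0 o) by exact: E_expR_gt0.
have A0 : (0 <= A)%E by apply: integral_ge0 => o _; rewrite lee_fin expR_ge0.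
have lA n : ((l n)%:E <= lne A)%E.
  rewrite /l -lne_EFin// lee_lne ?AE// in_itv/= ?leey ?A0//.
  by rewrite lee_fin ltW ?Epos.
have Acvg : (fun n => (\int[P]_o expR (cost_int T (rmin n) X0 o))%:E) @ \oo --> A.
  have h := @cvg_monotone_convergence _ _ _ P setT measurableT
    (fun n o => (expR (cost_int T (rmin n) X0 o))%:E) _ _ _.
  rewrite (_ : A = (\int[P]_o limn (fun n => (expR (cost_int T (rmin n) X0 o))%:E))%E).
    rewrite (_ : (fun n => _) = fun n => (\int[P]_o (expR (cost_int T (rmin n) X0 o))%:E)%E); last first.
      by apply/funext => n; rewrite EFinE//; exact/bmeas_L1/bmeas_expR.
    apply: h.
    - by move=> n; apply/measurable_EFinP; have [] := bmeas_expR (bn n).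
    - by move=> n o _; rewrite lee_fin expR_ge0.
    - by move=> o _ m n mn; rewrite lee_fin ler_expR; exact: (cost_min_mono solX0).
  apply: eq_integral => o _; apply/esym/cvg_lim => //.
  apply: cvg_EFin; first exact: nearW.
  apply: continuous_cvg; [exact: continuous_expR|exact: (cost_min_cvg solX0)].
have Ti : 0 <= T^-1 by rewrite invr_ge0 ltW.
apply/eqP; rewrite eq_le; apply/andP; split; last first.
  apply: ge_ereal_sup => _ [w aw <-].
  have pw i : progr P W (fun s o => w s o i 0) by apply: progr_coord; case: aw.
  have ew := admissible_energy T0 aw; have solX := solXs aw.
  rewrite (penalized_averageE pw ew solX) EFinM lee_wpmul2l ?lee_fin//.
  have ub n := bounded_upper P_complete BW T0 beta_meas Cb0 beta_growth (rmin_meas n) (n0 n)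
    (rmin_itv n) solX0 pw ew solX.
  move: lA; case: (lne A) => [a lA| _|/(_ 0%N)//]; last exact: leey.
  rewrite lee_fin lerBlDr.
  have h := E_cost_min_cvg pw ew solX.
  have <- := cvg_lim (@Rhausdorff R) h; apply: limr_le; first exact: cvgP h.
  apply: nearW => n; rewrite -lerBlDr; apply: le_trans (ub n) _.
  by have := lA n; rewrite lee_fin.
set S := ereal_sup _.
have key n e : 0 < e -> ((T^-1 * (l n - e))%:E <= S)%E.
  move=> e0; have [w aw hw] := bounded_lower P_complete BW T0 beta_meas Cb0 beta_growth
    (rmin_meas n) (n0 n) (rmin_itv n) solX0 solXs e0.
  have pw i : progr P W (fun s o => w s o i 0) by apply: progr_coord; case: aw.
  have ew := admissible_energy T0 aw; have solX := solXs aw.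
  apply: le_trans (ereal_sup_ubound (ex_intro2 _ _ w aw erefl)).
  rewrite (penalized_averageE pw ew solX) lee_fin ler_wpM2l//; apply: le_trans hw _.
  rewrite lerD2r; apply: le_E; [|exact: (cost_L1 pw ew solX)|by move=> o; exact: (cost_min_le solX)].
  have [pX _ _] := solX.
  exact: (bmeas_L1 P (cost_int_bmeas P_complete BW T0 (rmin_meas n) (rmin_itv n) pX)).
(* A finite [S] bounds all [l n], hence [A] by monotone convergence, hence [lne A]; the value [+oo]
   bounds anything; the value [-oo] contradicts [key]. *)
clearbody S; case: S key => [s key| key|key].
- have ls n : l n <= T * s.
    apply/ler_addgt0Pr => e e0; have := key n e e0; rewrite lee_fin -lerBlDr.
    by rewrite mulrC ler_pdivrMr// mulrC.
  have As : (A <= (expR (T * s))%:E)%E.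
    have <- := cvg_lim (@ereal_hausdorff R) Acvg; apply: lime_le; first exact: cvgP Acvg.
    by apply: nearW => n; rewrite lee_fin -ler_ln ?posrE ?expR_gt0// expRK; exact: ls.
  have : (lne A <= (T * s)%:E)%E.
    rewrite -[X in X%:E]expRK -lne_EFin ?expR_gt0// lee_lne// in_itv/= ?A0 ?leey//.
    by rewrite lee_fin expR_ge0.
  move=> h; apply: (@le_trans _ _ ((T^-1)%:E * (T * s)%:E)%E).
    by apply: lee_wpmul2l => //; rewrite lee_fin.
  by rewrite -EFinM mulKf// gt_eqF.
- exact: leey.
- by have := key 0%N 1 ltr01; rewrite leNgt ltNyr.
Qed.

End fixed_horizon.

Theorem corollary3p1 (R : realType) (d : nat)
  (lambda mu gamma : 'I_d -> R) (ell kappa : 'cV[R]_d)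
  (lambda_gt0 : forall i, 0 < lambda i)
  (mu_gt0 : forall i, 0 < mu i)
  (gamma_gt0 : forall i, 0 < gamma i)
  (sum_ratio : \sum_(i < d) lambda i / mu i = 1)
  (kappa_ge0 : forall i, 0 <= kappa i 0)
  (disp : measure_display) (Omega : measurableType disp)
  (P : probability Omega R) (P_complete : measure_is_complete P)
  (W : process R d Omega) (W_brownian : brownian_motion P W)
  (v : SM_control R d) (x : 'cV[R]_d)
  (X : process R d Omega)
  (X_solves : solves_SDE P W (relaxedv v (drift ell mu gamma)) (Sigma lambda)
                (fun _ _ => 0) x X)
  (Xstar : process R d Omega -> process R d Omega)
  (Xstar_solves : forall w : process R d Omega, admissible P W w ->
     solves_SDE P W (relaxedv v (drift ell mu gamma)) (Sigma lambda)
       w x (Xstar w)) :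
  risk_sensitive_value P (relaxed v (cost kappa)) X =
  limf_esup (fun T : R =>
    ereal_sup [set penalized_average P (relaxed v (cost kappa)) w (Xstar w) T
              | w in admissible P W]) +oo.
Proof.
rewrite /risk_sensitive_value; apply: limf_esup_eq_near.
(* The two functions of [T] agree at every positive horizon, so no limit is interchanged with the
   supremum. *)
exists 0; split; first exact: num_real.
move=> T /= T0.
have solX0 := solves_solution lambda_gt0 P_complete W_brownian T0
  (@zero_control_progr R d disp Omega P W) (zero_control_energy P T (d := d)) X_solves.
have solXs w (aw : admissible P W w) := solves_solution lambda_gt0 P_complete W_brownian T0
  (fun i => progr_coord i (proj1 aw)) (admissible_energy T0 aw) (Xstar_solves w aw).
exact: (fixed_horizon P_complete W_brownian T0 (scaled_drift_meas lambda mu gamma ell v)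
  (drift_cst_ge0 lambda mu gamma ell) (scaled_drift_growth lambda mu gamma ell v)
  (cost_meas kappa v) (cost_ge0 v kappa_ge0) (cost_growth v kappa_ge0) solX0 solXs).
Qed.
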